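(* Let $s\geq 1$ and $k\geq 2$ be integers and let $\lambda<0$. Let $V:\mathbb{R}\to\mathbb{R}$ be a real valued potential such that $V\in L^\infty(\mathbb{R})$, such that for every $j=1,\dots,s$ there is a constant $C_j>0$ with $$|\partial_x^j V(x)|\leq C_j (1+|x|)^{-1}\quad\text{for all } x\in\mathbb{R},$$ and such that $-\partial_x^2-V\geq 0$ in the operator sense on $L^2(\mathbb{R})$. Let $f\in\Sigma_s(\mathbb{R})$ and let $u\in\mathcal{C}(\mathbb{R};H^1(\mathbb{R}))$ be the unique global solution to $$\big(i\partial_t+\partial_x^2+V(x)+\lambda|u|^{2k}\big)u=0,\quad (t,x)\in\mathbb{R}\times\mathbb{R},\qquad u(0,x)=f(x).$$ Assume that $$\sup_{(t,x)\in\mathbb{R}^2}\langle t\rangle^{\frac12}|u(t,x)|<\infty .$$ Then there exists a constant $C>0$ (independent of $t$) such that $$\|u(t,\cdot)\|_{\Sigma_s(\mathbb{R})}^2\leq C\,\langle t\rangle^{2s}\quad\text{for all } t\in\mathbb{R}.$$ In particular, $u(t,\cdot)\in\Sigma_s(\mathbb{R})$ for every $t\in\mathbb{R}$.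
   Context: For an integer $s\ge 1$, $\Sigma_s(\mathbb{R})$ is the space of (complex valued) functions with finite norm $\|f\|_{\Sigma_s(\mathbb{R})}^2=\|f\|_{H^s(\mathbb{R})}^2+\int_{\mathbb{R}}x^{2s}|f(x)|^2\,dx$, where $H^s(\mathbb{R})$ is the classical Sobolev space. $\langle t\rangle=(1+t^2)^{1/2}$. Since $\lambda<0$ (defocusing case), for every $f\in H^1(\mathbb{R})$ the Cauchy problem has a unique global solution in $\mathcal{C}(\mathbb{R};H^1(\mathbb{R}))$ (in the sense of the Duhamel integral formulation); this is a known fact taken for granted. *)

(* Defs.v *)
From mathcomp Require Export all_boot all_order all_algebra.
From mathcomp Require Export complex.
From mathcomp Require Export all_classical all_reals all_analysis.

Set Implicit Arguments.
Unset Strict Implicit.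
Unset Printing Implicit Defensive.

Export Order.TTheory GRing.Theory Num.Theory.
Export numFieldNormedType.Exports.

#[global] Open Scope classical_set_scope.
#[global] Open Scope ring_scope.
#[global] Open Scope complex_scope.

Section Defs.
Variable R : realType.
Implicit Types (f g h : R -> R[i]) (V : R -> R) (u : R -> R -> R[i]).

Local Notation mu := (@lebesgue_measure R).

Definition jap (t : R) : R := Num.sqrt (1 + t ^+ 2).

(* Modulus with values in R; the norm `|z| of the library lives in R[i]. *)
Definition cmod (z : R[i]) : R := Normc.normc z.

Definition cis (theta : R) : R[i] := cos theta +i* sin theta.

(* Elements of L^2, H^s and Sigma_s are represented by plain functions R -> R[i];
   equality in these spaces is equality almost everywhere. *)

Definition cintegrable (A : set R) f : Prop :=
  mu.-integrable A (EFin \o (@complex.Re R \o f)) /\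
  mu.-integrable A (EFin \o (@complex.Im R \o f)).

Definition cintegral (A : set R) f : R[i] :=
  Rintegral mu A (@complex.Re R \o f) +i* Rintegral mu A (@complex.Im R \o f).

Definition clocally_integrable f : Prop :=
  locally_integrable setT (@complex.Re R \o f) /\
  locally_integrable setT (@complex.Im R \o f).

Definition in_L2 f : Prop :=
  @complex.Re R \o f \in Lfun mu 2%:E /\ @complex.Im R \o f \in Lfun mu 2%:E.

Definition L2norm2 f : \bar R := (\int[mu]_x (cmod (f x) ^+ 2)%:E)%E.

Definition L2inner f g : R[i] := cintegral setT (fun x => f x * (g x)^*).

Definition test_function (phi : R -> R) : Prop :=
  (forall (n : nat) (x : R), derivable (derive1n n phi) x 1) /\
  (exists M : R, forall x, M < `|x| -> phi x = 0).

Definition is_weak_derivative (n : nat) f g : Prop :=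
  [/\ clocally_integrable f, clocally_integrable g &
      forall phi, test_function phi ->
        cintegral setT (fun x => (derive1n n phi x)%:C * f x) =
        (- 1) ^+ n * cintegral setT (fun x => (phi x)%:C * g x)].

(* A representative of the n-th weak derivative, which is unique almost
   everywhere; the default value 0 is used when there is none. *)
Definition weak_derivative (n : nat) f : R -> R[i] :=
  xget (fun=> 0) [set g | is_weak_derivative n f g].

Definition in_Sobolev (s : nat) f : Prop :=
  in_L2 f /\
  forall j, (j <= s)%N -> exists2 g, is_weak_derivative j f g & in_L2 g.

(* The squared norm of H^s; only meaningful on in_Sobolev s. *)
Definition Sobolev_norm2 (s : nat) f : \bar R :=
  (\sum_(j < s.+1) L2norm2 (weak_derivative j f))%E.

Definition weight_norm2 (s : nat) f : \bar R :=
  (\int[mu]_x (x ^+ (2 * s) * cmod (f x) ^+ 2)%:E)%E.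

Definition in_Sigma (s : nat) f : Prop :=
  in_Sobolev s f /\ (weight_norm2 s f < +oo)%E.

Definition Sigma_norm2 (s : nat) f : \bar R :=
  (Sobolev_norm2 s f + weight_norm2 s f)%E.

(* - d^2/dx^2 - V >= 0 as an operator on L^2 with domain H^2; the order on R[i]
   makes [0 <= z] mean that z is real and nonnegative. *)
Definition schrodinger_nonneg V : Prop :=
  forall f, in_Sobolev 2 f ->
    0 <= L2inner (fun x => - weak_derivative 2 f x - (V x)%:C * f x) f.

(* g is the Fourier-Plancherel transform of f: the limit in L^2, as A tends to
   infinity, of (2 pi)^(-1/2) \int_{-A}^{A} exp(- i x xi) f(x) dx. *)
Definition is_Fourier f g : Prop :=
  [/\ in_L2 f, in_L2 g &
      L2norm2 (fun xi : R => g xi - ((Num.sqrt (2 * pi))^-1)%:C *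
        cintegral `[(- A), A] (fun x => cis (- (x * xi)) * f x))
      @[A --> +oo%R] --> (0 : \bar R)].

(* g = exp(i t d^2/dx^2) f: the Fourier multiplier exp(- i t xi^2). *)
Definition is_free_flow (t : R) f g : Prop :=
  exists fhat ghat : R -> R[i],
    [/\ is_Fourier f fhat, is_Fourier g ghat &
        {ae mu, forall xi : R, ghat xi = cis (- (t * xi ^+ 2)) * fhat xi}].

(* A representative: [is_free_flow t f] has a solution, unique almost
   everywhere, whenever f is in L^2. *)
Definition free_flow (t : R) f : R -> R[i] :=
  xget (fun=> 0) [set g | is_free_flow t f g].

Definition is_cintegral_between (a b : R) (phi : R -> R[i]) (z : R[i]) : Prop :=
  cintegrable `[Num.min a b, Num.max a b] phi /\
  z = (if a <= b then 1 else - 1) * cintegral `[Num.min a b, Num.max a b] phi.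

(* Integral from a to b of an L^2-valued function, defined by duality (Pettis
   integral); for continuous integrands it is also the Riemann and the Bochner
   integral. *)
Definition is_L2_integral (a b : R) (F : R -> R -> R[i]) g : Prop :=
  [/\ in_L2 g, forall tau, in_L2 (F tau) &
      forall h, in_L2 h ->
        is_cintegral_between a b (fun tau => L2inner (F tau) h) (L2inner g h)].

Definition continuous_in_H1 u : Prop :=
  (forall t, in_Sobolev 1 (u t)) /\
  (forall t0, Sobolev_norm2 1 (fun x => u t x - u t0 x) @[t --> t0]
              --> (0 : \bar R)).

Definition source (k : nat) (lambda : R) V (v : R -> R[i]) : R -> R[i] :=
  fun x => (V x + lambda * cmod (v x) ^+ (2 * k))%:C * v x.

(* u is in C(R; H^1) and, for every t,
     u(t) = exp(i t d^2) f + i \int_0^t exp(i (t - tau) d^2) N(u(tau)) dtau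
   in L^2, where N(v) = (V + lambda |v|^(2k)) v. *)
Definition NLS_solution (k : nat) (lambda : R) V f u : Prop :=
  [/\ continuous_in_H1 u,
      {ae mu, forall x : R, u 0 x = f x} &
      forall t, exists2 D : R -> R[i],
        is_L2_integral 0 t
          (fun tau => free_flow (t - tau) (source k lambda V (u tau))) D &
        {ae mu, forall x : R, u t x = free_flow t f x + (0 +i* 1) * D x}].

End Defs.

(* Main.v *)
Require Import Defs.
From HB Require Import structures.
From mathcomp Require Import measurable_realfun ess_sup_inf ring lra zify.

(* Regularity.  By Duhamel's formula, exp(i t xi^2) times the Fourier transform
   of u(t) is a differentiable curve in L^2; a Gronwall argument on difference
   quotients in x shows that u is continuous with values in H^s.
   Uniform bound.  Put P = d^2/dx^2 + V.  For a frequency truncation v of u, the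
   function w = P^m v solves w_t = i (P w + P^m r), and up to lower order terms
   |w|^2, resp. - <P w, w>, is the squared norm of v in H^(2m), resp. H^(2m+1).
   Since P commutes with itself the potential contributes no growth, while the
   nonlinear part of r is O(<t>^(-3/2) (1 + |u|_{H^j})) by the decay assumption,
   k >= 2 and Landau's inequality for derivatives.  As <t>^(-3/2) is integrable,
   sup_t |u(t)|_{H^s} is finite, by induction on the order.
   Weights.  Let r be a bounded smooth approximation of T + |x| with |r'| <= 1,
   where T = <t>.  Then |d/dt |r^s u|^2| <= 4 s |r^s u| |r^(s-1) u_x|.
   Integration by parts makes the norms of r^(s-b) d^b u almost log-convex in b,
   so that |r^(s-1) u_x| <= C (|r^s u| / T + T^(s-1)), and Gronwall's lemma on
   [-T, T] gives |r^s u(t)| <= C T^s. *)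

Set Implicit Arguments.
Unset Strict Implicit.
Unset Printing Implicit Defensive.

(** * The ring of almost everywhere classes *)

(** The proof leaves the plain functions of the statement for classes of measurable functions, a
    commutative ring in which pointwise identities are ring identities, and for a Fourier transform
    [Fo] under which a derivative is multiplication by [XM]. The bridges back are [is_free_flowP],
    [in_SobolevP] and [weight_norm2E]. The shaping obstacle is that neither P^m u nor x^s u can be
    differentiated in time as it stands: V has s derivatives, u has no more, and the weight is
    unbounded. Hence the frequency cutoff [Jn n], after which derivatives are bounded operators, and
    bounded weights. The cutoff does not commute with V, but u, V u and the nonlinear term run
    through compact sets for t in [-T, T], so its error is below any constant for n large. Since n
    is chosen after T and after the weight, an error of size 1 / T costs a bounded factor in
    Gronwall's lemma and n is absent from the result. The weight exceeds T = <t> for a similar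
    reason: a power of it lost to a derivative is worth a factor 1 / T, whose integral over [-T, T]
    is bounded. *)

Section AeRing.
Variable R : realType.
Local Notation mu := (@lebesgue_measure R).
Local Notation C := R[i].
Local Notation Re := (@complex.Re R).
Local Notation Im := (@complex.Im R).

Lemma aeS (P Q : R -> Prop) : (forall x, P x -> Q x) ->
  {ae mu, forall x, P x} -> {ae mu, forall x, Q x}.
Proof. by move=> PQ; apply: filterS; first exact: (ae_filter_ringOfSetsType mu). Qed.
Lemma aeS2 (P Q S : R -> Prop) : (forall x, P x -> Q x -> S x) ->
  {ae mu, forall x, P x} -> {ae mu, forall x, Q x} -> {ae mu, forall x, S x}.
Proof. by move=> PQ; apply: filterS2; first exact: (ae_filter_ringOfSetsType mu). Qed.
Lemma aeS3 (P Q S T : R -> Prop) : (forall x, P x -> Q x -> S x -> T x) ->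
  {ae mu, forall x, P x} -> {ae mu, forall x, Q x} -> {ae mu, forall x, S x} ->
  {ae mu, forall x, T x}.
Proof. by move=> PQ; apply: filterS3; first exact: (ae_filter_ringOfSetsType mu). Qed.

Definition cmeas (f : R -> C) : Prop :=
  measurable_fun setT (Re \o f) /\ measurable_fun setT (Im \o f).

Definition aeeq (f g : R -> C) : Prop := {ae mu, forall x, f x = g x}.

Lemma aeeq_refl f : aeeq f f. Proof. exact: aeW. Qed.
Lemma aeeq_sym f g : aeeq f g -> aeeq g f.
Proof. by rewrite /aeeq; apply: aeS => x ->. Qed.
Lemma aeeq_trans f g h : aeeq f g -> aeeq g h -> aeeq f h.
Proof. by rewrite /aeeq; apply: aeS2 => x -> ->. Qed.

(** Only the almost everywhere class of [f] enters the set from which the choice is made, so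
    equivalent functions receive the same representative and the quotient is realised as a set of
    functions. *)
Definition canon (f : R -> C) : R -> C :=
  xget (fun=> 0) [set g | cmeas g /\ aeeq g f].

Lemma canonP f : cmeas f -> cmeas (canon f) /\ aeeq (canon f) f.
Proof.
move=> mf; rewrite /canon; case: xgetP => [g _ //|/(_ f) []]; split=> //.
exact: aeeq_refl.
Qed.

Lemma canon_eq f g : aeeq f g -> canon f = canon g.
Proof.
move=> fg; rewrite /canon; congr xget; apply/seteqP; split=> h [mh hh]; split=> //.
  exact: aeeq_trans hh fg.
exact: aeeq_trans hh (aeeq_sym fg).
Qed.

(** A class is stored as its chosen representative; hence almost everywhere equality of
    representatives is Leibniz equality ([Meq]), which is what rewriting and [ring] require. *)
Record Mfun := MkMfun { rep : R -> C; _ : exists2 f, cmeas f & rep = canon f }.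

Lemma cmeas_cst (c : C) : cmeas (fun=> c).
Proof. by split; exact: measurable_cst. Qed.

Lemma rep_meas a : cmeas (rep a).
Proof. by case: a => r [f mf /= ->]; case: (canonP mf). Qed.

Lemma Meq a b : aeeq (rep a) (rep b) -> a = b.
Proof.
case: a => r ra; case: b => r' rb /= rr'.
suff E : r = r' by subst r'; congr MkMfun; exact: Prop_irrelevance.
case: ra => f mf rf; case: rb => g mg rg; rewrite rf rg; apply: canon_eq.
have [_ h1] := canonP mf; have [_ h2] := canonP mg.
by apply: aeeq_trans (aeeq_sym h1) _; rewrite -rf; apply: aeeq_trans rr' _; rewrite rg.
Qed.

(** Total: a function that is not measurable is sent to the class of 0, so every use of [piE]
    carries a proof of [cmeas]. *)
Definition pi (f : R -> C) : Mfun :=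
  match pselect (cmeas f) with
  | left mf => MkMfun (ex_intro2 _ _ f mf erefl)
  | right _ => MkMfun (ex_intro2 _ _ (fun=> 0) (cmeas_cst 0) erefl)
  end.

Lemma piE f : cmeas f -> aeeq (rep (pi f)) f.
Proof. by move=> mf; rewrite /pi; case: pselect => //= ?; case: (canonP mf). Qed.

Lemma pi_eq f g : cmeas f -> cmeas g -> aeeq f g -> pi f = pi g.
Proof.
move=> mf mg fg; apply: Meq; apply: aeeq_trans (piE mf) _.
exact: aeeq_trans fg (aeeq_sym (piE mg)).
Qed.

Lemma pi_inj f g : cmeas f -> cmeas g -> pi f = pi g -> aeeq f g.
Proof.
move=> mf mg fg; apply: aeeq_trans (aeeq_sym (piE mf)) _.
by rewrite fg; exact: piE.
Qed.

Lemma pi_rep a : pi (rep a) = a.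
Proof. exact: Meq (piE (rep_meas a)). Qed.

(** An elimination principle: an identity between classes is checked on measurable functions, where
    it holds pointwise. *)
Lemma piW (P : Mfun -> Prop) : (forall f, cmeas f -> P (pi f)) -> forall a, P a.
Proof. by move=> Pf a; rewrite -(pi_rep a); apply: Pf; exact: rep_meas. Qed.

Lemma cmeasD f g : cmeas f -> cmeas g -> cmeas (fun x => f x + g x).
Proof.
move=> [f1 f2] [g1 g2]; split.
  rewrite (_ : _ \o _ = (Re \o f) \+ (Re \o g)); first exact: measurable_funD.
  by apply/funext => x /=; case: (f x) (g x) => ? ? [].
rewrite (_ : _ \o _ = (Im \o f) \+ (Im \o g)); first exact: measurable_funD.
by apply/funext => x /=; case: (f x) (g x) => ? ? [].
Qed.

Lemma cmeasN f : cmeas f -> cmeas (fun x => - f x).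
Proof.
move=> [f1 f2]; split.
  rewrite (_ : _ \o _ = -%R \o (Re \o f)); last first.
    by apply/funext => x /=; case: (f x).
  exact: measurableT_comp.
rewrite (_ : _ \o _ = -%R \o (Im \o f)); last first.
  by apply/funext => x /=; case: (f x).
exact: measurableT_comp.
Qed.

Lemma cmeasM f g : cmeas f -> cmeas g -> cmeas (fun x => f x * g x).
Proof.
move=> [f1 f2] [g1 g2]; split.
  rewrite (_ : _ \o _ = ((Re \o f) \* (Re \o g)) \- ((Im \o f) \* (Im \o g))).
    by apply: measurable_funB; exact: measurable_funM.
  by apply/funext => x /=; case: (f x) (g x) => ? ? [].
rewrite (_ : _ \o _ = ((Re \o f) \* (Im \o g)) \+ ((Im \o f) \* (Re \o g))).
  by apply: measurable_funD; exact: measurable_funM.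
by apply/funext => x /=; case: (f x) (g x) => ? ? [].
Qed.

Lemma cmeas_conj f : cmeas f -> cmeas (fun x => (f x)^*).
Proof.
move=> [f1 f2]; split.
  rewrite (_ : _ \o _ = (Re \o f)) //.
  by apply/funext => x /=; case: (f x).
rewrite (_ : _ \o _ = -%R \o (Im \o f)); last first.
  by apply/funext => x /=; case: (f x).
exact: measurableT_comp.
Qed.

(* Locked: otherwise unification compares sums, products, ... of classes by
   unfolding them. *)
Definition Madd := locked (fun a b => pi (fun x => rep a x + rep b x)).
Definition Mopp := locked (fun a => pi (fun x => - rep a x)).
Definition Mmul := locked (fun a b => pi (fun x => rep a x * rep b x)).
Definition Mcst := locked (fun c : C => pi (fun=> c)).
Definition Mconj := locked (fun a => pi (fun x => (rep a x)^*)).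

Lemma Madd_pi f g : cmeas f -> cmeas g -> Madd (pi f) (pi g) = pi (fun x => f x + g x).
Proof.
move=> mf mg; rewrite /Madd -lock; apply: pi_eq; [apply: cmeasD; exact: rep_meas|exact: cmeasD|].
by apply: aeS2 _ (piE mf) (piE mg) => x -> ->.
Qed.
Lemma Mmul_pi f g : cmeas f -> cmeas g -> Mmul (pi f) (pi g) = pi (fun x => f x * g x).
Proof.
move=> mf mg; rewrite /Mmul -lock; apply: pi_eq; [apply: cmeasM; exact: rep_meas|exact: cmeasM|].
by apply: aeS2 _ (piE mf) (piE mg) => x -> ->.
Qed.
Lemma Mopp_pi f : cmeas f -> Mopp (pi f) = pi (fun x => - f x).
Proof.
move=> mf; rewrite /Mopp -lock; apply: pi_eq; [apply: cmeasN; exact: rep_meas|exact: cmeasN|].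
by apply: aeS _ (piE mf) => x ->.
Qed.
Lemma Mconj_pi f : cmeas f -> Mconj (pi f) = pi (fun x => (f x)^*).
Proof.
move=> mf; rewrite /Mconj -lock; apply: pi_eq; [apply: cmeas_conj; exact: rep_meas|exact: cmeas_conj|].
by apply: aeS _ (piE mf) => x ->.
Qed.

Lemma Mcst_pi c : Mcst c = pi (fun=> c).
Proof. by rewrite /Mcst -lock. Qed.

HB.instance Definition _ := gen_eqMixin Mfun.
HB.instance Definition _ := gen_choiceMixin Mfun.

Lemma MaddA : associative Madd.
Proof.
elim/piW=> f mf; elim/piW=> g mg; elim/piW=> h mh.
by rewrite !Madd_pi //; do 2?[exact: cmeasD]; congr pi; apply/funext => x; rewrite addrA.
Qed.
Lemma MaddC : commutative Madd.
Proof.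
elim/piW=> f mf; elim/piW=> g mg.
by rewrite !Madd_pi //; congr pi; apply/funext => x; rewrite addrC.
Qed.
Lemma Madd0 : left_id (Mcst 0) Madd.
Proof.
elim/piW=> f mf; rewrite Mcst_pi Madd_pi //; last exact: cmeas_cst.
by congr pi; apply/funext => x; rewrite add0r.
Qed.
Lemma MaddN : left_inverse (Mcst 0) Mopp Madd.
Proof.
elim/piW=> f mf; rewrite Mopp_pi // Mcst_pi Madd_pi //; last exact: cmeasN.
by congr pi; apply/funext => x; rewrite addNr.
Qed.
HB.instance Definition _ := GRing.isZmodule.Build Mfun MaddA MaddC Madd0 MaddN.

Lemma MmulA : associative Mmul.
Proof.
elim/piW=> f mf; elim/piW=> g mg; elim/piW=> h mh.
by rewrite !Mmul_pi //; do 2?[exact: cmeasM]; congr pi; apply/funext => x; rewrite mulrA.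
Qed.
Lemma MmulC : commutative Mmul.
Proof.
elim/piW=> f mf; elim/piW=> g mg.
by rewrite !Mmul_pi //; congr pi; apply/funext => x; rewrite mulrC.
Qed.
Lemma Mmul1 : left_id (Mcst 1) Mmul.
Proof.
elim/piW=> f mf; rewrite Mcst_pi Mmul_pi //; last exact: cmeas_cst.
by congr pi; apply/funext => x; rewrite mul1r.
Qed.
Lemma MmulD : left_distributive Mmul +%R.
Proof.
elim/piW=> f mf; elim/piW=> g mg; elim/piW=> h mh.
have E a b : a + b = Madd a b by [].
rewrite !E Madd_pi // !Mmul_pi // ?Madd_pi //; do ?[exact: cmeasM]; do ?[exact: cmeasD].
by congr pi; apply/funext => x; rewrite mulrDl.
Qed.
(** The ring is nonzero because the line is not a null set; [0, 1] is enough to see it. *)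
Lemma Mone_neq0 : Mcst 1 != 0 :> Mfun.
Proof.
rewrite -[0]/(Mcst 0) !Mcst_pi; apply/eqP => /(pi_inj (cmeas_cst 1) (cmeas_cst 0)) /= [A [mA A0 sA]].
have : mu setT = 0%E.
  apply/eqP; rewrite eq_le measure_ge0 andbT -A0 le_measure ?inE //=.
  by apply: subset_trans sA => x _ /= /eqP; rewrite oner_eq0.
have : (mu (`[0%R, 1%R]%classic : set R) <= mu setT)%E by rewrite le_measure ?inE //=.
move=> + E; rewrite E lebesgue_measure_itv /= lte_fin ltr01 -EFinB subr0 lee_fin.
by rewrite ler10.
Qed.
HB.instance Definition _ := GRing.Zmodule_isComNzRing.Build Mfun MmulA MmulC Mmul1 MmulD Mone_neq0.

Lemma piD f g : cmeas f -> cmeas g -> pi f + pi g = pi (fun x => f x + g x).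
Proof. exact: Madd_pi. Qed.
Lemma piM f g : cmeas f -> cmeas g -> pi f * pi g = pi (fun x => f x * g x).
Proof. exact: Mmul_pi. Qed.
Lemma piN f : cmeas f -> - pi f = pi (fun x => - f x).
Proof. exact: Mopp_pi. Qed.

Lemma repD (a b : Mfun) : {ae mu, forall x, rep (a + b) x = rep a x + rep b x}.
Proof.
suff : aeeq (rep (a + b)) (fun x => rep a x + rep b x) by [].
have := piD (rep_meas a) (rep_meas b); rewrite !pi_rep => ->.
by apply: piE; apply: cmeasD; exact: rep_meas.
Qed.
Lemma repM (a b : Mfun) : {ae mu, forall x, rep (a * b) x = rep a x * rep b x}.
Proof.
suff : aeeq (rep (a * b)) (fun x => rep a x * rep b x) by [].
have := piM (rep_meas a) (rep_meas b); rewrite !pi_rep => ->.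
by apply: piE; apply: cmeasM; exact: rep_meas.
Qed.
Lemma repN (a : Mfun) : {ae mu, forall x, rep (- a) x = - rep a x}.
Proof.
suff : aeeq (rep (- a)) (fun x => - rep a x) by [].
have := piN (rep_meas a); rewrite !pi_rep => ->.
by apply: piE; apply: cmeasN; exact: rep_meas.
Qed.
Lemma repB (a b : Mfun) : {ae mu, forall x, rep (a - b) x = rep a x - rep b x}.
Proof. by apply: aeS2 _ (repD a (- b)) (repN b) => x -> ->. Qed.
Lemma rep_conj (a : Mfun) : {ae mu, forall x, rep (Mconj a) x = (rep a x)^*}.
Proof.
suff : aeeq (rep (Mconj a)) (fun x => (rep a x)^*) by [].
have := Mconj_pi (rep_meas a); rewrite !pi_rep => ->.
by apply: piE; apply: cmeas_conj; exact: rep_meas.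
Qed.
Lemma rep_cst c : {ae mu, forall x, rep (Mcst c) x = c}.
Proof. by rewrite Mcst_pi; exact: piE (cmeas_cst _). Qed.
Lemma rep0 : {ae mu, forall x, rep 0 x = 0}.
Proof. exact: rep_cst. Qed.

End AeRing.

(** * The space L^2 *)

Section L2.
Variable R : realType.
Local Notation mu := (@lebesgue_measure R).
Local Notation C := R[i].
Local Notation Re := (@complex.Re R).
Local Notation Im := (@complex.Im R).
Local Notation M := (Mfun R).
Implicit Types (a b c : M) (f g : R -> R[i]).

Definition csq (z : C) : R := Re z ^+ 2 + Im z ^+ 2.
(** The real part of z w^*. So [rip] is the real inner product of L^2, and imaginary parts are
    reached by multiplying one argument by i. *)
Definition rdot (z w : C) : R := Re z * Re w + Im z * Im w.

Lemma cmod_sqr (z : C) : cmod z ^+ 2 = csq z.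
Proof.
by case: z => x y; rewrite /cmod /= sqr_sqrtr // addr_ge0 // sqr_ge0.
Qed.
Lemma cmod_ge0 (z : C) : 0 <= cmod z.
Proof. by case: z => x y; rewrite /cmod /= sqrtr_ge0. Qed.
Lemma csq_ge0 (z : C) : 0 <= csq z.
Proof. by rewrite addr_ge0 // sqr_ge0. Qed.
Lemma csqM (z w : C) : csq (z * w) = csq z * csq w.
Proof. by case: z w => x y [x' y']; rewrite /csq /=; ring. Qed.
Lemma cmodM (z w : C) : cmod (z * w) = cmod z * cmod w.
Proof. exact: Normc.normcM. Qed.
Lemma cmodD (z w : C) : cmod (z + w) <= cmod z + cmod w.
Proof. exact: le_normcD. Qed.
Lemma cmodN (z : C) : cmod (- z) = cmod z.
Proof. by case: z => x y; rewrite /cmod /= !sqrrN. Qed.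
Lemma cmod_conj (z : C) : cmod z^* = cmod z.
Proof. by case: z => x y; rewrite /cmod /= !sqrrN. Qed.
Lemma cmod_real (r : R) : cmod r%:C = `|r|.
Proof. by rewrite /cmod /= expr0n /= addr0 sqrtr_sqr. Qed.
Lemma cmod_csq (z : C) : cmod z = Num.sqrt (csq z).
Proof. by case: z. Qed.
Lemma Re_le_cmod (z : C) : `|Re z| <= cmod z.
Proof.
case: z => x y; rewrite /cmod /= -sqrtr_sqr ler_sqrt; last by rewrite addr_ge0 ?sqr_ge0.
by rewrite lerDl sqr_ge0.
Qed.
Lemma Im_le_cmod (z : C) : `|Im z| <= cmod z.
Proof.
case: z => x y; rewrite /cmod /= -sqrtr_sqr ler_sqrt; last by rewrite addr_ge0 ?sqr_ge0.
by rewrite lerDr sqr_ge0.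
Qed.
Lemma cmod_le_ReIm (z : C) : cmod z <= `|Re z| + `|Im z|.
Proof.
rewrite -(@ler_pXn2r _ 2) ?nnegrE ?cmod_ge0 ?addr_ge0 // cmod_sqr /csq.
rewrite -(real_normK (num_real (Re z))) -(real_normK (num_real (Im z))).
have := normr_ge0 (Re z); have := normr_ge0 (Im z); nra.
Qed.
Lemma rdot_le (z w : C) : `|rdot z w| <= csq z + csq w.
Proof.
rewrite /rdot /csq ler_norml; apply/andP; split.
  by have := sqr_ge0 (Re z + Re w); have := sqr_ge0 (Im z + Im w); nra.
by have := sqr_ge0 (Re z - Re w); have := sqr_ge0 (Im z - Im w); nra.
Qed.

Lemma measurable_csq f : cmeas f -> measurable_fun setT (csq \o f).
Proof. by move=> [f1 f2]; apply: measurable_funD; exact: measurable_funX. Qed.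
Lemma measurable_cmod f : cmeas f -> measurable_fun setT (@cmod R \o f).
Proof.
move=> mf; rewrite (_ : _ \o _ = Num.sqrt \o (csq \o f)).
  apply: (@measurableT_comp _ _ _ _ _ _ (@Num.sqrt R)); last exact: measurable_csq.
  by apply: continuous_measurable_fun => x; exact: sqrt_continuous.
by apply/funext => x /=; rewrite cmod_csq.
Qed.
Lemma measurable_rdot f g : cmeas f -> cmeas g ->
  measurable_fun setT (fun x => rdot (f x) (g x)).
Proof.
move=> [f1 f2] [g1 g2].
by apply: (measurable_funD (f:=fun x => Re (f x) * Re (g x))
  (g:=fun x => Im (f x) * Im (g x))); exact: measurable_funM.
Qed.

Definition n2 a : \bar R := (\int[mu]_x (csq (rep a x))%:E)%E.
Definition L2 a : Prop := (n2 a < +oo)%E.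
(** [fine] turns an infinite integral into 0, so the value carries information only together with
    [L2]. *)
Definition nm := locked (fun a => Num.sqrt (fine (n2 a)) : R).
Definition rip := locked (fun a b => (\int[mu]_x rdot (rep a x) (rep b x))%R).
Definition bdd a (B : R) : Prop := {ae mu, forall x, cmod (rep a x) <= B}.

Lemma nmE a : nm a = Num.sqrt (fine (n2 a)).
Proof. by rewrite /nm -lock. Qed.
Lemma ripE a b : rip a b = (\int[mu]_x rdot (rep a x) (rep b x))%R.
Proof. by rewrite /rip -lock. Qed.

Lemma n2_ge0 a : (0 <= n2 a)%E.
Proof. by apply: integral_ge0 => x _; rewrite lee_fin csq_ge0. Qed.

Lemma n2_ae a f : cmeas f -> aeeq (rep a) f -> n2 a = (\int[mu]_x (csq (f x))%:E)%E.
Proof.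
move=> mf af; apply: ge0_ae_eq_integral => //.
- by apply/measurable_EFinP; apply: measurable_csq; exact: rep_meas.
- by apply/measurable_EFinP; apply: measurable_csq.
- by move=> x _; rewrite lee_fin csq_ge0.
- by move=> x _; rewrite lee_fin csq_ge0.
- by apply: aeS _ af => x ->.
Qed.

Lemma n2_pi f : cmeas f -> n2 (pi f) = (\int[mu]_x (csq (f x))%:E)%E.
Proof. by move=> mf; apply: n2_ae => //; exact: piE. Qed.

Lemma n2_le a (F : R -> R) : measurable_fun setT F ->
  {ae mu, forall x, csq (rep a x) <= F x} -> (forall x, 0 <= F x) ->
  (n2 a <= \int[mu]_x (F x)%:E)%E.
Proof.
move=> mF aF F0; apply: ae_ge0_le_integral => //.
- by move=> x _; rewrite lee_fin csq_ge0.
- by apply/measurable_EFinP; apply: measurable_csq; exact: rep_meas.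
- by move=> x _; rewrite lee_fin.
- exact/measurable_EFinP.
- by apply: aeS _ aF => x h _; rewrite lee_fin.
Qed.

Lemma L2_csq a : L2 a -> mu.-integrable setT (EFin \o (csq \o rep a)).
Proof.
move=> La; apply/integrableP; split.
  by apply/measurable_EFinP; apply: measurable_csq; exact: rep_meas.
apply: le_lt_trans La; rewrite le_eqVlt; apply/orP; left; apply/eqP.
by apply: eq_integral => x _ /=; rewrite ger0_norm // csq_ge0.
Qed.

Lemma L2_rdot a b : L2 a -> L2 b ->
  mu.-integrable setT (EFin \o (fun x => rdot (rep a x) (rep b x))).
Proof.
move=> La Lb; apply: (le_integrable measurableT _ _ (integrableD measurableT (L2_csq La) (L2_csq Lb))).
  by apply/measurable_EFinP; apply: measurable_rdot; exact: rep_meas.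
move=> x _ /=; rewrite lee_fin.
exact: le_trans (rdot_le _ _) (ler_norm _).
Qed.

Lemma rip_ae a b f g : cmeas f -> cmeas g -> aeeq (rep a) f -> aeeq (rep b) g ->
  rip a b = (\int[mu]_x rdot (f x) (g x))%R.
Proof.
move=> mf mg af bg; rewrite ripE /Rintegral; congr fine.
apply: ae_eq_integral => //.
- by apply/measurable_EFinP; apply: measurable_rdot; exact: rep_meas.
- by apply/measurable_EFinP; apply: measurable_rdot.
- by apply: aeS2 _ af bg => x -> ->.
Qed.

Lemma rip_pi f g : cmeas f -> cmeas g -> rip (pi f) (pi g) = (\int[mu]_x rdot (f x) (g x))%R.
Proof. by move=> mf mg; apply: rip_ae => //; exact: piE. Qed.

Lemma ripC a b : rip a b = rip b a.
Proof. by rewrite !ripE; apply: eq_Rintegral => x _; rewrite /rdot; ring. Qed.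

Lemma L2D a b : L2 a -> L2 b -> L2 (a + b).
Proof.
move=> La Lb; rewrite /L2.
have i1 := integrableD measurableT (L2_csq La) (L2_csq Lb).
have i2 := integrableD measurableT i1 i1.
move/integrableP: i2 => [m2 i2]; apply: le_lt_trans i2.
apply: (@le_trans _ _ (\int[mu]_x (2 * (csq (rep a x) + csq (rep b x)))%:E)%E); last first.
  rewrite le_eqVlt; apply/orP; left; apply/eqP.
  apply: eq_integral => x _ /=.
  have P : 0 <= csq (rep a x) + csq (rep b x) by exact: addr_ge0 (csq_ge0 _) (csq_ge0 _).
  rewrite ger0_norm; last exact: (addr_ge0 P P).
  by congr EFin; ring.
apply: n2_le => [||x]; last exact: (mulr_ge0 (ler0n _ _) (addr_ge0 (csq_ge0 _) (csq_ge0 _))).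
  apply: measurable_funM => //.
  by apply: measurable_funD; apply: measurable_csq; exact: rep_meas.
apply: aeS _ (repD a b) => x ->; case: (rep a x) (rep b x) => p q [r s]; rewrite /csq /=.
have := sqr_ge0 (p - r); have := sqr_ge0 (q - s); nra.
Qed.

Lemma L2M a b B : bdd a B -> L2 b -> L2 (a * b).
Proof.
move=> aB Lb; rewrite /L2.
apply: (@le_lt_trans _ _ (\int[mu]_x (B ^+ 2 * csq (rep b x))%:E)%E).
  apply: n2_le => [||x]; last by rewrite mulr_ge0 ?sqr_ge0 ?csq_ge0.
    apply: measurable_funM => //; apply: measurable_csq; exact: rep_meas.
  apply: aeS2 _ aB (repM a b) => x h ->; rewrite csqM ler_wpM2r ?csq_ge0 //.
  by rewrite -cmod_sqr; have := cmod_ge0 (rep a x); nra.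
under eq_integral do rewrite EFinM.
rewrite ge0_integralZl_EFin ?sqr_ge0 //.
- by rewrite lte_mul_pinfty // lee_fin sqr_ge0.
- by move=> x _; rewrite lee_fin csq_ge0.
- by apply/measurable_EFinP; apply: measurable_csq; exact: rep_meas.
Qed.

Lemma bdd_cst z : bdd (Mcst z) (cmod z).
Proof. by apply: aeS _ (rep_cst z) => x ->. Qed.
Lemma bddM a b A B : 0 <= A -> bdd a A -> bdd b B -> bdd (a * b) (A * B).
Proof.
move=> A0 aA bB; apply: aeS3 _ aA bB (repM a b) => x h1 h2 ->.
by rewrite cmodM ler_pM // cmod_ge0.
Qed.
Lemma bddD a b A B : bdd a A -> bdd b B -> bdd (a + b) (A + B).
Proof.
move=> aA bB; apply: aeS3 _ aA bB (repD a b) => x h1 h2 ->.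
exact: le_trans (cmodD _ _) (lerD h1 h2).
Qed.
Lemma bddN a A : bdd a A -> bdd (- a) A.
Proof. by apply: aeS2 _ (repN a) => x -> h; rewrite cmodN. Qed.
Lemma bddB a b A B : bdd a A -> bdd b B -> bdd (a - b) (A + B).
Proof. by move=> aA /bddN; exact: bddD. Qed.
Lemma bdd_le a A B : A <= B -> bdd a A -> bdd a B.
Proof. by move=> AB; apply: aeS => x h; exact: le_trans h AB. Qed.
Lemma bdd_conj a A : bdd a A -> bdd (Mconj a) A.
Proof. by apply: aeS2 _ (rep_conj a) => x -> h; rewrite cmod_conj. Qed.
Lemma bdd_pi f B : cmeas f -> (forall x, cmod (f x) <= B) -> bdd (pi f) B.
Proof. by move=> mf fB; apply: aeS _ (piE mf) => x ->. Qed.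
(** A negative bound on a modulus would hold at no point, hence 1 = 0 almost everywhere. *)
Lemma bdd_ge0 a A : bdd a A -> 0 <= A.
Proof.
move=> aA; rewrite leNgt; apply/negP => A0.
have : {ae mu, forall x : R, (1 : R) = 0}.
  by apply: aeS _ aA => x h; have := le_lt_trans h A0; rewrite ltNge cmod_ge0.
move=> h; have /eqP := Mone_neq0 R; apply; rewrite -[0]/(Mcst 0) !Mcst_pi; apply: pi_eq; do ?exact: cmeas_cst.
by apply: aeS _ h => x /eqP; rewrite oner_eq0.
Qed.

Lemma L2Z z a : L2 a -> L2 (Mcst z * a).
Proof. exact: L2M (bdd_cst z). Qed.
Lemma McstN z : Mcst (- z) = - Mcst z :> M.
Proof. by rewrite !Mcst_pi piN //; exact: cmeas_cst. Qed.
Lemma L2N a : L2 a -> L2 (- a).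
Proof.
move=> La; rewrite (_ : - a = Mcst (-1) * a); first exact: L2Z.
by rewrite McstN mulNr (mul1r (a : M)).
Qed.
Lemma L2B a b : L2 a -> L2 b -> L2 (a - b).
Proof. by move=> La Lb; apply: L2D => //; exact: L2N. Qed.
Lemma L20 : L2 0.
Proof.
rewrite /L2 (_ : n2 0 = 0%E) // (n2_ae (cmeas_cst 0)); last exact: rep0.
by apply: integral0_eq => x _; rewrite /csq /= expr0n /= addr0.
Qed.
Lemma n2_conj a : n2 (Mconj a) = n2 a.
Proof.
rewrite (n2_ae (cmeas_conj (rep_meas a)) (rep_conj a)).
by apply: eq_integral => x _; case: (rep a x) => p q; rewrite /csq /= sqrrN.
Qed.
Lemma L2conj a : L2 a -> L2 (Mconj a).
Proof. by rewrite /L2 n2_conj. Qed.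
Lemma nm_conj a : nm (Mconj a) = nm a.
Proof. by rewrite !nmE n2_conj. Qed.

Lemma ripDl a b c : L2 a -> L2 b -> L2 c -> rip (a + b) c = rip a c + rip b c.
Proof.
move=> La Lb Lc; rewrite (rip_ae (cmeasD (rep_meas a) (rep_meas b)) (rep_meas c) (repD a b) (aeeq_refl _)).
rewrite !ripE -RintegralD //; do ?exact: L2_rdot.
apply: eq_Rintegral => x _; case: (rep a x) (rep b x) (rep c x) => ? ? [? ?] [? ?]; rewrite /rdot /=; ring.
Qed.
Lemma ripZl r a c : L2 a -> L2 c -> rip (Mcst r%:C * a) c = r * rip a c.
Proof.
move=> La Lc.
have h : aeeq (rep (Mcst r%:C * a)) (fun x => r%:C * rep a x).
  by apply: aeS2 _ (repM (Mcst r%:C) a) (rep_cst r%:C) => x -> ->.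
rewrite (rip_ae (cmeasM (cmeas_cst r%:C) (rep_meas a)) (rep_meas c) h (aeeq_refl _)).
rewrite !ripE -RintegralZl //; do ?exact: L2_rdot.
apply: eq_Rintegral => x _; case: (rep a x) (rep c x) => ? ? [? ?]; rewrite /rdot /=; ring.
Qed.
(** The two integrands coincide pointwise, so a multiplier crosses the inner product whether or not
    the products are in L^2. *)
Lemma rip_adj m a b : rip (m * a) b = rip a (Mconj m * b).
Proof.
have h : aeeq (rep (Mconj m * b)) (fun x => (rep m x)^* * rep b x).
  by apply: aeS2 _ (repM (Mconj m) b) (rep_conj m) => x -> ->.
rewrite (rip_ae (cmeasM (rep_meas m) (rep_meas a)) (rep_meas b) (repM m a) (aeeq_refl _)).
rewrite (rip_ae (rep_meas a) (cmeasM (cmeas_conj (rep_meas m)) (rep_meas b)) (aeeq_refl _) h).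
apply: eq_Rintegral => x _; case: (rep a x) (rep b x) (rep m x) => ? ? [? ?] [? ?]; rewrite /rdot /=; ring.
Qed.
Lemma rip_conj a b : rip (Mconj a) (Mconj b) = rip a b.
Proof.
rewrite (rip_ae (cmeas_conj (rep_meas a)) (cmeas_conj (rep_meas b)) (rep_conj a) (rep_conj b)) ripE.
apply: eq_Rintegral => x _; case: (rep a x) (rep b x) => ? ? [? ?]; rewrite /rdot /=; ring.
Qed.
Lemma MconjK a : Mconj (Mconj a) = a.
Proof.
apply: Meq; apply: aeS2 _ (rep_conj (Mconj a)) (rep_conj a) => x -> ->.
by case: (rep a x) => p q /=; rewrite opprK.
Qed.
Lemma MconjM a b : Mconj (a * b) = Mconj a * Mconj b.
Proof.
elim/piW: a => a ma; elim/piW: b => b mb.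
rewrite !(piM, Mconj_pi) //; do ?[exact: cmeasM|exact: cmeas_conj].
by congr pi; apply/funext => x; rewrite rmorphM.
Qed.
Lemma MconjD a b : Mconj (a + b) = Mconj a + Mconj b.
Proof.
elim/piW: a => a ma; elim/piW: b => b mb.
rewrite !(piD, Mconj_pi) //; do ?[exact: cmeasD|exact: cmeas_conj].
by congr pi; apply/funext => x; rewrite rmorphD.
Qed.
Lemma Mconj_cst z : Mconj (Mcst z) = Mcst z^* :> M.
Proof. by rewrite !Mcst_pi Mconj_pi //; exact: cmeas_cst. Qed.
Lemma McstM z w : Mcst (z * w) = Mcst z * Mcst w :> M.
Proof. by rewrite !Mcst_pi piM //; exact: cmeas_cst. Qed.
Lemma McstD z w : Mcst (z + w) = Mcst z + Mcst w :> M.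
Proof. by rewrite !Mcst_pi piD //; exact: cmeas_cst. Qed.
Lemma MconjN a : Mconj (- a) = - Mconj a.
Proof.
by apply/eqP; rewrite -addr_eq0 -MconjD addNr Mconj_cst (_ : (0:C)^* = 0) // rmorph0.
Qed.
Lemma MconjB a b : Mconj (a - b) = Mconj a - Mconj b.
Proof. by rewrite MconjD MconjN. Qed.

Lemma nm_ge0 a : 0 <= nm a. Proof. by rewrite nmE sqrtr_ge0. Qed.
Lemma nm_sqr a : nm a ^+ 2 = fine (n2 a).
Proof. by rewrite nmE sqr_sqrtr // fine_ge0 // n2_ge0. Qed.
Lemma rip_nm a : rip a a = nm a ^+ 2.
Proof.
by rewrite nm_sqr ripE /Rintegral /n2; congr fine; apply: eq_integral => x _.
Qed.
Lemma n2E a : L2 a -> n2 a = (nm a ^+ 2)%:E.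
Proof. by move=> La; rewrite nm_sqr fineK // ge0_fin_numE // n2_ge0. Qed.

Lemma nm_eq0 a : L2 a -> nm a = 0 -> a = 0.
Proof.
move=> La a0; apply: Meq; have := n2E La; rewrite a0 expr0n /= => h.
have mq : measurable_fun setT (EFin \o (csq \o rep a)).
  by apply/measurable_EFinP; apply: measurable_csq; exact: rep_meas.
have/(ae_eq_integral_abs mu measurableT mq) : (\int[mu]_x `|(csq (rep a x))%:E| = 0)%E.
  by rewrite -[RHS]h; apply: eq_integral => x _ /=; rewrite ger0_norm // csq_ge0.
move=> h0; apply: aeS2 _ h0 (rep0 R) => x /(_ Logic.I) /= [] + ->.
case: (rep a x) => p q; rewrite /csq /= => /eqP.
by rewrite paddr_eq0 ?sqr_ge0 // !sqrf_eq0 => /andP[/eqP -> /eqP ->].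
Qed.

End L2.

(** * Cauchy-Schwarz, Fatou, dominated convergence and completeness in L^2 *)

Section L2conv.
Variable R : realType.
Local Notation mu := (@lebesgue_measure R).
Local Notation C := R[i].
Local Notation Re := (@complex.Re R).
Local Notation Im := (@complex.Im R).
Local Notation M := (Mfun R).
Implicit Types (a b c : M) (f g : R -> C).

Lemma nmB_sqr a b : L2 a -> L2 b ->
  nm (a - b) ^+ 2 = nm a ^+ 2 - 2 * rip a b + nm b ^+ 2.
Proof.
move=> La Lb; have Lb' := L2N Lb; have Lab := L2B La Lb.
have rN c : L2 c -> rip (- b) c = - rip b c.
  move=> Lc; have := ripDl Lb Lb' Lc; rewrite subrr.
  have := ripDl (@L20 R) (@L20 R) Lc; rewrite addr0; lra.
rewrite -!rip_nm ripDl // rN // (ripC a) (ripC b) !ripDl // !rN // (ripC b a); ring.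
Qed.

Lemma ripNl a b : L2 a -> L2 b -> rip (- a) b = - rip a b.
Proof.
move=> La Lb; have := ripDl La (L2N La) Lb; rewrite subrr.
have := ripDl (@L20 R) (@L20 R) Lb; rewrite addr0; lra.
Qed.

Lemma ripBl a b c : L2 a -> L2 b -> L2 c -> rip (a - b) c = rip a c - rip b c.
Proof. by move=> La Lb Lc; rewrite ripDl //; [rewrite ripNl|exact: L2N]. Qed.
Lemma ripDr a b c : L2 a -> L2 b -> L2 c -> rip c (a + b) = rip c a + rip c b.
Proof. by move=> La Lb Lc; rewrite ripC ripDl // !(ripC c). Qed.
Lemma ripBr a b c : L2 a -> L2 b -> L2 c -> rip c (a - b) = rip c a - rip c b.
Proof. by move=> La Lb Lc; rewrite ripC ripBl // !(ripC c). Qed.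
Lemma ripNr a b : L2 a -> L2 b -> rip b (- a) = - rip b a.
Proof. by move=> La Lb; rewrite ripC ripNl // ripC. Qed.
Lemma ripZr r a c : L2 a -> L2 c -> rip c (Mcst r%:C * a) = r * rip c a.
Proof. by move=> La Lc; rewrite ripC ripZl // ripC. Qed.

Lemma nmZ r a : L2 a -> nm (Mcst r%:C * a) = `|r| * nm a.
Proof.
move=> La; apply/eqP; rewrite -(@eqrXn2 _ 2) ?nm_ge0 ?mulr_ge0 ?nm_ge0 //.
rewrite -rip_nm ripZl ?ripZr //; last exact: L2Z.
by rewrite rip_nm exprMn real_normK ?num_real //; apply/eqP; ring.
Qed.

Lemma nmN a : nm (- a) = nm a.
Proof.
rewrite !nmE (n2_ae (cmeasN (rep_meas a)) (repN a)); congr (Num.sqrt (fine _)).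
by apply: eq_integral => x _; case: (rep a x) => p q; rewrite /csq /= !sqrrN.
Qed.
Lemma nmBC a b : nm (a - b) = nm (b - a).
Proof. by rewrite -nmN opprB. Qed.

Lemma nm0 : nm (0 : M) = 0.
Proof.
have := nmB_sqr (@L20 R) (@L20 R); rewrite subr0 rip_nm => h.
by apply/eqP; rewrite -sqrf_eq0; apply/eqP; lra.
Qed.

Lemma CS a b : L2 a -> L2 b -> `|rip a b| <= nm a * nm b.
Proof.
move=> La Lb; have [b0|b0] := eqVneq (nm b) 0.
  rewrite (nm_eq0 Lb b0) nm0 mulr0.
  have := ripDr (@L20 R) (@L20 R) La; rewrite addr0 => h.
  by rewrite (_ : rip a 0 = 0) ?normr0 //; lra.
have B : 0 < nm b by rewrite lt_def b0 nm_ge0.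
rewrite -(@ler_pXn2r _ 2) ?nnegrE ?mulr_ge0 ?nm_ge0 // real_normK ?num_real // exprMn.
(* The t that minimises |a - t b|; nonnegativity of the minimum is the inequality. *)
set t := rip a b / nm b ^+ 2.
have := nmB_sqr La (L2Z t%:C Lb); rewrite ripZr // nmZ // exprMn real_normK ?num_real // => E.
have : 0 <= nm (a - Mcst t%:C * b) ^+ 2 by exact: sqr_ge0.
rewrite E; have tE : t * nm b ^+ 2 = rip a b by rewrite divfK // expf_neq0.
have -> : t ^+ 2 * nm b ^+ 2 = t * rip a b by rewrite expr2 -mulrA tE.
move=> h; have h1 : 0 <= nm a ^+ 2 - t * rip a b by lra.
have E2 : t * rip a b * nm b ^+ 2 = rip a b ^+ 2 by rewrite mulrAC tE expr2.
by have := mulr_ge0 h1 (sqr_ge0 (nm b)); rewrite mulrBl E2; lra.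
Qed.

Lemma nmB a b : L2 a -> L2 b -> nm (a - b) <= nm a + nm b.
Proof.
move=> La Lb; rewrite -(@ler_pXn2r _ 2) ?nnegrE ?addr_ge0 ?nm_ge0 // nmB_sqr //.
have := CS La Lb; rewrite ler_norml => /andP[h1 h2]; nra.
Qed.
Lemma nmD a b : L2 a -> L2 b -> nm (a + b) <= nm a + nm b.
Proof. by move=> La Lb; rewrite -{1}(opprK b) -(nmN b) nmB //; exact: L2N. Qed.
Lemma nm_tri c a b : L2 a -> L2 b -> L2 c -> nm (a - b) <= nm (a - c) + nm (c - b).
Proof.
move=> La Lb Lc; rewrite (_ : a - b = (a - c) + (c - b)); last by rewrite addrA subrK.
by apply: nmD; exact: L2B.
Qed.
Lemma nm_sub a b : L2 a -> L2 b -> nm a <= nm b + nm (a - b).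
Proof.
by move=> La Lb; rewrite -{1}(subrK b a) addrC nmD //; exact: L2B.
Qed.

Lemma nmM_bdd m a B : bdd m B -> L2 a -> nm (m * a) <= B * nm a.
Proof.
move=> mB La; have B0 := bdd_ge0 mB.
rewrite -(@ler_pXn2r _ 2) ?nnegrE ?mulr_ge0 ?nm_ge0 // exprMn -lee_fin.
rewrite -n2E; last exact: L2M mB La.
rewrite EFinM -n2E //.
rewrite -ge0_integralZl_EFin ?sqr_ge0 //; last 2 first.
- by move=> x _; rewrite lee_fin csq_ge0.
- by apply/measurable_EFinP; apply: measurable_csq; exact: rep_meas.
apply: (@n2_le _ _ (fun x => B ^+ 2 * csq (rep a x))) => [||x].
- by apply: measurable_funM => //; apply: measurable_csq; exact: rep_meas.
- apply: aeS2 _ mB (repM m a) => x h ->; rewrite csqM ler_wpM2r ?csq_ge0 //.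
  by rewrite -cmod_sqr; have := cmod_ge0 (rep m x); nra.
- by rewrite mulr_ge0 ?sqr_ge0 ?csq_ge0.
Qed.

Lemma nmM_unit m a : Mconj m * m = 1 -> nm (m * a) = nm a.
Proof.
move=> m1; apply/eqP; rewrite -(@eqrXn2 _ 2) ?nm_ge0 //.
by rewrite -!rip_nm rip_adj mulrA m1 mul1r.
Qed.

Lemma ext_rip a b : L2 a -> L2 b -> (forall c, L2 c -> rip a c = rip b c) -> a = b.
Proof.
move=> La Lb h; apply/eqP; rewrite -subr_eq0; apply/eqP; apply: nm_eq0; first exact: L2B.
apply/eqP; rewrite -sqrf_eq0 -rip_nm ripBl //; last exact: L2B.
by rewrite h ?subrr //; exact: L2B.
Qed.

Definition ctends (u : nat -> C) (l : C) : Prop :=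
  forall e : R, 0 < e -> exists N, forall n, (N <= n)%N -> cmod (u n - l) <= e.
(** Convergence to 0, meant for nonnegative sequences such as norms; hence only an upper bound is
    recorded. *)
Definition tz (u : nat -> R) : Prop :=
  forall e : R, 0 < e -> exists N, forall n, (N <= n)%N -> u n <= e.

Lemma tz_squeeze u v : (forall n, u n <= v n) -> tz v -> tz u.
Proof. by move=> uv h e /h[N hN]; exists N => n /hN; exact: le_trans (uv n). Qed.
Lemma tz_add u v : tz u -> tz v -> tz (fun n => u n + v n).
Proof.
move=> hu hv e e0; have e2 : 0 < e / 2 by rewrite divr_gt0.
have [N1 h1] := hu _ e2; have [N2 h2] := hv _ e2.
exists (maxn N1 N2) => n; rewrite geq_max => /andP[/h1 H1 /h2 H2].
by rewrite (splitr e) lerD.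
Qed.
Lemma tz_mul (c : R) u : 0 <= c -> tz u -> tz (fun n => c * u n).
Proof.
move=> c0 hu e e0; have [N hN] := hu (e / (c + 1)) (divr_gt0 e0 (ltr_wpDl c0 ltr01)).
exists N => n /hN h; have c1 : 0 < c + 1 by rewrite ltr_wpDl.
have : (c + 1) * u n <= e by rewrite mulrC -ler_pdivlMr.
have [u0|u0] := leP 0 (u n); first by nra.
by move=> _; apply: le_trans (ltW e0); rewrite mulr_ge0_le0 // ltW.
Qed.
Lemma tz_cvg u : (forall n, 0 <= u n) -> u @ \oo --> (0 : R) -> tz u.
Proof.
move=> u0 /cvgrPdist_le h e e0; have [N _ hN] := h _ e0.
by exists N => n /hN; rewrite sub0r normrN ger0_norm.
Qed.
Lemma tz_bound (x A : R) u : tz u -> (forall n, x <= A + u n) -> x <= A.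
Proof.
move=> hu h; apply/ler_addgt0Pr => e e0; have [N hN] := hu _ e0.
by apply: le_trans (h N) _; rewrite lerD2l hN.
Qed.

Lemma ctends_cvg u l : ctends u l -> (fun n => csq (u n)) @ \oo --> csq l.
Proof.
move=> h.
have hr : (fun n => Re (u n)) @ \oo --> Re l.
  apply/cvgrPdist_le => e e0; have [N hN] := h _ e0; exists N => // n /= /hN.
  by apply: le_trans; rewrite distrC; apply: le_trans (Re_le_cmod _); case: (u n) (l) => ? ? [].
have hi : (fun n => Im (u n)) @ \oo --> Im l.
  apply/cvgrPdist_le => e e0; have [N hN] := h _ e0; exists N => // n /= /hN.
  by apply: le_trans; rewrite distrC; apply: le_trans (Im_le_cmod _); case: (u n) (l) => ? ? [].
rewrite /csq !expr2 (_ : (fun n => _) = (fun n => Re (u n) * Re (u n) + Im (u n) * Im (u n))).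
  by apply: cvgD; exact: cvgM.
by apply/funext => n; rewrite !expr2.
Qed.

(** Fatou's lemma for the squared moduli. It is the way to see that a pointwise limit lies in L^2
    when only a uniform bound is known. *)
Lemma fatou_nm (h : nat -> M) (g : M) B : (forall n, L2 (h n)) -> (forall n, nm (h n) <= B) ->
  {ae mu, forall x, ctends (fun n => rep (h n) x) (rep g x)} -> L2 g /\ nm g <= B.
Proof.
move=> Lh hB hg; have B0 : 0 <= B by exact: le_trans (nm_ge0 _) (hB 0%N).
suff H : (n2 g <= (B ^+ 2)%:E)%E.
  have Lg : L2 g by apply: le_lt_trans H _; rewrite ltry.
  split=> //; rewrite -(@ler_pXn2r _ 2) ?nnegrE ?nm_ge0 //.
  by rewrite -lee_fin -n2E.
pose F n x := (csq (rep (h n) x))%:E.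
have mF n : measurable_fun setT (F n).
  by apply/measurable_EFinP; apply: measurable_csq; exact: rep_meas.
have F0 n x : setT x -> (0 <= F n x)%E by move=> _; rewrite lee_fin csq_ge0.
apply: (@le_trans _ _ (\int[mu]_x limn_einf (F^~ x))%E).
  apply: ae_ge0_le_integral => //.
  - by move=> x _; rewrite lee_fin csq_ge0.
  - by apply/measurable_EFinP; apply: measurable_csq; exact: rep_meas.
  - move=> x _; rewrite limn_einf_lim; apply: lime_ge; first exact: is_cvg_einfs.
    by apply: nearW => n; apply: le_ereal_inf_tmp => _ [m _ <-]; exact: F0.
  - rewrite (_ : (fun x => _) = (fun x => - limn_esup (-%E \o F^~ x))%E).
      apply: (measurableT_comp (f := -%E)); first exact: oppe_measurable.
      apply: measurable_fun_limn_esup => n.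
      by apply: (measurableT_comp (f := -%E)); [exact: oppe_measurable|exact: mF].
    by apply/funext => x; rewrite limn_esupN oppeK.
  apply: aeS _ hg => x hx _; have : F^~ x @ \oo --> (csq (rep g x))%:E.
    by apply: cvg_EFin; [exact: nearW|exact: ctends_cvg hx].
  by move=> /cvg_limn_einf_sup[-> _].
apply: le_trans (fatou mu measurableT mF F0) _.
rewrite limn_einf_lim; apply: lime_le; first exact: is_cvg_einfs.
apply: nearW => n; apply: (@le_trans _ _ (\int[mu]_x F n x)%E).
  by apply: ereal_inf_lbound; exists n => /=.
rewrite -/(n2 (h n)) n2E // lee_fin; have := nm_ge0 (h n); have := hB n; nra.
Qed.

Lemma dct_nm (A : nat -> M) a B : L2 a -> (forall n, bdd (A n) B) ->
  {ae mu, forall x, ctends (fun n => rep (A n) x) 0} -> tz (fun n => nm (A n * a)).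
Proof.
move=> La AB A0.
have ALB n : {ae mu, forall x, rep (A n * a) x = rep (A n) x * rep a x /\ cmod (rep (A n) x) <= B}.
  by apply: aeS2 _ (repM (A n) a) (AB n) => x h1 h2.
have ALL : {ae mu, forall x n, rep (A n * a) x = rep (A n) x * rep a x /\ cmod (rep (A n) x) <= B}.
  exact/ae_foralln.
pose F n x := (csq (rep (A n * a) x))%:E.
have [||||//|_ _ /=] := @dominated_convergence _ _ R mu setT measurableT F (cst 0)
    (fun x => (B ^+ 2)%:E * (csq (rep a x))%:E)%E.
- by move=> n; apply/measurable_EFinP; apply: measurable_csq; exact: rep_meas.
- exact: measurable_cst.
- apply: aeS2 _ ALL A0 => x h1 h2 _.
  have -> : (F^~ x) = EFin \o (fun n => csq (rep (A n) x) * csq (rep a x)).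
    by apply/funext => n /=; rewrite /F (h1 n).1 csqM.
  apply: cvg_EFin; first exact: nearW.
  have -> : (0 : R) = csq (0 : C) * csq (rep a x) by rewrite /csq /= expr0n /= addr0 mul0r.
  by apply: cvgM; [exact: ctends_cvg|exact: cvg_cst].
- by apply: integrableZl => //; exact: L2_csq.
- apply: aeS _ ALL => x h1 n _; rewrite /F (h1 n).1 csqM -EFinM abse_EFin lee_fin.
  rewrite ger0_norm; last by rewrite mulr_ge0 ?csq_ge0.
  rewrite ler_wpM2r ?csq_ge0 // -cmod_sqr.
  have := (h1 n).2; have := cmod_ge0 (rep (A n) x); nra.
rewrite integral0_eq // => h.
have h2 : (fun n => nm (A n * a) ^+ 2) @ \oo --> (0 : R).
  have -> : (fun n => nm (A n * a) ^+ 2) = (fun n => fine (\int[mu]_x F n x)%E).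
    by apply/funext => n; rewrite nm_sqr.
  exact: (fine_cvg h).
move=> e e0; have e2 : 0 < e ^+ 2 by rewrite exprn_gt0.
have [|N hN] := tz_cvg _ h2 e2; first by move=> n; exact: sqr_ge0.
by exists N => n /hN; rewrite ler_pXn2r ?nnegrE ?nm_ge0 // ltW.
Qed.

(** The upper limit gives a function that is measurable everywhere and agrees with the limit
    wherever the latter exists. *)
Lemma ae_limit (h : nat -> R -> C) : (forall n, cmeas (h n)) ->
  {ae mu, forall x, cvgn (fun n => Re (h n x)) /\ cvgn (fun n => Im (h n x))} ->
  exists2 g, cmeas g & {ae mu, forall x, ctends (fun n => h n x) (g x)}.
Proof.
move=> mh hc.
pose L (p : C -> R) x := fine (limn_esup (fun n => (p (h n x))%:E)).
have LE p x : cvgn (fun n => p (h n x)) -> (fun n => p (h n x)) @ \oo --> L p x.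
  move=> /cvg_ex[l hl]; suff -> : L p x = l by [].
  have : EFin \o (fun n => p (h n x)) @ \oo --> l%:E by apply: cvg_EFin => //; exact: nearW.
  by move=> /cvg_limn_einf_sup[_ E]; rewrite /L E.
have mL p : (forall n, measurable_fun setT (fun x => p (h n x))) -> measurable_fun setT (L p).
  move=> mp; apply: (measurableT_comp (f := fine)); first exact: fine_measurable.
  by apply: measurable_fun_limn_esup => n; apply/measurable_EFinP.
exists (fun x => L Re x +i* L Im x).
  by split; apply: mL => n; [case: (mh n)|case: (mh n)].
apply: aeS _ hc => x [/LE hr /LE hi] e e0; have e2 : 0 < e / 2 by rewrite divr_gt0.
have [N1 _ h1] := (cvgrPdist_le _ _).1 hr _ e2; have [N2 _ h2] := (cvgrPdist_le _ _).1 hi _ e2.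
exists (maxn N1 N2) => n; rewrite geq_max => /andP[/h1 H1 /h2 H2].
apply: le_trans (cmod_le_ReIm _) _; rewrite (splitr e).
move: H1 H2; rewrite !(distrC (L _ _)); case: (h n x) => p q /= H1 H2.
exact: lerD.
Qed.

Lemma cvg_telescope (u : nat -> R) (K : R) : (forall n, `|u n.+1 - u n| <= K / 2 ^+ n) ->
  cvgn u.
Proof.
move=> hu; have K0 : 0 <= K by have := hu 0%N; rewrite expr0 divr1; exact: le_trans.
suff h : cvgn (series (telescope u)).
  rewrite (_ : u = cst (u 0%N) \+ series (telescope u)).
    by apply: is_cvgD => //; exact: is_cvg_cst.
  by apply/funext => n; rewrite /= -eq_sum_telescope.
apply: normed_cvg; apply: (@series_le_cvg _ _ (geometric K 2^-1)) => n /=.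
- exact: normr_ge0.
- by rewrite mulr_ge0 // exprn_ge0 // invr_ge0.
- by rewrite exprVn; exact: hu.
apply: is_cvg_geometric_series; rewrite ger0_norm ?invr_ge0 // invf_lt1 //; lra.
Qed.

(** Riesz-Fischer: increments this small make the sequence converge almost everywhere, and Fatou's
    lemma transfers the norm estimate to the limit. *)
Lemma L2_complete_fast (h : nat -> M) : (forall n, L2 (h n)) ->
  (forall n, nm (h n.+1 - h n) <= (4 ^+ n)^-1) ->
  exists2 g : M, L2 g & forall n, nm (h n - g) <= 2 / 4 ^+ n.
Proof.
move=> Lh hh.
have LD n : L2 (h n.+1 - h n) by exact: L2B.
(* The weight 4^n keeps the series integrable, the n-th integral being at most 4^-n, while
   finiteness of the sum [G] at x gives increments of size 2^-n there. *)
pose F n x := (4 ^+ n * csq (rep (h n.+1 - h n) x))%:E.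
have mF n : measurable_fun setT (F n).
  apply/measurable_EFinP; apply: measurable_funM => //.
  by apply: measurable_csq; exact: rep_meas.
have F0 n x : setT x -> (0 <= F n x)%E.
  by move=> _; rewrite lee_fin mulr_ge0 ?csq_ge0 ?exprn_ge0.
have IF n : (\int[mu]_x F n x <= ((4^-1) ^+ n)%:E)%E.
  rewrite /F; under eq_integral do rewrite EFinM.
  rewrite ge0_integralZl_EFin ?exprn_ge0 //; last 2 first.
  - by move=> x _; rewrite lee_fin csq_ge0.
  - by apply/measurable_EFinP; apply: measurable_csq; exact: rep_meas.
  rewrite -/(n2 (h n.+1 - h n)) n2E // -EFinM lee_fin.
  have p4 : 0 < (4 : R) ^+ n by rewrite exprn_gt0.
  apply: (@le_trans _ _ (4 ^+ n * ((4 ^+ n)^-1) ^+ 2)).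
    by apply: ler_wpM2l; [exact: ltW|apply: lerXn2r; rewrite ?nnegrE ?nm_ge0 ?invr_ge0 ?exprn_ge0].
  by rewrite expr2 mulrA divff ?gt_eqF // mul1r exprVn.
pose G x := (\sum_(n <oo) F n x)%E.
have mG : measurable_fun setT G by apply: ge0_emeasurable_sum => // k x _ _; exact: F0.
have IG : mu.-integrable setT G.
  apply/integrableP; split => //.
  under eq_integral do (rewrite gee0_abs; last by apply: nneseries_ge0 => n _ _; exact: F0).
  rewrite integral_nneseries //.
  apply: (@le_lt_trans _ _ (\sum_(n <oo) (EFin \o (geometric 1 (4^-1 : R))) n)%E).
    apply: lee_nneseries => [n _ _|n _]; first by apply: integral_ge0 => x _; exact: F0.
    by rewrite /= mul1r.
  rewrite (_ : (\sum_(n <oo) _)%E = limn (EFin \o series (geometric 1 (4^-1 : R)))); last first.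
    by apply: congr_lim; apply/funext => n /=; rewrite /series /= -sumEFin.
  rewrite EFin_lim ?ltry //; apply: is_cvg_geometric_series.
  by rewrite ger0_norm ?invr_ge0 // invf_lt1 //; lra.
have hC : {ae mu, forall x, cvgn (fun n => Re (rep (h n) x)) /\ cvgn (fun n => Im (rep (h n) x))}.
  have hB : {ae mu, forall x n, rep (h n.+1 - h n) x = rep (h n.+1) x - rep (h n) x}.
    by apply/ae_foralln => n; exact: repB.
  apply: aeS2 _ hB (integrable_ae measurableT IG) => x hx /(_ Logic.I) Gf.
  have FG n : (F n x <= G x)%E.
    apply: le_trans (nneseries_lim_ge n.+1 _); last by move=> k _ _; exact: F0.
    by rewrite big_nat_recr //= leeDr // sume_ge0 // => k _; exact: F0.
  have key n : csq (rep (h n.+1) x - rep (h n) x) <= (Num.sqrt (fine (G x)) / 2 ^+ n) ^+ 2.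
    have := FG n; rewrite -(fineK Gf) lee_fin hx => h1.
    have G0 : 0 <= fine (G x) by apply: le_trans h1; rewrite mulr_ge0 ?csq_ge0 ?exprn_ge0.
    rewrite expr_div_n sqr_sqrtr // -exprM mulnC exprM ler_pdivlMr ?exprn_gt0 //.
    by rewrite mulrC (_ : (2 ^+ 2 : R) = 4) //; ring.
  have K0 n : 0 <= Num.sqrt (fine (G x)) / 2 ^+ n by rewrite divr_ge0 ?sqrtr_ge0 ?exprn_ge0.
  split; apply: (@cvg_telescope _ (Num.sqrt (fine (G x)))) => n;
    rewrite -(@ler_pXn2r _ 2) ?nnegrE // real_normK ?num_real //; apply: le_trans (key n);
    by case: (rep (h n.+1) x) (rep (h n) x) => ? ? [? ?]; rewrite /csq /= ?lerDl ?lerDr sqr_ge0.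
have [g mg hg] := ae_limit (fun n => rep_meas (h n)) hC.
(* The subtracted term 2 / 2^k is what lets the induction on k close. *)
have Lnn n k : nm (h (n + k)%N - h n) <= (2 - (2 : R) / 2 ^+ k) / 4 ^+ n.
  elim: k => [|k IH]; first by rewrite addn0 subrr nm0 expr0 divr1 subrr mul0r.
  apply: (le_trans (nm_tri (Lh _) (Lh n) (Lh (n + k)%N))).
  apply: le_trans (lerD _ IH) _; first by rewrite addnS; exact: hh.
  rewrite exprD exprSr !invfM.
  have -> : (4 : R) ^+ k = 2 ^+ k * 2 ^+ k by rewrite -exprMn; congr (_ ^+ k); ring.
  rewrite invfM; set a := (4 ^+ n)^-1; set b := (2 ^+ k)^-1.
  have a0 : 0 <= a by rewrite invr_ge0 exprn_ge0.
  have b0 : 0 <= b by rewrite invr_ge0 exprn_ge0.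
  have b1 : b <= 1 by rewrite invf_le1 ?exprn_gt0 // exprn_ege1 // ler1n.
  have -> : 2 * (b * 2^-1) = b by field.
  rewrite -subr_ge0 (_ : _ - _ = a * (b * (1 - b))); last by ring.
  by rewrite !mulr_ge0 // subr_ge0.
have Ln2 n k : nm (h (n + k)%N - h n) <= 2 / 4 ^+ n.
  apply: le_trans (Lnn n k) _; apply: ler_wpM2r; first by rewrite invr_ge0 exprn_ge0.
  by rewrite gerBl divr_ge0 // exprn_ge0.
have hg2 n : L2 (h n - pi g) /\ nm (h n - pi g) <= 2 / 4 ^+ n.
  apply: (@fatou_nm (fun k => h n - h (n + k)%N)) => [k|k|]; first exact: L2B.
    by rewrite nmBC.
  have hB : {ae mu, forall x k, rep (h n - h (n + k)%N) x = rep (h n) x - rep (h (n + k)%N) x}.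
    by apply/ae_foralln => k; exact: repB.
  have hB' : {ae mu, forall x, rep (h n - pi g) x = rep (h n) x - g x}.
    by apply: aeS2 _ (repB (h n) (pi g)) (piE mg) => x -> ->.
  apply: aeS3 _ hB hB' hg => x h1 h2 h3 e e0; have [N hN] := h3 e e0.
  exists N => k Nk; rewrite h1 h2 (_ : _ - _ = - (rep (h (n + k)%N) x - g x)); last by ring.
  rewrite cmodN; apply: hN.
  exact: leq_trans Nk (leq_addl _ _).
exists (pi g); last by move=> n; case: (hg2 n).
have [h1 _] := hg2 0%N; rewrite (_ : pi g = h 0%N - (h 0%N - pi g)); first exact: L2B.
by rewrite opprB addrC subrK.
Qed.

Lemma L2_complete (h : nat -> M) : (forall n, L2 (h n)) ->
  (forall e, 0 < e -> exists N, forall n m, (N <= n)%N -> (N <= m)%N -> nm (h n - h m) <= e) ->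
  exists2 g : M, L2 g & tz (fun n => nm (h n - g)).
Proof.
move=> Lh hc.
have p4 k : 0 < (4 ^+ k : R)^-1 by rewrite invr_gt0 exprn_gt0.
have [N hN] := choice (fun k => hc _ (p4 k)).
(* Summing the ranks makes the extracted indices nondecreasing while they stay above [N k]. *)
pose K k := (k + \sum_(i < k.+1) N i)%N.
have NK k : (N k <= K k)%N by rewrite /K big_ord_recr addnA leq_addl.
have KK k : (K k <= K k.+1)%N by rewrite /K leq_add // [leqRHS]big_ord_recr leq_addr.
have [g Lg hg] := @L2_complete_fast (fun k => h (K k)) (fun k => Lh _)
  (fun k => hN k _ _ (leq_trans (NK k) (KK k)) (NK k)).
exists g => // e e0; have e2 : 0 < e / 2 by rewrite divr_gt0.
have [N0 hN0] := hc _ e2.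
have [k hk] : exists k, 2 / 4 ^+ k <= e / 2 /\ (N0 <= K k)%N.
  pose k := maxn N0 (Num.truncn (4 / e)).+1; exists k; split; last first.
    exact: leq_trans (leq_maxl _ _) (leq_addr _ _).
  have p : 0 < (4 ^+ k : R) by rewrite exprn_gt0.
  have h1 : 4 / e < k%:R.
    by apply: lt_le_trans (truncnS_gt _) _; rewrite ler_nat leq_maxr.
  have h2 : (k%:R : R) <= 4 ^+ k by rewrite -natrX ler_nat ltnW // ltn_expl.
  have h3 := lt_le_trans h1 h2; move: h3; rewrite ltr_pdivrMr // ler_pdivrMr // => h3.
  by nra.
exists (K k) => n Kn; apply: le_trans (nm_tri (Lh n) Lg (Lh (K k))) _.
rewrite (splitr e); apply: lerD; last exact: le_trans (hg k) hk.1.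
by apply: hN0; [exact: leq_trans hk.2 Kn|exact: hk.2].
Qed.

End L2conv.

(** * Affine changes of variable, translations, density by orthogonality *)

Section Affine.
Variable R : realType.
Local Notation mu := (@lebesgue_measure R).
Local Notation C := R[i].
Local Notation Re := (@complex.Re R).
Local Notation Im := (@complex.Im R).
Local Notation M := (Mfun R).
Implicit Types (a b c : M) (f g : R -> C) (s h : R).

Definition aff s h (x : R) : R := s * x + h.

Lemma measurable_aff s h : measurable_fun setT (aff s h : measurableTypeR R -> measurableTypeR R).
Proof. by apply: measurable_funD => //; apply: measurable_funM. Qed.

(** Both sides are measures in A that agree on the intervals ]a, b], and these determine Lebesgue
    measure. A negative s reverses the interval, which is why the two signs are treated apart. *)
Lemma lebesgue_aff s h (A : set R) : s != 0 -> measurable A ->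
  mu A = (`|s|%:E * mu (aff s h @^-1` A))%E.
Proof.
move=> s0.
pose m1 : {measure set (measurableTypeR R) -> \bar R} :=
  measure_function_pushforward__canonical__measure_function_Measure mu (measurable_aff s h).
pose m2 : {measure set (measurableTypeR R) -> \bar R} := mscale (NngNum (normr_ge0 s)) m1.
move: A; apply: (@lebesgue_measure_unique _ m2) => _ [[a b] _ <-] /=.
rewrite /m2 /mscale /= /pushforward.
have [s_gt0|s_le0] := ltP 0 s.
  have -> : aff s h @^-1` `]a, b]%classic = `](a - h) / s, (b - h) / s]%classic.
    apply/seteqP; split=> x; rewrite /= !in_itv /= /aff ltr_pdivrMr // ler_pdivlMr // => /andP[h1 h2];
      apply/andP; split; lra.
  rewrite !lebesgue_measure_itv /= !lte_fin ltr_pM2r ?invr_gt0 // ltrD2r.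
  case: ifPn => _; last by rewrite mule0.
  rewrite -!EFinB -EFinM -mulrBl gtr0_norm // mulrCA divff // mulr1.
  by congr EFin; ring.
have s_lt0 : s < 0 by rewrite lt_def eq_sym s0.
have -> : aff s h @^-1` `]a, b]%classic = `[(b - h) / s, (a - h) / s[%classic.
  apply/seteqP; split=> x; rewrite /= !in_itv /= /aff ltr_ndivlMr // ler_ndivrMr // => /andP[h1 h2];
    apply/andP; split; lra.
rewrite !lebesgue_measure_itv /= !lte_fin ltr_nM2r ?invr_lt0 // ltrD2r.
case: ifPn => _; last by rewrite mule0.
rewrite -!EFinB -EFinM -mulrBl ltr0_norm // mulrCA mulNr divff // mulrN1.
by congr EFin; ring.
Qed.

Lemma ge0_integral_aff s h (F : R -> \bar R) : s != 0 -> measurable_fun setT F ->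
  (forall x, 0 <= F x)%E ->
  (\int[mu]_x F x = `|s|%:E * \int[mu]_x F (aff s h x))%E.
Proof.
move=> s0 mF F0.
pose m1 : {measure set (measurableTypeR R) -> \bar R} :=
  measure_function_pushforward__canonical__measure_function_Measure mu (measurable_aff s h).
pose m2 : {measure set (measurableTypeR R) -> \bar R} := mscale (NngNum (normr_ge0 s)) m1.
rewrite (@eq_measure_integral _ _ _ setT m2); last first.
  by move=> A mA _; exact: (lebesgue_aff h s0 mA).
rewrite ge0_integral_mscale //=; congr (_ * _)%E.
by rewrite ge0_integral_pushforward //; exact: measurable_aff.
Qed.

Lemma ae_aff s h (P : R -> Prop) : s != 0 -> {ae mu, forall x, P x} ->
  {ae mu, forall x, P (aff s h x)}.
Proof.
move=> s0 [N [mN N0 PN]]; exists (aff s h @^-1` N); split.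
- by rewrite -[X in measurable X]setTI; exact: measurable_aff.
- have := lebesgue_aff h s0 mN; rewrite N0 => /esym/eqP; rewrite mule_eq0 eqe normr_eq0 (negbTE s0) /=.
  by move=> /eqP.
- by move=> x /= Px; apply: PN.
Qed.

Lemma cmeas_aff s h f : cmeas f -> cmeas (fun x => f (aff s h x)).
Proof.
by move=> [f1 f2]; split;
  [apply: (measurableT_comp f1)|apply: (measurableT_comp f2)]; exact: measurable_aff.
Qed.

Definition Aff := locked (fun s h a => pi (fun x => rep a (aff s h x)) : M).

Lemma AffE s h a : Aff s h a = pi (fun x => rep a (aff s h x)).
Proof. by rewrite /Aff -lock. Qed.

Lemma Aff_pi s h f : s != 0 -> cmeas f -> Aff s h (pi f) = pi (fun x => f (aff s h x)).
Proof.
move=> s0 mf; rewrite AffE; apply: pi_eq; do ?exact: cmeas_aff (rep_meas _); do ?exact: cmeas_aff.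
exact: ae_aff (piE mf).
Qed.
Lemma AffD s h a b : s != 0 -> Aff s h (a + b) = Aff s h a + Aff s h b.
Proof.
move=> s0; elim/piW: a => a ma; elim/piW: b => b mb.
by rewrite !(Aff_pi, piD) //; do ?[exact: cmeasD|exact: cmeas_aff].
Qed.
Lemma AffM s h a b : s != 0 -> Aff s h (a * b) = Aff s h a * Aff s h b.
Proof.
move=> s0; elim/piW: a => a ma; elim/piW: b => b mb.
by rewrite !(Aff_pi, piM) //; do ?[exact: cmeasM|exact: cmeas_aff].
Qed.
Lemma Aff_conj s h a : s != 0 -> Aff s h (Mconj a) = Mconj (Aff s h a).
Proof.
move=> s0; elim/piW: a => a ma.
by rewrite !(Aff_pi, Mconj_pi) //; do ?[exact: cmeas_conj|exact: cmeas_aff].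
Qed.
Lemma Aff_cst s h z : s != 0 -> Aff s h (Mcst z) = Mcst z.
Proof. by move=> s0; rewrite Mcst_pi Aff_pi //; exact: cmeas_cst. Qed.
Lemma AffN s h a : s != 0 -> Aff s h (- a) = - Aff s h a.
Proof.
by move=> s0; apply/eqP; rewrite -addr_eq0 -AffD // addNr Aff_cst.
Qed.
Lemma AffB s h a b : s != 0 -> Aff s h (a - b) = Aff s h a - Aff s h b.
Proof. by move=> s0; rewrite AffD // AffN. Qed.

Lemma n2_aff s h a : s != 0 -> n2 a = (`|s|%:E * n2 (Aff s h a))%E.
Proof.
move=> s0; rewrite AffE [in RHS]n2_pi; last exact: cmeas_aff (rep_meas _).
rewrite {1}/n2 (ge0_integral_aff h s0) //.
- by apply/measurable_EFinP; apply: measurable_csq; exact: rep_meas.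
- by move=> x; rewrite lee_fin csq_ge0.
Qed.
Lemma L2_aff s h a : s != 0 -> L2 a -> L2 (Aff s h a).
Proof.
move=> s0; rewrite /L2 (n2_aff h a s0); have := n2_ge0 (Aff s h a).
case: (n2 (Aff s h a)) => [r _ _| _|//]; first by rewrite ltry.
by rewrite gt0_muley // lte_fin normr_gt0.
Qed.
Lemma nm_aff s h a : s != 0 -> L2 a -> nm a ^+ 2 = `|s| * nm (Aff s h a) ^+ 2.
Proof.
move=> s0 La; rewrite !nm_sqr (n2_aff h a s0) fineM //.
by rewrite ge0_fin_numE ?n2_ge0 //; exact: L2_aff.
Qed.
Lemma rip_polar a b : L2 a -> L2 b -> rip a b = (nm (a + b) ^+ 2 - nm (a - b) ^+ 2) / 4.
Proof.
move=> La Lb; have := nmB_sqr La (L2N Lb); rewrite opprK nmN ripNr // => ->.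
by rewrite nmB_sqr //; field.
Qed.
Lemma rip_aff s h a b : s != 0 -> L2 a -> L2 b ->
  rip a b = `|s| * rip (Aff s h a) (Aff s h b).
Proof.
move=> s0 La Lb; rewrite (rip_polar La Lb) (rip_polar (L2_aff h s0 La) (L2_aff h s0 Lb)).
rewrite -(AffD h a b s0) -(AffB h a b s0) (nm_aff h s0 (L2D La Lb)) (nm_aff h s0 (L2B La Lb)).
set x := nm _ ^+ 2; set y := nm _ ^+ 2; clearbody x y.
have -> : `|s| * x - `|s| * y = `|s| * (x - y) by ring.
by rewrite -mulrA.
Qed.
Lemma bdd_aff s h a B : s != 0 -> bdd a B -> bdd (Aff s h a) B.
Proof.
move=> s0 aB; rewrite AffE; apply: aeS2 _ (piE (cmeas_aff s h (rep_meas a))) (ae_aff h s0 aB) => x.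
by move=> ->.
Qed.

Definition Tr h a : M := Aff 1 h a.
Let n10 : (1 : R) != 0. Proof. exact: oner_neq0. Qed.
Lemma TrD h a b : Tr h (a + b) = Tr h a + Tr h b. Proof. exact: AffD. Qed.
Lemma TrM h a b : Tr h (a * b) = Tr h a * Tr h b. Proof. exact: AffM. Qed.
Lemma TrB h a b : Tr h (a - b) = Tr h a - Tr h b. Proof. exact: AffB. Qed.
Lemma Tr_conj h a : Tr h (Mconj a) = Mconj (Tr h a). Proof. exact: Aff_conj. Qed.
Lemma Tr_cst h z : Tr h (Mcst z) = Mcst z. Proof. exact: Aff_cst. Qed.
Lemma L2_Tr h a : L2 a -> L2 (Tr h a). Proof. exact: L2_aff. Qed.
Lemma nm_Tr h a : L2 a -> nm (Tr h a) = nm a.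
Proof.
move=> La; apply/eqP; rewrite -(@eqrXn2 _ 2) ?nm_ge0 //.
by rewrite [X in _ == X](nm_aff h n10 La) normr1 mul1r.
Qed.
Lemma bdd_Tr h a B : bdd a B -> bdd (Tr h a) B. Proof. exact: bdd_aff. Qed.
Lemma TrTr h k a : Tr h (Tr k a) = Tr (h + k) a.
Proof.
elim/piW: a => a ma; rewrite /Tr !Aff_pi //; last exact: cmeas_aff.
by congr pi; apply/funext => x; rewrite /aff !mul1r addrA.
Qed.
Lemma Tr0 a : Tr 0 a = a.
Proof.
elim/piW: a => a ma; rewrite /Tr Aff_pi //.
by congr pi; apply/funext => x; rewrite /aff mul1r addr0.
Qed.

(* A subspace of L2 with trivial orthogonal complement is dense: a minimizing
   sequence is Cauchy by the parallelogram law. *)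
Lemma dense_of_orth (W : M -> Prop) : (forall w, W w -> L2 w) -> W 0 ->
  (forall w w', W w -> W w' -> W (w + w')) ->
  (forall (r : R) w, W w -> W (Mcst r%:C * w)) ->
  (forall f : M, L2 f -> (forall w, W w -> rip f w = 0) -> f = 0) ->
  forall f : M, L2 f -> forall e, 0 < e -> exists2 w, W w & nm (f - w) <= e.
Proof.
move=> WL W0 WD WZ Wo f Lf.
pose D := [set nm (f - w) | w in [set w | W w]].
have D0 : D !=set0 by exists (nm (f - 0)); exists 0.
have Dlb : lbound D 0 by move=> _ [w _ <-]; exact: nm_ge0.
have Di : has_inf D by split=> //; exists 0.
pose d := inf D.
have dle w : W w -> d <= nm (f - w) by move=> Ww; apply: ge_inf; [exists 0|exists w].
have d0 : 0 <= d by apply: lb_le_inf.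
have wex (e : R) : 0 < e -> exists w, W w /\ nm (f - w) <= d + e.
  by move=> e0; have [_ [w Ww <-] h] := inf_adherent e0 Di; exists w; split => //; exact: ltW.
have en n : 0 < (n.+1%:R : R)^-1 by rewrite invr_gt0.
have [w hw] := choice (fun n => wex _ (en n)).
have Lw n : L2 (w n) by exact: WL (hw n).1.
have par n m (e : R) : 0 <= e -> nm (f - w n) <= d + e -> nm (f - w m) <= d + e ->
    nm (w n - w m) ^+ 2 <= 4 * (2 * d * e + e ^+ 2).
  move=> e0 hn hm; set p := f - w n; set q := f - w m.
  have Lp : L2 p by exact: L2B. have Lq : L2 q by exact: L2B.
  have E1 : w n - w m = q - p by rewrite /p /q; ring.
  have h2 : Mcst (2^-1)%:C + Mcst (2^-1)%:C = 1 :> M.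
    by rewrite -McstD -rmorphD /= (_ : 2^-1 + 2^-1 = 1 :> R) //; field.
  pose v := Mcst (2^-1)%:C * (w n + w m).
  have Wv : W v by apply: WZ; apply: WD; [exact: (hw n).1|exact: (hw m).1].
  have E2 : f - v = Mcst (2^-1)%:C * (p + q).
    rewrite /v /p /q -[X in X - _](mul1r f) -h2; ring.
  have := dle _ Wv; rewrite E2 nmZ; last exact: L2D.
  rewrite ger0_norm ?invr_ge0 // => h3.
  have E3 : nm (p + q) ^+ 2 = nm p ^+ 2 + 2 * rip p q + nm q ^+ 2.
    by have := nmB_sqr Lp (L2N Lq); rewrite opprK nmN ripNr // => ->; ring.
  have h4 : (2 * d) ^+ 2 <= nm (p + q) ^+ 2.
    by rewrite lerXn2r ?nnegrE ?nm_ge0 ?mulr_ge0 //; lra.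
  rewrite E1 nmB_sqr // ripC; rewrite E3 in h4.
  have h5 : nm p ^+ 2 <= (d + e) ^+ 2 by rewrite lerXn2r ?nnegrE ?nm_ge0 ?addr_ge0.
  have h6 : nm q ^+ 2 <= (d + e) ^+ 2 by rewrite lerXn2r ?nnegrE ?nm_ge0 ?addr_ge0.
  nra.
have tail (e : R) : 0 < e -> exists N, forall n, (N <= n)%N -> nm (f - w n) <= d + e.
  move=> e0; exists (Num.truncn e^-1) => n Nn; apply: le_trans (hw n).2 _; rewrite lerD2l.
  rewrite -[leRHS]invrK lef_pV2 ?posrE ?invr_gt0 //; apply: ltW.
  by apply: lt_le_trans (truncnS_gt _) _; rewrite ler_nat.
have [g Lg hg] : exists2 g : M, L2 g & tz (fun n => nm (w n - g)).
  apply: L2_complete => // e e0.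
  pose e1 := Num.min 1 (e ^+ 2 / (4 * (2 * d + 1))).
  have q0 : 0 < 4 * (2 * d + 1) by lra.
  have e10 : 0 < e1 by rewrite lt_min ltr01 divr_gt0 // exprn_gt0.
  have [N hN] := tail _ e10; exists N => n m /hN hn /hN hm.
  rewrite -(@ler_pXn2r _ 2) ?nnegrE ?nm_ge0 //; last exact: ltW.
  apply: le_trans (par n m e1 (ltW e10) hn hm) _.
  have a1 : e1 <= 1 by rewrite ge_min lexx.
  have a2 : e1 * (4 * (2 * d + 1)) <= e ^+ 2 by rewrite -ler_pdivlMr // ge_min lexx orbT.
  nra.
have gorth v : W v -> rip (f - g) v = 0.
  move=> Wv; have Lv := WL _ Wv; have Lfg : L2 (f - g) by exact: L2B.
  have upper : nm (f - g) <= d.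
    apply/ler_addgt0Pr => e e0; have e2 : 0 < e / 2 by rewrite divr_gt0.
    have [N1 h1] := tail _ e2; have [N2 h2] := hg _ e2.
    have := h1 _ (leq_maxl N1 N2); have := h2 _ (leq_maxr N1 N2).
    have := nm_tri Lf Lg (Lw (maxn N1 N2)); lra.
  have lower t : d <= nm (f - g - Mcst t%:C * v).
    apply/ler_addgt0Pr => e e0; have [N hN] := hg _ e0; have := hN _ (leqnn N) => h1.
    apply: le_trans (dle (w N + Mcst t%:C * v) _) _.
      by apply: WD; [exact: (hw N).1|exact: WZ].
    have -> : f - (w N + Mcst t%:C * v) = (f - g - Mcst t%:C * v) - (w N - g) by ring.
    apply: le_trans (nmB _ _) (lerD (lexx _) h1); first by apply: L2B => //; exact: L2Z.
    exact: L2B.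
  have key t : 0 <= t ^+ 2 * nm v ^+ 2 - 2 * t * rip (f - g) v.
    have h1 : d ^+ 2 <= nm (f - g - Mcst t%:C * v) ^+ 2 by rewrite lerXn2r ?nnegrE ?nm_ge0.
    have h2 : nm (f - g) ^+ 2 <= d ^+ 2 by rewrite lerXn2r ?nnegrE ?nm_ge0.
    move: h1; rewrite nmB_sqr //; last exact: L2Z.
    rewrite ripZr // nmZ // exprMn real_normK ?num_real //; nra.
  have [v0|v0] := eqVneq (nm v) 0.
    by have := key 1; have := key (-1); rewrite v0; nra.
  have vp : 0 < nm v ^+ 2 by rewrite exprn_gt0 // lt_def v0 nm_ge0.
  (* At this value of t the quadratic in [key] equals minus the square of the inner product over
     |v|^2, which forces the inner product to vanish. *)
  have := key (rip (f - g) v / nm v ^+ 2).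
  set r := rip _ _; set q := r / _; have E : q * nm v ^+ 2 = r by rewrite divfK // gt_eqF.
  have -> : q ^+ 2 * nm v ^+ 2 = q * r by rewrite expr2 -mulrA E.
  move=> h1; have h2 : q * r <= 0 by lra.
  have h3 : (q * nm v ^+ 2) * r <= 0 by rewrite mulrAC; nra.
  by rewrite E in h3; apply/eqP; rewrite -sqrf_eq0; apply/eqP; nra.
have fg : f = g by apply/eqP; rewrite -subr_eq0; apply/eqP; apply: Wo => //; exact: L2B.
move=> e e0; have [N hN] := hg _ e0; exists (w N); first exact: (hw N).1.
by rewrite nmBC fg; exact: hN.
Qed.

End Affine.

(** * Calculus on the real line *)

Section RealCalc.
Variable R : realType.
Local Notation mu := (@lebesgue_measure R).

Lemma mvt_ex (f df : R -> R) : (forall x : R, is_derive x 1 f (df x)) ->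
  forall a b, exists2 c, Num.min a b <= c <= Num.max a b & f b - f a = df c * (b - a).
Proof.
move=> h.
have cf a b : {within `[a, b], continuous f}.
  by apply: derivable_within_continuous => x _; case: (h x).
have main a b : a <= b -> exists2 c, a <= c <= b & f b - f a = df c * (b - a).
  move=> ab; have [c] := @MVT_segment _ f df a b ab (fun x _ => h x) (cf a b).
  by rewrite in_itv /= => ? ?; exists c.
move=> a b; have [ab|/ltW ba] := leP a b.
  by have [c hc E] := main _ _ ab; exists c.
have [c hc E] := main _ _ ba; exists c; last by rewrite -opprB E -mulrN opprB.
by [].
Qed.

Lemma lip_of_deriv (f df : R -> R) (B : R) : (forall x : R, is_derive x 1 f (df x)) ->
  (forall x, `|df x| <= B) -> forall a b, `|f b - f a| <= B * `|b - a|.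
Proof.
move=> h hB a b; have [c _ ->] := mvt_ex h a b.
by rewrite normrM ler_wpM2r.
Qed.

Lemma norm_sin_le (x : R) : `|sin x| <= `|x|.
Proof.
have := @lip_of_deriv (@sin R) (@cos R) 1 (fun x => is_derive_sin x) (@cos_max R) 0 x.
by rewrite sin0 !subr0 mul1r.
Qed.

Lemma one_sub_cos_le (x : R) : 1 - cos x <= x ^+ 2 / 2.
Proof.
have E : cos x = cos (x / 2 *+ 2) by congr cos; rewrite mulr2n; field.
rewrite E cos_mulr2n cos2sin2.
have : sin (x / 2) ^+ 2 <= (x / 2) ^+ 2.
  rewrite -(real_normK (num_real (sin _))) -(real_normK (num_real (x / 2))).
  by rewrite lerXn2r ?nnegrE // norm_sin_le.
have -> : (x / 2) ^+ 2 = x ^+ 2 / 4 by field.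
by move=> h; rewrite mulr2n; lra.
Qed.

Lemma measurable_invr : measurable_fun setT (fun x : R => x^-1).
Proof.
have -> : setT = ([set x : R | x != 0] `|` [set 0]) :> set R.
  by apply/seteqP; split=> x //= _; have [->|h] := eqVneq x 0; [right|left].
have o : open [set x : R | x != 0].
  rewrite (_ : [set x | _] = ~` [set 0]); last by apply/seteqP; split=> x /= /eqP.
  by rewrite openC; exact: closed_eq.
apply/measurable_funU => //; first exact: open_measurable.
split; last exact: measurable_fun_set1.
apply: open_continuous_measurable_fun => // x; rewrite inE /= => x0.
by apply: cvgV => //; exact: cvg_id.
Qed.

(** Lebesgue differentiation: the primitive starting at -n vanishes, and f is its derivative at
    almost every point beyond -n. Then n is arbitrary. *)
Lemma zero_of_itv (f : R -> R) : locally_integrable setT f ->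
  (forall a b, a < b -> \int[mu]_(x in `[a, b]) f x = 0) -> {ae mu, forall x, f x = 0}.
Proof.
move=> lf h.
have mf : measurable_fun setT f by case: lf.
have If a b : mu.-integrable `[a, b] (EFin \o f).
  apply/integrableP; split; first by apply/measurable_EFinP; exact: measurable_funTS.
  by case: lf => _ _ /(_ `[a, b]%classic); apply => //; exact: segment_compact.
have H n : {ae mu, forall x, - n%:R < x -> f x = 0}.
  have := @FTC1 R f (BLeft (- n%:R)) (fun y => If _ y) lf.
  apply: aeS => x hx xn; have [|_ <-] := hx; first by rewrite /= lte_fin.
  rewrite (_ : (fun _ => _) = cst 0); first exact: derive1_cst.
  apply/funext => y; have [ny|yn|<-] := ltgtP (- n%:R) y; first exact: h.
    by rewrite set_itv_ge ?Rintegral_set0 // bnd_simp -ltNge.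
  by rewrite set_itv1 Rintegral_set1.
have : {ae mu, forall x n, - n%:R < x -> f x = 0} by exact/ae_foralln.
apply: aeS => x /(_ (Num.truncn (- x)).+1); apply.
by rewrite ltrNl truncnS_gt.
Qed.

End RealCalc.

(** * The Fourier transform on L^2 *)

Section Basis.
Variable R : realType.
Local Notation mu := (@lebesgue_measure R).
Local Notation C := R[i].
Local Notation Re := (@complex.Re R).
Local Notation Im := (@complex.Im R).
Local Notation M := (Mfun R).

Definition cr (r : R) : C := r%:C.
Definition ii : M := Mcst 'i.

(* The transform is first defined on step functions, where it is explicit; it is
   isometric up to the constant [kap], whose value is never needed. *)
Definition ebase (a x : R) : R := \1_(`]0, a]%classic) x - \1_(`]a, 0]%classic) x.
Definition ebas := locked (fun a : R => pi (fun x => (ebase a x)%:C) : M).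
(** The integral of exp(- i x y) for y from 0 to a, in closed form. At x = 0 the convention 1 / 0 =
    0 gives another value, on a null set. *)
Definition hatf (a x : R) : C := (sin (a * x) / x) +i* ((cos (a * x) - 1) / x).
Definition hat := locked (fun a : R => pi (hatf a) : M).
Lemma ebasE a : ebas a = pi (fun x => (ebase a x)%:C).
Proof. by rewrite /ebas -lock. Qed.
Lemma hatE a : hat a = pi (hatf a).
Proof. by rewrite /hat -lock. Qed.

Lemma cmeas_real (F : R -> R) : measurable_fun setT F -> cmeas (fun x => (F x)%:C).
Proof. by move=> mF; split; rewrite /comp /=; [exact: mF|exact: measurable_cst]. Qed.

Lemma measurable_ebase a : measurable_fun setT (ebase a).
Proof. by apply: measurable_funB; exact: measurable_indic. Qed.

Lemma cmeas_hatf a : cmeas (hatf a).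
Proof.
have ml : measurable_fun setT (fun x : R => a * x) by apply: measurable_funM.
split.
  apply: (measurable_funM (f := fun x => sin (a * x))); last exact: measurable_invr.
  apply: (@measurableT_comp _ _ _ _ _ _ (@sin R)) => //.
  by apply: continuous_measurable_fun => x; exact: continuous_sin.
apply: (measurable_funM (f := fun x => cos (a * x) - 1)); last exact: measurable_invr.
apply: (measurable_funB (f := fun x => cos (a * x))) => //.
apply: (@measurableT_comp _ _ _ _ _ _ (@cos R)) => //.
by apply: continuous_measurable_fun => x; exact: continuous_cos.
Qed.

Lemma aeN0 : {ae mu, forall x : R, x != 0}.
Proof.
exists [set 0]; split => //; first exact: lebesgue_measure_set1.
by move=> x /= /negP; rewrite negbK => /eqP.
Qed.

Lemma csq_hatf a x : csq (hatf a x) = 2 * ((1 - cos (a * x)) / x ^+ 2).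
Proof.
by rewrite /csq /= !expr_div_n sin2cos2; ring.
Qed.

Lemma ebase_sqr a x : ebase a x ^+ 2 = \1_(`]Num.min 0 a, Num.max 0 a]%classic) x.
Proof.
rewrite /ebase !indicE !mem_setE /=.
have [a0|a0] := leP 0 a; rewrite ?(min_l a0) ?(max_r a0) ?(min_r (ltW a0)) ?(max_l (ltW a0)) !in_itv /=.
  by case: (ltP 0 x) => h1; case: (leP x a) => h2; case: (ltP a x) => h3; rewrite /= ?subr0 ?expr1n ?expr0n //; exfalso; lra.
by case: (ltP 0 x) => h1; case: (leP x a) => h2; case: (ltP a x) => h3; rewrite /= ?subr0 ?sub0r ?sqrrN ?expr1n ?expr0n //; exfalso; lra.
Qed.

Lemma n2_ebas a : n2 (ebas a) = `|a|%:E.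
Proof.
rewrite ebasE n2_pi; last by apply: cmeas_real; exact: measurable_ebase.
under eq_integral do rewrite /csq /= expr0n /= addr0 ebase_sqr.
transitivity (mu (`]Num.min 0 a, Num.max 0 a]%classic : set R)).
  by rewrite integral_indic // setIT.
rewrite lebesgue_measure_itv /= lte_fin.
have [a0|a0] := leP 0 a; first rewrite ?(min_l a0) ?(max_r a0).
  by rewrite ger0_norm //; case: ltP => h; [rewrite -EFinB subr0|congr EFin; lra].
rewrite ?(min_r (ltW a0)) ?(max_l (ltW a0)) a0 ltr0_norm //.
by rewrite -EFinB sub0r.
Qed.

Lemma L2_ebas a : L2 (ebas a). Proof. by rewrite /L2 n2_ebas ltry. Qed.
Lemma nm_ebas a : nm (ebas a) ^+ 2 = `|a|. Proof. by rewrite nm_sqr n2_ebas. Qed.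

Lemma Tr_ebas h a : Tr h (ebas a) = ebas (a - h) - ebas (- h).
Proof.
have mE b : cmeas (fun x => (ebase b x)%:C) by apply: cmeas_real; exact: measurable_ebase.
rewrite /Tr !ebasE Aff_pi ?oner_neq0 // piN // piD //; last exact: cmeasN.
congr pi; apply/funext => x; rewrite -rmorphN -rmorphD /=; congr (_%:C).
rewrite /ebase /aff mul1r !indicE !mem_setE /= !in_itv /=.
do ![case: (ltP _ _) => ? | case: (leP _ _) => ?] => /=; try (exfalso; lra); by rewrite ?subrr ?subr0 ?sub0r ?opprK ?add0r ?addr0 ?addNr ?subrr.
Qed.

Lemma conj_ebas a : Mconj (ebas a) = ebas a.
Proof.
rewrite ebasE Mconj_pi; last by apply: cmeas_real; exact: measurable_ebase.
by congr pi; apply/funext => x; rewrite /= oppr0.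
Qed.

Lemma oneDsqrV_int : (\int[mu]_x ((oneDsqr x)^-1)%:E < +oo)%E.
Proof.
rewrite ge0_symfun_integralT; last 3 first.
- by move=> x; rewrite invr_ge0 /oneDsqr addr_ge0 ?sqr_ge0.
- by move=> x; exact: continuous_oneDsqrV.
- by move=> x /=; rewrite /oneDsqr sqrrN.
rewrite (_ : [set x | _] = `[0, +oo[%classic); last by rewrite -set_itvcy.
by rewrite integral0y_oneDsqr -!EFinM ltry.
Qed.

(** The squared modulus is 2 (1 - cos x) / x^2, and 1 - cos x is at most both x^2 / 2 and 2;
    together these give 8 / (1 + x^2) with room to spare. *)
Lemma hat_int_fin : (\int[mu]_x (csq (hatf 1 x))%:E < +oo)%E.
Proof.
have mo : measurable_fun setT (fun x : R => 8 * (oneDsqr x)^-1).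
  apply: measurable_funM => //; apply: continuous_measurable_fun => x; exact: continuous_oneDsqrV.
apply: (@le_lt_trans _ _ (\int[mu]_x (8 * (oneDsqr x)^-1)%:E)%E).
  apply: ge0_le_integral => //.
  - by move=> x _; rewrite lee_fin csq_ge0.
  - by apply/measurable_EFinP; apply: measurable_csq; exact: cmeas_hatf.
  - exact/measurable_EFinP.
  move=> x _; rewrite lee_fin csq_hatf mul1r /oneDsqr.
  have [->|x0] := eqVneq x 0; first by rewrite cos0 subrr mul0r mulr0 mulr_ge0 // invr_ge0; nra.
  have x2 : 0 < x ^+ 2 by rewrite exprn_even_gt0.
  have p1 : 0 < 1 + x ^+ 2 by lra.
  rewrite mulrA ler_pdivrMr // mulrAC ler_pdivlMr //.
  have := one_sub_cos_le x; have := cos_geN1 x; have := cos_le1 x; nra.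
under eq_integral do rewrite EFinM.
have m0 x : [set: R] x -> (0 <= ((oneDsqr x)^-1)%:E)%E.
  by move=> _; rewrite lee_fin invr_ge0 /oneDsqr addr_ge0 ?sqr_ge0.
have m1 : measurable_fun setT (fun x : R => ((oneDsqr x)^-1)%:E).
  by apply/measurable_EFinP; apply: continuous_measurable_fun => x; exact: continuous_oneDsqrV.
rewrite ge0_integralZl_EFin //.
by apply: lte_mul_pinfty => //; exact: oneDsqrV_int.
Qed.

Definition kap := locked (nm (hat 1) ^+ 2 : R).
Lemma kapE : kap = nm (hat 1) ^+ 2. Proof. by rewrite /kap -lock. Qed.

Lemma L2_hat1 : L2 (hat 1).
Proof. by rewrite /L2 hatE n2_pi; [exact: hat_int_fin|exact: cmeas_hatf]. Qed.

Lemma kap_gt0 : 0 < kap.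
Proof.
rewrite kapE lt_def sqr_ge0 andbT; apply/eqP => /eqP; rewrite sqrf_eq0 => /eqP /(nm_eq0 L2_hat1) h.
have : aeeq (hatf 1) (fun=> 0).
  by apply: pi_inj; [exact: cmeas_hatf|exact: cmeas_cst|rewrite -Mcst_pi -hatE; exact: h].
move=> [A [mA A0 sA]].
have : (mu (`]1%R, 2%R[%classic : set R) <= mu A)%E.
  rewrite le_measure ?inE //; apply: subset_trans sA => x /=; rewrite in_itv /= => /andP[x1 x2] /eqP.
  rewrite eq_complex /= mul1r => /andP[/eqP + _].
  move/eqP; rewrite mulf_eq0 invr_eq0 => /orP[/eqP|/eqP]; last by lra.
  apply/eqP; rewrite gt_eqF // sin_gt0_pi //; have := pi_ge2 R; lra.
rewrite A0 lebesgue_measure_itv /= lte_fin ltr1n -EFinB lee_fin; lra.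
Qed.

Lemma Aff_hat s a : s != 0 -> Aff s 0 (hat a) = Mcst (cr s^-1) * hat (a * s).
Proof.
move=> s0; rewrite !hatE Aff_pi //; last exact: cmeas_hatf.
rewrite Mcst_pi piM; [|exact: cmeas_cst|exact: cmeas_hatf].
apply: pi_eq; [apply: cmeas_aff; exact: cmeas_hatf|apply: cmeasM; [exact: cmeas_cst|exact: cmeas_hatf]|].
apply: aeS _ aeN0 => x x0; rewrite /hatf /aff addr0 mulrA /cr.
by apply/eqP; rewrite eq_complex /= !invfM !mul0r subr0 addr0; apply/andP; split; apply/eqP; ring.
Qed.

Lemma hat0 : hat 0 = 0.
Proof.
rewrite -[RHS]/(Mcst 0) Mcst_pi hatE; congr pi; apply/funext => x.
by rewrite /hatf !mul0r sin0 cos0 subrr !mul0r.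
Qed.
Lemma ebas0 : ebas 0 = 0.
Proof. by apply: (nm_eq0 (L2_ebas 0)); apply/eqP; rewrite -sqrf_eq0 nm_ebas normr0. Qed.

(** By dilation: [hat a] is a times [hat 1] at the point a x, so its squared norm is |a| times that
    of [hat 1], just as |a| is the squared norm of [ebas a]. This is the source of the isometry. *)
Lemma hat_nm a : L2 (hat a) /\ nm (hat a) ^+ 2 = kap * `|a|.
Proof.
have [->|a0] := eqVneq a 0; first by rewrite hat0 nm0 normr0 mulr0 expr0n; split=> //; exact: L20.
have Eh : hat a = Mcst (cr a) * Aff a 0 (hat 1).
  by rewrite Aff_hat // mulrA -McstM /cr -rmorphM divff // mul1r [Mcst 1 * _]mul1r.
have La : L2 (hat a) by rewrite Eh; apply: L2Z; apply: L2_aff => //; exact: L2_hat1.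
have LA := L2_aff 0 a0 L2_hat1.
split=> //; rewrite Eh (nmZ a LA) kapE (nm_aff 0 a0 L2_hat1) exprMn.
by move: (nm _ ^+ 2) (`|a|) => x y; ring.
Qed.
Lemma L2_hat a : L2 (hat a). Proof. by case: (hat_nm a). Qed.
Lemma nm_hat a : nm (hat a) ^+ 2 = kap * `|a|. Proof. by case: (hat_nm a). Qed.

End Basis.

(** * Isometry of the transform on step functions *)

Section Plancherel.
Variable R : realType.
Local Notation mu := (@lebesgue_measure R).
Local Notation C := R[i].
Local Notation Re := (@complex.Re R).
Local Notation Im := (@complex.Im R).
Local Notation M := (Mfun R).
Local Notation ii := (@ii R).
Local Notation kap := (@kap R).
Implicit Types (f g : M).

Lemma Ceq (z w : C) : Re z = Re w -> Im z = Im w -> z = w.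
Proof. by case: z w => ? ? [? ?] /= -> ->. Qed.

Lemma csq_cis (t : R) : csq (cis t) = 1.
Proof. by rewrite /csq /= cos2Dsin2. Qed.
Lemma cmod_cis (t : R) : cmod (cis t) = 1.
Proof. by rewrite cmod_csq csq_cis sqrtr1. Qed.
Lemma cisD (t s : R) : cis (t + s) = cis t * cis s.
Proof. by apply: Ceq; rewrite /= ?cosD ?sinD //; ring. Qed.
Lemma cis0 : cis 0 = 1 :> C.
Proof. by apply: Ceq; rewrite /= ?cos0 ?sin0. Qed.
Lemma cis_conj (t : R) : (cis t)^* = cis (- t).
Proof. by apply: Ceq; rewrite /= ?cosN ?sinN. Qed.

Lemma cmeas_cis (p : R -> R) : measurable_fun setT p -> cmeas (fun x => cis (p x)).
Proof.
move=> mp; split.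
  apply: (@measurableT_comp _ _ _ _ _ _ (@cos R)) => //.
  by apply: continuous_measurable_fun => x; exact: continuous_cos.
apply: (@measurableT_comp _ _ _ _ _ _ (@sin R)) => //.
by apply: continuous_measurable_fun => x; exact: continuous_sin.
Qed.

Definition expi := locked (fun p : R -> R => pi (fun x => cis (p x)) : M).
Lemma expiE p : expi p = pi (fun x => cis (p x)).
Proof. by rewrite /expi -lock. Qed.
Lemma expiD (p q : R -> R) : measurable_fun setT p -> measurable_fun setT q ->
  expi (fun x => p x + q x) = expi p * expi q.
Proof.
move=> mp mq; rewrite !expiE piM; do ?exact: cmeas_cis.
by congr pi; apply/funext => x; rewrite cisD.
Qed.
Lemma expi0 : expi (fun=> 0) = 1.
Proof. by rewrite expiE cis0 -Mcst_pi. Qed.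
Lemma expi_conj (p : R -> R) : measurable_fun setT p -> Mconj (expi p) = expi (fun x => - p x).
Proof.
move=> mp; rewrite !expiE Mconj_pi; last exact: cmeas_cis.
by congr pi; apply/funext => x; rewrite cis_conj.
Qed.
Lemma expi_unit (p : R -> R) : measurable_fun setT p -> Mconj (expi p) * expi p = 1.
Proof.
move=> mp; rewrite expi_conj // -expiD //; last exact: measurable_funN.
by rewrite -expi0; congr expi; apply/funext => x; rewrite addNr.
Qed.
Lemma bdd_expi (p : R -> R) : measurable_fun setT p -> bdd (expi p) 1.
Proof. by move=> mp; rewrite expiE; apply: bdd_pi; [exact: cmeas_cis|move=> x; rewrite cmod_cis]. Qed.
Lemma L2_expi (p : R -> R) f : measurable_fun setT p -> L2 f -> L2 (expi p * f).
Proof. by move=> mp; apply: L2M; exact: bdd_expi. Qed.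
Lemma nm_expi (p : R -> R) f : measurable_fun setT p -> nm (expi p * f) = nm f.
Proof. by move=> mp; apply: nmM_unit; exact: expi_unit. Qed.

Definition modu (h : R) : M := expi (fun x => h * x).
Lemma measurable_lin (h : R) : measurable_fun setT (fun x : R => h * x).
Proof. by apply: measurable_funM. Qed.
Hint Resolve measurable_lin : core.

Lemma modu_hat h a : modu h * hat a = hat (a - h) - hat (- h).
Proof.
have mh := cmeas_cis (measurable_lin h); have mN := cmeasN (cmeas_hatf (- h)).
rewrite /modu expiE !hatE piM //; last exact: cmeas_hatf.
rewrite piN ?piD //; do ?exact: cmeas_hatf.
congr pi; apply/funext => x; apply: Ceq => /=; rewrite (mulrBl x a h) mulNr ?sinB ?sinN ?cosB ?cosN; ring.
Qed.

Lemma hat_opp (a : R) : hat (- a) = - Mconj (hat a).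
Proof.
rewrite !hatE Mconj_pi ?piN; do ?exact: cmeas_conj (cmeas_hatf a); do ?exact: cmeas_hatf.
congr pi; apply/funext => x; apply: Ceq => /=; rewrite mulNr ?sinN ?cosN; ring.
Qed.

Lemma Mcst_split (z : C) : Mcst z = Mcst (cr (Re z)) + Mcst (cr (Im z)) * ii.
Proof.
rewrite /ii -McstM -McstD; congr Mcst; apply: Ceq; rewrite /cr /=; ring.
Qed.
Lemma ii2 : ii * ii = -1.
Proof. have -> : (1 : M) = Mcst 1 by []. rewrite /ii -McstM -McstN; congr Mcst; apply: Ceq => /=; ring. Qed.
Lemma ii_conj : Mconj ii = - ii.
Proof. by rewrite /ii Mconj_cst -McstN; congr Mcst; apply: Ceq => /=; ring. Qed.
Lemma cr1 : Mcst (cr 1) = 1 :> M. Proof. by []. Qed.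
Lemma cr_conj (r : R) : Mconj (Mcst (cr r)) = Mcst (cr r) :> M.
Proof. by rewrite Mconj_cst; congr Mcst; apply: Ceq; rewrite /= ?oppr0. Qed.
Lemma crM (r s : R) : Mcst (cr (r * s)) = Mcst (cr r) * Mcst (cr s) :> M.
Proof. by rewrite -McstM /cr rmorphM. Qed.
Lemma crN (r : R) : Mcst (cr (- r)) = - Mcst (cr r) :> M.
Proof. by rewrite -McstN /cr rmorphN. Qed.
Lemma nm_ii f : nm (ii * f) = nm f.
Proof. by apply: nmM_unit; rewrite ii_conj mulNr ii2 opprK. Qed.
Lemma L2ii f : L2 f -> L2 (ii * f). Proof. exact: L2Z. Qed.

Lemma rip_half f g : L2 f -> L2 g -> rip f g = (nm f ^+ 2 + nm g ^+ 2 - nm (f - g) ^+ 2) / 2.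
Proof. by move=> Lf Lg; rewrite nmB_sqr //; field. Qed.

(** Polarisation. Up to a modulation [hat a - hat b] is [hat (a - b)], and up to a translation
    [ebas a - ebas b] is [ebas (a - b)], so every norm in the identity is known. *)
Lemma rip_hat a b : rip (hat a) (hat b) = kap * rip (ebas a) (ebas b).
Proof.
rewrite (rip_half (L2_hat a) (L2_hat b)) (rip_half (L2_ebas a) (L2_ebas b)).
have -> : hat a - hat b = modu (- b) * hat (a - b).
  by rewrite modu_hat opprK subrK.
have -> : ebas a - ebas b = Tr (- b) (ebas (a - b)) by rewrite Tr_ebas opprK subrK.
rewrite /modu nm_expi // (nm_Tr (- b) (L2_ebas (a - b))) !nm_hat !nm_ebas.
by field.
Qed.

Lemma Reflect_hat (a : R) : Aff (-1) 0 (hat a) = Mconj (hat a).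
Proof.
have n1 : (-1 : R) != 0 by rewrite oppr_eq0 oner_neq0.
by rewrite Aff_hat // invrN1 mulrN1 hat_opp crN cr1 mulN1r opprK.
Qed.

(** The reflection x -> -x preserves the inner product and conjugates [hat], so this number equals
    its opposite. *)
Lemma ripi_hat (a b : R) : rip (ii * hat a) (hat b) = 0.
Proof.
have n1 : (-1 : R) != 0 by rewrite oppr_eq0 oner_neq0.
have Lh (c : R) : L2 (hat c) := L2_hat c.
have := rip_aff 0 n1 (L2ii (Lh a)) (Lh b).
rewrite normrN1 mul1r AffM // Aff_cst // !Reflect_hat -/ii.
have -> : ii * Mconj (hat a) = Mconj (- (ii * hat a)).
  by rewrite MconjN MconjM ii_conj mulNr opprK.
rewrite rip_conj ripNl //; last exact: L2ii.
by move=> h; lra.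
Qed.

Lemma ripi_ebas (a b : R) : rip (ii * ebas a) (ebas b) = 0.
Proof.
have Le (c : R) : L2 (ebas c) := L2_ebas c.
have : rip (ii * ebas a) (ebas b) = rip (Mconj (- (ii * ebas a))) (Mconj (ebas b)).
  by rewrite !MconjN MconjM ii_conj !conj_ebas mulNr opprK.
rewrite rip_conj ripNl //; last exact: L2ii.
by move=> h; lra.
Qed.

Lemma ripz_hat z a b : rip (Mcst z * hat a) (hat b) = kap * rip (Mcst z * ebas a) (ebas b).
Proof.
rewrite Mcst_split !mulrDl -!mulrA.
have L x y : L2 x -> L2 (Mcst y * (ii * x)) by move=> Lx; apply: L2Z; exact: L2ii.
rewrite (ripDl (L2Z _ (L2_hat a)) (L _ _ (L2_hat a)) (L2_hat b)).
rewrite (ripDl (L2Z _ (L2_ebas a)) (L _ _ (L2_ebas a)) (L2_ebas b)).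
rewrite (ripZl _ (L2_hat a) (L2_hat b)) (ripZl _ (L2ii (L2_hat a)) (L2_hat b)).
rewrite (ripZl _ (L2_ebas a) (L2_ebas b)) (ripZl _ (L2ii (L2_ebas a)) (L2_ebas b)).
by rewrite ripi_hat ripi_ebas rip_hat; ring.
Qed.

Lemma ripzz_hat z w a b :
  rip (Mcst z * hat a) (Mcst w * hat b) = kap * rip (Mcst z * ebas a) (Mcst w * ebas b).
Proof.
rewrite [LHS]ripC [in RHS]ripC rip_adj [in RHS]rip_adj ripC [in RHS]ripC.
by rewrite Mconj_cst !mulrA -McstM ripz_hat.
Qed.

(** Finite combinations are coded by lists, sums being concatenations. That [ht l] depends only on
    the function [st l] is a consequence of the isometry [rip_ht]. *)
Definition st (l : seq (C * R)) : M := \sum_(p <- l) Mcst p.1 * ebas p.2.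
Definition ht (l : seq (C * R)) : M := \sum_(p <- l) Mcst p.1 * hat p.2.

Lemma st_nil : st [::] = 0. Proof. by rewrite /st big_nil. Qed.
Lemma ht_nil : ht [::] = 0. Proof. by rewrite /ht big_nil. Qed.
Lemma st_cons p l : st (p :: l) = Mcst p.1 * ebas p.2 + st l.
Proof. by rewrite /st big_cons. Qed.
Lemma ht_cons p l : ht (p :: l) = Mcst p.1 * hat p.2 + ht l.
Proof. by rewrite /ht big_cons. Qed.
Lemma st_cat l l' : st (l ++ l') = st l + st l'. Proof. by rewrite /st big_cat. Qed.
Lemma ht_cat l l' : ht (l ++ l') = ht l + ht l'. Proof. by rewrite /ht big_cat. Qed.
Definition lz (z : C) (l : seq (C * R)) := [seq (z * p.1, p.2) | p <- l].
Lemma st_z z l : st (lz z l) = Mcst z * st l.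
Proof.
elim: l => [|p l IH]; first by rewrite st_nil mulr0.
by rewrite /= !st_cons IH /= McstM mulrDr mulrA.
Qed.
Lemma ht_z z l : ht (lz z l) = Mcst z * ht l.
Proof.
elim: l => [|p l IH]; first by rewrite ht_nil mulr0.
by rewrite /= !ht_cons IH /= McstM mulrDr mulrA.
Qed.
Lemma L2_st l : L2 (st l).
Proof.
elim: l => [|p l IH]; first by rewrite st_nil; exact: L20.
by rewrite st_cons; apply: L2D => //; apply: L2Z; exact: L2_ebas.
Qed.
Lemma L2_ht l : L2 (ht l).
Proof.
elim: l => [|p l IH]; first by rewrite ht_nil; exact: L20.
by rewrite ht_cons; apply: L2D => //; apply: L2Z; exact: L2_hat.
Qed.

Lemma rip0l f : L2 f -> rip 0 f = 0.
Proof. by move=> Lf; have := ripDl (L20 R) (L20 R) Lf; rewrite addr0 => h; lra. Qed.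

Lemma rip_ht l l' : rip (ht l) (ht l') = kap * rip (st l) (st l').
Proof.
elim: l => [|p l IH].
  by rewrite ht_nil st_nil !rip0l ?mulr0 //; [exact: L2_st|exact: L2_ht].
rewrite st_cons ht_cons (ripDl (L2Z _ (L2_hat _)) (L2_ht l) (L2_ht l')).
rewrite (ripDl (L2Z _ (L2_ebas _)) (L2_st l) (L2_st l')) IH mulrDr; congr (_ + _).
elim: l' {IH} => [|q l' IH].
  by rewrite ht_nil st_nil ![rip _ 0]ripC !rip0l ?mulr0 //; apply: L2Z; [exact: L2_ebas|exact: L2_hat].
rewrite st_cons ht_cons (ripDr (L2Z _ (L2_hat _)) (L2_ht l') (L2Z _ (L2_hat _))).
by rewrite (ripDr (L2Z _ (L2_ebas _)) (L2_st l') (L2Z _ (L2_ebas _))) IH mulrDr ripzz_hat.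
Qed.

Lemma nm_ht l : nm (ht l) ^+ 2 = kap * nm (st l) ^+ 2.
Proof. by rewrite -!rip_nm rip_ht. Qed.
Lemma nm_htE l : nm (ht l) = Num.sqrt kap * nm (st l).
Proof.
apply/eqP; rewrite -(@eqrXn2 _ 2) ?nm_ge0 ?mulr_ge0 ?sqrtr_ge0 ?nm_ge0 // exprMn.
by rewrite sqr_sqrtr ?nm_ht // ltW // kap_gt0.
Qed.

Lemma st_sub l l' : st (l ++ lz (-1) l') = st l - st l'.
Proof. by rewrite st_cat st_z McstN mulN1r. Qed.
Lemma ht_sub l l' : ht (l ++ lz (-1) l') = ht l - ht l'.
Proof. by rewrite ht_cat ht_z McstN mulN1r. Qed.

Lemma L2_locint f (p : C -> R) : L2 f -> (forall z, `|p z| <= cmod z) ->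
  measurable_fun setT (p \o rep f) -> locally_integrable setT (p \o rep f).
Proof.
move=> Lf hp mp; split => //; first exact: openT.
move=> K _ cK; have mK := compact_measurable cK.
have fK : (mu K < +oo)%E by exact: compact_finite_measure.
apply: (@le_lt_trans _ _ (\int[mu]_(x in K) (1 + csq (rep f x))%:E)%E).
  apply: ge0_le_integral => //.
  - apply/measurable_EFinP; apply: (@measurableT_comp _ _ _ _ _ _ (@Num.norm R R)) => //.
    exact: measurable_funTS.
  - apply/measurable_EFinP; apply: measurable_funTS; apply: measurable_funD => //.
    by apply: measurable_csq; exact: rep_meas.
  - move=> x _; rewrite lee_fin; apply: le_trans (hp _) _.
    rewrite -cmod_sqr; have := cmod_ge0 (rep f x); nra.
under eq_integral do rewrite EFinD.
rewrite ge0_integralD //; last 2 first.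
- by move=> x _; rewrite lee_fin csq_ge0.
- by apply/measurable_EFinP; apply: measurable_funTS; apply: measurable_csq; exact: rep_meas.
apply: lte_add_pinfty; first by rewrite integral_cst // mul1e.
apply: le_lt_trans Lf; apply: ge0_subset_integral => //.
- by apply/measurable_EFinP; apply: measurable_csq; exact: rep_meas.
- by move=> x _; rewrite lee_fin csq_ge0.
Qed.

End Plancherel.

(** * Extension of the transform to L^2 and its inverse *)

Section Fourier.
Variable R : realType.
Local Notation mu := (@lebesgue_measure R).
Local Notation C := R[i].
Local Notation Re := (@complex.Re R).
Local Notation Im := (@complex.Im R).
Local Notation M := (Mfun R).
Local Notation ii := (@ii R).
Local Notation kap := (@kap R).
Implicit Types (f g : M).

Lemma Rintegral_indic (F : R -> R) (A : set R) : measurable A ->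
  (\int[mu]_(x in A) F x = \int[mu]_x (F x * \1_A x))%R.
Proof.
move=> mA; rewrite Rintegral_mkcond; apply: eq_Rintegral => x _.
by rewrite patchE indicE; case: (x \in A); rewrite ?mulr1 ?mulr0.
Qed.

Lemma ebaseB (a b x : R) : a < b -> ebase b x - ebase a x = \1_(`]a, b]%classic) x.
Proof.
move=> ab; rewrite /ebase !indicE !mem_setE /= !in_itv /=.
do ![case: (ltP _ _) => ? | case: (leP _ _) => ?] => /=; try (exfalso; lra); by rewrite ?subrr ?subr0 ?sub0r ?opprK ?add0r ?addr0 ?addNr ?subrr.
Qed.

(** Differences of [ebas] are indicators of intervals, so the real part integrates to 0 over each
    interval and [zero_of_itv] applies. *)
Lemma ebas_orth_Re f : L2 f -> (forall a, rip f (ebas a) = 0) -> {ae mu, forall x, Re (rep f x) = 0}.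
Proof.
move=> Lf h.
have mRe : measurable_fun setT (Re \o rep f) by case: (rep_meas f).
apply: zero_of_itv.
  exact: (L2_locint Lf (@Re_le_cmod R) mRe).
move=> a b ab; have mE (c : R) : cmeas (fun x => (ebase c x)%:C).
  by apply: cmeas_real; exact: measurable_ebase.
have := ripBr (L2_ebas b) (L2_ebas a) Lf; rewrite !h subrr => E.
rewrite -[RHS]E !ebasE piN // piD //; last exact: cmeasN.
rewrite -{2}(pi_rep f) rip_pi; [|exact: rep_meas|apply: cmeasD => //; exact: cmeasN].
have Li := L2_locint Lf (@Re_le_cmod R) mRe.
have Iab : mu.-integrable `[a, b] (EFin \o (Re \o rep f)).
  apply/integrableP; split; first by apply/measurable_EFinP; exact: measurable_funTS.
  by case: Li => _ _ /(_ `[a, b]%classic); apply => //; exact: segment_compact.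
rewrite -Rintegral_itv_obnd_cbnd; last first.
  by apply: integrableS Iab => //; apply: subset_itvr; rewrite bnd_simp.
rewrite Rintegral_indic //; apply: eq_Rintegral => x _.
by rewrite -ebaseB // /rdot /= oppr0 addr0 mulr0 addr0.
Qed.

Lemma ebas_orth f : L2 f -> (forall a, rip f (ebas a) = 0) ->
  (forall a, rip (ii * f) (ebas a) = 0) -> f = 0.
Proof.
move=> Lf h1 h2; apply: Meq.
have hr := ebas_orth_Re Lf h1; have hi := ebas_orth_Re (L2ii Lf) h2.
have hii : {ae mu, forall x, rep (ii * f) x = 'i * rep f x}.
  by apply: aeS2 _ (repM ii f) (rep_cst 'i) => x -> ->.
have h0 : {ae mu, forall x, rep f x = 0}.
  apply: aeS3 _ hr hi hii => x r0 hx E; move: hx; rewrite E.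
  by case: (rep f x) r0 => p q /= -> h; apply: Ceq => //=; lra.
by apply: aeS2 _ h0 (rep0 R) => x -> ->.
Qed.

Lemma st_dense f : L2 f -> forall e, 0 < e -> exists l, nm (f - st l) <= e.
Proof.
move=> Lf e e0.
have [|||||w [l ->] h] := @dense_of_orth R (fun w => exists l, w = st l) _ _ _ _ _ f Lf e e0.
- by move=> _ [l ->]; exact: L2_st.
- by exists [::]; rewrite st_nil.
- by move=> _ _ [l ->] [l' ->]; exists (l ++ l'); rewrite st_cat.
- by move=> r _ [l ->]; exists (lz r%:C l); rewrite st_z.
- move=> g Lg h.
  have h1 z a : rip g (Mcst z * ebas a) = 0.
    by apply: h; exists [:: (z, a)]; rewrite st_cons st_nil addr0.
  apply: ebas_orth => // a; first by have := h1 1 a; rewrite [Mcst 1 * _]mul1r.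
  by rewrite rip_adj ii_conj -McstN h1.
- by exists l.
Qed.

(** The closure of the pairs ([st l], [ht l]), seen as a graph in L^2. Completeness and [nm_htE]
    make it total on L^2, [FTr_rip] makes it single valued. *)
Definition FTr f g : Prop := [/\ L2 f, L2 g &
  forall e, 0 < e -> exists l, nm (f - st l) <= e /\ nm (g - ht l) <= e].

Lemma FTr_st l : FTr (st l) (ht l).
Proof.
split; [exact: L2_st|exact: L2_ht|move=> e e0; exists l].
by rewrite !subrr nm0 ltW.
Qed.

Lemma FTr_ex f : L2 f -> exists g, FTr f g.
Proof.
move=> Lf; have en n : 0 < (n.+1%:R : R)^-1 by rewrite invr_gt0.
have [l hl] := choice (fun n => st_dense Lf (en n)).
have sm (e : R) : 0 < e -> exists N, forall n, (N <= n)%N -> nm (f - st (l n)) <= e.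
  move=> e0; exists (Num.truncn e^-1) => n Nn; apply: le_trans (hl n) _.
  rewrite -[leRHS]invrK lef_pV2 ?posrE ?invr_gt0 //; apply: ltW.
  by apply: lt_le_trans (truncnS_gt _) _; rewrite ler_nat.
have K0 : 0 < Num.sqrt kap by rewrite sqrtr_gt0 kap_gt0.
have [|e e0|g Lg hg] := @L2_complete R (fun n => ht (l n)); first by move=> n; exact: L2_ht.
  have e2 : 0 < e / (2 * Num.sqrt kap) by rewrite divr_gt0 // mulr_gt0.
  have [N hN] := sm _ e2; exists N => n m /hN hn /hN hm.
  rewrite -ht_sub nm_htE st_sub.
  have h : nm (st (l n) - st (l m)) <= e / (2 * Num.sqrt kap) + e / (2 * Num.sqrt kap).
    apply: le_trans (nm_tri (L2_st _) (L2_st _) Lf) _.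
    by apply: lerD; [rewrite nmBC|].
  apply: le_trans (ler_wpM2l (ltW K0) h) _.
  by rewrite le_eqVlt; apply/orP; left; apply/eqP; field; rewrite gt_eqF.
exists g; split=> // e e0; have [N1 h1] := sm _ e0; have [N2 h2] := hg _ e0.
exists (l (maxn N1 N2)); split; first by apply: h1; exact: leq_maxl.
by rewrite nmBC; apply: h2; exact: leq_maxr.
Qed.

Lemma eq_of_eps (x y K : R) : (forall e, 0 < e -> e <= 1 -> `|x - y| <= K * e) -> x = y.
Proof.
move=> h; apply/eqP; rewrite -subr_eq0 -normr_le0; apply/ler_addgt0Pr => e e0.
pose d := Num.min 1 (e / (`|K| + 1)).
have K1 : 0 < `|K| + 1 by rewrite ltr_wpDl.
have d0 : 0 < d by rewrite lt_min ltr01 divr_gt0.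
have d1 : d <= 1 by rewrite ge_min lexx.
have d2 : d * (`|K| + 1) <= e by rewrite -ler_pdivlMr // ge_min lexx orbT.
rewrite add0r; apply: le_trans (h _ d0 d1) _; have := ler_norm K; nra.
Qed.

Lemma rip_approx a a' b b' : L2 a -> L2 a' -> L2 b -> L2 b' ->
  `|rip a b - rip a' b'| <= nm (a - a') * nm b + nm a' * nm (b - b') :> R.
Proof.
move=> La La' Lb Lb'.
have -> : rip a b - rip a' b' = rip (a - a') b + rip a' (b - b').
  by rewrite ripBl // ripBr //; ring.
apply: le_trans (ler_normD _ _) _; apply: lerD; apply: CS => //; exact: L2B.
Qed.

Lemma FTr_rip f g f' g' : FTr f g -> FTr f' g' -> rip g g' = kap * rip f f'.
Proof.
move=> [Lf Lg h] [Lf' Lg' h'].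
apply: (@eq_of_eps _ _ ((nm g' + nm g + 1) + kap * (nm f' + nm f + 1))) => e e0 e1.
have [l [l1 l2]] := h _ e0; have [l' [l1' l2']] := h' _ e0.
have H1 := rip_approx Lg (L2_ht l) Lg' (L2_ht l').
have H2 := rip_approx Lf (L2_st l) Lf' (L2_st l').
have k0 := kap_gt0 R.
have A1 : nm (ht l) <= nm g + e.
  by have := nm_sub (L2_ht l) Lg; rewrite (nmBC (ht l)); lra.
have A2 : nm (st l) <= nm f + e.
  by have := nm_sub (L2_st l) Lf; rewrite (nmBC (st l)); lra.
have -> : rip g g' - kap * rip f f' = (rip g g' - rip (ht l) (ht l'))
    - kap * (rip f f' - rip (st l) (st l')) by rewrite rip_ht; ring.
apply: le_trans (ler_normB _ _) _; rewrite normrM (gtr0_norm k0) mulrDl.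
have nn (x : M) := nm_ge0 x.
have B1 : nm (g - ht l) * nm g' + nm (ht l) * nm (g' - ht l') <= (nm g' + nm g + 1) * e.
  have := nn g'; have := nn (g' - ht l'); have := nn (ht l); nra.
have B2 : nm (f - st l) * nm f' + nm (st l) * nm (f' - st l') <= (nm f' + nm f + 1) * e.
  have := nn f'; have := nn (f' - st l'); have := nn (st l); nra.
apply: lerD; first exact: le_trans H1 B1.
by rewrite -mulrA; apply: ler_wpM2l; [exact: ltW|exact: le_trans H2 B2].
Qed.

Lemma FTrD f g f' g' : FTr f g -> FTr f' g' -> FTr (f + f') (g + g').
Proof.
move=> [Lf Lg h] [Lf' Lg' h']; split; [exact: L2D|exact: L2D|move=> e e0].
have e2 : 0 < e / 2 by rewrite divr_gt0.
have [l [l1 l2]] := h _ e2; have [l' [l1' l2']] := h' _ e2.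
exists (l ++ l'); rewrite st_cat ht_cat (splitr e).
split.
  rewrite (_ : _ - _ = (f - st l) + (f' - st l')); last by ring.
  by apply: le_trans (nmD _ _) (lerD l1 l1'); apply: L2B => //; exact: L2_st.
rewrite (_ : _ - _ = (g - ht l) + (g' - ht l')); last by ring.
by apply: le_trans (nmD _ _) (lerD l2 l2'); apply: L2B => //; exact: L2_ht.
Qed.

Lemma FTrZ z f g : FTr f g -> FTr (Mcst z * f) (Mcst z * g).
Proof.
move=> [Lf Lg h]; split; [exact: L2Z|exact: L2Z|move=> e e0].
have c0 : 0 < cmod z + 1 by rewrite ltr_wpDl // cmod_ge0.
have [l [l1 l2]] := h _ (divr_gt0 e0 c0).
exists (lz z l); rewrite st_z ht_z -!mulrBr.
have aux x : L2 x -> nm x <= e / (cmod z + 1) -> nm (Mcst z * x) <= e.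
  move=> Lx hx; apply: le_trans (nmM_bdd (bdd_cst z) Lx) _.
  apply: le_trans (ler_wpM2l (cmod_ge0 z) hx) _.
  rewrite mulrCA ger_pMr // ler_pdivrMr // mul1r; lra.
by split; apply: aux => //; apply: L2B => //; [exact: L2_st|exact: L2_ht].
Qed.

Lemma FTr_uniq f g g' : FTr f g -> FTr f g' -> g = g'.
Proof.
move=> h h'; apply/eqP; rewrite -subr_eq0; apply/eqP.
have hN := FTrZ (-1) h'; rewrite McstN !mulN1r in hN.
have hD := FTrD h hN; rewrite subrr in hD.
have [L0 Lg _] := hD; apply: nm_eq0 => //; apply/eqP; rewrite -sqrf_eq0 -rip_nm.
by rewrite (FTr_rip hD hD) rip0l ?mulr0 //.
Qed.

(** A choice in the graph [FTr]; the default 0 is taken only outside L^2. *)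
Definition Fo := locked (fun f => xget 0 [set g | FTr f g] : M).
Lemma FoP f : L2 f -> FTr f (Fo f).
Proof.
move=> Lf; rewrite /Fo -lock; have [g hg] := FTr_ex Lf.
by case: xgetP => [h _ //|/(_ g)].
Qed.
Lemma Fo_eq f g : FTr f g -> Fo f = g.
Proof. by move=> h; have [Lf _ _] := h; apply: FTr_uniq (FoP Lf) h. Qed.
Lemma L2Fo f : L2 f -> L2 (Fo f). Proof. by move=> /FoP[]. Qed.
Lemma FoD f g : L2 f -> L2 g -> Fo (f + g) = Fo f + Fo g.
Proof. by move=> Lf Lg; apply: Fo_eq; apply: FTrD; exact: FoP. Qed.
Lemma FoZ z f : L2 f -> Fo (Mcst z * f) = Mcst z * Fo f.
Proof. by move=> Lf; apply: Fo_eq; apply: FTrZ; exact: FoP. Qed.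
Lemma FoN f : L2 f -> Fo (- f) = - Fo f.
Proof. by move=> Lf; rewrite -mulN1r -[1]/(Mcst 1) -McstN FoZ // McstN mulN1r. Qed.
Lemma FoB f g : L2 f -> L2 g -> Fo (f - g) = Fo f - Fo g.
Proof. by move=> Lf Lg; rewrite FoD ?FoN //; exact: L2N. Qed.
Lemma Fo_rip f g : L2 f -> L2 g -> rip (Fo f) (Fo g) = kap * rip f g.
Proof. by move=> Lf Lg; apply: FTr_rip; exact: FoP. Qed.
Lemma Fo_nm f : L2 f -> nm (Fo f) = Num.sqrt kap * nm f.
Proof.
move=> Lf; apply/eqP; rewrite -(@eqrXn2 _ 2) ?nm_ge0 ?mulr_ge0 ?sqrtr_ge0 ?nm_ge0 // exprMn.
by rewrite -!rip_nm Fo_rip // sqr_sqrtr // ltW // kap_gt0.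
Qed.
Lemma Fo_st l : Fo (st l) = ht l. Proof. exact: Fo_eq (FTr_st l). Qed.

Lemma Fo_Tr h f : L2 f -> Fo (Tr h f) = modu h * Fo f.
Proof.
move=> Lf; apply: Fo_eq; have [_ Lg hl] := FoP Lf.
have mh : measurable_fun setT (fun x : R => h * x) by exact: measurable_lin.
split; [exact: L2_Tr|exact: L2_expi|move=> e /hl[l [l1 l2]]].
have [l' [E1 E2]] : exists l', st l' = Tr h (st l) /\ ht l' = modu h * ht l.
  elim: l {l1 l2} => [|p l [l' [IH1 IH2]]].
    by exists [::]; rewrite st_nil ht_nil -[0]/(Mcst 0) Tr_cst mulr0.
  exists ((p.1, p.2 - h) :: (- p.1, - h) :: l').
  rewrite !st_cons !ht_cons IH1 IH2; split; first by rewrite TrD TrM Tr_cst Tr_ebas /= McstN; ring.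
  by rewrite mulrDr (mulrCA (modu h)) modu_hat /= McstN; ring.
exists l'; rewrite E1 E2 -TrB -mulrBr /modu nm_expi // nm_Tr //.
by apply: L2B => //; exact: L2_st.
Qed.

Lemma Aff_ebas (t a : R) : t != 0 -> Aff t 0 (ebas (a * t)) = Mcst (cr (Num.sg t)) * ebas a.
Proof.
move=> t0; have mE (c : R) : cmeas (fun x => (ebase c x)%:C).
  by apply: cmeas_real; exact: measurable_ebase.
rewrite !ebasE Aff_pi // Mcst_pi piM //; last exact: cmeas_cst.
apply: pi_eq; [exact: (@cmeas_aff R t 0 _ (mE (a * t)))|apply: cmeasM => //; exact: cmeas_cst|].
have hN (b : R) : {ae mu, forall x, x != b}.
  exists [set b]; split => //; first exact: lebesgue_measure_set1.
  by move=> x /= /negP; rewrite negbK => /eqP.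
apply: aeS2 _ (hN 0) (hN a) => x x0 xa; rewrite /cr -rmorphM /= /aff addr0; congr (_%:C).
rewrite /ebase !indicE !mem_setE /= !in_itv /=.
have [tp|tn] := ltP 0 t.
  rewrite (gtr0_sg tp) mul1r pmulr_rgt0 // pmulr_rle0 // (mulrC a) ler_pM2l // ltr_pM2l //.
have {}tn : t < 0 by rewrite lt_def eq_sym t0.
rewrite (ltr0_sg tn) nmulr_rgt0 // nmulr_rle0 // (mulrC a) ler_nM2l // ltr_nM2l //.
rewrite [0 <= x]le_eqVlt eq_sym (negbTE x0) [a <= x]le_eqVlt eq_sym (negbTE xa) [x <= 0]le_eqVlt (negbTE x0).
by rewrite [x <= a]le_eqVlt (negbTE xa) /= mulN1r opprB; congr (_ - _); rewrite andbC.
Qed.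

(** Dilation by t = b / a exchanges the two indices; the factors |t|, 1 / t and the sign of t that
    it produces multiply to 1. *)
Lemma rip_hat_swap (z : C) (a b : R) : rip (Mcst z * hat a) (ebas b) = rip (Mcst z * hat b) (ebas a).
Proof.
have [->|a0] := eqVneq a 0.
  by rewrite hat0 ebas0 mulr0 ripC [RHS]ripC !(ripC _ 0) !rip0l //; [apply: L2Z; exact: L2_hat|exact: L2_ebas].
have [->|b0] := eqVneq b 0.
  by rewrite hat0 ebas0 mulr0 !(ripC _ 0) !rip0l //; [exact: L2_ebas|apply: L2Z; exact: L2_hat].
have t0 : b / a != 0 by rewrite mulf_neq0 // invr_eq0.
rewrite (rip_aff 0 t0 (L2Z z (L2_hat a)) (L2_ebas b)) AffM // Aff_cst // Aff_hat //.
have E : a * (b / a) = b by rewrite mulrCA divff ?mulr1.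
have EA := Aff_ebas a t0; rewrite E in EA; rewrite EA E mulrCA.
have L1 : L2 (Mcst z * hat b) by apply: L2Z; exact: L2_hat.
rewrite (ripZl _ L1 (L2Z _ (L2_ebas a))) (ripZr _ (L2_ebas a) L1).
rewrite !mulrA -[RHS]mul1r; congr (_ * _).
have n0 : `|b / a| != 0 by rewrite normr_eq0.
have -> : Num.sg (b / a) = `|b / a| / (b / a) by rewrite normrEsg -mulrA divff ?mulr1.
by rewrite mulf_div -!expr2 real_normK ?num_real // divff // sqrf_eq0.
Qed.

Lemma rip_hat_ebas (z : C) (a b : R) :
  rip (Mcst z * hat a) (ebas b) = rip (Mcst z * ebas a) (Mconj (hat b)).
Proof.
rewrite rip_hat_swap (mulrC _ (hat b)) (mulrC _ (ebas a)) (rip_adj (hat b)) (rip_adj (ebas a)).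
by rewrite conj_ebas (mulrC (ebas a)).
Qed.

Lemma rip_ht_conj (l l' : seq (C * R)) : rip (ht l) (Mconj (st l')) = rip (st l) (Mconj (ht l')).
Proof.
have C0 : Mconj 0 = 0 :> M by rewrite -[0]/(Mcst 0) Mconj_cst rmorph0.
elim: l => [|p l IH].
  by rewrite ht_nil st_nil !rip0l //; apply: L2conj; [exact: L2_ht|exact: L2_st].
rewrite st_cons ht_cons (ripDl (L2Z _ (L2_hat _)) (L2_ht l) (L2conj (L2_st l'))).
rewrite (ripDl (L2Z _ (L2_ebas _)) (L2_st l) (L2conj (L2_ht l'))) IH; congr (_ + _).
elim: l' {IH} => [|q l' IH].
  by rewrite ht_nil st_nil C0 ![rip _ 0]ripC !rip0l //; apply: L2Z; [exact: L2_ebas|exact: L2_hat].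
rewrite st_cons ht_cons !MconjD !MconjM !Mconj_cst.
rewrite (ripDr (L2Z _ (L2conj (L2_ebas _))) (L2conj (L2_st l')) (L2Z _ (L2_hat _))).
rewrite (ripDr (L2Z _ (L2conj (L2_hat _))) (L2conj (L2_ht l')) (L2Z _ (L2_ebas _))) IH; congr (_ + _).
rewrite conj_ebas ![rip _ (Mcst q.1^* * _)]ripC !(rip_adj (Mcst q.1^*)) ![rip _ (Mconj _ * _)]ripC.
by rewrite Mconj_cst !mulrA -McstM rip_hat_ebas.
Qed.

(** Symmetry for the bilinear pairing, which reflects the symmetric kernel exp(- i x y); on step
    functions it is [rip_ht_conj], and both sides are continuous in L^2. *)
Lemma Fo_adj f g : L2 f -> L2 g -> rip (Fo f) (Mconj g) = rip f (Mconj (Fo g)).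
Proof.
move=> Lf Lg; have [_ Lf' h] := FoP Lf; have [_ Lg' h'] := FoP Lg.
apply: (@eq_of_eps _ _ ((nm g + nm (Fo f) + 1) + (nm (Fo g) + nm f + 1))) => e e0 e1.
have [l [l1 l2]] := h _ e0; have [l' [l1' l2']] := h' _ e0.
have H1 := rip_approx Lf' (L2_ht l) (L2conj Lg) (L2conj (L2_st l')).
have H2 := rip_approx Lf (L2_st l) (L2conj Lg') (L2conj (L2_ht l')).
move: H1 H2; rewrite -!MconjB !nm_conj rip_ht_conj => H1 H2.
have A1 : nm (ht l) <= nm (Fo f) + e.
  by have := nm_sub (L2_ht l) Lf'; rewrite (nmBC (ht l)); lra.
have A2 : nm (st l) <= nm f + e.
  by have := nm_sub (L2_st l) Lf; rewrite (nmBC (st l)); lra.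
set X := rip (st l) _ in H1 H2.
have -> : rip (Fo f) (Mconj g) - rip f (Mconj (Fo g)) = (rip (Fo f) (Mconj g) - X)
   - (rip f (Mconj (Fo g)) - X) by ring.
apply: le_trans (ler_normB _ _) _; rewrite mulrDl.
have nn (x : M) := nm_ge0 x.
apply: lerD.
  apply: le_trans H1 _; have := nn g; have := nn (g - st l'); have := nn (ht l); nra.
apply: le_trans H2 _; have := nn (Fo g); have := nn (Fo g - ht l'); have := nn (st l); nra.
Qed.

(** By [Fo_adj] the adjoint of [Fo] is [Fo] between two conjugations, and by [Fo_rip] the adjoint
    composed with [Fo] is multiplication by [kap]; hence this formula for the inverse. *)
Definition Fi g : M := Mcst (cr kap^-1) * Mconj (Fo (Mconj g)).

Lemma L2Fi g : L2 g -> L2 (Fi g).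
Proof. by move=> Lg; apply: L2Z; apply: L2conj; apply: L2Fo; exact: L2conj. Qed.

Lemma FiK f : L2 f -> Fi (Fo f) = f.
Proof.
move=> Lf; apply: ext_rip => //; first by apply: L2Fi; exact: L2Fo.
move=> c Lc; have LFf := L2Fo Lf; have k0 : kap != 0 by rewrite gt_eqF // kap_gt0.
rewrite /Fi ripZl //; last by apply: L2conj; apply: L2Fo; exact: L2conj.
rewrite ripC -Fo_adj //; last exact: L2conj.
by rewrite MconjK Fo_rip // mulrA mulVf // mul1r ripC.
Qed.

Lemma FoK g : L2 g -> Fo (Fi g) = g.
Proof.
move=> Lg; have Lc := L2conj Lg; have := FiK Lc; rewrite /Fi.
have E : Fo (Mcst (cr kap^-1) * Mconj (Fo (Mconj g))) = Mcst (cr kap^-1) * Fo (Mconj (Fo (Mconj g))).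
  by rewrite FoZ //; apply: L2conj; exact: L2Fo.
by rewrite E => /(congr1 (@Mconj R)); rewrite MconjM cr_conj !MconjK.
Qed.

End Fourier.

(** * The truncated Fourier integral *)

Section Link.
Variable R : realType.
Local Notation mu := (@lebesgue_measure R).
Local Notation C := R[i].
Local Notation Re := (@complex.Re R).
Local Notation Im := (@complex.Im R).
Local Notation M := (Mfun R).
Local Notation ii := (@ii R).
Local Notation kap := (@kap R).

Lemma in_L2P (f : R -> C) : in_L2 f <-> cmeas f /\ L2 (pi f).
Proof.
split=> [[hr hi]|[[mr mi] L]].
  have mf : cmeas f.
    by split; [move: hr|move: hi]; rewrite inE => /andP[/[!inE]].
  split=> //; rewrite /L2 n2_pi //.
  have := integrableD measurableT (Lfun2_integrable_sqr hr) (Lfun2_integrable_sqr hi).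
  move/integrableP => [_]; apply: le_lt_trans; rewrite le_eqVlt; apply/orP; left; apply/eqP.
  by apply: eq_integral => x _ /=; rewrite ger0_norm // addr_ge0 ?sqr_ge0.
have aux (p : C -> R) : measurable_fun setT (p \o f) -> (forall z, p z ^+ 2 <= csq z) ->
    p \o f \in Lfun mu 2%:E.
  move=> mp hp; rewrite inE; apply/andP; split; rewrite inE /=; first exact: mp.
  rewrite /finite_norm unlock /Lnorm poweR_lty //.
  apply: le_lt_trans L; apply: (@le_trans _ _ (\int[mu]_x (p (f x) ^+ 2)%:E)%E).
    rewrite le_eqVlt; apply/orP; left; apply/eqP; apply: eq_integral => x _ /=.
    by rewrite powR_mulrn // real_normK ?num_real.
  rewrite n2_pi //; apply: ge0_le_integral => //.
  - by move=> x _; rewrite lee_fin sqr_ge0.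
  - by apply/measurable_EFinP; exact: measurable_funX.
  - by apply/measurable_EFinP; exact: measurable_csq.
  - by move=> x _; rewrite lee_fin.
split; apply: aux => // z; rewrite /csq ?lerDl ?lerDr sqr_ge0 //.
Qed.

Lemma L2norm2_nm (f : R -> C) (a : M) : L2 a -> cmeas f -> aeeq (rep a) f ->
  L2norm2 f = (nm a ^+ 2)%:E.
Proof.
move=> La mf af; rewrite -n2E // (n2_ae mf af).
by apply: eq_integral => x _; rewrite cmod_sqr.
Qed.

Lemma in_L2_rep (a : M) : L2 a -> in_L2 (rep a).
Proof. by move=> La; apply/in_L2P; split; [exact: rep_meas|rewrite pi_rep]. Qed.

Lemma ebase_int (a : R) (g G : R -> R) : continuous g ->
  (forall x : R, is_derive x 1 G (g x)) ->
  (\int[mu]_x (ebase a x * g x) = G a - G 0)%R.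
Proof.
have main (h H : R -> R) a1 b1 : continuous h -> (forall x : R, is_derive x 1 H (h x)) ->
    a1 < b1 -> (\int[mu]_x (\1_(`]a1, b1]%classic) x * h x) = H b1 - H a1)%R.
  move=> ch dH ab.
  have cH : continuous H.
    by move=> x; apply: differentiable_continuous; apply/derivable1_diffP; case: (dH x).
  under eq_Rintegral do rewrite mulrC.
  rewrite -Rintegral_indic // Rintegral_itv_obnd_cbnd; last first.
    apply: integrableS (continuous_compact_integrable (@segment_compact _ a1 b1) _) => //.
      by apply: subset_itvr; rewrite bnd_simp.
    exact: continuous_subspaceT.
  rewrite /Rintegral (@continuous_FTC2 _ h H) //=.
  - exact: continuous_subspaceT.
  - split; first by move=> x _; case: (dH x).
      by apply: cvg_at_right_filter; exact: cH.
    by apply: cvg_at_left_filter; exact: cH.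
  - by move=> x _; rewrite derive1E; case: (dH x).
move=> cg dG; have [a0|a0|<-] := ltgtP 0 a.
- rewrite -(main g G) //; apply: eq_Rintegral => x _; congr (_ * _); rewrite /ebase.
  by rewrite [X in _ - X]indicE mem_setE /= in_itv /=; case: (ltP a x) => ?; case: (leP x 0) => ? /=; rewrite ?subr0 //; exfalso; lra.
- rewrite (_ : G a - G 0 = (- G 0) - (- G a)); last by ring.
  have cN : continuous (fun x => - g x) by move=> x; apply: cvgN; exact: cg.
  have dN (x : R) : is_derive x 1 (fun x => - G x) (- g x) by exact: (is_deriveN (dG x)).
  rewrite -(main _ _ a 0 cN dN a0).
  apply: eq_Rintegral => x _; rewrite mulrN -mulNr; congr (_ * _); rewrite /ebase.
  rewrite [X in X - _]indicE mem_setE /= in_itv /=.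
  by case: (ltP 0 x) => ?; case: (leP x a) => ? /=; rewrite ?sub0r //; exfalso; lra.
- rewrite subrr (_ : (fun x => _) = cst 0); first by rewrite /Rintegral integral0.
  apply/funext => x; rewrite /ebase subrr mul0r //.
Qed.

Definition indM (A : R) : M := pi (fun x => (\1_(`[- A, A]%classic) x)%:C).
Definition chix (A xi : R) : M := pi (fun x => (\1_(`[- A, A]%classic) x)%:C * cis (x * xi)).
(** The integral of exp(- i x xi) f(x) over [-A, A], written with the real inner product so that
    linearity and Cauchy-Schwarz apply; the second slot is the imaginary part. *)
Definition ftp (A : R) (f : M) (xi : R) : C := rip f (chix A xi) +i* rip f (ii * chix A xi).

Lemma cmeas_ind (A : set R) : measurable A -> cmeas (fun x => (\1_A x)%:C : C).
Proof. by move=> mA; apply: cmeas_real; exact: measurable_indic. Qed.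
Lemma cmeas_cisr (xi : R) : cmeas (fun x => cis (x * xi)).
Proof. by apply: cmeas_cis; apply: measurable_funM. Qed.
Lemma cmeas_chix (A xi : R) : cmeas (fun x => (\1_(`[- A, A]%classic) x)%:C * cis (x * xi)).
Proof. by apply: cmeasM; [exact: cmeas_ind|exact: cmeas_cisr]. Qed.

Lemma bdd_indM A : bdd (indM A) 1.
Proof.
apply: bdd_pi; first exact: cmeas_ind.
by move=> x; rewrite cmod_real indicE; case: (_ \in _); rewrite ?normr1 ?normr0.
Qed.
Lemma L2_indM A f : L2 f -> L2 (indM A * f).
Proof. exact: L2M (bdd_indM A). Qed.
Lemma indM_idem A : indM A * indM A = indM A.
Proof.
rewrite /indM piM; do ?exact: cmeas_ind.
congr pi; apply/funext => x; rewrite -rmorphM /= indicE.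
by case: (_ \in _); rewrite ?mulr1 ?mulr0.
Qed.
Lemma conj_indM A : Mconj (indM A) = indM A.
Proof.
rewrite /indM Mconj_pi; last exact: cmeas_ind.
by congr pi; apply/funext => x; rewrite /= oppr0.
Qed.

Lemma L2_chix A xi : L2 (chix A xi).
Proof.
rewrite /L2 n2_pi; last exact: cmeas_chix.
rewrite (_ : (\int[mu]_x _)%E = (\int[mu]_x (\1_(`[- A, A]%classic) x)%:E)%E); last first.
  apply: eq_integral => x _; rewrite csqM csq_cis mulr1 /csq /= expr0n addr0 indicE.
  by case: (_ \in _); rewrite ?expr1n ?expr0n.
rewrite integral_indic // setIT.
by apply: compact_finite_measure; exact: segment_compact.
Qed.

Lemma ftp_cintegral (A : R) (f : R -> C) (xi : R) : in_L2 f ->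
  cintegral `[- A, A] (fun x => cis (- (x * xi)) * f x) = ftp A (pi f) xi.
Proof.
move=> /in_L2P[mf Lf]; have mc := cmeas_chix A xi.
apply: Ceq; rewrite /cintegral /ftp /=.
  rewrite rip_pi // (Rintegral_indic _ (measurable_itv `[- A, A])); apply: eq_Rintegral => x _ /=.
  by case: (f x) => p q; rewrite /rdot /= cosN sinN; ring.
rewrite /ii Mcst_pi piM //; last exact: cmeas_cst.
rewrite rip_pi //; last by apply: cmeasM => //; exact: cmeas_cst.
rewrite (Rintegral_indic _ (measurable_itv `[- A, A])); apply: eq_Rintegral => x _ /=.
by case: (f x) => p q; rewrite /rdot /= cosN sinN; ring.
Qed.

Lemma ftpD A f g xi : L2 f -> L2 g -> ftp A (f + g) xi = ftp A f xi + ftp A g xi.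
Proof.
move=> Lf Lg; have L1 := L2_chix A xi; have L2c := L2ii L1.
by apply: Ceq; rewrite /ftp /= ripDl.
Qed.
Lemma ftpZ A z f xi : L2 f -> ftp A (Mcst z * f) xi = z * ftp A f xi.
Proof.
move=> Lf; have L1 := L2_chix A xi; have L2c := L2ii L1.
have L3 := L2ii Lf.
have E : Mcst z * f = Mcst (cr (Re z)) * f + Mcst (cr (Im z)) * (ii * f).
  by rewrite [in LHS]Mcst_split mulrDl mulrA.
have E1 : rip (ii * f) (chix A xi) = - rip f (ii * chix A xi).
  by rewrite rip_adj ii_conj mulNr ripNr.
have E2 : rip (ii * f) (ii * chix A xi) = rip f (chix A xi).
  by rewrite rip_adj ii_conj mulrA mulNr ii2 opprK mul1r.
have LA : L2 (Mcst (cr (Re z)) * f) by exact: L2Z.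
have LB : L2 (Mcst (cr (Im z)) * (ii * f)) by exact: L2Z.
apply: Ceq; rewrite /ftp /= E (ripDl LA LB) // (ripZl _ Lf) // (ripZl _ L3) // ?E1 ?E2; case: z {E LA LB} => p q /=; ring.
Qed.
Lemma ftpB A f g xi : L2 f -> L2 g -> ftp A (f - g) xi = ftp A f xi - ftp A g xi.
Proof.
move=> Lf Lg; have LN := L2N Lg; rewrite ftpD // -mulN1r -[1]/(Mcst 1) -McstN ftpZ //.
by rewrite mulN1r.
Qed.
Lemma ftp_le A f xi : L2 f -> cmod (ftp A f xi) <= 2 * nm (chix A xi) * nm f.
Proof.
move=> Lf; have L1 := L2_chix A xi; have L2c := L2ii L1.
apply: le_trans (cmod_le_ReIm _) _; rewrite /ftp /=.
have := CS Lf L1; have := CS Lf L2c; rewrite nm_ii; lra.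
Qed.

Lemma ftp_ebas (A a xi : R) : `|a| <= A -> xi != 0 -> ftp A (ebas a) xi = hatf a xi.
Proof.
move=> aA x0.
have mE : cmeas (fun x => (ebase a x)%:C) by apply: cmeas_real; exact: measurable_ebase.
have mc := cmeas_chix A xi.
have key x : ebase a x * \1_(`[- A, A]%classic) x = ebase a x.
  rewrite /ebase !indicE !mem_setE /= !in_itv /=; move: aA; rewrite ler_norml => /andP[? ?].
  by do ![case: (ltP _ _) => ? | case: (leP _ _) => ?] => /=; rewrite ?mulr1 ?mulr0 ?subrr ?mul0r //; exfalso; lra.
have dl (x : R) : is_derive x 1 (fun y : R => y * xi) xi.
  by apply: is_derive_eq; rewrite scaler0 add0r /GRing.scale /= mulr1.
have dsin (x : R) : is_derive x 1 (fun y : R => sin (y * xi) / xi) (cos (x * xi)).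
  have := is_deriveZ xi^-1 (@is_derive1_comp R (@sin R) (fun y => y * xi) x _ _ (is_derive_sin (x * xi)) (dl x)).
  rewrite (_ : xi^-1 \*: _ = (fun y : R => sin (y * xi) / xi)); last first.
    by apply/funext => y /=; rewrite /GRing.scale /= mulrC.
  by rewrite /GRing.scale /= mulrC mulfK.
have dcos (x : R) : is_derive x 1 (fun y : R => cos (y * xi) / xi) (- sin (x * xi)).
  have := is_deriveZ xi^-1 (@is_derive1_comp R (@cos R) (fun y => y * xi) x _ _ (is_derive_cos (x * xi)) (dl x)).
  rewrite (_ : xi^-1 \*: _ = (fun y : R => cos (y * xi) / xi)); last first.
    by apply/funext => y /=; rewrite /GRing.scale /= mulrC.
  by rewrite /GRing.scale /= mulrC mulfK.
apply: Ceq; rewrite /ftp ebasE /=.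
  rewrite rip_pi // -(subr0 (sin _ / xi)).
  have cc : continuous (fun x : R => cos (x * xi)).
    by move=> x; apply: continuous_comp; [exact: mulrr_continuous|exact: continuous_cos].
  have := ebase_int a cc dsin; rewrite mul0r sin0 mul0r => <-.
  by apply: eq_Rintegral => x _; rewrite /rdot /= -[in RHS](key x); ring.
rewrite /ii Mcst_pi piM //; last exact: cmeas_cst.
rewrite rip_pi //; last by apply: cmeasM => //; exact: cmeas_cst.
have cs : continuous (fun x : R => - sin (x * xi)).
  move=> x; apply: continuousN.
  by apply: continuous_comp; [exact: mulrr_continuous|exact: continuous_sin].
have := ebase_int a cs dcos; rewrite mul0r cos0 mulrBl => <-.
by apply: eq_Rintegral => x _; rewrite /rdot /= -[in RHS](key x); ring.
Qed.

End Link.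

(** * The free flow *)

Section FreeFlow.
Variable R : realType.
Local Notation mu := (@lebesgue_measure R).
Local Notation C := R[i].
Local Notation Re := (@complex.Re R).
Local Notation Im := (@complex.Im R).
Local Notation M := (Mfun R).
Local Notation ii := (@ii R).
Local Notation kap := (@kap R).
Local Notation Fo := (@Fo R).
Implicit Types f g : M.

(** Truncating [ebas a] to [-A, A] gives [ebas] at the clipped endpoint, so cutoffs of step
    functions are again step functions. *)
Definition clip (A a : R) : R := Num.max (- A) (Num.min a A).

Lemma clip_le (A a : R) : 0 <= A -> `|clip A a| <= A.
Proof.
move=> A0; rewrite /clip ler_norml le_max lexx /= ge_max ge_min lexx orbT andbT; lra.
Qed.

Lemma indM_ebas (A a : R) : 0 <= A -> indM A * ebas a = ebas (clip A a).
Proof.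
move=> A0; have mE (c : R) : cmeas (fun x => (ebase c x)%:C).
  by apply: cmeas_real; exact: measurable_ebase.
have mI : cmeas (fun x => (\1_(`[- A, A]%classic) x)%:C : C) by exact: cmeas_ind.
rewrite /indM !ebasE piM //; apply: pi_eq => //; first exact: cmeasM.
have hN (b : R) : {ae mu, forall x, x != b}.
  exists [set b]; split => //; first exact: lebesgue_measure_set1.
  by move=> x /= /negP; rewrite negbK => /eqP.
apply: aeS _ (hN (- A)) => x xA; rewrite -rmorphM /=; congr (_%:C).
rewrite /ebase !indicE !mem_setE /= !in_itv /= /clip le_max le_min gt_max gt_min.
have xA' : (- A <= x) = (- A < x) by rewrite le_eqVlt eq_sym (negbTE xA).
rewrite xA'; do ![case: (ltP _ _) => ? | case: (leP _ _) => ?] => /=; rewrite ?mulr1 ?mul1r ?mulr0 ?mul0r ?subrr ?subr0 ?sub0r //; exfalso; lra.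
Qed.

Definition clipl (A : R) (l : seq (C * R)) := [seq (p.1, clip A p.2) | p <- l].
Definition hatl (l : seq (C * R)) (x : R) : C := \sum_(p <- l) p.1 * hatf p.2 x.

Lemma st_clipl A l : 0 <= A -> st (clipl A l) = indM A * st l.
Proof.
move=> A0; elim: l => [|p l IH]; first by rewrite st_nil mulr0.
by rewrite /= !st_cons IH /= -indM_ebas // mulrDr mulrCA.
Qed.

Lemma cmeas_hatl l : cmeas (hatl l).
Proof.
elim: l => [|p l IH].
  rewrite (_ : hatl _ = fun=> 0); first exact: cmeas_cst.
  by apply/funext => x; rewrite /hatl big_nil.
rewrite (_ : hatl _ = fun x => p.1 * hatf p.2 x + hatl l x).
  by apply: cmeasD => //; apply: cmeasM; [exact: cmeas_cst|exact: cmeas_hatf].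
by apply/funext => x; rewrite /hatl big_cons.
Qed.

Lemma ht_pi l : ht l = pi (hatl l).
Proof.
elim: l => [|p l IH].
  rewrite ht_nil -[LHS]/(Mcst 0) Mcst_pi; congr pi.
  by apply/funext => x; rewrite /hatl big_nil.
rewrite ht_cons IH hatE Mcst_pi piM; [|exact: cmeas_cst|exact: cmeas_hatf].
rewrite piD; [|by apply: cmeasM; [exact: cmeas_cst|exact: cmeas_hatf]|exact: cmeas_hatl].
by congr pi; apply/funext => x; rewrite /hatl big_cons.
Qed.

Lemma ftp_clip A l xi : 0 <= A -> xi != 0 -> ftp A (st (clipl A l)) xi = hatl (clipl A l) xi.
Proof.
move=> A0 x0; elim: l => [|p l IH].
  rewrite /clipl /= st_nil /hatl big_nil; have L1 := L2_chix A xi; have L2c := L2ii L1.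
  by apply: Ceq; rewrite /ftp /= rip0l.
rewrite /= st_cons ftpD; [|by apply: L2Z; exact: L2_ebas|exact: L2_st].
rewrite ftpZ; last exact: L2_ebas.
by rewrite ftp_ebas ?clip_le // IH /hatl big_cons.
Qed.

Lemma ctends_cauchy (u : nat -> C) (l : C) : ctends u l ->
  cvgn (fun n => Re (u n)) /\ cvgn (fun n => Im (u n)).
Proof.
move=> h; split; apply/cvg_ex; [exists (Re l)|exists (Im l)]; apply/cvgrPdist_le => e e0;
  have [N hN] := h _ e0; exists N => // n /= /hN; apply: le_trans; rewrite distrC.
  by apply: le_trans (Re_le_cmod _); case: (u n) (l) => ? ? [].
by apply: le_trans (Im_le_cmod _); case: (u n) (l) => ? ? [].
Qed.

Lemma ctends_uniq (u : nat -> C) (l l' : C) : ctends u l -> ctends u l' -> l = l'.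
Proof.
move=> h h'; apply/eqP; rewrite -subr_eq0; apply/eqP; apply: (@Normc.eq0_normc R).
apply/eqP; rewrite eq_le cmod_ge0 andbT; apply/ler_addgt0Pr => e e0; rewrite add0r.
have e2 : 0 < e / 2 by rewrite divr_gt0.
have [N1 h1] := h _ e2; have [N2 h2] := h' _ e2.
have := h1 _ (leq_maxl N1 N2); have := h2 _ (leq_maxr N1 N2).
set w := u _ => H2 H1; rewrite (_ : l - l' = (w - l') - (w - l)); last by ring.
by apply: le_trans (cmodD _ _) _; rewrite cmodN (splitr e) lerD.
Qed.

Lemma clip_dense (A : R) f : 0 <= A -> L2 f -> indM A * f = f ->
  exists l : nat -> seq (C * R), forall e : R, 0 < e ->
    exists N, forall n, (N <= n)%N -> nm (f - st (clipl A (l n))) <= e.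
Proof.
move=> A0 Lf fA; have en n : 0 < (n.+1%:R : R)^-1 by rewrite invr_gt0.
have [l hl0] := choice (fun n => st_dense Lf (en n)); exists l => e e0.
exists (Num.truncn e^-1) => n Nn; apply: (@le_trans _ _ n.+1%:R^-1).
  rewrite st_clipl // -{1}fA -mulrBr; apply: le_trans (nmM_bdd (bdd_indM A) _) _.
    by apply: L2B => //; exact: L2_st.
  by rewrite mul1r.
rewrite -[leRHS]invrK lef_pV2 ?posrE ?invr_gt0 //; apply: ltW.
by apply: lt_le_trans (truncnS_gt _) _; rewrite ler_nat.
Qed.

Lemma ftp_tends (A : R) f xi (l : nat -> seq (C * R)) : L2 f ->
  (forall e : R, 0 < e -> exists N, forall n, (N <= n)%N -> nm (f - st (l n)) <= e) ->
  ctends (fun n => ftp A (st (l n)) xi) (ftp A f xi).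
Proof.
move=> Lf sm e e0; pose K := 2 * nm (chix A xi) + 1.
have K0 : 0 < K by rewrite ltr_wpDl // mulr_ge0 // nm_ge0.
have [N hN] := sm _ (divr_gt0 e0 K0); exists N => n /hN h.
rewrite -ftpB //; last exact: L2_st.
apply: le_trans (ftp_le A xi (L2B (L2_st _) Lf)) _; rewrite nmBC.
move: h; rewrite ler_pdivlMr // => h.
have := nm_ge0 (f - st (l n)); rewrite /K in h; have := nm_ge0 (chix A xi); nra.
Qed.

Lemma cmeas_lim (h : nat -> R -> C) (g : R -> C) : (forall n, cmeas (h n)) ->
  (forall x, ctends (h ^~ x) (g x)) -> cmeas g.
Proof.
move=> mh hg.
have aux (p : C -> R) : (forall z w, `|p z - p w| <= cmod (z - w)) ->
    (forall n, measurable_fun setT (p \o h n)) -> measurable_fun setT (p \o g).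
  move=> hp mp; apply: (@measurable_fun_cvg _ _ _ _ (fun n => p \o h n)) => // x _.
  apply/cvgrPdist_le => e /(hg x)[N hN]; exists N => // n /= /hN.
  by apply: le_trans; rewrite distrC.
split; apply: aux => [[? ?] [? ?]|n]; try by case: (mh n).
  exact: (Re_le_cmod (_ +i* _)).
exact: (Im_le_cmod (_ +i* _)).
Qed.

Lemma cmeas_ftp (A : R) f : 0 <= A -> L2 f -> indM A * f = f -> cmeas (ftp A f).
Proof.
move=> A0 Lf fA; have [l sm] := clip_dense A0 Lf fA.
apply: (@cmeas_lim (fun n => ftp A (st (clipl A (l n))))) => [n|x]; last exact: ftp_tends.
set F := ftp _ _; set H := hatl (clipl A (l n)).
(* Agreement of the integral with [hatl] is known away from xi = 0 only; a multiple of an indicator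
   corrects the value there. *)
rewrite (_ : F = fun x => H x + (\1_[set (0 : R)] x)%:C * (F 0 - H 0)).
  by apply: cmeasD; [exact: cmeas_hatl|apply: cmeasM; [exact: cmeas_ind|exact: cmeas_cst]].
apply/funext => x; rewrite indicE; case: (eqVneq x 0) => [->|x0].
  by rewrite (_ : (0 \in _) = true) ?mul1r ?subrKC //; apply/mem_set.
rewrite (_ : (x \in _) = false) ?mul0r ?addr0; first by rewrite /F ftp_clip.
by apply/negbTE; rewrite notin_setE /=; exact/eqP.
Qed.

(* For a square-integrable function supported in [-A, A] the transform is the
   classical Fourier integral. *)
Lemma Fo_compact (A : R) f : 0 <= A -> L2 f -> indM A * f = f ->
  {ae mu, forall xi, rep (Fo f) xi = ftp A f xi}.
Proof.
move=> A0 Lf fA; have LF := L2Fo Lf.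
have [l0 sm] := clip_dense A0 Lf fA; pose l n := clipl A (l0 n).
have pw xi : xi != 0 -> ctends (fun n => hatl (l n) xi) (ftp A f xi).
  move=> x0 e /(@ftp_tends A f xi _ Lf sm)[N hN]; exists N => n /hN.
  by rewrite ftp_clip.
have [g mg hg] : exists2 g, cmeas g & {ae mu, forall x, ctends (fun n => hatl (l n) x) (g x)}.
  apply: ae_limit => [n|]; first exact: cmeas_hatl.
  by apply: aeS _ (aeN0 R) => x x0; apply: ctends_cauchy (pw x x0).
suff E : Fo f = pi g.
  apply: aeS3 _ (piE mg) hg (aeN0 R) => x h1 h2 h3; rewrite E h1.
  exact: ctends_uniq h2 (pw x h3).
suff h e : 0 < e -> L2 (Fo f - pi g) /\ nm (Fo f - pi g) <= e.
  apply/eqP; rewrite -subr_eq0; apply/eqP; apply: nm_eq0; first by case: (h 1 ltr01).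
  apply/eqP; rewrite eq_le nm_ge0 andbT; apply/ler_addgt0Pr => e /h[_].
  by rewrite add0r.
move=> e0; have K0 : 0 < Num.sqrt kap by rewrite sqrtr_gt0 kap_gt0.
have [N hN] := sm _ (divr_gt0 e0 K0).
(* The same transforms converge to [g] pointwise and to [Fo f] in norm; Fatou's lemma bounds the
   distance of the two limits by every e. *)
apply: (@fatou_nm R (fun n => Fo f - ht (l (n + N)%N))) => [n|n|].
- by apply: L2B => //; exact: L2_ht.
- rewrite -Fo_st -FoB //; last exact: L2_st.
  rewrite Fo_nm; last by apply: L2B => //; exact: L2_st.
  have := hN (n + N)%N (leq_addl _ _); rewrite ler_pdivlMr // mulrC; exact.
- have hB : {ae mu, forall x n, rep (Fo f - ht (l (n + N)%N)) x = rep (Fo f) x - hatl (l (n + N)%N) x}.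
    apply/ae_foralln => n; rewrite ht_pi.
    by apply: aeS2 _ (repB (Fo f) (pi (hatl (l (n + N)%N)))) (piE (cmeas_hatl (l (n + N)%N))) => x -> ->.
  have hB' : {ae mu, forall x, rep (Fo f - pi g) x = rep (Fo f) x - g x}.
    by apply: aeS2 _ (repB (Fo f) (pi g)) (piE mg) => x -> ->.
  apply: aeS3 _ hB hB' hg => x h1 h2 h3 e1 e10; have [N1 hN1] := h3 e1 e10.
  exists N1 => n Nn; rewrite h1 h2 (_ : _ - _ = - (hatl (l (n + N)%N) x - g x)); last by ring.
  by rewrite cmodN; apply: hN1; exact: leq_trans Nn (leq_addr _ _).
Qed.

Definition cpi : R := (Num.sqrt (2 * (@trigo.pi R)))^-1.

Lemma cpi_neq0 : cpi != 0.
Proof. by rewrite invr_eq0 gt_eqF // sqrtr_gt0 mulr_gt0 // pi_gt0. Qed.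

Lemma indM_tz f : L2 f -> tz (fun n => nm (f - indM n%:R * f)).
Proof.
move=> Lf; have E n : f - indM n%:R * f = (1 - indM n%:R) * f by rewrite mulrBl mul1r.
rewrite (_ : (fun n => _) = (fun n => nm ((1 - indM n%:R) * f))); last by apply/funext => n; rewrite E.
have hB : {ae mu, forall x n, rep (1 - indM n%:R) x = 1 - (\1_(`[- n%:R, n%:R]%classic) x)%:C}.
  apply/ae_foralln => n.
  by apply: aeS3 _ (repB 1 (indM n%:R)) (rep_cst 1) (piE (cmeas_ind (measurable_itv `[- n%:R, n%:R]))) => x -> -> ->.
apply: (@dct_nm R _ _ 2) => // [n|].
  rewrite (_ : 2 = cmod (1 : C) + 1); last by rewrite (_ : (1 : C) = (1 : R)%:C) // cmod_real normr1.
  by apply: bddB (bdd_indM _); exact: bdd_cst.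
apply: aeS _ hB => x h e e0; exists (Num.truncn `|x|).+1 => n Nn.
have xn : `|x| <= n%:R by apply: ltW; apply: lt_le_trans (truncnS_gt _) _; rewrite ler_nat.
rewrite h indicE mem_setE /= in_itv /= -ler_norml xn !subrr /cmod /Normc.normc /= expr0n addr0 sqrtr0; exact: ltW.
Qed.

Lemma indM_mono (A B : R) f : A <= B -> L2 f -> nm (f - indM B * f) <= nm (f - indM A * f).
Proof.
move=> AB Lf; have E : f - indM B * f = (1 - indM B) * (f - indM A * f).
  have EI : indM B * indM A = indM A.
    rewrite /indM piM; do ?exact: cmeas_ind; congr pi; apply/funext => x.
    rewrite -rmorphM /= !indicE !mem_setE /= !in_itv /=; congr (_%:C).
    by do ![case: (leP _ _) => ?] => /=; rewrite ?mulr1 ?mulr0 //; exfalso; lra.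
  rewrite [RHS](_ : _ = f - indM B * f + (indM B * indM A) * f - indM A * f); last by ring.
  by rewrite EI addrK.
have LA : L2 (f - indM A * f) by apply: L2B => //; exact: L2_indM.
rewrite E; apply: le_trans (nmM_bdd (B := 1) _ LA) _; last by rewrite mul1r.
have hB : {ae mu, forall x, rep (1 - indM B) x = 1 - (\1_(`[- B, B]%classic) x)%:C}.
  by apply: aeS3 _ (repB 1 (indM B)) (rep_cst 1) (piE (cmeas_ind (measurable_itv `[- B, B]))) => x -> -> ->.
apply: aeS _ hB => x ->; rewrite indicE; case: (_ \in _); first by rewrite subrr /cmod /Normc.normc /= expr0n addr0 sqrtr0 ler01.
by rewrite subr0 (_ : (1 : C) = (1 : R)%:C) // cmod_real normr1.
Qed.

Lemma L2norm2_ae (f g : R -> C) : cmeas f -> cmeas g -> aeeq f g -> L2norm2 f = L2norm2 g.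
Proof.
have mc (h : R -> C) : cmeas h -> measurable_fun setT (fun x => (cmod (h x) ^+ 2)%:E).
  move=> mh; apply/measurable_EFinP; apply: measurable_funX; exact: measurable_cmod.
move=> mf mg h; apply: ge0_ae_eq_integral => //; do ?exact: mc;
  do ?by move=> x _; rewrite lee_fin sqr_ge0.
by apply: aeS _ h => x -> _.
Qed.

Lemma trunc_transform (f g : R -> C) (A : R) : 0 <= A -> in_L2 f -> in_L2 g ->
  L2norm2 (fun xi : R => g xi - ((Num.sqrt (2 * (@trigo.pi R)))^-1)%:C *
        cintegral `[(- A), A] (fun x => cis (- (x * xi)) * f x)) =
  (nm (pi g - Mcst (cr cpi) * Fo (indM A * pi f)) ^+ 2)%:E.
Proof.
move=> A0 hf hg; have /in_L2P[mf Lf] := hf; have /in_L2P[mg Lg] := hg.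
have LI := L2_indM A Lf; have LF := L2Fo LI.
have Ef := Fo_compact A0 LI; rewrite mulrA indM_idem in Ef; have {}Ef := Ef erefl.
have Eft xi : ftp A (indM A * pi f) xi = ftp A (pi f) xi.
  rewrite /ftp !(rip_adj (indM A)) conj_indM mulrCA.
  suff -> : indM A * chix A xi = chix A xi by [].
  rewrite /indM /chix piM; [|exact: cmeas_ind|exact: cmeas_chix].
  congr pi; apply/funext => x; rewrite mulrA -rmorphM /= indicE.
  by case: (_ \in _); rewrite ?mulr1 ?mulr0.
set F := fun xi : R => _ - _.
have EF : aeeq F (fun xi => g xi - cpi%:C * rep (Fo (indM A * pi f)) xi).
  by apply: aeS _ Ef => xi ->; rewrite /F ftp_cintegral // Eft.
have EG : aeeq (rep (pi g - Mcst (cr cpi) * Fo (indM A * pi f)))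
    (fun xi => g xi - cpi%:C * rep (Fo (indM A * pi f)) xi).
  have h1 : aeeq (rep (Mcst (cr cpi) * Fo (indM A * pi f))) (fun xi => cpi%:C * rep (Fo (indM A * pi f)) xi).
    by apply: aeS2 _ (repM (Mcst (cr cpi)) (Fo (indM A * pi f))) (rep_cst (cr cpi)) => x -> ->.
  by apply: aeS3 _ (repB (pi g) (Mcst (cr cpi) * Fo (indM A * pi f))) h1 (piE mg) => x -> -> ->.
have mG : cmeas (fun xi => g xi - cpi%:C * rep (Fo (indM A * pi f)) xi).
  by apply: cmeasD => //; apply: cmeasN; apply: cmeasM; [exact: cmeas_cst|exact: rep_meas].
rewrite -(L2norm2_nm _ mG EG); last by apply: L2B => //; exact: L2Z.
have mF : cmeas F.
  rewrite (_ : F = fun xi => g xi - cpi%:C * ftp A (indM A * pi f) xi).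
    apply: cmeasD => //; apply: cmeasN; apply: cmeasM; first exact: cmeas_cst.
    by apply: cmeas_ftp => //; rewrite mulrA indM_idem.
  by apply/funext => xi; rewrite /F ftp_cintegral // Eft.
by apply: L2norm2_ae.
Qed.

Lemma ecvg0_lt (T : Type) (F : set_system T) (FF : Filter F) (f : T -> \bar R) :
  f x @[x --> F] --> (0 : \bar R) -> forall e : R, 0 < e -> \forall x \near F, (f x < e%:E)%E.
Proof.
move=> h e e0; have : nbhs (0 : \bar R) [set x | (x < e%:E)%E].
  apply: open_nbhs_nbhs; split; first exact: open_ereal_lt_ereal.
  by rewrite /= lte_fin.
by move/h.
Qed.

Lemma ecvg0_fin (T : Type) (F : set_system T) (FF : Filter F) (f : T -> \bar R) (g : T -> R) :
  (\forall x \near F, f x = (g x)%:E) -> (forall e : R, 0 < e -> \forall x \near F, `|g x| <= e) ->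
  f x @[x --> F] --> (0 : \bar R).
Proof.
move=> fg hg; apply: (@cvg_trans _ ((g x)%:E @[x --> F])).
  by apply: near_eq_cvg; apply: filterS fg => x ->.
apply: cvg_EFin; first by apply: nearW.
apply/cvgrPdist_le => e /hg; apply: filterS => x /=.
by rewrite sub0r normrN.
Qed.

(** The integral over [-A, A] is the transform of the truncation of f to [-A, A], which tends to f
    in L^2; so the limit in [is_Fourier] amounts to this identity. *)
Lemma is_FourierP (f g : R -> C) : is_Fourier f g <->
  [/\ in_L2 f, in_L2 g & pi g = Mcst (cr cpi) * Fo (pi f)].
Proof.
pose K := `|cpi| * Num.sqrt kap.
have K0 : 0 <= K by rewrite mulr_ge0.
have bound A : L2 (pi f) ->
    nm (Mcst (cr cpi) * Fo (pi f) - Mcst (cr cpi) * Fo (indM A * pi f)) = K * nm (pi f - indM A * pi f).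
  move=> Lf; have LI := L2_indM A Lf.
  have LB := L2B Lf LI; rewrite -mulrBr -FoB // nmZ ?Fo_nm //; last exact: L2Fo.
  by rewrite /K mulrA.
have small e : L2 (pi f) -> 0 < e -> exists N, forall A : R, N%:R <= A -> K * nm (pi f - indM A * pi f) <= e.
  move=> Lf e0; have K1 : 0 < K + 1 by rewrite ltr_wpDl.
  have [N hN] := indM_tz Lf (divr_gt0 e0 K1); exists N => A NA.
  have := hN _ (leqnn N); have := indM_mono NA Lf; rewrite ler_pdivlMr // => h1 h2.
  have := nm_ge0 (pi f - indM A * pi f); nra.
split=> [[hf hg h]|[hf hg h]]; have /in_L2P[mf Lf] := hf; have /in_L2P[mg Lg] := hg; split=> //.
  have LT A : L2 (Mcst (cr cpi) * Fo (indM A * pi f)) by apply: L2Z; apply: L2Fo; exact: L2_indM.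
  have L1 : L2 (Mcst (cr cpi) * Fo (pi f)) by apply: L2Z; exact: L2Fo.
  apply/eqP; rewrite -subr_eq0; apply/eqP; apply: nm_eq0; first exact: L2B.
  apply/eqP; rewrite eq_le nm_ge0 andbT; apply/ler_addgt0Pr => e e0; rewrite add0r.
  have e2 : 0 < e / 2 by rewrite divr_gt0.
  have [N hN] := small _ Lf e2.
  have := ecvg0_lt _ h (exprn_gt0 2 e2) => -[B [_ hB]].
  pose A := Num.max (`|B| + 1) N%:R.
  have BA : B < A by rewrite /A lt_max (le_lt_trans (ler_norm _)) // ltrDl.
  have NA : N%:R <= A by rewrite /A le_max lexx orbT.
  have A0 : 0 <= A by apply: le_trans NA; rewrite ler0n.
  have := hB _ BA; rewrite trunc_transform // lte_fin ltr_pXn2r ?nnegrE ?nm_ge0 ?(ltW e2) // => H1.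
  have := hN _ NA; rewrite -bound // => H2.
  have := nm_tri Lg L1 (LT A); rewrite [nm (Mcst _ * _ - _)]nmBC; lra.
apply: (@ecvg0_fin _ _ _ _ (fun A => nm (pi g - Mcst (cr cpi) * Fo (indM A * pi f)) ^+ 2)).
  by exists 0; split=> // A /ltW A0; exact: trunc_transform.
move=> e e0; have se : 0 < Num.sqrt e by rewrite sqrtr_gt0.
have [N hN] := small _ Lf se; exists N%:R; split=> // A /ltW /hN.
rewrite -bound // -h => H; rewrite ger0_norm ?sqr_ge0 // -[leRHS](sqr_sqrtr (ltW e0)).
by rewrite lerXn2r ?nnegrE ?nm_ge0 ?sqrtr_ge0.
Qed.

Lemma Mcst_lreg (c : R) : c != 0 -> injective (fun a : M => Mcst (cr c) * a).
Proof.
move=> c0 a b /(congr1 (fun w => Mcst (cr c^-1) * w)) /=.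
by rewrite !mulrA -crM mulVf // cr1 !mul1r.
Qed.

(** Both transforms carry the same nonzero factor [cpi], which cancels, and the normalisation of
    [Fo] no longer matters. *)
Lemma is_free_flowP (t : R) (f g : R -> C) : is_free_flow t f g <->
  [/\ in_L2 f, in_L2 g & Fo (pi g) = expi (fun xi : R => - (t * xi ^+ 2)) * Fo (pi f)].
Proof.
have mp : measurable_fun setT (fun xi : R => - (t * xi ^+ 2)).
  by apply: measurableT_comp => //; apply: measurable_funM => //; exact: measurable_funX.
have mc : cmeas (fun xi : R => cis (- (t * xi ^+ 2))) by exact: cmeas_cis.
split=> [[fh [gh [/is_FourierP[hf hfh E1] /is_FourierP[hg hgh E2] h]]]|[hf hg h]].
  split=> //; apply: (Mcst_lreg cpi_neq0); rewrite /=.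
  rewrite -E2 mulrCA -E1 expiE piM //; last by case/in_L2P: hfh.
  apply: pi_eq => //; first by case/in_L2P: hgh.
  by apply: cmeasM => //; case/in_L2P: hfh.
have LF (w : R -> C) : in_L2 w -> L2 (Mcst (cr cpi) * Fo (pi w)).
  by move=> /in_L2P[_ Lw]; apply: L2Z; exact: L2Fo.
exists (rep (Mcst (cr cpi) * Fo (pi f))), (rep (Mcst (cr cpi) * Fo (pi g))); split.
- by apply/is_FourierP; split=> //; [exact: in_L2_rep (LF _ hf)|rewrite pi_rep].
- by apply/is_FourierP; split=> //; [exact: in_L2_rep (LF _ hg)|rewrite pi_rep].
rewrite h mulrCA expiE; set w := Mcst _ * _.
by apply: aeS2 _ (repM (pi (fun xi : R => cis (- (t * xi ^+ 2)))) w) (piE mc) => x -> ->.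
Qed.

Lemma free_flowP (t : R) (f : R -> C) : in_L2 f ->
  in_L2 (free_flow t f) /\ Fo (pi (free_flow t f)) = expi (fun xi : R => - (t * xi ^+ 2)) * Fo (pi f).
Proof.
move=> hf; have /in_L2P[mf Lf] := hf.
have mp : measurable_fun setT (fun xi : R => - (t * xi ^+ 2)).
  by apply: measurableT_comp => //; apply: measurable_funM => //; exact: measurable_funX.
have LE : L2 (expi (fun xi : R => - (t * xi ^+ 2)) * Fo (pi f)) by apply: (L2_expi mp); exact: L2Fo.
have ex : is_free_flow t f (rep (Fi (expi (fun xi : R => - (t * xi ^+ 2)) * Fo (pi f)))).
  by apply/is_free_flowP; split => //; [apply: in_L2_rep; exact: L2Fi|rewrite pi_rep FoK].
have : is_free_flow t f (free_flow t f) by apply: xgetPex; exists (rep (Fi (expi (fun xi : R => - (t * xi ^+ 2)) * Fo (pi f)))).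
by move=> /is_free_flowP[].
Qed.

End FreeFlow.

(** * L^2 derivatives and sup bounds *)

Section Derivative.
Variable R : realType.
Local Notation mu := (@lebesgue_measure R).
Local Notation C := R[i].
Local Notation Re := (@complex.Re R).
Local Notation Im := (@complex.Im R).
Local Notation M := (Mfun R).
Local Notation ii := (@ii R).
Local Notation kap := (@kap R).
Local Notation Fo := (@Fo R).
Implicit Types f g : M.

(** Multiplication by i xi, the symbol of d/dx under [Fo]. *)
Definition XM : M := locked (pi (fun x : R => 0 +i* x)).
Lemma cmeas_ix : cmeas (fun x : R => 0 +i* x).
Proof. by split; [exact: (measurable_cst (0 : R))|exact: measurable_id]. Qed.
Lemma XME : XM = pi (fun x : R => 0 +i* x).
Proof. by rewrite /XM -lock. Qed.
Lemma conj_XM : Mconj XM = - XM.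
Proof.
rewrite XME Mconj_pi ?piN; do ?exact: cmeas_ix.
by congr pi; apply/funext => x; apply: Ceq => /=; rewrite ?oppr0.
Qed.

Lemma Fo_inj f g : L2 f -> L2 g -> Fo f = Fo g -> f = g.
Proof. by move=> Lf Lg h; rewrite -(FiK Lf) h FiK. Qed.

Definition dF f g : Prop := [/\ L2 f, L2 g & Fo g = XM * Fo f].

Lemma dFD f f' g g' : dF f f' -> dF g g' -> dF (f + g) (f' + g').
Proof.
move=> [Lf Lf' hf] [Lg Lg' hg]; split; do ?exact: L2D.
by rewrite !FoD // hf hg mulrDr.
Qed.
Lemma dFZ z f f' : dF f f' -> dF (Mcst z * f) (Mcst z * f').
Proof.
move=> [Lf Lf' hf]; split; do ?exact: L2Z.
by rewrite !FoZ // hf mulrCA.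
Qed.
Lemma dFN f f' : dF f f' -> dF (- f) (- f').
Proof.
move=> [Lf Lf' hf]; split; do ?exact: L2N.
by rewrite !FoN // hf mulrN.
Qed.
Lemma dFB f f' g g' : dF f f' -> dF g g' -> dF (f - g) (f' - g').
Proof. by move=> hf hg; apply: dFD => //; exact: dFN. Qed.
Lemma dF_Tr h f f' : dF f f' -> dF (Tr h f) (Tr h f').
Proof.
move=> [Lf Lf' hf]; split; do ?exact: L2_Tr.
by rewrite !Fo_Tr // hf mulrCA.
Qed.

Lemma dF_adj f f' g g' : dF f f' -> dF g g' -> rip f' g = - rip f g'.
Proof.
move=> [Lf Lf' hf] [Lg Lg' hg]; have k0 : kap != 0 by rewrite gt_eqF // kap_gt0.
apply: (mulfI k0); rewrite mulrN -!Fo_rip // hf rip_adj conj_XM mulNr -hg ripNr //; exact: L2Fo.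
Qed.

Definition dq (h : R) f : M := Mcst (cr h^-1) * (Tr h f - f).
(** Almost everywhere this is (exp(i h x) - 1) / (i h x), the quotient of the symbols of the
    difference quotient and of d/dx. Its modulus is at most 1 and it tends to 1 with h. *)
Definition mh (h : R) : M := Mcst (cr h^-1) * Mconj (hat h).

Lemma L2_dq h f : L2 f -> L2 (dq h f).
Proof. by move=> Lf; apply: L2Z; apply: L2B => //; exact: L2_Tr. Qed.
Lemma dqD h f g : dq h (f + g) = dq h f + dq h g.
Proof. by rewrite /dq TrD; ring. Qed.
Lemma dq_conj h f : dq h (Mconj f) = Mconj (dq h f).
Proof. by rewrite /dq Tr_conj MconjM MconjB cr_conj. Qed.
Lemma dqM h f g : dq h (f * g) = Tr h f * dq h g + dq h f * g.
Proof. by rewrite /dq TrM; ring. Qed.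

Lemma mh_pi h : mh h = pi (fun x => h^-1%:C * (hatf h x)^*).
Proof.
have mH := cmeas_hatf h; have mC := cmeas_conj mH.
rewrite /mh hatE Mconj_pi // Mcst_pi piM //; exact: cmeas_cst.
Qed.
Lemma cmeas_mh (h : R) : cmeas (fun x => h^-1%:C * (hatf h x)^*).
Proof. by apply: cmeasM; [exact: cmeas_cst|apply: cmeas_conj; exact: cmeas_hatf]. Qed.

Lemma mh_XM h : h != 0 -> mh h * XM = Mcst (cr h^-1) * (modu h - 1).
Proof.
move=> h0; rewrite mh_pi XME piM; [|exact: cmeas_mh|exact: cmeas_ix].
have mm : cmeas (fun x => cis (h * x)) by apply: cmeas_cis; exact: measurable_lin.
rewrite /modu expiE -[1]/(Mcst 1) !Mcst_pi piN ?piD ?piM //; do ?[exact: cmeas_cst|by apply: cmeasD => //; apply: cmeasN; exact: cmeas_cst|apply: cmeasN; exact: cmeas_cst].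
apply: pi_eq.
- by apply: cmeasM; [exact: cmeas_mh|exact: cmeas_ix].
- by apply: cmeasM; [exact: cmeas_cst|apply: cmeasD => //; apply: cmeasN; exact: cmeas_cst].
apply: aeS _ (@aeN0 R) => x x0; apply: Ceq => /=; field; by rewrite ?x0 ?h0.
Qed.

Lemma bdd_mh h : h != 0 -> bdd (mh h) 1.
Proof.
move=> h0; rewrite mh_pi; apply: bdd_pi; first exact: cmeas_mh.
move=> x; rewrite cmodM cmod_conj cmod_real cmod_csq csq_hatf.
have h1 : 0 < `|h| by rewrite normr_gt0.
rewrite normfV mulrC ler_pdivrMr // mul1r -sqrtr_sqr ler_sqrt ?sqr_ge0 //.
have [->|x0] := eqVneq x 0; first by rewrite expr0n invr0 !mulr0 sqr_ge0.
have x2 : 0 < x ^+ 2 by rewrite exprn_even_gt0.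
rewrite mulrA ler_pdivrMr //; have := one_sub_cos_le (h * x); rewrite exprMn; lra.
Qed.

Lemma sin_sub_le (t : R) : `|sin t - t| <= t ^+ 2.
Proof.
have d (x : R) : is_derive x 1 (fun y : R => sin y - y) (cos x - 1) by apply: is_derive_eq.
have [c [hc E]] := mvt_ex d 0 t; move: E; rewrite sin0 !subr0 => ->.
have dc (x : R) : is_derive x 1 (@cos R) (- sin x) by exact: is_derive_cos.
have := lip_of_deriv dc (B := 1) (fun x => _) 0 c; rewrite cos0 subr0 mul1r => hl.
have {}hl : `|cos c - 1| <= `|c| by apply: hl => x; rewrite normrN sin_max.
have ct : `|c| <= `|t|.
  move: hc; case: (leP 0 t) => t0 /andP[c1 c2]; rewrite ler_norml.
    by rewrite (ger0_norm t0); apply/andP; split => //; lra.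
  by rewrite (ltr0_norm t0); apply/andP; split => //; lra.
by rewrite normrM -(real_normK (num_real t)) expr2 ler_wpM2r // (le_trans hl).
Qed.

Lemma mh_near1 (h x : R) : h != 0 -> x != 0 -> cmod (h^-1%:C * (hatf h x)^* - 1) <= 2 * `|h * x|.
Proof.
move=> h0 x0; apply: le_trans (cmod_le_ReIm _) _.
have hx : h * x != 0 by rewrite mulf_neq0.
rewrite /hatf /= (_ : _ - 1 = (sin (h * x) - h * x) / (h * x)); last by field; rewrite h0 x0.
rewrite (_ : _ + - 0 = (1 - cos (h * x)) / (h * x)); last by field; rewrite h0 x0.
move: hx; set y := h * x => y0; have p : 0 < `|y| by rewrite normr_gt0.
rewrite !normrM !normfV -mulrDl -ler_pdivlMr ?invr_gt0 // invrK.
have := sin_sub_le y; have := one_sub_cos_le y; rewrite -(real_normK (num_real y)).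
have c1 : 0 <= 1 - cos y by rewrite subr_ge0; exact: cos_le1.
rewrite (ger0_norm c1) -normrM -/y; nra.
Qed.

Definition tends0 (h : nat -> R) : Prop := forall n, h n != 0 /\ `|h n| <= n.+1%:R^-1.
Definition h0 (n : nat) : R := n.+1%:R^-1.
Lemma h0_tends : tends0 h0.
Proof. by move=> n; rewrite /h0 invr_eq0 pnatr_eq0 ger0_norm. Qed.

Lemma ctends_small (h : nat -> R) (K : R) (u : nat -> C) (l : C) : tends0 h ->
  (forall n, cmod (u n - l) <= K * `|h n|) -> ctends u l.
Proof.
move=> ht hu e e0; exists (Num.truncn (`|K| / e)) => n Nn; apply: le_trans (hu n) _.
have [_ hn] := ht n; have nn : 0 < n.+1%:R :> R by [].
apply: (@le_trans _ _ (`|K| * n.+1%:R^-1)).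
  by rewrite (le_trans (ler_wpM2r _ (ler_norm K))) // ler_wpM2l.
rewrite ler_pdivrMr // mulrC -ler_pdivrMr //; apply: ltW.
by apply: lt_le_trans (truncnS_gt _) _; rewrite ler_nat.
Qed.

Lemma mh_tends h : tends0 h -> {ae mu, forall x, ctends (fun n => rep (mh (h n)) x) 1}.
Proof.
move=> ht; have E : {ae mu, forall x n, rep (mh (h n)) x = (h n)^-1%:C * (hatf (h n) x)^*}.
  apply/ae_foralln => n; rewrite mh_pi; apply: piE; exact: cmeas_mh.
apply: aeS2 _ E (@aeN0 R) => x h1 x0.
apply: (ctends_small (K := 2 * `|x|) ht) => n; rewrite h1.
by have := mh_near1 (ht n).1 x0; rewrite normrM mulrA mulrAC.
Qed.

Lemma Fo_dq0 h f : L2 f -> Fo (dq h f) = Mcst (cr h^-1) * (modu h - 1) * Fo f.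
Proof.
move=> Lf; have LT := L2_Tr h Lf; rewrite /dq FoZ ?FoB ?Fo_Tr //; last exact: L2B.
by ring.
Qed.

Lemma Fo_dq h f f' : h != 0 -> dF f f' -> Fo (dq h f) = mh h * Fo f'.
Proof. by move=> h1 [Lf Lf' hf]; rewrite Fo_dq0 // -mh_XM // -mulrA -hf. Qed.

Lemma nm_Fo_le f g : L2 f -> L2 g -> nm (Fo f) <= nm (Fo g) -> nm f <= nm g.
Proof. by move=> Lf Lg; rewrite !Fo_nm // ler_pM2l // sqrtr_gt0 kap_gt0. Qed.

Lemma nm_dq_le h f f' : h != 0 -> dF f f' -> nm (dq h f) <= nm f'.
Proof.
move=> h1 df; have [Lf Lf' _] := df; apply: nm_Fo_le => //; first exact: L2_dq.
rewrite (Fo_dq h1 df) -[leRHS]mul1r; apply: nmM_bdd; [exact: bdd_mh|exact: L2Fo].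
Qed.

Lemma Fo_tz (u : nat -> M) : (forall n, L2 (u n)) -> tz (fun n => nm (Fo (u n))) -> tz (fun n => nm (u n)).
Proof.
move=> Lu hu; have k0 : 0 < Num.sqrt kap by rewrite sqrtr_gt0 kap_gt0.
apply: (@tz_squeeze _ _ (fun n => (Num.sqrt kap)^-1 * nm (Fo (u n)))).
  by move=> n; rewrite Fo_nm // mulKf // gt_eqF.
by apply: tz_mul => //; rewrite invr_ge0 ltW.
Qed.

Lemma dq_tz h f f' : tends0 h -> dF f f' -> tz (fun n => nm (dq (h n) f - f')).
Proof.
move=> ht df; have [Lf Lf' _] := df; apply: Fo_tz => [n|]; first by apply: L2B => //; exact: L2_dq.
have L := L2Fo Lf'.
rewrite (_ : (fun n => _) = (fun n => nm ((mh (h n) - 1) * Fo f'))); last first.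
  by apply/funext => n; rewrite FoB ?(Fo_dq (ht n).1 df) //; [rewrite mulrBl mul1r|exact: L2_dq].
apply: (@dct_nm _ _ _ (1 + cmod (1 : C))) => // [n|].
  by apply: bddB; [exact: bdd_mh (ht n).1|exact: bdd_cst].
have E : {ae mu, forall x n, rep (mh (h n) - 1) x = rep (mh (h n)) x - 1}.
  apply/ae_foralln => n; apply: aeS2 _ (repB (mh (h n)) 1) (rep_cst 1) => x -> ->; exact: erefl.
by apply: aeS2 _ E (mh_tends ht) => x h1 h2 e e0; have [N hN] := h2 e e0; exists N => n /hN; rewrite h1 subr0.
Qed.

Lemma ctendsM (z : C) (u : nat -> C) l : ctends u l -> ctends (fun n => u n * z) (l * z).
Proof.
move=> h e e0; have k0 : 0 < cmod z + 1 by rewrite ltr_wpDl // cmod_ge0.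
have [N hN] := h _ (divr_gt0 e0 k0); exists N => n /hN; rewrite -mulrBl cmodM ler_pdivlMr //.
have := cmod_ge0 (u n - l); nra.
Qed.

(** Bounded difference quotients produce a derivative: on the Fourier side they converge pointwise
    to i xi times the transform, and Fatou's lemma puts this limit in L^2. *)
Lemma dF_of_dq h f B : L2 f -> tends0 h -> (forall n, nm (dq (h n) f) <= B) ->
  exists2 g, dF f g & nm g <= B.
Proof.
move=> Lf ht hB; have LD n := L2_dq (h n) Lf.
have k0 : 0 < Num.sqrt kap by rewrite sqrtr_gt0 kap_gt0.
have E n : Fo (dq (h n) f) = mh (h n) * (XM * Fo f) by rewrite Fo_dq0 // -mh_XM ?(ht n).1 // mulrA.
have [n|n||LX nX] := @fatou_nm _ (fun n => Fo (dq (h n) f)) (XM * Fo f) (Num.sqrt kap * B).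
- exact: L2Fo.
- by rewrite Fo_nm // ler_pM2l.
- have EE : {ae mu, forall x n, rep (Fo (dq (h n) f)) x = rep (mh (h n)) x * rep (XM * Fo f) x}.
    by apply/ae_foralln => n; rewrite E; exact: repM.
  apply: aeS2 _ EE (mh_tends ht) => x h1 h2.
  rewrite (_ : (fun n => _) = (fun n => rep (mh (h n)) x * rep (XM * Fo f) x)); last by apply/funext => n; rewrite h1.
  by rewrite -[X in ctends _ X]mul1r; exact: ctendsM.
exists (Fi (XM * Fo f)); first by split => //; [exact: L2Fi|rewrite FoK].
by rewrite -(ler_pM2l k0) -Fo_nm ?FoK //; exact: L2Fi.
Qed.

(** Convergent quotients are bounded from some rank on, so a derivative exists by [dF_of_dq], and
    uniqueness of limits identifies it with g. *)
Lemma dF_of_lim h f g : L2 f -> L2 g -> tends0 h -> tz (fun n => nm (dq (h n) f - g)) -> dF f g.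
Proof.
move=> Lf Lg ht hl; have LD n := L2_dq (h n) Lf.
have [N hN] := hl 1 ltr01.
have ht' : tends0 (fun n => h (n + N)%N).
  move=> n; have [a b] := ht (n + N)%N; split => //; apply: le_trans b _.
  by rewrite lef_pV2 ?posrE // ler_nat ltnS leq_addr.
have [g' dg _] : exists2 g', dF f g' & nm g' <= nm g + 1.
  apply: dF_of_dq ht' _ => // n; apply: le_trans (nm_sub (LD _) Lg) _; rewrite lerD2l.
  exact: hN (leq_addl _ _).
suff <- : g' = g by []; have [_ Lg' _] := dg.
apply/eqP; rewrite -subr_eq0; apply/eqP; apply: nm_eq0; first exact: L2B.
apply/eqP; rewrite eq_le nm_ge0 andbT; apply: (@tz_bound _ _ _ _ (tz_add (dq_tz ht dg) hl)) => n.
by rewrite add0r (nmBC _ g'); exact: nm_tri.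
Qed.

Lemma dF_conj f f' : dF f f' -> dF (Mconj f) (Mconj f').
Proof.
move=> df; have [Lf Lf' _] := df; apply: (@dF_of_lim h0); do ?exact: L2conj; first exact: h0_tends.
rewrite (_ : (fun n => _) = (fun n => nm (dq (h0 n) f - f'))); first exact: dq_tz h0_tends df.
by apply/funext => n; rewrite dq_conj -MconjB nm_conj.
Qed.

(** The discrete Leibniz rule [dqM] passed to the limit. The two limits concerning a are hypotheses
    because they hold for different reasons when a is in H^1 and when a is a bounded function with
    bounded derivative. *)
Lemma dF_Mr h a a' b b' B : tends0 h -> dF b b' -> bdd a B -> L2 (a' * b) ->
  tz (fun n => nm ((Tr (h n) a - a) * b')) -> tz (fun n => nm ((dq (h n) a - a') * b)) ->
  (forall n, L2 ((dq (h n) a) * b)) ->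
  dF (a * b) (a * b' + a' * b).
Proof.
move=> ht db ba La'b t1 t2 Ld; have [Lb Lb' _] := db.
have Lab' := L2M ba Lb'; have bT n := bdd_Tr (h n) ba.
apply: (@dF_of_lim h) => //; [exact: L2M ba Lb|exact: L2D|].
have t3 : tz (fun n => B * nm (dq (h n) b - b')) by apply: tz_mul (bdd_ge0 ba) (dq_tz ht db).
apply: tz_squeeze (tz_add t3 (tz_add t1 t2)) => n.
rewrite dqM (_ : _ - _ = Tr (h n) a * (dq (h n) b - b') + ((Tr (h n) a - a) * b' + (dq (h n) a - a') * b)); last by ring.
have L1 : L2 (dq (h n) b - b') by apply: L2B => //; exact: L2_dq.
have L2' : L2 (Tr (h n) a * (dq (h n) b - b')) by exact: L2M (bT n) L1.
have L3 : L2 ((Tr (h n) a - a) * b') by rewrite mulrBl; apply: L2B => //; exact: L2M (bT n) Lb'.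
have L4 : L2 ((dq (h n) a - a') * b) by rewrite mulrBl; exact: L2B.
apply: le_trans (nmD L2' (L2D L3 L4)) _; apply: lerD; first exact: nmM_bdd.
exact: nmD.
Qed.

End Derivative.

(** * Sobolev embedding by duality *)

Section SupBounds.
Variable R : realType.
Local Notation mu := (@lebesgue_measure R).
Local Notation C := R[i].
Local Notation Re := (@complex.Re R).
Local Notation Im := (@complex.Im R).
Local Notation M := (Mfun R).
Local Notation ii := (@ii R).
Local Notation kap := (@kap R).
Local Notation Fo := (@Fo R).
Local Notation h0 := (@h0 R).
Local Notation XM := (@XM R).
Implicit Types f g a b : M.

Definition oneA (A : set R) : M := pi (fun x => (\1_A x)%:C).

Lemma L2_oneA A : measurable A -> (mu A < +oo)%E -> L2 (oneA A).
Proof.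
move=> mA fA; rewrite /L2 n2_pi; last exact: cmeas_ind.
rewrite (_ : (\int[mu]_x _)%E = (\int[mu]_x (\1_A x)%:E)%E).
  by rewrite integral_indic // setIT.
apply: eq_integral => x _; rewrite /csq /= expr0n addr0 indicE.
by case: (_ \in _); rewrite ?expr1n ?expr0n.
Qed.

Lemma integrable_cstA (A : set R) (B : R) : measurable A -> (mu A < +oo)%E ->
  mu.-integrable A (EFin \o (fun=> B)).
Proof.
move=> mA fA; apply/integrableP; split; first by apply/measurable_EFinP; exact: measurable_cst.
rewrite (_ : (fun x => _) = cst (`|B|%:E)) // integral_cst //.
by apply: lte_mul_pinfty.
Qed.

Lemma rip_oneA f A : measurable A -> rip f (oneA A) = (\int[mu]_(x in A) Re (rep f x))%R.
Proof.
move=> mA; rewrite /oneA (rip_ae (f := rep f) (rep_meas _) (cmeas_ind mA)); last 2 first.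
- exact: aeeq_refl.
- by apply: piE; exact: cmeas_ind.
rewrite [RHS]Rintegral_indic //; apply: eq_Rintegral => x _; rewrite /rdot /=; ring.
Qed.

Lemma rip_oneA_le f B A : bdd f B -> measurable A -> (mu A < +oo)%E ->
  `|rip f (oneA A)| <= B * fine (mu A).
Proof.
move=> bf mA fA; rewrite rip_oneA //.
have mRe : measurable_fun A (Re \o rep f).
  by apply: measurable_funTS; case: (rep_meas f).
have iB : mu.-integrable A (EFin \o cst B).
  exact: integrable_cstA.
have aeB : ae_eq mu A (EFin \o (fun x => Num.max (- B) (Num.min B (Re (rep f x))))) (EFin \o (Re \o rep f)).
  apply: aeS _ bf => x hx _ /=; congr (_%:E).
  have := le_trans (Re_le_cmod _) hx; rewrite ler_norml => /andP[h1 h2].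
  by rewrite (min_idPr h2) (max_idPr h1).
have mF : measurable_fun A (fun x => Num.max (- B) (Num.min B (Re (rep f x)))).
  by apply: measurable_maxr => //; apply: measurable_minr.
have B0 := bdd_ge0 bf.
have Fle x : `|Num.max (- B) (Num.min B (Re (rep f x)))| <= B.
  by rewrite ler_norml le_max lexx /= ge_max ge_min lexx andbT ge0_cp.
have iF : mu.-integrable A (EFin \o (fun x => Num.max (- B) (Num.min B (Re (rep f x))))).
  apply: le_integrable iB => //; first exact/measurable_EFinP.
  by move=> x _ /=; rewrite lee_fin (ger0_norm B0).
have -> : (\int[mu]_(x in A) Re (rep f x))%R = (\int[mu]_(x in A) (Num.max (- B) (Num.min B (Re (rep f x)))))%R.
  rewrite /Rintegral; congr fine; apply: ae_eq_integral => //; do ?exact/measurable_EFinP.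
  exact: ae_eq_sym.
apply: le_trans (le_normr_Rintegral _ iF) _ => //.
have := le_Rintegral mA (integrable_norm iF) iB; rewrite Rintegral_cst // -/(Rintegral _ _ _); apply=> x _; exact: Fle.
Qed.

(** Testing on the part of [-n, n] where Re f is at least B + 1 / (n + 1) forces that part to be
    null, and these parts cover the exceptional set. *)
Lemma ae_le_dual f (B : R) : L2 f ->
  (forall (A : set R) n, measurable A -> A `<=` `[- n%:R, n%:R]%classic -> rip f (oneA A) <= B * fine (mu A)) ->
  {ae mu, forall x, Re (rep f x) <= B}.
Proof.
move=> Lf h.
have mRe : measurable_fun setT (Re \o rep f) by case: (rep_meas f).
pose A n := `[- n%:R, n%:R]%classic `&` [set x | B + n.+1%:R^-1 <= Re (rep f x)].
have mA n : measurable (A n).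
  apply: measurableI => //; rewrite -[X in measurable X]setTI.
  rewrite (_ : [set x | _] = (Re \o rep f) @^-1` `[B + n.+1%:R^-1, +oo[%classic).
    exact: mRe.
  by apply/seteqP; split=> x /=; rewrite in_itv /= andbT.
have fA n : (mu (A n) < +oo)%E.
  apply: (@le_lt_trans _ _ (mu `[- n%:R, n%:R]%classic)).
    apply: le_measure; [apply/mem_set; exact: mA|apply/mem_set; exact: measurable_itv|exact: subIsetl].
  by apply: compact_finite_measure; exact: segment_compact.
have zA n : mu (A n) = 0%E.
  have A1 := h (A n) n (mA n) (@subIsetl _ _ _).
  have iRe : mu.-integrable (A n) (EFin \o (Re \o rep f)).
    have [_ _ hK] := L2_locint Lf (@Re_le_cmod R) mRe.
    have i1 : mu.-integrable `[- n%:R, n%:R]%classic (EFin \o (Re \o rep f)).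
      apply/integrableP; split; first by apply/measurable_EFinP; apply: measurable_funTS.
      by apply: hK => //; exact: segment_compact.
    apply: integrableS i1; [exact: measurable_itv|exact: mA|exact: subIsetl].
  have : (B + n.+1%:R^-1) * fine (mu (A n)) <= rip f (oneA (A n)).
    have i0 := integrable_cstA (B + n.+1%:R^-1) (mA n) (fA n).
    have := @le_Rintegral _ _ _ mu (A n) _ _ (mA n) i0 iRe.
    by rewrite Rintegral_cst ?rip_oneA //; [apply=> x []|exact: mA].
  move=> H; have := le_trans H A1; rewrite mulrDl gerDl.
  rewrite pmulr_rle0 ?invr_gt0 // => H2; have H3 : fine (mu (A n)) = 0.
    by apply/eqP; rewrite eq_le H2 fine_ge0.
  by rewrite -[LHS]fineK ?H3 // ge0_fin_numE.
have : mu.-negligible (\bigcup_n A n).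
  by apply: negligible_bigcup => n; exists (A n); split; [exact: mA|exact: zA|].
apply: negligibleS => x /= /negP; rewrite -ltNge => hx.
have d0 : 0 < Re (rep f x) - B by lra.
exists (maxn (Num.truncn (Re (rep f x) - B)^-1) (Num.truncn `|x|).+1) => //; set n := maxn _ _; split => /=.
  rewrite in_itv /= -ler_norml; apply: ltW; apply: lt_le_trans (truncnS_gt _) _.
  by rewrite ler_nat leq_maxr.
rewrite -lerBrDl -[leRHS]invrK lef_pV2 ?posrE ?invr_gt0 //; apply: ltW.
by apply: lt_le_trans (truncnS_gt _) _; rewrite ler_nat ltnS leq_maxl.
Qed.

(** The values 1, -1, i, -i of z bound the real and imaginary parts by B, whence the factor 2. In
    this dual form a sup bound can be read off from the Fourier isometry. *)
Lemma bdd_dual f (B : R) : L2 f ->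
  (forall (z : C) (A : set R) n, cmod z = 1 -> measurable A -> A `<=` `[- n%:R, n%:R]%classic -> rip (Mcst z * f) (oneA A) <= B * fine (mu A)) ->
  bdd f (2 * B).
Proof.
move=> Lf h.
have H (z : C) : cmod z = 1 -> {ae mu, forall x, Re (z * rep f x) <= B}.
  move=> z1; have := ae_le_dual (L2Z z Lf) (fun A n => h z A n z1).
  move=> hz; apply: aeS3 _ hz (repM (Mcst z) f) (rep_cst z) => x + E1 E2.
  by rewrite E1 E2.
have c1 : cmod (1 : C) = 1 by rewrite /cmod /Normc.normc /= expr0n addr0 expr1n sqrtr1.
have ci : cmod ('i : C) = 1 by rewrite /cmod /Normc.normc /= expr0n add0r expr1n sqrtr1.
have R1 := H _ c1.
have R2 : {ae mu, forall x, Re (- 1 * rep f x) <= B} by apply: H; rewrite cmodN.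
have R3 := H _ ci.
have R4 : {ae mu, forall x, Re (- 'i * rep f x) <= B} by apply: H; rewrite cmodN.
have R12 : {ae mu, forall x, `|Re (rep f x)| <= B}.
  apply: aeS2 _ R1 R2 => x; case: (rep f x) => p q /=.
  by rewrite ler_norml => h1 h2; apply/andP; split; lra.
apply: aeS3 _ R12 R3 R4 => x h1 h2 h3; apply: le_trans (cmod_le_ReIm _) _.
rewrite mulr2n mulrDl mul1r lerD //; move: h2 h3; case: (rep f x) => p q /=.
by rewrite ler_norml => h2 h3; apply/andP; split; lra.
Qed.

(* The function 1/(1 + i x). *)
Definition wfun (x : R) : C := (1 / (1 + x ^+ 2)) +i* (- x / (1 + x ^+ 2)).
Lemma cmeas_wfun : cmeas wfun.
Proof.
have mo : measurable_fun setT (fun x : R => (oneDsqr x)^-1).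
  by apply: continuous_measurable_fun => x; exact: continuous_oneDsqrV.
by split; apply: measurable_funM => //; apply: measurableT_comp.
Qed.
Definition wM : M := pi wfun.

Lemma wM_XM : wM * (1 + XM) = 1.
Proof.
have c1 := @cmeas_cst R 1; have cx := cmeas_ix R; have cw := cmeas_wfun.
rewrite /wM XME -[1]/(Mcst 1) Mcst_pi piD // piM //; last exact: cmeasD.
congr pi; apply/funext => x; have n0 : 1 + x ^+ 2 != 0 by rewrite gt_eqF // ltr_pwDl ?sqr_ge0.
by apply: Ceq => /=; field.
Qed.

Lemma L2_wM : L2 wM.
Proof.
rewrite /L2 n2_pi; last exact: cmeas_wfun.
apply: le_lt_trans (oneDsqrV_int R); rewrite le_eqVlt; apply/orP; left; apply/eqP.
apply: eq_integral => x _; congr (_%:E); rewrite /csq /wfun /oneDsqr /=.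
by have n0 : 1 + x ^+ 2 != 0 by [rewrite gt_eqF // ltr_pwDl ?sqr_ge0]; field.
Qed.

(** By [Fo_compact] the transform of the indicator is a classical integral, whose real and imaginary
    parts are each at most the measure of A. *)
Lemma bdd_Fo_oneA (A : set R) n : measurable A -> A `<=` `[- n%:R, n%:R]%classic -> bdd (Fo (oneA A)) (2 * fine (mu A)).
Proof.
move=> mA hA.
have fA : (mu A < +oo)%E.
  apply: (@le_lt_trans _ _ (mu `[- n%:R, n%:R]%classic)); first by apply: le_measure; rewrite ?inE.
  by apply: compact_finite_measure; exact: segment_compact.
have E : indM n%:R * oneA A = oneA A.
  rewrite /indM /oneA piM; do ?exact: cmeas_ind.
  congr pi; apply/funext => x; rewrite -rmorphM /= !indicE; congr (_%:C).
  have [xA|xA] := boolP (x \in A); last by rewrite mulr0.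
  by rewrite (_ : (x \in _) = true) ?mulr1 //; apply/mem_set; apply: hA; exact: set_mem.
apply: aeS _ (Fo_compact (ler0n _ n) (L2_oneA mA fA) E) => x ->.
have bc : bdd (chix n%:R x) 1.
  apply: bdd_pi; first exact: cmeas_chix.
  move=> y; rewrite cmodM cmod_cis mulr1 cmod_real indicE.
  by case: (_ \in _); rewrite ?normr1 ?normr0.
have bic : bdd (ii * chix n%:R x) 1.
  have := bddM (cmod_ge0 'i) (bdd_cst 'i) bc; rewrite mulr1.
  by apply: bdd_le; rewrite /cmod /Normc.normc /= expr0n add0r expr1n sqrtr1.
apply: le_trans (cmod_le_ReIm _) _; rewrite /ftp /= !(ripC (oneA A)) mulr2n mulrDl !mul1r.
have := rip_oneA_le bc mA fA; have := rip_oneA_le bic mA fA; rewrite !mul1r; exact: (fun h1 h2 => lerD h2 h1).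
Qed.

Definition Csob : R := 4 * nm wM / Num.sqrt kap.
Lemma Csob_ge0 : 0 <= Csob.
Proof. by rewrite divr_ge0 ?sqrtr_ge0 // mulr_ge0 ?nm_ge0. Qed.

(** Since (1 + i xi) Fo f = Fo (f + f'), the pairing of f with an indicator becomes one of Fo (f +
    f') with an L^2 function, 1 / (1 + i xi) up to conjugation, times a function bounded by twice
    the measure. With the 2 of [bdd_dual] this gives the 4 in [Csob]. *)
Lemma sobolev_bdd f f' : dF f f' -> bdd f (Csob * (nm f + nm f')).
Proof.
move=> df; have k0 := kap_gt0 R.
have -> : Csob * (nm f + nm f') = 2 * (2 * nm wM / Num.sqrt kap * (nm f + nm f')) by rewrite /Csob; ring.
have [Lf Lf' Ef] := df; apply: bdd_dual => // z A n z1 mA hA.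
have fA : (mu A < +oo)%E.
  apply: (@le_lt_trans _ _ (mu `[- n%:R, n%:R]%classic)); first by apply: le_measure; rewrite ?inE.
  by apply: compact_finite_measure; exact: segment_compact.
have bz : bdd (Mcst z : M) 1 by rewrite -z1; exact: bdd_cst.
have Lzf := L2Z z Lf; have LA := L2_oneA mA fA.
have E : Fo (Mcst z * f) = wM * Fo (Mcst z * (f + f')).
  rewrite !FoZ ?FoD ?Ef //; last exact: L2D.
  rewrite -[LHS]mul1r -wM_XM; ring.
have Ls : L2 (Mcst z * (f + f')) by apply: L2Z; exact: L2D.
rewrite -(ler_pM2l k0) -Fo_rip // E rip_adj.
have -> : Mconj wM * Fo (oneA A) = Fo (oneA A) * Mconj wM by rewrite mulrC.
have LW : L2 (Mconj wM) by apply: L2conj; exact: L2_wM.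
have bA := bdd_Fo_oneA mA hA; have LFA := L2M bA LW; have LFs := L2Fo Ls.
apply: le_trans (ler_norm _) _; apply: le_trans (CS LFs LFA) _.
have H1 : nm (Fo (Mcst z * (f + f'))) <= Num.sqrt kap * (nm f + nm f').
  rewrite Fo_nm // ler_wpM2l ?sqrtr_ge0 //; apply: le_trans (nmM_bdd bz (L2D Lf Lf')) _.
  by rewrite mul1r nmD.
have H2 := nmM_bdd bA LW; rewrite nm_conj in H2.
apply: (@le_trans _ _ (Num.sqrt kap * (nm f + nm f') * (2 * fine (mu A) * nm wM))).
  by apply: ler_pM => //; exact: nm_ge0.
rewrite -[X in _ <= X * _](sqr_sqrtr (ltW k0)) le_eqVlt; apply/orP; left; apply/eqP.
by field; rewrite gt_eqF // sqrtr_gt0.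
Qed.

Lemma dF_bdd f f' : dF f f' -> exists B, bdd f B.
Proof. by move=> /sobolev_bdd; exists (Csob * (nm f + nm f')). Qed.

Lemma Tr_tz h f : L2 f -> tends0 h -> tz (fun n => nm (Tr (h n) f - f)).
Proof.
move=> Lf ht; apply: Fo_tz => [n|]; first by apply: L2B => //; exact: L2_Tr.
have L := L2Fo Lf.
rewrite (_ : (fun n => _) = (fun n => nm ((modu (h n) - 1) * Fo f))); last first.
  by apply/funext => n; rewrite FoB ?Fo_Tr //; [rewrite mulrBl mul1r|exact: L2_Tr].
have mm (a : R) : cmeas (fun x => cis (a * x)) by apply: cmeas_cis; exact: measurable_lin.
apply: (@dct_nm _ _ _ (1 + cmod (1 : C))) => // [n|].
  by apply: bddB; [apply: bdd_expi; exact: measurable_lin|exact: bdd_cst].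
have E : {ae mu, forall x n, rep (modu (h n) - 1) x = cis (h n * x) - 1}.
  apply/ae_foralln => n; apply: aeS3 _ (repB (modu (h n)) 1) (rep_cst 1) (piE (mm (h n))) => x -> -> <-.
  by rewrite /modu expiE.
apply: aeS _ E => x h1.
apply: (ctends_small (K := 2 * `|x|) ht) => n; rewrite h1 subr0.
apply: le_trans (cmod_le_ReIm _) _; rewrite /= subr0.
have dc (y : R) : is_derive y 1 (@cos R) (- sin y) by exact: is_derive_cos.
have := lip_of_deriv dc (B := 1) (fun x => _) 0 (h n * x); rewrite cos0 subr0 mul1r normrM => hl.
have {}hl : `|cos (h n * x) - 1| <= `|h n| * `|x| by apply: hl => y; rewrite normrN sin_max.
have := norm_sin_le (h n * x); rewrite normrM; nra.
Qed.

(** The Sobolev bound applied to the difference of a and its translate makes the translation error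
    small in sup norm; the same bound on b controls the other limit. *)
Lemma dF_mul a a' b b' : dF a a' -> dF b b' -> dF (a * b) (a * b' + a' * b).
Proof.
move=> da db; have [La La' _] := da; have [Lb Lb' _] := db.
have [A bA] := dF_bdd da; have [B bB] := dF_bdd db.
have Lq n := L2_dq (h0 n) La.
apply: (dF_Mr (h := h0) (B := A)) => //.
- exact: h0_tends.
- by rewrite mulrC; exact: L2M bB La'.
- have t1 : tz (fun n => nm b' * Csob * (nm (Tr (h0 n) a - a) + nm (Tr (h0 n) a' - a'))).
    apply: tz_mul; first by rewrite mulr_ge0 ?nm_ge0 ?Csob_ge0.
    by apply: tz_add; apply: Tr_tz => //; exact: h0_tends.
  apply: tz_squeeze t1 => n; have dT := dFB (dF_Tr (h0 n) da) da.
  apply: le_trans (nmM_bdd (sobolev_bdd dT) Lb') _.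
  by rewrite mulrC mulrA.
- have t1 : tz (fun n => B * nm (dq (h0 n) a - a')).
    by apply: tz_mul (bdd_ge0 bB) (dq_tz (@h0_tends R) da).
  apply: tz_squeeze t1 => n; rewrite mulrC; apply: nmM_bdd => //; exact: L2B.
- by move=> n; rewrite mulrC; exact: L2M bB (Lq n).
Qed.

End SupBounds.

(** * Landau's inequality and multiplication by smooth functions *)

Section Multipliers.
Variable R : realType.
Local Notation mu := (@lebesgue_measure R).
Local Notation C := R[i].
Local Notation Re := (@complex.Re R).
Local Notation Im := (@complex.Im R).
Local Notation M := (Mfun R).
Local Notation ii := (@ii R).
Local Notation kap := (@kap R).
Local Notation Fo := (@Fo R).
Local Notation h0 := (@h0 R).
Local Notation XM := (@XM R).
Implicit Types f g a b : M.

(** By contradiction: failing values of h below 1 / (n + 1) would form a sequence [tends0]. *)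
Lemma eps_of_tz (P : R -> R) : (forall h, tends0 h -> tz (fun n => P (h n))) ->
  forall e : R, 0 < e -> exists2 d : R, 0 < d & forall h, h != 0 -> `|h| <= d -> P h <= e.
Proof.
move=> H e e0; apply: contrapT => N.
have hn (n : nat) : exists h : R, [/\ h != 0, `|h| <= n.+1%:R^-1 & e < P h].
  apply: contrapT => N2; apply: N; exists n.+1%:R^-1 => // h h1 h2.
  by rewrite leNgt; apply/negP => h3; apply: N2; exists h.
have [h hh] := choice hn.
have ht : tends0 h by move=> n; have [] := hh n.
have e2 : 0 < e / 2 by rewrite divr_gt0.
by have [k hk] := H h ht _ e2; have := hk _ (leqnn k); have [_ _] := hh k; lra.
Qed.

Lemma dq_eps f f' : dF f f' -> forall e : R, 0 < e ->
  exists2 d : R, 0 < d & forall h, h != 0 -> `|h| <= d -> nm (dq h f - f') <= e.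
Proof. by move=> df; apply: eps_of_tz => h ht; exact: dq_tz. Qed.

Lemma is_derive_eps (F : R -> R) (x l : R) :
  (forall e : R, 0 < e -> exists2 d : R, 0 < d & forall h, h != 0 -> `|h| <= d -> `|F (x + h) - F x - h * l| <= e * `|h|) ->
  is_derive x 1 F l.
Proof.
move=> H; have c : h^-1 *: ((F \o shift x) (h *: 1) - F x) @[h --> 0^'] --> l.
  apply/cvgrPdist_le => e e0; have [d d0 hd] := H _ e0.
  exists d => //= h /=; rewrite sub0r normrN => hd1 hn0.
  have h1 : 0 < `|h| by rewrite normr_gt0.
  rewrite distrC /GRing.scale /= mulr1 -(ler_pM2r h1) -normrM.
  rewrite (_ : _ * h = F (x + h) - F x - h * l); last by rewrite (addrC x); field.
  exact: hd (ltW hd1).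
apply: DeriveDef; first by apply/cvg_ex; exists l.
exact: (cvg_lim _ c).
Qed.

Lemma is_derive_rip_Tr f f' g (h : R) : dF f f' -> L2 g ->
  is_derive h 1 (fun s => rip (Tr s f) g) (rip (Tr h f') g).
Proof.
move=> df Lg; have [Lf Lf' _] := df; apply: is_derive_eps => e e0.
have k0 : 0 < nm g + 1 by rewrite ltr_wpDl ?nm_ge0.
have [d d0 hd] := dq_eps df (divr_gt0 e0 k0); exists d => // s s0 sd.
have := hd _ s0 sd; rewrite ler_pdivlMr // => H.
have E : Tr (h + s) f - Tr h f - Mcst (cr s) * Tr h f' = Mcst (cr s) * Tr h (dq s f - f').
  rewrite /dq !(TrB, TrM) TrTr Tr_cst mulrBr [in RHS]mulrA -crM divff // cr1 mul1r //.
have LT := L2_Tr (h + s) Lf; have L1 := L2_Tr h Lf; have L2' := L2_Tr h Lf'.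
rewrite -ripZl // -ripBl // -ripBl //; [|exact: L2B|exact: L2Z].
have L3 : L2 (dq s f - f') by apply: L2B => //; exact: L2_dq.
rewrite -/(cr s) E; have L4 : L2 (Tr h (dq s f - f')) by exact: L2_Tr.
apply: le_trans (CS (L2Z _ L4) Lg) _; rewrite nmZ // nm_Tr //.
have := nm_ge0 (dq s f - f'); have := nm_ge0 g; have := normr_ge0 s; nra.
Qed.

(** Let S(h) be the pairing of the translate of z f with the indicator of D. Two mean value theorems
    give S'(0) = (S(d) - S(0)) / d - c S''(c') with c <= d. Each pairing is at most a sup bound
    times the measure of D, and [bdd_dual] returns to f'. *)
Lemma landau f f' f'' A B (d : R) : dF f f' -> dF f' f'' -> bdd f A -> bdd f'' B -> 0 < d ->
  bdd f' (2 * (2 * A / d + d * B)).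
Proof.
move=> df df' bf bf'' d0; have [Lf Lf' _] := df; have [_ Lf'' _] := df'.
apply: bdd_dual => // z D n z1 mD hD.
have fD : (mu D < +oo)%E.
  apply: (@le_lt_trans _ _ (mu `[- n%:R, n%:R]%classic)); first by apply: le_measure; rewrite ?inE.
  by apply: compact_finite_measure; exact: segment_compact.
have LD := L2_oneA mD fD; pose S h (w : M) := rip (Tr h (Mcst z * w)) (oneA D).
have bS w K h : bdd w K -> `|S h w| <= K * fine (mu D).
  move=> bw; apply: rip_oneA_le => //; apply: bdd_Tr.
  by have := bddM ler01 (_ : bdd (Mcst z) 1) bw; rewrite mul1r; apply; rewrite -z1; exact: bdd_cst.
have d1 (h : R) : is_derive h 1 (fun s => S s f) (S h f') by apply: is_derive_rip_Tr LD; exact: dFZ.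
have d2 (h : R) : is_derive h 1 (fun s => S s f') (S h f'') by apply: is_derive_rip_Tr LD; exact: dFZ.
have [c hc E1] := mvt_ex d1 0 d; have [c' _ E2] := mvt_ex d2 0 c.
move: E1 E2 hc; rewrite !subr0 => E1 E2; case: (leP 0 d) => [_|]; last lra; move=> /andP[c0 cd].
rewrite -[Mcst z * f']Tr0 -/(S 0 f').
have b1 := bS f A d bf; have b2 := bS f A 0 bf; have b3 := bS f'' B c' bf''.
have m0 : 0 <= fine (mu D) by rewrite fine_ge0.
have B0 : 0 <= B * fine (mu D) by rewrite mulr_ge0 // (bdd_ge0 bf'').
have E3 : S 0 f' = (S d f - S 0 f) / d - S c' f'' * c.
  by rewrite E1 -E2; field; rewrite gt_eqF.
rewrite E3 [leRHS]mulrDl; apply: lerD.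
  rewrite ler_pdivrMr // (_ : _ * d = 2 * A * fine (mu D)); last by field; rewrite gt_eqF.
  by move: b1 b2; rewrite !ler_norml => /andP[? ?] /andP[? ?]; lra.
have : - (S c' f'') * c <= B * fine (mu D) * c.
  by rewrite ler_wpM2r //; move: b3; rewrite ler_norml => /andP[? ?]; lra.
nra.
Qed.

Definition rM (m : R -> R) : M := pi (fun x => (m x)%:C).

Lemma rep_rM m : measurable_fun setT m -> {ae mu, forall x, rep (rM m) x = (m x)%:C}.
Proof. by move=> mm; apply: piE; exact: cmeas_real. Qed.
Lemma rMD m n : measurable_fun setT m -> measurable_fun setT n -> rM m + rM n = rM (fun x => m x + n x).
Proof.
move=> mm mn; rewrite /rM piD; do ?exact: cmeas_real.
by congr pi; apply/funext => x; rewrite rmorphD.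
Qed.
Lemma rMN m : measurable_fun setT m -> - rM m = rM (fun x => - m x).
Proof.
move=> mm; rewrite /rM piN; last exact: cmeas_real.
by congr pi; apply/funext => x; rewrite rmorphN.
Qed.
Lemma rMM m n : measurable_fun setT m -> measurable_fun setT n -> rM m * rM n = rM (fun x => m x * n x).
Proof.
move=> mm mn; rewrite /rM piM; do ?exact: cmeas_real.
by congr pi; apply/funext => x; rewrite rmorphM.
Qed.
Lemma rM_cst (c : R) : rM (fun=> c) = Mcst (cr c).
Proof. by rewrite Mcst_pi. Qed.
Lemma conj_rM m : measurable_fun setT m -> Mconj (rM m) = rM m.
Proof.
move=> mm; rewrite /rM Mconj_pi; last exact: cmeas_real.
by congr pi; apply/funext => x; rewrite /= oppr0.
Qed.
Lemma Tr_rM h m : measurable_fun setT m -> Tr h (rM m) = rM (fun x => m (x + h)).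
Proof.
move=> mm; rewrite /Tr /rM Aff_pi //; last exact: cmeas_real.
by congr pi; apply/funext => x; rewrite /aff mul1r.
Qed.
Lemma bdd_rM (m : R -> R) (B : R) : measurable_fun setT m -> (forall x, `|m x| <= B) -> bdd (rM m) B.
Proof. by move=> mm h; apply: bdd_pi; [exact: cmeas_real|move=> x; rewrite cmod_real]. Qed.

Lemma measurable_shift (m : R -> R) (h : R) : measurable_fun setT m ->
  measurable_fun setT (fun x : R => m (x + h)).
Proof. by move=> mm; apply: (measurableT_comp mm); apply: measurable_funD. Qed.

Lemma derive_eps (m : R -> R) (l x : R) : is_derive x 1 m l ->
  forall e : R, 0 < e -> exists2 d : R, 0 < d & forall h, h != 0 -> `|h| <= d -> `|h^-1 * (m (x + h) - m x) - l| <= e.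
Proof.
move=> [dx E] e e0; have : h^-1 *: ((m \o shift x) (h *: 1) - m x) @[h --> 0^'] --> l.
  by rewrite -E; exact: dx.
move=> /cvgrPdist_le /(_ _ e0) [d /= d0 hd]; exists (d / 2); first exact: divr_gt0.
move=> h h1 hd2; have := hd h; rewrite /= sub0r normrN => /(_ _ h1).
rewrite distrC /GRing.scale /= mulr1 (addrC h); apply.
by apply: le_lt_trans hd2 _; rewrite ltr_pdivrMr // ltr_pMr // ltrDl.
Qed.

Lemma derive_quot (m m' : R -> R) x h : (forall y : R, is_derive y 1 m (m' y)) -> tends0 h ->
  ctends (fun n => ((h n)^-1 * (m (x + h n) - m x))%:C) (m' x)%:C.
Proof.
move=> dm ht e e0; have [d d0 hd] := derive_eps (dm x) e0.
exists (Num.truncn d^-1) => n Nn; rewrite -rmorphB cmod_real; have [hn0 hn] := ht n.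
apply: hd => //; apply: le_trans hn _; rewrite -[leRHS]invrK lef_pV2 ?posrE ?invr_gt0 //; apply: ltW.
by apply: lt_le_trans (truncnS_gt _) _; rewrite ler_nat.
Qed.

Lemma continuous_deriv (m m' : R -> R) : (forall y : R, is_derive y 1 m (m' y)) -> continuous m.
Proof.
by move=> dm x; apply: differentiable_continuous; apply/derivable1_diffP; case: (dm x).
Qed.

(** A derivative is a pointwise limit of difference quotients, hence measurable even where it is not
    continuous. *)
Lemma measurable_deriv (m m' : R -> R) : (forall y : R, is_derive y 1 m (m' y)) ->
  measurable_fun setT m /\ measurable_fun setT m'.
Proof.
move=> dm; have mm : measurable_fun setT m.
  by apply: continuous_measurable_fun; exact: continuous_deriv dm.
split=> //; have [+ _] : cmeas (fun x => (m' x)%:C); last by [].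
apply: (@cmeas_lim _ (fun n x => ((h0 n)^-1 * (m (x + h0 n) - m x))%:C)) => [n|x].
  apply: cmeas_real; apply: measurable_funM => //; apply: measurable_funB => //.
  exact: measurable_shift.
exact: derive_quot dm (@h0_tends R).
Qed.

(** Here m is bounded as a class and m' at every point: the situation of the potential, given in
    L^infinity with bounded derivatives. *)
Lemma dF_rM (m m' : R -> R) (A B : R) b b' : (forall y : R, is_derive y 1 m (m' y)) ->
  bdd (rM m) A -> (forall x, `|m' x| <= B) -> dF b b' -> dF (rM m * b) (rM m * b' + rM m' * b).
Proof.
move=> dm bA hB db; have [Lb Lb' _] := db; have [mm mm'] := measurable_deriv dm.
have bB := bdd_rM mm' hB; have h0t := @h0_tends R.
have msh h := measurable_shift h mm.
have Edq h : dq h (rM m) = rM (fun x => h^-1 * (m (x + h) - m x)).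
  rewrite /dq Tr_rM // rMN // rMD //; last exact: measurableT_comp.
  rewrite -rM_cst rMM //; by [apply: measurable_cst|apply: measurable_funD => //; exact: measurableT_comp].
have mq (h : R) : measurable_fun setT (fun x : R => h^-1 * (m (x + h) - m x)).
  by apply: measurable_funM => //; exact: measurable_funB.
have bq n : bdd (dq (h0 n) (rM m)) B.
  rewrite Edq; apply: bdd_rM => // x; have [hn0 _] := h0t n.
  rewrite normrM normfV mulrC ler_pdivrMr ?normr_gt0 //.
  by have := lip_of_deriv dm hB x (x + h0 n); rewrite addrAC subrr add0r.
apply: (dF_Mr (h := h0) h0t db bA) => [||| n].
- exact: L2M bB Lb.
- apply: (@dct_nm _ _ _ (A + A)) => // [n|].
    by apply: bddB => //; exact: bdd_Tr.
  have E : {ae mu, forall x n, rep (Tr (h0 n) (rM m) - rM m) x = (m (x + h0 n) - m x)%:C}.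
    apply/ae_foralln => n; rewrite Tr_rM //.
    apply: aeS3 _ (repB (rM (fun x => m (x + h0 n))) (rM m)) (rep_rM (msh (h0 n))) (rep_rM mm) => x -> -> ->.
    by rewrite rmorphB.
  apply: aeS _ E => x h1; apply: (ctends_small (K := B) h0t) => n; rewrite h1 subr0 cmod_real.
  by have := lip_of_deriv dm hB x (x + h0 n); rewrite addrAC subrr add0r.
- apply: (@dct_nm _ _ _ (B + B)) => // [n|]; first exact: bddB.
  have E : {ae mu, forall x n, rep (dq (h0 n) (rM m) - rM m') x = ((h0 n)^-1 * (m (x + h0 n) - m x))%:C - (m' x)%:C}.
    apply/ae_foralln => n; rewrite Edq.
    by apply: aeS3 _ (repB (rM (fun x => (h0 n)^-1 * (m (x + h0 n) - m x))) (rM m')) (rep_rM (mq (h0 n))) (rep_rM mm') => x -> -> ->.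
  apply: aeS _ E => x h1 e e0; have [N hN] := derive_quot x dm h0t e0.
  by exists N => n /hN; rewrite h1 subr0.
- exact: L2M (bq n) Lb.
Qed.

End Multipliers.

(** * Weak derivatives and Sobolev spaces *)

Section TestFunctions.
Variable R : realType.
Local Notation mu := (@lebesgue_measure R).
Local Notation C := R[i].
Local Notation Re := (@complex.Re R).
Local Notation Im := (@complex.Im R).
Local Notation M := (Mfun R).
Local Notation ii := (@ii R).
Local Notation kap := (@kap R).
Local Notation Fo := (@Fo R).
Local Notation h0 := (@h0 R).
Local Notation XM := (@XM R).

(** The flat function exp(- e / y) with powers of 1 / y, so that the family is closed under
    derivation. For n = 0 it rises from 0 to 1, on a scale set by e. *)
Definition gb (e : R) (n : nat) (y : R) : R := if 0 < y then y^-1 ^+ n * expR (- e / y) else 0.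

Lemma exp_pow_le (z : R) n : 0 <= z -> z ^+ n * expR (- z) <= n.+1%:R ^+ n.
Proof.
move=> z0; rewrite expRN ler_pdivrMr ?expR_gt0 //.
have n0 : 0 < n.+1%:R :> R by [].
have -> : expR z = expR (z / n.+1%:R) ^+ n.+1 by rewrite -expRM_natr divfK // gt_eqF.
have h : z / n.+1%:R <= expR (z / n.+1%:R).
  by apply: le_trans (expR_ge1Dx _); rewrite lerDr.
have p0 : 0 <= z / n.+1%:R by rewrite divr_ge0.
have e1 : 1 <= expR (z / n.+1%:R) by apply: le_trans (expR_ge1Dx _); rewrite lerDl.
apply: (@le_trans _ _ (n.+1%:R ^+ n * expR (z / n.+1%:R) ^+ n)).
  rewrite -exprMn lerXn2r ?nnegrE ?mulr_ge0 ?expR_ge0 //.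
  by rewrite -ler_pdivrMl // mulrC.
rewrite ler_wpM2l ?exprn_ge0 // exprS ler_peMl // exprn_ge0 // expR_ge0.
Qed.

Lemma gb_ge0 e n y : 0 <= gb e n y.
Proof. by rewrite /gb; case: ltP => // y0; rewrite mulr_ge0 ?expR_ge0 // exprn_ge0 // invr_ge0 ltW. Qed.

Lemma gb_le e n y : 0 < e -> gb e n y <= (n.+1%:R / e) ^+ n.
Proof.
move=> e0; rewrite /gb; case: ltP => y0; last by rewrite exprn_ge0 // divr_ge0 // ltW.
have := exp_pow_le n (divr_ge0 (ltW e0) (ltW y0)).
move=> h; rewrite [leRHS]exprMn (_ : y^-1 ^+ n = (e / y) ^+ n * e^-1 ^+ n); last first.
  by rewrite -exprMn; congr (_ ^+ _); field; rewrite !gt_eqF.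
rewrite mulrAC mulNr; apply: ler_wpM2r; last exact: h.
by rewrite exprn_ge0 // invr_ge0 ltW.
Qed.

(** The exponential absorbs two more powers of 1 / y, so the function vanishes to second order at 0;
    this settles differentiability there. *)
Lemma gb_small e n y : 0 < e -> gb e n y <= (n.+3%:R / e) ^+ n.+2 * y ^+ 2.
Proof.
move=> e0; have := gb_le n.+2 y e0; rewrite /gb; case: ltP => y0; last first.
  by move=> h; rewrite mulr_ge0 // sqr_ge0.
rewrite -[n.+2]addn2 exprD; set K := _ ^+ (n + 2) => h.
have -> : y^-1 ^+ n * expR (- e / y) = y^-1 ^+ n * y^-1 ^+ 2 * expR (- e / y) * y ^+ 2.
  by field; rewrite gt_eqF.
by rewrite ler_wpM2r ?sqr_ge0.
Qed.

Lemma is_derive_local (F G : R -> R) (x l d : R) : 0 < d -> (forall h, `|h| <= d -> F (x + h) = G (x + h)) ->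
  is_derive x 1 G l -> is_derive x 1 F l.
Proof.
move=> d0 FG dG; apply: is_derive_eps => e e0; have [d' d'0 hd] := derive_eps dG e0.
exists (Num.min d d') => [|h h1]; first by rewrite lt_min d0.
rewrite le_min => /andP[hd1 hd2].
have E0 : F x = G x by rewrite -[x]addr0 FG // normr0 ltW.
rewrite FG // E0; have h2 : 0 < `|h| by rewrite normr_gt0.
have := hd _ h1 hd2; rewrite -(ler_pM2r h2) -normrM.
by rewrite (_ : (_ - l) * h = G (x + h) - G x - h * l) //; field.
Qed.

Lemma is_derive_gb e n (y : R) : 0 < e ->
  is_derive y 1 (gb e n) (- n%:R * gb e n.+1 y + e * gb e n.+2 y).
Proof.
move=> e0; case: (ltgtP 0 y) => [y0|y0|<-].
- apply: (@is_derive_local _ (fun z => z^-1 ^+ n * expR (- e * z^-1)) y _ (y / 2)); first exact: divr_gt0.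
    move=> h; rewrite ler_norml => /andP[h1 h2]; rewrite /gb (_ : 0 < y + h) //; lra.
  have dV : is_derive y 1 (fun z : R => z^-1) (- y ^- 2).
    by apply: is_derive_eq (is_deriveV _ _) _; rewrite ?gt_eqF // /GRing.scale /= mulr1.
  have dE : is_derive y 1 (fun z : R => expR (- e * z^-1)) (expR (- e * y^-1) * (- e * (- y ^- 2))).
    have dl : is_derive y 1 (fun z : R => - e * z^-1) (- e * - y ^- 2).
      have d := is_deriveM (is_derive_cst (- e) y (1 : R)) dV.
      by apply: is_derive_eq d _; rewrite scaler0 addr0.
    exact: (@is_derive1_comp R expR (fun z => - e * z^-1) y _ _ (is_derive_expR _) dl).
  have -> : (fun z => z^-1 ^+ n * expR (- e * z^-1)) = (fun z => z^-1) ^+ n * (fun z => expR (- e * z^-1)).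
    by apply/funext => z; rewrite !fctE.
  apply: is_derive_eq (is_deriveM (is_deriveX n dV) dE) _; rewrite /gb y0 !fctE /GRing.scale /=.
  case: n => [|n] /=; first by rewrite !mul0r ?mulr0n expr0; field; rewrite gt_eqF.
  by rewrite -exprVn !exprS expr0; set K := _.+1%:R; set P := y^-1 ^+ n; set E := expR _; ring.
- apply: (@is_derive_local _ (cst 0) y _ (- y)); first by rewrite oppr_gt0.
    move=> h; rewrite ler_norml => /andP[h1 h2]; rewrite /gb ltNge (_ : y + h <= 0) //; lra.
  by rewrite /gb ltNge (ltW y0) /= !mulr0 addr0; exact: is_derive_cst.
- rewrite /gb ltxx !mulr0 addr0; apply: is_derive_eps => e' e'0.
  set K := (n.+3%:R / e) ^+ n.+2; have K0 : 0 <= K by rewrite exprn_ge0 // divr_ge0 // ltW.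
  have K1 : 0 < K + 1 by rewrite ltr_wpDl.
  exists (e' / (K + 1)); first exact: divr_gt0.
  move=> h h1; rewrite ler_pdivlMr // => h2; rewrite add0r mulr0 !subr0 -/(gb e n h) -/(gb e n 0).
  rewrite (_ : gb e n 0 = 0) ?subr0; last by rewrite /gb ltxx.
  rewrite ger0_norm ?gb_ge0 //; apply: le_trans (gb_small n h e0) _; rewrite -/K.
  rewrite -(real_normK (num_real h)); have := normr_ge0 h; nra.
Qed.

(** A class of expressions stable under derivation, so that smoothness of the products of [chi] with
    cosines and sines follows by induction on the order. *)
Inductive sm : (R -> R) -> Prop :=
| sm_cst c : sm (fun=> c)
| sm_cos xi : sm (fun x => cos (x * xi))
| sm_sin xi : sm (fun x => sin (x * xi))
| sm_gb e n s a : 0 < e -> sm (fun x => gb e n (s * x + a))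
| sm_add f g : sm f -> sm g -> sm (fun x => f x + g x)
| sm_mul f g : sm f -> sm g -> sm (fun x => f x * g x).

Lemma is_derive_lin (x xi : R) : is_derive x 1 (fun y : R => y * xi) xi.
Proof. by apply: is_derive_eq; rewrite scaler0 add0r /GRing.scale /= mulr1. Qed.

Lemma is_derive_aff (x s a : R) : is_derive x 1 (fun y : R => s * y + a) s.
Proof.
have d := is_deriveD (is_deriveZ s (is_derive_id x (1 : R))) (is_derive_cst a x (1 : R)).
by apply: is_derive_eq d _; rewrite addr0 /GRing.scale /= mulr1.
Qed.

Lemma sm_deriv f : sm f -> exists2 f', sm f' & forall x : R, is_derive x 1 f (f' x).
Proof.
elim=> [c|xi|xi|e n s a e0|{}f g _ [f' sf df] _ [g' sg dg]|{}f g sf0 [f' sf df] sg0 [g' sg dg]].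
- by exists (fun=> 0); [exact: sm_cst|move=> x; exact: is_derive_cst].
- exists (fun x => - xi * sin (x * xi)); first by apply: sm_mul; [exact: sm_cst|exact: sm_sin].
  move=> x; have := @is_derive1_comp R (@cos R) (fun y => y * xi) x _ _ (is_derive_cos (x * xi)) (is_derive_lin x xi).
  by move=> h; apply: is_derive_eq h _; ring.
- exists (fun x => xi * cos (x * xi)); first by apply: sm_mul; [exact: sm_cst|exact: sm_cos].
  move=> x; have := @is_derive1_comp R (@sin R) (fun y => y * xi) x _ _ (is_derive_sin (x * xi)) (is_derive_lin x xi).
  by move=> h; apply: is_derive_eq h _; ring.
- exists (fun x => s * (- n%:R * gb e n.+1 (s * x + a) + e * gb e n.+2 (s * x + a))).
    by do ?[exact: sm_cst|exact: sm_gb|apply: sm_add|apply: sm_mul].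
  move=> x; have := @is_derive1_comp R (gb e n) (fun y => s * y + a) x _ _ (is_derive_gb n (s * x + a) e0) (is_derive_aff x s a).
  by move=> h; apply: is_derive_eq h _; ring.
- by exists (fun x => f' x + g' x); [exact: sm_add|move=> x; exact: is_deriveD].
- exists (fun x => f x * g' x + g x * f' x); first by apply: sm_add; exact: sm_mul.
  by move=> x; exact: is_deriveM.
Qed.

Lemma sm_derive1n f n : sm f -> sm (derive1n n f).
Proof.
elim: n f => [|n IH] f sf; first by rewrite derive1n0.
have [f' sf' df] := sm_deriv sf; rewrite derive1nS.
have [g' sg' dg] := sm_deriv (IH _ sf).
by rewrite (_ : _^`()%classic = g') //; apply/funext => x; rewrite derive1E; case: (dg x).
Qed.

Lemma sm_derivable f : sm f -> forall (n : nat) (x : R), derivable (derive1n n f) x 1.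
Proof.
by move=> sf n x; have [g' _ dg] := sm_deriv (sm_derive1n n sf); case: (dg x).
Qed.

(* A smooth cutoff supported in [a, b], increasing to the indicator of (a, b) as e decreases to 0. *)
Definition chi (e a b x : R) : R := gb e 0 (1 * x + - a) * gb e 0 (- 1 * x + b).

Lemma sm_chi e a b : 0 < e -> sm (chi e a b).
Proof. by move=> e0; apply: sm_mul; exact: sm_gb. Qed.

Lemma chi_out e a b x : ~~ (a < x < b) -> chi e a b x = 0.
Proof.
rewrite negb_and -!leNgt /chi /gb => /orP[h|h].
  by rewrite ltNge (_ : 1 * x + - a <= 0) ?mul0r //; lra.
by rewrite [X in _ * X]ifF ?mulr0 // ltNge; apply/negbF; lra.
Qed.

Lemma chi_test e a b (f : R -> R) : 0 < e -> sm f -> test_function (fun x => chi e a b x * f x).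
Proof.
move=> e0 sf; split.
  by apply: sm_derivable; apply: sm_mul => //; exact: sm_chi.
exists (Num.max `|a| `|b|) => x; rewrite gt_max => /andP[h1 h2].
rewrite chi_out ?mul0r //; apply/negP => /andP[xa xb].
case: (lerP 0 x) => x0; first by move: h2; rewrite (ger0_norm x0); have := ler_norm b; lra.
by move: h1; rewrite (ltr0_norm x0); have := ler_norm (- a); rewrite normrN; lra.
Qed.

Lemma gb0_bounds e y : 0 < e -> 0 <= gb e 0 y <= 1.
Proof. by move=> e0; rewrite gb_ge0 /=; have := gb_le 0 y e0; rewrite expr0. Qed.

Lemma gb0_near1 e y : 0 < e -> 0 < y -> 1 - gb e 0 y <= e / y.
Proof.
move=> e0 y0; rewrite /gb y0 expr0 mul1r; have := expR_ge1Dx (- e / y); rewrite mulNr; lra.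
Qed.

Lemma chi_bounds e a b x : 0 < e -> 0 <= chi e a b x <= 1.
Proof.
move=> e0; have /andP[? ?] := gb0_bounds (1 * x + - a) e0; have /andP[? ?] := gb0_bounds (- 1 * x + b) e0.
by rewrite /chi mulr_ge0 // mulr_ile1.
Qed.

Lemma chi_near1 e a b x : 0 < e -> a < x -> x < b -> 1 - chi e a b x <= e / (x - a) + e / (b - x).
Proof.
move=> e0 xa xb.
have /andP[p1 p2] := gb0_bounds (1 * x + - a) e0; have /andP[q1 q2] := gb0_bounds (- 1 * x + b) e0.
have := @gb0_near1 e (1 * x + - a) e0; have := @gb0_near1 e (- 1 * x + b) e0.
rewrite mul1r mulN1r (addrC (- x)) !subr_gt0 => /(_ xb) h1 /(_ xa) h2.
by move: p1 p2 q1 q2; rewrite /chi mul1r mulN1r (addrC (- x)); nra.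
Qed.

Definition dchi (e a b x : R) : R :=
  gb e 0 (1 * x + - a) * (- 1 * (e * gb e 2 (- 1 * x + b))) + gb e 0 (- 1 * x + b) * (1 * (e * gb e 2 (1 * x + - a))).

Lemma is_derive_chi e a b (x : R) : 0 < e -> is_derive x 1 (chi e a b) (dchi e a b x).
Proof.
move=> e0.
have d (s c : R) : is_derive x 1 (fun y => gb e 0 (s * y + c)) (s * (e * gb e 2 (s * x + c))).
  have := @is_derive1_comp R (gb e 0) (fun y => s * y + c) x _ _ (is_derive_gb 0 (s * x + c) e0) (is_derive_aff x s c).
  by move=> h; apply: is_derive_eq h _; ring.
exact: (is_deriveM (d 1 (- a)) (d (- 1) b)).
Qed.

(** [gb e 2] is at most (3 / e)^2; multiplied by e, and for the two factors of [chi], this is 18 /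
    e, which is small for large e. *)
Lemma dchi_le e a b x : 0 < e -> `|dchi e a b x| <= 18 / e.
Proof.
move=> e0; have H y : 0 <= e * gb e 2 y <= 9 / e.
  have h0 := mulr_ge0 (ltW e0) (gb_ge0 e 2 y); rewrite h0 /=; have h := ler_wpM2l (ltW e0) (gb_le 2 y e0).
  by apply: le_trans h _; rewrite le_eqVlt; apply/orP; left; apply/eqP; field; rewrite gt_eqF.
have /andP[p1 p2] := gb0_bounds (1 * x + - a) e0; have /andP[q1 q2] := gb0_bounds (- 1 * x + b) e0.
have /andP[r1 r2] := H (1 * x + - a); have /andP[s1 s2] := H (- 1 * x + b).
have E : 18 / e = 9 / e + 9 / e by field; rewrite gt_eqF.
rewrite /dchi; move: p1 p2 q1 q2 r1 r2 s1 s2 E; set P := gb _ 0 _; set Q := e * _; set P' := gb _ 0 _; set Q' := e * _.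
by set D := 9 / e => ? ? ? ? ? ? ? ? ->; rewrite ler_norml; apply/andP; split; nra.
Qed.

End TestFunctions.

(** * Weak derivatives in L^2 are Fourier derivatives *)

Section WeakDerivative.
Variable R : realType.
Local Notation mu := (@lebesgue_measure R).
Local Notation C := R[i].
Local Notation Re := (@complex.Re R).
Local Notation Im := (@complex.Im R).
Local Notation M := (Mfun R).
Local Notation ii := (@ii R).
Local Notation kap := (@kap R).
Local Notation Fo := (@Fo R).
Local Notation h0 := (@h0 R).
Local Notation XM := (@XM R).

Lemma cint_test (f : R -> C) (phi : R -> R) : cmeas f -> measurable_fun setT phi ->
  cintegral setT (fun x => (phi x)%:C * f x) = rip (pi f) (rM phi) +i* rip (pi f) (ii * rM phi).
Proof.
move=> mf mp; have mc := cmeas_real mp; apply: Ceq; rewrite /cintegral /=.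
  rewrite /rM rip_pi //; apply: eq_Rintegral => x _ /=.
  by case: (f x) => p q; rewrite /rdot /=; ring.
rewrite /ii Mcst_pi /rM piM //; last exact: cmeas_cst.
rewrite rip_pi //; last by apply: cmeasM => //; exact: cmeas_cst.
apply: eq_Rintegral => x _ /=.
by case: (f x) => p q; rewrite /rdot /=; ring.
Qed.

Lemma L2_indMA (A : R) : L2 (indM A).
Proof.
apply: (L2_oneA (measurable_itv `[- A, A])).
by apply: compact_finite_measure; exact: segment_compact.
Qed.

Lemma indM_rM (A : R) (m : R -> R) : measurable_fun setT m -> (forall x, A < `|x| -> m x = 0) ->
  indM A * rM m = rM m.
Proof.
move=> mm h; rewrite /indM /rM piM; [|exact: cmeas_ind|exact: cmeas_real].
congr pi; apply/funext => x; rewrite -rmorphM /= indicE mem_setE /= in_itv /= -ler_norml.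
by case: leP => [_|/h ->]; rewrite ?mul1r ?mulr0.
Qed.

Lemma L2_rM_supp (A B : R) (m : R -> R) : measurable_fun setT m -> (forall x, A < `|x| -> m x = 0) ->
  (forall x, `|m x| <= B) -> L2 (rM m).
Proof.
move=> mm h hB; rewrite -(indM_rM mm h) mulrC.
exact: L2M (bdd_rM mm hB) (L2_indMA A).
Qed.

Lemma test_deriv phi : test_function (R := R) phi -> test_function (phi^`())%classic.
Proof.
move=> [d [M0 hM]]; split.
  move=> n x; have := d n.+1 x; rewrite /derive1n iterSr; exact.
exists M0 => x xM; have z0 : is_derive x 1 phi 0.
  apply: (@is_derive_local _ phi (cst 0) x 0 ((`|x| - M0) / 2)).
  - by rewrite divr_gt0 // subr_gt0.
  - move=> h hh; apply: hM; have := ler_normB (x + h) h; rewrite addrK => h1; lra.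
by rewrite derive1E; case: z0.
Qed.

Lemma test_is_derive phi (x : R) : test_function (R := R) phi -> is_derive x 1 phi (phi^`()%classic x).
Proof. by move=> [d _]; rewrite derive1E; apply: DeriveDef => //; exact: (d 0%N x). Qed.

Lemma test_measurable phi : test_function (R := R) phi -> measurable_fun setT phi.
Proof. by move=> t; have [] := measurable_deriv (fun x => test_is_derive x t). Qed.

Lemma test_bounded phi : test_function (R := R) phi -> exists B, forall x, `|phi x| <= B.
Proof.
move=> t; have [_ [M0 hM]] := t.
have cp : {within `[- `|M0|, `|M0|], continuous phi}.
  by apply: continuous_subspaceT; exact: continuous_deriv (fun x => test_is_derive x t).
have /compact_bounded[B0 [_ hB]] := continuous_compact cp (@segment_compact _ _ _).
exists (`|B0| + 1) => x; have [xM|xM] := leP `|x| `|M0|.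
  apply: (hB (`|B0| + 1)); first by apply: le_lt_trans (ler_norm _) _; rewrite ltrDl.
  by exists x => //=; rewrite in_itv /= -ler_norml.
by rewrite hM ?normr0 ?addr_ge0 //; apply: le_lt_trans (ler_norm _) xM.
Qed.

Lemma L2_test phi : test_function (R := R) phi -> L2 (rM phi).
Proof.
move=> t; have [B hB] := test_bounded t; have [_ [M0 hM]] := t.
exact: L2_rM_supp (test_measurable t) hM hB.
Qed.

Lemma dF_test phi : test_function (R := R) phi -> dF (rM phi) (rM (phi^`()%classic)).
Proof.
move=> t; have t' := test_deriv t; have h0t := @h0_tends R.
have [B hB] := test_bounded t'; have [_ [M0 hM]] := t; have [_ [M1 hM1]] := t'.
have dp (x : R) := test_is_derive x t; have mp := test_measurable t; have mp' := test_measurable t'.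
apply: (@dF_of_lim _ h0) => //; do ?exact: L2_test.
(* The extra 1 leaves room for the translations, whose step is at most 1: beyond [A] the quotient
   and the derivative both vanish. *)
pose A := Num.max M0 M1 + 1.
have mq (h : R) : measurable_fun setT (fun x : R => h^-1 * (phi (x + h) - phi x)).
  by apply: measurable_funM => //; apply: measurable_funB => //; exact: measurable_shift.
have md (h : R) : measurable_fun setT (fun x : R => h^-1 * (phi (x + h) - phi x) + - phi^`()%classic x).
  by apply: measurable_funD => //; exact: measurableT_comp.
have Edq h : dq h (rM phi) - rM phi^`()%classic = rM (fun x => h^-1 * (phi (x + h) - phi x) + - phi^`()%classic x).
  rewrite /dq Tr_rM // rMN // rMD //; [|exact: measurable_shift|exact: measurableT_comp].
  rewrite -rM_cst rMM //; last by apply: measurable_funB => //; exact: measurable_shift.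
  by rewrite rMN // rMD //; exact: measurableT_comp.
have EA n : dq (h0 n) (rM phi) - rM phi^`()%classic = (dq (h0 n) (rM phi) - rM phi^`()%classic) * indM A.
  rewrite mulrC Edq indM_rM // => x xA; have [_ hn] := h0t n.
  have hn1 : `|h0 n| <= 1 by apply: le_trans hn _; rewrite invf_le1 // ler1n.
  have xM : M0 + 1 < `|x| by apply: le_lt_trans xA; rewrite lerD2r le_max lexx.
  have xM1 : M1 + 1 < `|x| by apply: le_lt_trans xA; rewrite lerD2r le_max lexx orbT.
  rewrite (hM (x + h0 n)) ?(hM x) ?(hM1 x) ?subrr ?mulr0 ?oppr0 ?addr0 //; try lra.
  have := ler_normB (x + h0 n) (h0 n); rewrite addrK => h1; lra.
rewrite (_ : (fun n => _) = (fun n => nm ((dq (h0 n) (rM phi) - rM phi^`()%classic) * indM A))); last first.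
  by apply/funext => n; rewrite -EA.
apply: (@dct_nm _ _ _ (B + B)) => [|n|]; first exact: L2_indMA.
  rewrite Edq; apply: bdd_rM => // x; have [hn0 _] := h0t n.
  apply: le_trans (ler_normB _ _) _; apply: lerD => //.
  rewrite normrM normfV mulrC ler_pdivrMr ?normr_gt0 //.
  by have := lip_of_deriv dp hB x (x + h0 n); rewrite addrAC subrr add0r.
have E : {ae mu, forall x n, rep (dq (h0 n) (rM phi) - rM phi^`()%classic) x =
    (((h0 n)^-1 * (phi (x + h0 n) - phi x)) - phi^`()%classic x)%:C}.
  by apply/ae_foralln => n; rewrite Edq; exact: rep_rM.
apply: aeS _ E => x h1 e e0; have [N hN] := derive_quot x dp h0t e0.
by exists N => n /hN; rewrite h1 subr0 rmorphB.
Qed.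

Definition wd F G : Prop := forall phi, test_function (R := R) phi ->
  rip F (rM phi^`()%classic) = - rip G (rM phi) /\
  rip F (ii * rM phi^`()%classic) = - rip G (ii * rM phi).

Lemma dF_wd F G : dF F G -> wd F G.
Proof.
move=> d phi t; have dp := dF_test t; split.
  by rewrite (dF_adj d dp) opprK.
by rewrite (dF_adj d (dFZ 'i dp)) opprK.
Qed.

Lemma dchi_out (e a b x : R) : ~~ (a < x < b) -> dchi e a b x = 0.
Proof.
rewrite negb_and -!leNgt /dchi /gb => /orP[h|h].
  by rewrite ltNge (_ : 1 * x + - a <= 0) ?mul0r ?mulr0 ?addr0 //; lra.
by rewrite (_ : (0 < - 1 * x + b) = false) ?mul0r ?mulr0 ?addr0 //; apply/negbTE; rewrite -leNgt; lra.
Qed.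

Lemma out_norm (A x : R) : A < `|x| -> ~~ (- A < x < A).
Proof. by move=> h; rewrite -ltr_norml -leNgt ltW. Qed.

(** The weak derivative is tested on chi cos(x xi) and chi sin(x xi), whose derivatives produce the
    factor i xi and a term with the derivative of chi. *)
Lemma ftp_weak F G (e A xi : R) : L2 F -> L2 G -> wd F G -> 0 < e ->
  ftp A (rM (chi e (- A) A) * G) xi =
  (0 +i* xi) * ftp A (rM (chi e (- A) A) * F) xi - ftp A (rM (dchi e (- A) A) * F) xi.
Proof.
move=> LF LG w e0; set ch := chi e (- A) A; set dch := dchi e (- A) A.
have dc (x : R) : is_derive x 1 ch (dch x) := is_derive_chi (- A) A x e0.
have [mc mdc] := measurable_deriv dc.
have bc x : `|ch x| <= 1 by have /andP[h1 h2] := chi_bounds (- A) A x e0; rewrite ger0_norm.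
have bdc x : `|dch x| <= 18 / e by exact: dchi_le.
have sc x : A < `|x| -> ch x = 0 by move=> /out_norm; exact: chi_out.
have sdc x : A < `|x| -> dch x = 0 by move=> /out_norm; exact: dchi_out.
have dcos (x : R) : is_derive x 1 (fun y : R => cos (y * xi)) (- sin (x * xi) * xi).
  by have := @is_derive1_comp R (@cos R) (fun y => y * xi) x _ _ (is_derive_cos (x * xi)) (is_derive_lin x xi).
have dsin (x : R) : is_derive x 1 (fun y : R => sin (y * xi)) (cos (x * xi) * xi).
  by have := @is_derive1_comp R (@sin R) (fun y => y * xi) x _ _ (is_derive_sin (x * xi)) (is_derive_lin x xi).
pose co x := ch x * cos (x * xi); pose si x := ch x * sin (x * xi).
pose co' x := ch x * (- sin (x * xi) * xi) + cos (x * xi) * dch x.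
pose si' x := ch x * (cos (x * xi) * xi) + sin (x * xi) * dch x.
have dco (x : R) : is_derive x 1 co (co' x) by exact: is_deriveM.
have dsi (x : R) : is_derive x 1 si (si' x) by exact: is_deriveM.
have tco : test_function co by apply: chi_test => //; exact: sm_cos.
have tsi : test_function si by apply: chi_test => //; exact: sm_sin.
have [mco mco'] := measurable_deriv dco; have [msi msi'] := measurable_deriv dsi.
have Eco : co^`()%classic = co' by apply/funext => x; rewrite derive1E; case: (dco x).
have Esi : si^`()%classic = si' by apply/funext => x; rewrite derive1E; case: (dsi x).
have Lco := L2_test tco; have Lsi := L2_test tsi.
have Lco' := L2_test (test_deriv tco); have Lsi' := L2_test (test_deriv tsi).
have [w1 w2] := w _ tco; have [w3 w4] := w _ tsi; rewrite Eco in w1 w2 Lco'; rewrite Esi in w3 w4 Lsi'.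
set K := chix A xi; have LK : L2 K := L2_chix A xi.
have bM := bdd_rM mc bc; have bdM := bdd_rM mdc bdc.
have mK := cmeas_chix A xi; have mi := @cmeas_cst R 'i.
have ind m x : (forall x, A < `|x| -> m x = 0) -> m x * \1_(`[- A, A]%classic) x = m x.
  by move=> h; rewrite indicE mem_setE /= in_itv /= -ler_norml; case: leP => [_|/h ->]; rewrite ?mulr1 ?mulr0.
have E1 : rM ch * K = rM co + ii * rM si.
  rewrite /K /chix /rM /ii Mcst_pi !piM ?piD //; do ?[exact: cmeas_real|apply: cmeasM => //; exact: cmeas_real].
  congr pi; apply/funext => x; rewrite mulrA -rmorphM /= ind // /co /si; apply: Ceq => /=; ring.
have E2 : rM co' + ii * rM si' = rM dch * K + Mcst (cr xi) * (ii * (rM ch * K)).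
  rewrite /K /chix /rM /ii !Mcst_pi.
  have mm1 := cmeasM (cmeas_real mc) mK; have mm2 := cmeasM (cmeas_real mdc) mK.
  have mm3 := cmeasM mi mm1; have mm4 := cmeasM (@cmeas_cst R (cr xi)) mm3.
  have mm5 := cmeas_real mco'; have mm6 := cmeasM mi (cmeas_real msi').
  rewrite !piM ?piD //; do ?exact: cmeas_real; do ?exact: cmeas_cst.
  congr pi; apply/funext => x; rewrite !(mulrA _%:C (_ %:C)) -!rmorphM /= !ind // /co' /si' /cr.
  by apply: Ceq => /=; ring.
have LcK : L2 (rM ch * K) by exact: L2M bM LK.
have LdK : L2 (rM dch * K) by exact: L2M bdM LK.
have adj m H (k : M) : measurable_fun setT m -> rip (rM m * H) k = rip H (rM m * k).
  by move=> mm; rewrite rip_adj conj_rM.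
have LicK := L2ii LcK; have LziK := L2Z (cr xi) LicK.
have LidK := L2ii LdK; have LiicK := L2ii LicK; have LziiK := L2Z (cr xi) LiicK.
have ii2' (k : M) : ii * (ii * k) = - k by rewrite mulrA ii2 mulN1r.
have Lisi := L2ii Lsi; have Lisi' := L2ii Lsi'; have Lico := L2ii Lco; have Lico' := L2ii Lco'.
have P1 : rip (rM ch * G) K = - rip (rM dch * F) K - xi * rip (rM ch * F) (ii * K).
  rewrite (adj ch G K mc) (adj dch F K mdc) (adj ch F (ii * K) mc) E1 (ripDr Lco Lisi LG).
  have -> : rip G (rM co) + rip G (ii * rM si) = - rip F (rM co' + ii * rM si').
    by rewrite (ripDr Lco' Lisi' LF); lra.
  by rewrite E2 (ripDr LdK LziK LF) (ripZr _ LicK LF) (mulrCA (rM ch) ii); ring.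
have P2 : rip (rM ch * G) (ii * K) = - rip (rM dch * F) (ii * K) + xi * rip (rM ch * F) K.
  rewrite (adj ch G (ii * K) mc) (adj dch F (ii * K) mdc) (adj ch F K mc).
  rewrite (mulrCA (rM ch) ii) (mulrCA (rM dch) ii) E1 mulrDr ii2' (ripBr Lico Lsi LG).
  have -> : rip G (ii * rM co) - rip G (rM si) = - rip F (ii * (rM co' + ii * rM si')).
    by rewrite mulrDr ii2' (ripBr Lico' Lsi' LF); lra.
  rewrite E2 mulrDr (mulrCA ii (Mcst _)) (ripDr LidK LziiK LF) (ripZr _ LiicK LF) ii2' (ripNr LcK LF) -E1; ring.
by apply: Ceq; rewrite /ftp /= -/K ?P1 ?P2; ring.
Qed.

Lemma Fo_weak F G (e A : R) : 0 <= A -> L2 F -> L2 G -> wd F G -> 0 < e ->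
  Fo (rM (chi e (- A) A) * G) = XM * Fo (rM (chi e (- A) A) * F) - Fo (rM (dchi e (- A) A) * F).
Proof.
move=> A0 LF LG w e0.
have dc (x : R) : is_derive x 1 (chi e (- A) A) (dchi e (- A) A x) := is_derive_chi (- A) A x e0.
have [mc mdc] := measurable_deriv dc.
have bM : bdd (rM (chi e (- A) A)) 1.
  by apply: bdd_rM => // x; have /andP[h1 h2] := chi_bounds (- A) A x e0; rewrite ger0_norm.
have bdM : bdd (rM (dchi e (- A) A)) (18 / e) by apply: bdd_rM => // x; exact: dchi_le.
have I1 : indM A * rM (chi e (- A) A) = rM (chi e (- A) A).
  by apply: indM_rM => // x /out_norm; exact: chi_out.
have I2 : indM A * rM (dchi e (- A) A) = rM (dchi e (- A) A).
  by apply: indM_rM => // x /out_norm; exact: dchi_out.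
have FC m B H : bdd (rM m) B -> L2 H -> indM A * rM m = rM m ->
    {ae mu, forall xi, rep (Fo (rM m * H)) xi = ftp A (rM m * H) xi}.
  by move=> bm LH Im; apply: Fo_compact => //; [exact: L2M bm LH|rewrite mulrA Im].
apply: Meq; set F1 := Fo _; set F2 := Fo _; set F3 := Fo _.
have EX : {ae mu, forall xi, rep (XM * F2) xi = (0 +i* xi) * rep F2 xi}.
  have hX : {ae mu, forall xi, rep XM xi = 0 +i* xi} by rewrite XME; apply: piE; exact: cmeas_ix.
  by apply: aeS2 _ (repM XM F2) hX => x -> ->.
have H1 := aeS2 _ (FC _ _ _ bM LG I1) (FC _ _ _ bM LF I1).
have H2 := aeS3 _ (FC _ _ _ bdM LF I2) (repB (XM * F2) F3) EX.
have H3 : {ae mu, forall xi, rep F1 xi = ftp A (rM (chi e (- A) A) * G) xi /\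
    rep F2 xi = ftp A (rM (chi e (- A) A) * F) xi} by exact: H1.
have H4 : {ae mu, forall xi, rep (XM * F2 - F3) xi = (0 +i* xi) * rep F2 xi - ftp A (rM (dchi e (- A) A) * F) xi}.
  by apply: H2 => xi h1 -> ->; rewrite /F3 h1.
by apply: aeS2 _ H3 H4 => xi [E1 E2] ->; rewrite E1 E2; exact: ftp_weak.
Qed.

(** With e = n + 1 and radius (n + 1)^2 the parameter e is small against the radius, so the cutoff
    tends to 1, and yet its derivative, at most 18 / e, tends to 0. The second fact is what [wd_dF]
    needs. *)
Lemma chi_tz F : L2 F -> tz (fun n => nm (rM (chi (n.+1%:R : R) (- n.+1%:R ^+ 2) (n.+1%:R ^+ 2)) * F - F)).
Proof.
move=> LF; pose c n : M := rM (chi (n.+1%:R : R) (- n.+1%:R ^+ 2) (n.+1%:R ^+ 2)).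
have mc n : measurable_fun setT (chi (n.+1%:R : R) (- n.+1%:R ^+ 2) (n.+1%:R ^+ 2)).
  have dc (x : R) := is_derive_chi (- n.+1%:R ^+ 2) (n.+1%:R ^+ 2) x (ltr0Sn R n).
  have [mc _] := measurable_deriv dc; exact: mc.
rewrite (_ : (fun n => _) = (fun n => nm ((c n - 1) * F))); last first.
  by apply/funext => n; rewrite mulrBl mul1r.
apply: (@dct_nm _ _ _ (1 + cmod (1 : C))) => // [n|].
  apply: bddB; last exact: bdd_cst.
  by apply: bdd_rM => // x; have /andP[h1 h2] := chi_bounds (- n.+1%:R ^+ 2) (n.+1%:R ^+ 2) x (ltr0Sn R n); rewrite ger0_norm.
have E : {ae mu, forall x n, rep (c n - 1) x = (chi n.+1%:R (- n.+1%:R ^+ 2) (n.+1%:R ^+ 2) x)%:C - 1}.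
  apply/ae_foralln => n.
  by apply: aeS3 _ (repB (c n) 1) (rep_rM (mc n)) (rep_cst 1) => x -> -> ->.
apply: aeS _ E => x h1 e e0; exists (maxn (Num.truncn (2 * `|x|)) (Num.truncn (4 / e))) => n.
rewrite geq_max => /andP[n1 n2]; rewrite h1 subr0 (_ : forall r : R, r%:C - 1 = (r - 1)%:C) ?cmod_real 1?distrC; last by move=> r; rewrite rmorphB.
have p1 : 1 <= n.+1%:R :> R by rewrite ler1n.
have xn : 2 * `|x| <= n.+1%:R by apply: ltW; apply: lt_le_trans (truncnS_gt _) _; rewrite ler_nat.
have en : 4 / e <= n.+1%:R by apply: ltW; apply: lt_le_trans (truncnS_gt _) _; rewrite ler_nat.
move: p1 xn en; set N := n.+1%:R => p1 xn en.
have N0 : 0 < N by lra.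
have /andP[c0 c1] := chi_bounds (- N ^+ 2) (N ^+ 2) x N0.
rewrite ger0_norm ?subr_ge0 //.
have [x1 x2] : - N ^+ 2 / 2 <= x /\ x <= N ^+ 2 / 2.
  by have := ler_norm x; have := ler_norm (- x); rewrite normrN; split; nra.
apply: le_trans (chi_near1 N0 _ _) _; [nra|nra|].
have NN : 0 < N ^+ 2 / 2 by rewrite divr_gt0 // exprn_gt0.
have b1 : N / (x - - N ^+ 2) <= N / (N ^+ 2 / 2).
  by rewrite ler_wpM2l ?lef_pV2 ?posrE ?(ltW N0) //; nra.
have b2 : N / (N ^+ 2 - x) <= N / (N ^+ 2 / 2).
  by rewrite ler_wpM2l ?lef_pV2 ?posrE ?(ltW N0) //; nra.
have E2 : N / (N ^+ 2 / 2) = 2 / N by field; rewrite gt_eqF.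
have E3 : 2 / N + 2 / N <= e.
  rewrite -mulrDl ler_pdivrMr //; move: en; rewrite ler_pdivrMr //; lra.
by apply: le_trans (lerD b1 b2) _; rewrite E2.
Qed.

Lemma bdd_indM_XM (n : nat) : bdd (indM n%:R * XM) n%:R.
Proof.
have cx := cmeas_ix R; rewrite XME /indM piM //; last exact: cmeas_ind.
apply: bdd_pi; first by apply: cmeasM => //; exact: cmeas_ind.
move=> x; rewrite cmodM cmod_real indicE mem_setE /= in_itv /= -ler_norml.
case: (leP `|x| n%:R) => [h|_]; last by rewrite normr0 mul0r.
by rewrite (_ : true%:R = 1 :> R) // normr1 mul1r /= expr0n add0r sqrtr_sqr.
Qed.

Lemma indM_ext (a : M) : (forall n : nat, indM n%:R * a = 0) -> a = 0.
Proof.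
move=> h; apply: Meq.
have E : {ae mu, forall x n, (\1_(`[- n%:R, n%:R]%classic) x)%:C * rep a x = 0}.
  apply/ae_foralln => n; have := repM (indM n%:R) a; rewrite h => h1.
  by apply: aeS3 _ h1 (piE (cmeas_ind (measurable_itv `[- n%:R, n%:R]))) (rep_cst 0) => x + <- E0; rewrite E0.
apply: aeS2 _ E (rep_cst 0) => x hx ->; have := hx (Num.truncn `|x|).+1.
rewrite indicE mem_setE /= in_itv /= -ler_norml (ltW (truncnS_gt _)) mul1r; exact.
Qed.

(** Removes the cutoff from [Fo_weak]. Multiplication by [XM] being unbounded, the identity is first
    restricted to |xi| <= N, which suffices by [indM_ext]. *)
Lemma wd_dF F G : L2 F -> L2 G -> wd F G -> dF F G.
Proof.
move=> LF LG w; split=> //; apply/eqP; rewrite -subr_eq0; apply/eqP; apply: indM_ext => N.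
have LFF := L2Fo LF; have LFG := L2Fo LG.
pose c n := rM (chi n.+1%:R (- n.+1%:R ^+ 2) (n.+1%:R ^+ 2)) : M.
pose c' n := rM (dchi n.+1%:R (- n.+1%:R ^+ 2) (n.+1%:R ^+ 2)) : M.
have dc n (x : R) := is_derive_chi (- n.+1%:R ^+ 2) (n.+1%:R ^+ 2) x (ltr0Sn R n).
have bM n : bdd (c n) 1.
  have [mc _] := measurable_deriv (dc n).
  by apply: bdd_rM => // x; have /andP[h1 h2] := chi_bounds (- n.+1%:R ^+ 2) (n.+1%:R ^+ 2) x (ltr0Sn R n); rewrite ger0_norm.
have bdM n : bdd (c' n) (18 / n.+1%:R).
  have [_ mdc] := measurable_deriv (dc n).
  by apply: bdd_rM => // x; exact: dchi_le.
have Lc n H : L2 H -> L2 (c n * H) by exact: L2M (bM n).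
have Lc' n H : L2 H -> L2 (c' n * H) by exact: L2M (bdM n).
have bI := bdd_indM (N%:R : R); have bX := bdd_indM_XM N.
have LIG : L2 (indM N%:R * (Fo G - XM * Fo F)).
  by rewrite mulrBr mulrA; apply: L2B; [exact: L2M bI LFG|exact: L2M bX LFF].
apply: nm_eq0 => //; apply/eqP; rewrite eq_le nm_ge0 andbT.
pose K := Num.sqrt kap; have K0 : 0 <= K by exact: sqrtr_ge0.
have t1 := tz_mul K0 (chi_tz LG).
have t2 := tz_mul (mulr_ge0 (ler0n _ N) K0) (chi_tz LF).
have t3 : tz (fun n => K * nm F * 18 * n.+1%:R^-1).
  apply: tz_mul; first by rewrite !mulr_ge0 ?nm_ge0.
  move=> e e0; exists (Num.truncn e^-1) => n Nn.
  rewrite -[leRHS]invrK lef_pV2 ?posrE ?invr_gt0 //; apply: ltW.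
  by apply: lt_le_trans (truncnS_gt _) _; rewrite ler_nat.
apply: (tz_bound (tz_add t1 (tz_add t2 t3))) => n; rewrite add0r.
have /= E := Fo_weak (sqr_ge0 (n.+1%:R : R)) LF LG w (ltr0Sn R n).
rewrite -/(c n) -/(c' n) in E.
have L1 := L2B (Lc n _ LG) LG; have L2' := L2B (Lc n _ LF) LF.
have -> : indM N%:R * (Fo G - XM * Fo F) =
   - (indM N%:R * Fo (c n * G - G)) + (indM N%:R * XM * Fo (c n * F - F) - indM N%:R * Fo (c' n * F)).
  rewrite !FoB //; try exact: Lc; rewrite E; ring.
have LA : L2 (indM N%:R * Fo (c n * G - G)) by apply: L2M bI _; exact: L2Fo.
have LB : L2 (indM N%:R * XM * Fo (c n * F - F)) by apply: L2M bX _; exact: L2Fo.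
have LC : L2 (indM N%:R * Fo (c' n * F)) by apply: L2M bI _; apply: L2Fo; exact: Lc'.
apply: le_trans (nmD (L2N LA) (L2B LB LC)) _; rewrite nmN; apply: lerD.
  by apply: le_trans (nmM_bdd bI (L2Fo L1)) _; rewrite mul1r Fo_nm.
apply: le_trans (nmB LB LC) _; apply: lerD.
  by apply: le_trans (nmM_bdd bX (L2Fo L2')) _; rewrite Fo_nm // mulrA.
apply: le_trans (nmM_bdd bI (L2Fo (Lc' n _ LF))) _; rewrite mul1r Fo_nm; last exact: Lc'.
have := nmM_bdd (bdM n) LF => h; apply: le_trans (ler_wpM2l K0 h) _.
by rewrite le_eqVlt; apply/orP; left; apply/eqP; field; rewrite gt_eqF.
Qed.

End WeakDerivative.

(** * Comparison with the Sobolev spaces of the statement *)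

Section SobolevLink.
Variable R : realType.
Local Notation mu := (@lebesgue_measure R).
Local Notation C := R[i].
Local Notation Re := (@complex.Re R).
Local Notation Im := (@complex.Im R).
Local Notation M := (Mfun R).
Local Notation ii := (@ii R).
Local Notation kap := (@kap R).
Local Notation Fo := (@Fo R).
Local Notation h0 := (@h0 R).
Local Notation XM := (@XM R).

Lemma locint_itv (F : R -> R) a b : locally_integrable setT F -> mu.-integrable `[a, b] (EFin \o F).
Proof.
move=> [mF _ hF]; apply/integrableP; split.
  by apply/measurable_EFinP; exact: measurable_funTS.
by apply: hF => //; exact: segment_compact.
Qed.

Lemma chi_itv (F : R -> R) a b : a < b -> locally_integrable setT F ->
  (\int[mu]_x (chi (h0 n) a b x * F x))%R @[n --> \oo] --> (\int[mu]_(x in `[a, b]) F x)%R.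
Proof.
move=> ab lF; have iF := locint_itv a b lF; have [mF _ _] := lF.
have e0 n : 0 < h0 n by rewrite invr_gt0.
have mc n : measurable_fun setT (chi (h0 n) a b).
  have dc (x : R) := is_derive_chi a b x (e0 n).
  by have [mc _] := measurable_deriv dc.
have En n : (\int[mu]_x (chi (h0 n) a b x * F x))%R = (\int[mu]_(x in `[a, b]) (chi (h0 n) a b x * F x))%R.
  rewrite [RHS]Rintegral_indic //; apply: eq_Rintegral => x _.
  rewrite indicE mem_setE /= in_itv /=; case: (boolP (a < x < b)) => [/andP[/ltW -> /ltW ->]|h].
    by rewrite mulr1.
  by rewrite chi_out // !mul0r.
under eq_fun do rewrite En.
rewrite /Rintegral; apply: fine_cvg; rewrite fineK; last exact: integrable_fin_num.
have mD : measurable (`[a, b]%classic : set R) by exact: measurable_itv.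
have [||||//|_ _] := @dominated_convergence _ _ R mu `[a, b]%classic mD
   (fun n x => (chi (h0 n) a b x * F x)%:E) (EFin \o F) (fun x => `|F x|%:E).
- by move=> n; apply/measurable_EFinP; apply: measurable_funTS; apply: measurable_funM; [exact: mc|exact: mF].
- by apply/measurable_EFinP; exact: measurable_funTS.
- have hN (c : R) : {ae mu, forall x, x != c}.
    exists [set c]; split => //; first exact: lebesgue_measure_set1.
    by move=> x /= /negP; rewrite negbK => /eqP.
  apply: aeS2 _ (hN a) (hN b) => x xa xb; rewrite /= in_itv /= => /andP[ax xb'].
  have {}ax : a < x by rewrite lt_def xa.
  have {}xb : x < b by rewrite lt_def eq_sym xb.
  apply: cvg_EFin; first exact: nearW.
  rewrite -[X in _ --> X]mul1r; apply: cvgM; last exact: cvg_cst.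
  apply/cvgrPdist_le => e e1; pose K := (x - a)^-1 + (b - x)^-1.
  have K0 : 0 < K by rewrite addr_gt0 // invr_gt0 subr_gt0.
  exists (Num.truncn (K / e)) => // n /= Nn.
  have /andP[c0 c1] := chi_bounds a b x (e0 n); rewrite ger0_norm ?subr_ge0 //.
  apply: le_trans (chi_near1 (e0 n) ax xb) _; rewrite -mulrDr -/K /h0 mulrC ler_pdivrMr //.
  rewrite mulrC -ler_pdivrMr //; apply: ltW; apply: lt_le_trans (truncnS_gt _) _.
  by rewrite ler_nat.
- exact: (integrable_norm iF).
- apply: aeW => x n _ /=; rewrite lee_fin normrM ler_piMl //.
  by have /andP[c0 c1] := chi_bounds a b x (e0 n); rewrite ger0_norm.
by [].
Qed.

(** Test functions approach the indicators of intervals, and integrals over intervals determine a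
    locally integrable function. *)
Lemma test_uniq (F G : R -> R) : locally_integrable setT F -> locally_integrable setT G ->
  (forall phi, test_function phi -> (\int[mu]_x (phi x * F x) = \int[mu]_x (phi x * G x))%R) ->
  {ae mu, forall x, F x = G x}.
Proof.
move=> lF lG h.
suff H : {ae mu, forall x, F x - G x = 0} by apply: aeS _ H => x /eqP; rewrite subr_eq0 => /eqP.
apply: zero_of_itv; first exact: locally_integrableB.
move=> a b ab; rewrite RintegralB //; [|exact: locint_itv|exact: locint_itv].
apply/eqP; rewrite subr_eq0; apply/eqP.
have e0 n : 0 < h0 n by rewrite invr_gt0.
have cF := chi_itv ab lF; have cG := chi_itv ab lG.
have E : (fun n => \int[mu]_x (chi (h0 n) a b x * F x))%R = (fun n => \int[mu]_x (chi (h0 n) a b x * G x))%R.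
  apply/funext => n; apply: h.
  have := chi_test a b (e0 n) (sm_cst (1 : R)).
  by rewrite (_ : (fun x => _) = chi (h0 n) a b) //; apply/funext => x; rewrite mulr1.
by rewrite E in cF; exact: (cvg_unique _ cF cG).
Qed.

Lemma weak_uniq n (f g g' : R -> C) : is_weak_derivative n f g -> is_weak_derivative n f g' -> aeeq g g'.
Proof.
move=> [_ [l1 l2] h] [_ [l1' l2'] h'].
have E phi : test_function phi ->
    cintegral setT (fun x => (phi x)%:C * g x) = cintegral setT (fun x => (phi x)%:C * g' x).
  move=> t; have := h phi t; rewrite (h' phi t) => /(congr1 (fun z => (- 1) ^+ n * z)).
  by rewrite !mulrA -!exprD addnn -mul2n exprM sqrrN !expr1n !mul1r.
have ReE (phi : R -> R) (w : R -> C) : (fun x => phi x * Re (w x)) = (Re \o (fun x => (phi x)%:C * w x)).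
  by apply/funext => x /=; case: (w x) => p q /=; ring.
have ImE (phi : R -> R) (w : R -> C) : (fun x => phi x * Im (w x)) = (Im \o (fun x => (phi x)%:C * w x)).
  by apply/funext => x /=; case: (w x) => p q /=; ring.
have H1 : {ae mu, forall x, (Re \o g) x = (Re \o g') x}.
  apply: test_uniq => // phi t; have := E phi t; rewrite /cintegral => -[E1 _].
  by rewrite /= (ReE phi g) (ReE phi g').
have H2 : {ae mu, forall x, (Im \o g) x = (Im \o g') x}.
  apply: test_uniq => // phi t; have := E phi t; rewrite /cintegral => -[_ E2].
  by rewrite /= (ImE phi g) (ImE phi g').
by apply: aeS2 _ H1 H2 => x /=; exact: Ceq.
Qed.

Lemma locint_ae (F G : R -> R) : locally_integrable setT F -> measurable_fun setT G ->
  {ae mu, forall x, F x = G x} -> locally_integrable setT G.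
Proof.
move=> [mF oF hF] mG FG; split=> // K sK cK; have mK := compact_measurable cK.
rewrite (_ : (\int[mu]_(x in K) _)%E = (\int[mu]_(x in K) (`|F x|)%:E)%E); first exact: hF.
have mN (H : R -> R) : measurable_fun setT H -> measurable_fun K (fun x => `|H x|%:E).
  move=> mH; apply/measurable_EFinP; apply: (@measurableT_comp _ _ _ _ _ _ (@Num.norm R R)) => //.
  exact: measurable_funTS.
by apply: ae_eq_integral => //; [exact: mN|exact: mN|apply: aeS _ FG => x -> _].
Qed.

Lemma in_L2_locint (f : R -> C) : in_L2 f -> clocally_integrable f.
Proof.
move=> /in_L2P[mf Lf]; have [m1 m2] := mf; have [r1 r2] := rep_meas (pi f).
split.
  apply: (locint_ae (L2_locint Lf (@Re_le_cmod R) r1)) => //.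
  by apply: aeS _ (piE mf) => x /= ->.
apply: (locint_ae (L2_locint Lf (@Im_le_cmod R) r2)) => //.
by apply: aeS _ (piE mf) => x /= ->.
Qed.

Lemma clocint_cmeas (f : R -> C) : clocally_integrable f -> cmeas f.
Proof. by move=> [[m1 _ _] [m2 _ _]]; split. Qed.

Definition CT (phi : R -> R) (F : M) : C := rip F (rM phi) +i* rip F (ii * rM phi).

Lemma test_derive1n n phi : test_function (R := R) phi -> test_function (derive1n n phi).
Proof. by move=> t; elim: n => [|n IH] //; rewrite derive1nS; exact: test_deriv. Qed.

Lemma wdP F G : wd F G <-> forall phi, test_function (R := R) phi -> CT phi^`()%classic F = - CT phi G.
Proof.
split=> h phi t; have := h phi t; rewrite /CT; first by move=> [-> ->]; apply: Ceq.
by move=> [-> ->].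
Qed.

(** The identity of order n tested on phi' and the one of order n + 1 tested on phi have the same
    left-hand side. *)
Lemma weak_wd n (f g g' : R -> C) : in_L2 g -> in_L2 g' -> is_weak_derivative n f g ->
  is_weak_derivative n.+1 f g' -> dF (pi g) (pi g').
Proof.
move=> /in_L2P[mg Lg] /in_L2P[mg' Lg'] [_ _ h] [_ _ h']; apply: wd_dF => //; apply/wdP => phi t.
have t' := test_deriv t; have := h' phi t; have := h _ t'.
have -> : derive1n n phi^`()%classic = derive1n n.+1 phi by rewrite /derive1n iterSr.
move=> -> /(congr1 (fun z => (- 1) ^+ n * z)).
have s2 : (- 1) ^+ n * (- 1) ^+ n = 1 :> C by rewrite -exprD addnn -mul2n exprM sqrrN !expr1n.
rewrite !cint_test //; [|exact: test_measurable|exact: test_measurable].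
rewrite -!/(CT _ _); set A := CT _ _; set B := CT _ _; rewrite exprS => E.
rewrite -[A]mul1r -s2 -mulrA E (_ : _ * _ = - ((- 1) ^+ n * (- 1) ^+ n * B)); last by ring.
by rewrite s2 mul1r.
Qed.

(** A sequence of successive derivatives: the common ground between the weak derivatives of
    [in_Sobolev] and the Fourier definition [Hs]. *)
Definition chain (s : nat) (F : nat -> M) : Prop :=
  L2 (F 0%N) /\ forall j, (j < s)%N -> dF (F j) (F j.+1).

Lemma chain_L2 s F j : chain s F -> (j <= s)%N -> L2 (F j).
Proof. by move=> [L0 h]; case: j => // j /h[]. Qed.

Lemma chain_CT s F j phi : chain s F -> (j <= s)%N -> test_function (R := R) phi ->
  CT (derive1n j phi) (F 0%N) = (- 1) ^+ j * CT phi (F j).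
Proof.
move=> c; elim: j phi => [|j IH] phi js t; first by rewrite expr0 mul1r derive1n0.
have -> : derive1n j.+1 phi = derive1n j phi^`()%classic by rewrite /derive1n iterSr.
rewrite IH; [|exact: ltnW|exact: test_deriv].
have /wdP -> // := dF_wd (c.2 j js).
by rewrite exprS; ring.
Qed.

Lemma chain_weak s F j (f : R -> C) : in_L2 f -> chain s F -> F 0%N = pi f -> (j <= s)%N ->
  is_weak_derivative j f (rep (F j)).
Proof.
move=> hf c F0 js; have /in_L2P[mf Lf] := hf; have LF := chain_L2 c js.
split; [exact: in_L2_locint|exact: in_L2_locint (in_L2_rep LF)|move=> phi t].
rewrite !cint_test //; [|exact: rep_meas|exact: test_measurable|exact: test_measurable (test_derive1n j t)].
by rewrite pi_rep -F0; exact: (chain_CT c js t).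
Qed.

Lemma in_SobolevP s (f : R -> C) : in_Sobolev s f <->
  cmeas f /\ exists F, chain s F /\ F 0%N = pi f.
Proof.
split=> [[hf h]|[mf [F [c F0]]]].
  have /in_L2P[mf Lf] := hf; split=> //.
  have [g hg] : exists g : nat -> R -> C, forall j, (j <= s)%N -> is_weak_derivative j f (g j) /\ in_L2 (g j).
    have hj (j : nat) : exists g, (j <= s)%N -> is_weak_derivative j f g /\ in_L2 g.
      by case: (leqP j s) => [/h[g g1 g2]|_]; [exists g|exists f].
    by have [g hg] := choice hj; exists g.
  pose G j := if j is 0%N then f else g j.
  have hG j : (j <= s)%N -> is_weak_derivative j f (G j) /\ in_L2 (G j).
    case: j => [_|j]; last exact: hg.
    split=> //; split; [exact: in_L2_locint|exact: in_L2_locint|].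
    by move=> phi _; rewrite expr0 mul1r derive1n0.
  exists (fun j => pi (G j)); split; last exact: erefl.
  split; first exact: Lf.
  move=> j js.
  have [w1 l1] := hG _ (ltnW js); have [w2 l2] := hG _ js.
  exact: weak_wd w1 w2.
have hf : in_L2 f by apply/in_L2P; split=> //; rewrite -F0; exact: c.1.
split=> // j js; exists (rep (F j)); first exact: chain_weak c F0 js.
exact: in_L2_rep (chain_L2 c js).
Qed.

Lemma weak_derivativeP s F j (f : R -> C) : cmeas f -> chain s F -> F 0%N = pi f -> (j <= s)%N ->
  cmeas (weak_derivative j f) /\ aeeq (rep (F j)) (weak_derivative j f).
Proof.
move=> mf c F0 js.
have hf : in_L2 f by apply/in_L2P; split=> //; rewrite -F0; exact: c.1.
have w := chain_weak hf c F0 js.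
have w' : is_weak_derivative j f (weak_derivative j f) by apply: xgetPex; exists (rep (F j)).
by split; [have [_ /clocint_cmeas] := w'|exact: weak_uniq w w'].
Qed.

Lemma Sobolev_norm2E s F (f : R -> C) : cmeas f -> chain s F -> F 0%N = pi f ->
  Sobolev_norm2 s f = (\sum_(j < s.+1) nm (F j) ^+ 2)%:E.
Proof.
move=> mf c F0; rewrite /Sobolev_norm2 -sumEFin; apply: eq_bigr => j _.
have js : (j <= s)%N by rewrite -ltnS.
have [mw hw] := weak_derivativeP mf c F0 js.
exact: L2norm2_nm (chain_L2 c js) mw hw.
Qed.

End SobolevLink.

(** * Derivatives of higher order *)

Section Hs.
Variable R : realType.
Local Notation mu := (@lebesgue_measure R).
Local Notation C := R[i].
Local Notation Re := (@complex.Re R).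
Local Notation Im := (@complex.Im R).
Local Notation M := (Mfun R).
Local Notation ii := (@ii R).
Local Notation kap := (@kap R).
Local Notation Fo := (@Fo R).
Local Notation h0 := (@h0 R).
Local Notation XM := (@XM R).
Implicit Types f g : M.

Lemma FiD f g : L2 f -> L2 g -> Fi (f + g) = Fi f + Fi g.
Proof.
move=> Lf Lg; apply: Fo_inj; [by apply: L2Fi; exact: L2D|by apply: L2D; exact: L2Fi|].
by rewrite FoD ?FoK //; [exact: L2D|exact: L2Fi|exact: L2Fi].
Qed.
Lemma FiZ z f : L2 f -> Fi (Mcst z * f) = Mcst z * Fi f.
Proof.
move=> Lf; apply: Fo_inj; [by apply: L2Fi; exact: L2Z|by apply: L2Z; exact: L2Fi|].
by rewrite FoZ ?FoK //; [exact: L2Z|exact: L2Fi].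
Qed.

(** The derivative of order j as a Fourier multiplier: a total operation, meaningful on [Hs j]. *)
Definition Dd (j : nat) f : M := Fi (XM ^+ j * Fo f).
Definition Hs (s : nat) f : Prop := L2 f /\ forall j, (j <= s)%N -> L2 (XM ^+ j * Fo f).
Definition hn (s : nat) f : R := \sum_(j < s.+1) nm (Dd j f).

Lemma Hs_L2 s f : Hs s f -> L2 f. Proof. by case. Qed.
Lemma Hs_le s r f : (r <= s)%N -> Hs s f -> Hs r f.
Proof. by move=> rs [Lf h]; split=> // j jr; apply: h; exact: leq_trans jr rs. Qed.
Lemma L2_Dd s j f : Hs s f -> (j <= s)%N -> L2 (Dd j f).
Proof. by move=> [_ h] /h; exact: L2Fi. Qed.
Lemma Dd0 f : L2 f -> Dd 0 f = f.
Proof. by move=> Lf; rewrite /Dd expr0 mul1r FiK. Qed.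
Lemma Fo_Dd s j f : Hs s f -> (j <= s)%N -> Fo (Dd j f) = XM ^+ j * Fo f.
Proof. by move=> [_ h] /h L; rewrite /Dd FoK. Qed.
Lemma dF_Dd s j f : Hs s f -> (j < s)%N -> dF (Dd j f) (Dd j.+1 f).
Proof.
move=> H js; split; [exact: L2_Dd H (ltnW js)|exact: L2_Dd H js|].
by rewrite !(Fo_Dd H) //; [rewrite exprS mulrA|exact: ltnW].
Qed.
Lemma dF_Dd1 s f : Hs s.+1 f -> dF f (Dd 1 f).
Proof. by move=> H; rewrite -{1}(Dd0 (Hs_L2 H)); apply: dF_Dd H _. Qed.
Lemma Dd_dF j f g : dF f g -> Dd j.+1 f = Dd j g.
Proof. by move=> [_ _ E]; rewrite /Dd E exprSr mulrA. Qed.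
Lemma Hs_dF s f g : dF f g -> Hs s g -> Hs s.+1 f.
Proof.
move=> [Lf Lg E] [_ h]; split=> // -[|j] js; first by rewrite expr0 mul1r; exact: L2Fo.
by rewrite exprSr -mulrA -E; exact: h.
Qed.
Lemma Hs_Dd s j f : Hs (j + s) f -> Hs s (Dd j f).
Proof.
move=> H; split; first by apply: L2_Dd H _; exact: leq_addr.
move=> i js; rewrite (Fo_Dd H) ?leq_addr // mulrA -exprD.
by apply: H.2; rewrite addnC leq_add2l.
Qed.
Lemma Dd_Dd s i j f : Hs s f -> (j <= s)%N -> Dd i (Dd j f) = Dd (i + j) f.
Proof. by move=> H js; rewrite {1}/Dd (Fo_Dd H js) mulrA -exprD. Qed.
Lemma HsS s f : Hs s.+1 f -> Hs s (Dd 1 f). Proof. exact: (@Hs_Dd s 1). Qed.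
Lemma Hs0 f : L2 f -> Hs 0 f.
Proof. by move=> Lf; split=> // -[|j] // _; rewrite expr0 mul1r; exact: L2Fo. Qed.

Lemma HsD s f g : Hs s f -> Hs s g -> Hs s (f + g).
Proof.
move=> [Lf hf] [Lg hg]; split; first exact: L2D.
by move=> j js; rewrite FoD // mulrDr; apply: L2D; [exact: hf|exact: hg].
Qed.
Lemma HsZ s z f : Hs s f -> Hs s (Mcst z * f).
Proof.
move=> [Lf hf]; split; first exact: L2Z.
by move=> j js; rewrite FoZ // mulrCA; apply: L2Z; exact: hf.
Qed.
Lemma HsN s f : Hs s f -> Hs s (- f).
Proof. by move=> H; rewrite -mulN1r -[1]/(Mcst 1) -McstN; exact: HsZ. Qed.
Lemma HsB s f g : Hs s f -> Hs s g -> Hs s (f - g).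
Proof. by move=> H1 H2; apply: HsD => //; exact: HsN. Qed.
Lemma DdD s j f g : Hs s f -> Hs s g -> (j <= s)%N -> Dd j (f + g) = Dd j f + Dd j g.
Proof.
move=> [Lf hf] [Lg hg] js; rewrite /Dd FoD // mulrDr FiD //; [exact: hf|exact: hg].
Qed.
Lemma DdZ s j z f : Hs s f -> (j <= s)%N -> Dd j (Mcst z * f) = Mcst z * Dd j f.
Proof. by move=> [Lf hf] js; rewrite /Dd FoZ // mulrCA FiZ //; exact: hf. Qed.
Lemma DdN s j f : Hs s f -> (j <= s)%N -> Dd j (- f) = - Dd j f.
Proof.
by move=> H js; rewrite -mulN1r -[1]/(Mcst 1) -McstN (DdZ _ H js) McstN [- Mcst 1 * _]mulN1r.
Qed.
Lemma DdB s j f g : Hs s f -> Hs s g -> (j <= s)%N -> Dd j (f - g) = Dd j f - Dd j g.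
Proof. by move=> H1 H2 js; rewrite (DdD H1 (HsN H2) js) (DdN H2 js). Qed.

Lemma Hs_chain s f : Hs s f -> chain s (fun j => Dd j f).
Proof.
by move=> H; split=> [|j js]; [rewrite Dd0; [exact: Hs_L2 H|exact: Hs_L2 H]|exact: dF_Dd H js].
Qed.
Lemma chain_Hs s F : chain s F -> Hs s (F 0%N) /\ forall j, (j <= s)%N -> F j = Dd j (F 0%N).
Proof.
move=> [L0 c]; have E j : (j <= s)%N -> Fo (F j) = XM ^+ j * Fo (F 0%N) /\ L2 (F j).
  elim: j => [_|j IH js]; first by rewrite expr0 mul1r.
  have [_ L1 ->] := c j js; have [-> _] := IH (ltnW js); split=> //.
  by rewrite exprS mulrA.
split; first by split=> // j /E[<- ?]; exact: L2Fo.
by move=> j /E[h L]; rewrite /Dd -h FiK.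
Qed.

Lemma Hs_conj s f : Hs s f -> Hs s (Mconj f) /\ forall j, (j <= s)%N -> Dd j (Mconj f) = Mconj (Dd j f).
Proof.
move=> H; have [|h1 h2] := @chain_Hs s (fun j => Mconj (Dd j f)).
  split=> [|j js]; first by apply: L2conj; exact: L2_Dd H _.
  by apply: dF_conj; exact: dF_Dd H js.
by rewrite Dd0 in h1 h2; [split=> // j /h2|exact: Hs_L2 H|exact: Hs_L2 H..].
Qed.
Lemma Hs_Tr s h f : Hs s f -> Hs s (Tr h f) /\ forall j, (j <= s)%N -> Dd j (Tr h f) = Tr h (Dd j f).
Proof.
move=> H; have [|h1 h2] := @chain_Hs s (fun j => Tr h (Dd j f)).
  split=> [|j js]; first by apply: L2_Tr; exact: L2_Dd H _.
  by apply: dF_Tr; exact: dF_Dd H js.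
by rewrite Dd0 in h1 h2; [split=> // j /h2|exact: Hs_L2 H|exact: Hs_L2 H..].
Qed.
Lemma Hs_dq s h f : Hs s f -> Hs s (dq h f).
Proof. by move=> H; apply: HsZ; apply: HsB => //; have [] := Hs_Tr h H. Qed.
Lemma Dd_dq s h f j : Hs s f -> (j <= s)%N -> Dd j (dq h f) = dq h (Dd j f).
Proof.
move=> H js; have [HT ET] := Hs_Tr h H.
by rewrite /dq (DdZ _ (HsB HT H) js) (DdB HT H js) ET.
Qed.

Lemma hn_ge0 s f : 0 <= hn s f.
Proof. by apply: sumr_ge0 => j _; exact: nm_ge0. Qed.
Lemma hn_dF s f g : dF f g -> hn s.+1 f = nm f + hn s g.
Proof.
move=> d; have [Lf _ _] := d; rewrite /hn big_ord_recl /= Dd0 //; congr (_ + _).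
by apply: eq_bigr => j _; rewrite /= /bump /= add1n (Dd_dF _ d).
Qed.
Lemma hnS s f : hn s.+1 f = hn s f + nm (Dd s.+1 f).
Proof. by rewrite /hn big_ord_recr. Qed.
Lemma hn0 f : L2 f -> hn 0 f = nm f.
Proof. by move=> Lf; rewrite /hn big_ord_recr big_ord0 /= Dd0 // add0r. Qed.
Lemma hn_mono s r f : (r <= s)%N -> hn r f <= hn s f.
Proof.
elim: s => [|s IH]; first by rewrite leqn0 => /eqP ->.
rewrite leq_eqVlt => /orP[/eqP -> //|]; rewrite ltnS => /IH h.
by rewrite hnS (le_trans h) // lerDl nm_ge0.
Qed.
Lemma nm_Dd_le s j f : (j <= s)%N -> nm (Dd j f) <= hn s f.
Proof.
move=> js; apply: le_trans (hn_mono f js); case: j {js} => [|j].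
  by rewrite /hn big_ord_recr big_ord0 /= add0r.
by rewrite hnS lerDr hn_ge0.
Qed.
Lemma nm_le_hn s f : L2 f -> nm f <= hn s f.
Proof. by move=> Lf; rewrite -{1}(Dd0 Lf); exact: nm_Dd_le. Qed.
Lemma hnD s f g : Hs s f -> Hs s g -> hn s (f + g) <= hn s f + hn s g.
Proof.
move=> Hf Hg; rewrite /hn -big_split /=; apply: ler_sum => j _.
have js : (j <= s)%N by rewrite -ltnS.
by rewrite (DdD Hf Hg js); apply: nmD; [exact: L2_Dd Hf js|exact: L2_Dd Hg js].
Qed.
Lemma hnZ s r f : Hs s f -> hn s (Mcst (cr r) * f) = `|r| * hn s f.
Proof.
move=> Hf; rewrite /hn mulr_sumr; apply: eq_bigr => j _.
have js : (j <= s)%N by rewrite -ltnS.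
by rewrite (DdZ _ Hf js) nmZ //; exact: L2_Dd Hf js.
Qed.
Lemma hn_ii s f : Hs s f -> hn s (ii * f) = hn s f.
Proof.
move=> Hf; apply: eq_bigr => j _; have js : (j <= s)%N by rewrite -ltnS.
by rewrite (DdZ _ Hf js) nm_ii.
Qed.
Lemma hnN s f : Hs s f -> hn s (- f) = hn s f.
Proof.
move=> Hf; apply: eq_bigr => j _; have js : (j <= s)%N by rewrite -ltnS.
by rewrite (DdN Hf js) nmN.
Qed.
Lemma hnB s f g : Hs s f -> Hs s g -> hn s (f - g) <= hn s f + hn s g.
Proof. by move=> Hf Hg; rewrite -(hnN Hg); apply: hnD => //; exact: HsN. Qed.
Lemma hn_conj s f : Hs s f -> hn s (Mconj f) = hn s f.
Proof.
move=> Hf; have [_ E] := Hs_conj Hf; apply: eq_bigr => j _.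
by rewrite E ?nm_conj // -ltnS.
Qed.
Lemma hn_Tr s h f : Hs s f -> hn s (Tr h f) = hn s f.
Proof.
move=> Hf; have [_ E] := Hs_Tr h Hf; apply: eq_bigr => j _.
have js : (j <= s)%N by rewrite -ltnS.
by rewrite E ?nm_Tr //; exact: L2_Dd Hf js.
Qed.

Lemma bdd_hn f : Hs 1 f -> bdd f (Csob R * hn 1 f).
Proof.
move=> H; have d := dF_Dd1 H; rewrite (hn_dF _ d) (hn0 (Hs_L2 (HsS H))).
exact: sobolev_bdd.
Qed.

(** The asymmetry lets the induction start at m = 0, where f is only in L^2 and g is bounded by
    Sobolev. A derivative falling on either factor leaves a product of the same type. *)
Lemma Hs_bilin m : exists2 K, 0 <= K & forall f g, Hs m f -> Hs m.+1 g ->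
  Hs m (f * g) /\ hn m (f * g) <= K * (hn m f * hn m.+1 g).
Proof.
elim: m => [|m [K K0 IH]].
  exists (Csob R) => [|f g Hf Hg]; first exact: Csob_ge0.
  have b := bdd_hn Hg; have Lf := Hs_L2 Hf.
  have L : L2 (f * g) by rewrite mulrC; exact: L2M b Lf.
  split; first exact: Hs0.
  by rewrite !hn0 // mulrCA -mulrA -[leRHS]mulrC mulrC (mulrC f) [leRHS]mulrC mulrA; apply: nmM_bdd.
exists (Csob R + (K + K)) => [|f g Hf Hg]; first by rewrite !addr_ge0 ?Csob_ge0.
have Hf' := HsS Hf; have Hg' := HsS Hg.
have df := dF_Dd1 Hf; have dg := dF_Dd1 Hg; have d := dF_mul df dg.
have [H1 N1] := IH _ _ (Hs_le (leqnSn m) Hf) Hg'.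
have [H2 N2] := IH _ _ Hf' (Hs_le (leqnSn m.+1) Hg).
split; first exact: Hs_dF d (HsD H1 H2).
rewrite (hn_dF _ d); apply: le_trans (lerD (lexx _) (hnD H1 H2)) _.
have b := bdd_hn (Hs_le (isT : (1 <= m.+2)%N) Hg).
have n0 : nm (f * g) <= Csob R * hn 1 g * nm f by rewrite mulrC; exact: nmM_bdd b (Hs_L2 Hf).
have a1 : nm f <= hn m.+1 f := nm_le_hn _ (Hs_L2 Hf).
have a2 : hn 1 g <= hn m.+2 g by exact: hn_mono.
have a3 : hn m f <= hn m.+1 f by exact: hn_mono.
have a4 : hn m.+1 g <= hn m.+2 g by exact: hn_mono.
have a5 : hn m (Dd 1 f) <= hn m.+1 f by rewrite (hn_dF _ df) lerDr nm_ge0.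
have a6 : hn m.+1 (Dd 1 g) <= hn m.+2 g by rewrite (hn_dF _ dg) lerDr nm_ge0.
have p1 : nm (f * g) <= Csob R * (hn m.+1 f * hn m.+2 g).
  apply: le_trans n0 _; rewrite -mulrA ler_wpM2l ?Csob_ge0 // mulrC.
  by apply: ler_pM => //; [exact: nm_ge0|exact: hn_ge0].
have p2 : hn m (f * Dd 1 g) <= K * (hn m.+1 f * hn m.+2 g).
  by apply: le_trans N1 _; rewrite ler_wpM2l // ler_pM ?hn_ge0.
have p3 : hn m (Dd 1 f * g) <= K * (hn m.+1 f * hn m.+2 g).
  by apply: le_trans N2 _; rewrite ler_wpM2l // ler_pM ?hn_ge0.
rewrite !mulrDl; exact: lerD p1 (lerD p2 p3).
Qed.

(** In (f g)' each summand has one factor in H^m and one in H^(m+1), which is the case of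
    [Hs_bilin]. *)
Lemma Hs_alg m : exists2 K, 0 <= K & forall f g, Hs m.+1 f -> Hs m.+1 g ->
  Hs m.+1 (f * g) /\ hn m.+1 (f * g) <= K * (hn m.+1 f * hn m.+1 g).
Proof.
have [K K0 hK] := Hs_bilin m.
exists (Csob R + (K + K)) => [|f g Hf Hg]; first by rewrite !addr_ge0 ?Csob_ge0.
have Hf' := HsS Hf; have Hg' := HsS Hg.
have df := dF_Dd1 Hf; have dg := dF_Dd1 Hg; have d := dF_mul df dg.
have [H1 N1] := hK _ _ Hg' Hf; have [H2 N2] := hK _ _ Hf' Hg; rewrite (mulrC (Dd 1 g)) in H1 N1.
split; first exact: Hs_dF d (HsD H1 H2).
rewrite (hn_dF _ d); apply: le_trans (lerD (lexx _) (hnD H1 H2)) _.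
have b := bdd_hn (Hs_le (isT : (1 <= m.+1)%N) Hg).
have n0 : nm (f * g) <= Csob R * hn 1 g * nm f by rewrite mulrC; exact: nmM_bdd b (Hs_L2 Hf).
have a1 : nm f <= hn m.+1 f := nm_le_hn _ (Hs_L2 Hf).
have a2 : hn 1 g <= hn m.+1 g by exact: hn_mono.
have a5 : hn m (Dd 1 f) <= hn m.+1 f by rewrite (hn_dF _ df) lerDr nm_ge0.
have a6 : hn m (Dd 1 g) <= hn m.+1 g by rewrite (hn_dF _ dg) lerDr nm_ge0.
have p1 : nm (f * g) <= Csob R * (hn m.+1 f * hn m.+1 g).
  apply: le_trans n0 _; rewrite -mulrA ler_wpM2l ?Csob_ge0 // mulrC.
  by apply: ler_pM => //; [exact: nm_ge0|exact: hn_ge0].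
have p2 : hn m (f * Dd 1 g) <= K * (hn m.+1 f * hn m.+1 g).
  by apply: le_trans N1 _; rewrite ler_wpM2l // mulrC ler_pM ?hn_ge0.
have p3 : hn m (Dd 1 f * g) <= K * (hn m.+1 f * hn m.+1 g).
  by apply: le_trans N2 _; rewrite ler_wpM2l // ler_pM ?hn_ge0.
rewrite !mulrDl; exact: lerD p1 (lerD p2 p3).
Qed.

(** [W i] stands for the i-th derivative of V. The pointwise bound is asked of the derivatives only,
    V itself being given in L^infinity. *)
Definition smoothV (s : nat) (W : nat -> R -> R) (B : R) : Prop :=
  [/\ 0 <= B, forall i, (i < s)%N -> forall x : R, is_derive x 1 (W i) (W i.+1 x),
      forall i, (i <= s)%N -> bdd (rM (W i)) B &
      forall i, (0 < i <= s)%N -> forall x, `|W i x| <= B].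

(** Differentiation replaces [W i] by [W i.+1], hence the statement for all i with i + m <= s. K is
    fixed before s and W, so it also serves for the difference quotients of V. *)
Lemma Hs_rM (B : R) m : 0 <= B -> exists2 K, 0 <= K & forall s W i f, smoothV s W B -> (i + m <= s)%N -> Hs m f ->
  Hs m (rM (W i) * f) /\ hn m (rM (W i) * f) <= K * hn m f.
Proof.
move=> B0; elim: m => [|m [K K0 IH]].
  exists B => // s W i f [_ _ bW _]; rewrite addn0 => /bW b Hf; have Lf := Hs_L2 Hf.
  have L := L2M b Lf; split; first exact: Hs0.
  by rewrite !hn0 //; exact: nmM_bdd.
exists (B + (K + K)) => [|s W i f sV is_ Hf]; first by rewrite !addr_ge0.
have [_ dW bW hW] := sV.
have ilt : (i < s)%N by apply: leq_trans is_; rewrite addnS ltnS leq_addr.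
have df := dF_Dd1 Hf.
have bi := bW _ (ltnW ilt).
have d := dF_rM (dW i ilt) bi (hW _ _) df.
have {}d : dF (rM (W i) * f) (rM (W i) * Dd 1 f + rM (W i.+1) * f) by apply: d; rewrite ilt.
have [||H1 N1] := IH s W i (Dd 1 f) sV; [by apply: leq_trans is_; rewrite leq_add2l|exact: HsS|].
have [||H2 N2] := IH s W i.+1 f sV; [by rewrite addSnnS|exact: Hs_le Hf|].
split; first exact: Hs_dF d (HsD H1 H2).
rewrite (hn_dF _ d); apply: le_trans (lerD (lexx _) (hnD H1 H2)) _.
have n0 := nmM_bdd bi (Hs_L2 Hf); have a1 : nm f <= hn m.+1 f := nm_le_hn _ (Hs_L2 Hf).
have a3 : hn m f <= hn m.+1 f by exact: hn_mono.
have a5 : hn m (Dd 1 f) <= hn m.+1 f by rewrite (hn_dF _ df) lerDr nm_ge0.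
rewrite !mulrDl; apply: lerD; first exact: le_trans n0 (ler_wpM2l B0 a1).
by apply: lerD; [apply: le_trans N1 _|apply: le_trans N2 _]; rewrite ler_wpM2l.
Qed.

End Hs.

(** * Curves in L^2 and Gronwall arguments *)

Section Curves.
Variable R : realType.
Local Notation mu := (@lebesgue_measure R).
Local Notation C := R[i].
Local Notation Re := (@complex.Re R).
Local Notation Im := (@complex.Im R).
Local Notation M := (Mfun R).
Local Notation ii := (@ii R).
Local Notation kap := (@kap R).
Local Notation Fo := (@Fo R).
Local Notation h0 := (@h0 R).
Local Notation XM := (@XM R).
Implicit Types (f g : M) (a b : R -> M).

Definition ccont a : Prop := (forall t, L2 (a t)) /\
  forall t (e : R), 0 < e -> exists2 d : R, 0 < d & forall h, `|h| <= d -> nm (a (t + h) - a t) <= e.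
Definition cder a b : Prop := [/\ forall t, L2 (a t), forall t, L2 (b t) &
  forall t (e : R), 0 < e -> exists2 d : R, 0 < d &
    forall h, `|h| <= d -> nm (a (t + h) - a t - Mcst (cr h) * b t) <= e * `|h|].

Lemma cder_lip a b : cder a b -> forall t, exists2 d : R, 0 < d &
  forall h, `|h| <= d -> nm (a (t + h) - a t) <= (1 + nm (b t)) * `|h|.
Proof.
move=> [La Lb H] t; have [d d0 hd] := H t 1 ltr01; exists d => // h /hd h1.
have L1 := L2B (La (t + h)) (La t); have L2' := L2Z (cr h) (Lb t).
apply: le_trans (nm_sub L1 L2') _; rewrite nmZ //; lra.
Qed.

Lemma cder_cont a b : cder a b -> ccont a.
Proof.
move=> H; have [La Lb _] := H; split=> // t e e0; have [d d0 hd] := cder_lip H t.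
have K0 : 0 < 1 + nm (b t) by rewrite ltr_pwDl // nm_ge0.
exists (Num.min d (e / (1 + nm (b t)))); first by rewrite lt_min d0 divr_gt0.
move=> h; rewrite le_min ler_pdivlMr // => /andP[/hd h1 h2]; apply: le_trans h1 _.
by rewrite mulrC.
Qed.

Lemma cder_bdd m B a a' : bdd m B -> cder a a' -> cder (fun t => m * a t) (fun t => m * a' t).
Proof.
move=> bm [La La' Ha]; split=> [t|t|t e e0]; do ?exact: L2M bm _.
have B0 := bdd_ge0 bm; have B1 : 0 < B + 1 by rewrite ltr_wpDl.
have [d d0 hd] := Ha t _ (divr_gt0 e0 B1); exists d => // h /hd H.
have LA := L2B (L2B (La (t + h)) (La t)) (L2Z (cr h) (La' t)).
rewrite (_ : _ - _ = m * (a (t + h) - a t - Mcst (cr h) * a' t)); last by ring.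
apply: le_trans (nmM_bdd bm LA) _; move: H; rewrite mulrAC ler_pdivlMr //.
have := nm_ge0 (a (t + h) - a t - Mcst (cr h) * a' t); have := normr_ge0 h; nra.
Qed.

Lemma ccont_bdd m B a : bdd m B -> ccont a -> ccont (fun t => m * a t).
Proof.
move=> bm [La Ha]; split=> [t|t e e0]; first exact: L2M bm _.
have B0 := bdd_ge0 bm; have B1 : 0 < B + 1 by rewrite ltr_wpDl.
have [d d0 hd] := Ha t _ (divr_gt0 e0 B1); exists d => // h /hd H.
rewrite -mulrBr; apply: le_trans (nmM_bdd bm (L2B (La _) (La _))) _; move: H; rewrite ler_pdivlMr //.
have := nm_ge0 (a (t + h) - a t); nra.
Qed.

Lemma cder_rip a a' b b' (t : R) : cder a a' -> cder b b' ->
  is_derive t 1 (fun s => rip (a s) (b s)) (rip (a' t) (b t) + rip (a t) (b' t)).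
Proof.
move=> Ha Hb; have [La La' ha] := Ha; have [Lb Lb' hb] := Hb; apply: is_derive_eps => e e0.
have [_ ca] := cder_cont Ha.
pose K := nm (b t) + nm (a t) + nm (b' t) + 2; pose e1 := Num.min 1 (e / K).
have na := nm_ge0 (a t); have nb := nm_ge0 (b t); have nb' := nm_ge0 (b' t).
have K0 : 0 < K by rewrite /K; lra.
have e10 : 0 < e1 by rewrite lt_min ltr01 divr_gt0.
have [d1 d10 h1] := ha t _ e10; have [d2 d20 h2] := hb t _ e10; have [d3 d30 h3] := ca t _ e10.
exists (Num.min d1 (Num.min d2 d3)); first by rewrite !lt_min d10 d20.
move=> h _; rewrite !le_min => /and3P[/h1 H1 /h2 H2 /h3 H3].
set A := a (t + h) in H1 H3 *; set B := b (t + h) in H2 *.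
have LA : L2 A by exact: La. have LB : L2 B by exact: Lb.
set P := A - a t - Mcst (cr h) * a' t in H1; set Q := B - b t - Mcst (cr h) * b' t in H2.
have LP : L2 P by apply: L2B; [exact: L2B|exact: L2Z].
have LQ : L2 Q by apply: L2B; [exact: L2B|exact: L2Z].
have LD : L2 (A - a t) by exact: L2B.
have E : rip A B - rip (a t) (b t) - h * (rip (a' t) (b t) + rip (a t) (b' t)) =
    rip P (b t) + rip A Q + h * rip (A - a t) (b' t).
  have LZ := L2Z (cr h) (La' t); have LZ' := L2Z (cr h) (Lb' t).
  rewrite /P /Q (ripBl LD LZ) // (ripBl LA) // (ripBr (L2B LB (Lb t)) LZ') // (ripBr LB) // (ripBl LA (La t)) //.
  rewrite ripZl // ripZr //; ring.
rewrite E; apply: le_trans (ler_normD _ _) _; apply: le_trans (lerD (ler_normD _ _) (lexx _)) _.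
rewrite normrM; have c1 := CS LP (Lb t); have c2 := CS LA LQ; have c3 := CS LD (Lb' t).
have nA : nm A <= nm (a t) + 1.
  apply: le_trans (nm_sub LA (La t)) _; rewrite lerD2l; apply: le_trans H3 _.
  by rewrite /e1 ge_min lexx.
have eK : e1 * K <= e by rewrite -ler_pdivlMr // /e1 ge_min lexx orbT.
have hh := normr_ge0 h; have nP := nm_ge0 P; have nQ := nm_ge0 Q; have nD := nm_ge0 (A - a t).
have s1 : nm P * nm (b t) <= e1 * `|h| * nm (b t) by rewrite ler_wpM2r.
have s2 : nm A * nm Q <= (nm (a t) + 1) * (e1 * `|h|) by apply: ler_pM => //; exact: nm_ge0.
have s3 : `|h| * `|rip (A - a t) (b' t)| <= `|h| * (e1 * nm (b' t)).
  by rewrite ler_wpM2l // (le_trans c3) // ler_wpM2r.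
have s4 : e1 * K * `|h| <= e * `|h| by rewrite ler_wpM2r.
have s5 : 0 <= e1 * `|h| by rewrite mulr_ge0 // ltW.
rewrite /K in s4; nra.
Qed.

Lemma cont_eps (F : R -> R) : (forall t (e : R), 0 < e -> exists2 d : R, 0 < d &
  forall h, `|h| <= d -> `|F (t + h) - F t| <= e) -> continuous F.
Proof.
move=> H t; apply/cvgrPdist_le => e /(H t)[d d0 hd]; exists d => //= s /= hs.
by have := hd (s - t); rewrite subrKC !(distrC _ (F t)) (distrC s); apply; exact: ltW.
Qed.

Lemma ccont_rip a b : ccont a -> ccont b -> continuous (fun t => rip (a t) (b t)).
Proof.
move=> [La Ha] [Lb Hb]; apply: cont_eps => t e e0.
pose K := nm (b t) + nm (a t) + 2; pose e1 := Num.min 1 (e / K).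
have na := nm_ge0 (a t); have nb := nm_ge0 (b t).
have K0 : 0 < K by rewrite /K; lra.
have e10 : 0 < e1 by rewrite lt_min ltr01 divr_gt0.
have [d1 d10 h1] := Ha t _ e10; have [d2 d20 h2] := Hb t _ e10.
exists (Num.min d1 d2); first by rewrite !lt_min d10 d20.
move=> h; rewrite !le_min => /andP[/h1 H1 /h2 H2].
set A := a (t + h) in H1 *; set B := b (t + h) in H2 *.
have LA : L2 A by exact: La. have LB : L2 B by exact: Lb.
have E : rip A B - rip (a t) (b t) = rip (A - a t) (b t) + rip A (B - b t).
  rewrite ripBl // ripBr //; ring.
rewrite E; apply: le_trans (ler_normD _ _) _.
have c1 := CS (L2B LA (La t)) (Lb t); have c2 := CS LA (L2B LB (Lb t)).
have nA : nm A <= nm (a t) + 1.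
  apply: le_trans (nm_sub LA (La t)) _; rewrite lerD2l; apply: le_trans H1 _.
  by rewrite /e1 ge_min lexx.
have eK : e1 * K <= e by rewrite -ler_pdivlMr // /e1 ge_min lexx orbT.
have s1 : nm (A - a t) * nm (b t) <= e1 * nm (b t) by rewrite ler_wpM2r.
have s2 : nm A * nm (B - b t) <= (nm (a t) + 1) * e1 by apply: ler_pM => //; exact: nm_ge0.
rewrite /K in eK; nra.
Qed.

Lemma ccont_cst f : L2 f -> ccont (fun=> f).
Proof.
by move=> Lf; split=> // t e e0; exists 1 => // h _; rewrite subrr nm0 ltW.
Qed.

Lemma FTC_between (g y : R -> R) : continuous g ->
  (forall t, y t = y 0 + (if 0 <= t then 1 else -1) * \int[mu]_(x in `[Num.min 0 t, Num.max 0 t]) g x) ->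
  forall t : R, is_derive t 1 y (g t).
Proof.
(* A base point to the left of 0 and of a neighbourhood of t, so that a single primitive covers both
   signs of t. *)
move=> cg hy t; pose a := - (`|t| + 2).
have ig u : mu.-integrable `[a, u] (EFin \o g).
  apply: continuous_compact_integrable; first exact: segment_compact.
  exact: continuous_subspaceT.
pose G (x : R) := (\int[mu]_(s in [set` `[a, x]]) g s)%R.
have dG x : a < x -> derivable G x 1 /\ G^`()%classic x = g x.
  move=> ax; have xu : x < x + 1 by rewrite ltrDl.
  exact: (continuous_FTC1_closed xu (ig _) ax (cg x)).
have fdG (x : R) : a < x -> is_derive x 1 G (g x).
  by move=> /dG[d E]; rewrite -E derive1E; exact: DeriveDef.
have cG x : a < x -> {for x, continuous G}.
  by move=> /dG[d _]; apply: differentiable_continuous; exact/derivable1_diffP.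
have I2 p q : a < p -> p < q -> (\int[mu]_(x in `[p, q]) g x)%R = G q - G p.
  move=> ap pq; have aq := lt_trans ap pq; rewrite /Rintegral (@continuous_FTC2 _ g G) //=.
  - exact: continuous_subspaceT.
  - split; first by move=> x; rewrite in_itv /= => /andP[px _]; case: (dG x (lt_trans ap px)).
      by apply: cvg_at_right_filter; exact: cG.
    by apply: cvg_at_left_filter; exact: cG.
  - by move=> x; rewrite in_itv /= => /andP[px _]; case: (dG x (lt_trans ap px)).
have a0 : a < 0 by rewrite /a; have := normr_ge0 t; lra.
have Ey s : a < s -> y s = y 0 + (G s - G 0).
  move=> as_; rewrite hy; case: (ltgtP 0 s) => [s0|s0|<-].
  - by rewrite I2 // mul1r.
  - by rewrite I2 // mulN1r opprB.
  by rewrite set_itv1 Rintegral_set1 mulr0 subrr.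
have at_ : a < t by rewrite /a; have := ler_norm (- t); rewrite normrN; lra.
apply: (@is_derive_local _ y (fun s => y 0 + (G s - G 0)) t (g t) 1) => //.
  move=> h; rewrite ler_norml => /andP[h1 h2]; apply: Ey.
  by rewrite /a; have := ler_norm (- t); rewrite normrN; lra.
have d := fdG t at_.
have := is_deriveD (is_derive_cst (y 0) t (1 : R)) (is_deriveB d (is_derive_cst (G 0) t (1 : R))).
by move=> dd; apply: is_derive_eq dd _; rewrite subr0 add0r.
Qed.

Lemma gronwall1 (E E' A al : R -> R) (T : R) : (forall t : R, is_derive t 1 E (E' t)) ->
  (forall t : R, is_derive t 1 A (al t)) ->
  (forall t, 0 <= t <= T -> E' t <= al t * E t) ->
  forall t, 0 <= t <= T -> E t <= E 0 * expR (A t - A 0).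
Proof.
move=> dE dA h t /andP[t0 tT]; pose F x := E x * expR (- A x).
have dF (x : R) : is_derive x 1 F (E x * (expR (- A x) * - al x) + expR (- A x) * E' x).
  have d1 := @is_derive1_comp R expR (fun y => - A y) x _ _ (is_derive_expR (- A x)) (is_deriveN (dA x)).
  exact: (is_deriveM (dE x) d1).
have [c hc Ec] := mvt_ex dF 0 t.
move: hc; case: (leP 0 t) t0 => // t0 _ /andP[c0 ct].
have cT : 0 <= c <= T by rewrite c0 (le_trans ct).
have Ft : F t <= F 0.
  rewrite -subr_le0 Ec subr0; apply: mulr_le0_ge0 => //.
  have := h c cT; have := expR_ge0 (- A c); nra.
have := ler_wpM2r (expR_ge0 (A t)) Ft; rewrite /F -!mulrA -!expRD addNr expR0 mulr1.
by rewrite (addrC (- A 0)).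
Qed.

(** Backward times reduce to forward ones by t -> -t, hence the two-sided bound on E' and a rate
    depending on |t|. *)
Lemma gronwall (E E' A al : R -> R) (T : R) : (forall t : R, is_derive t 1 E (E' t)) ->
  (forall t : R, is_derive t 1 A (al t)) ->
  (forall t, `|t| <= T -> `|E' t| <= al `|t| * E t) ->
  forall t, `|t| <= T -> E t <= E 0 * expR (A `|t| - A 0).
Proof.
move=> dE dA h t tT; have [t0|t0] := leP 0 t.
  rewrite ger0_norm // in tT *; apply: (gronwall1 dE dA (T := T)); last by rewrite t0.
  move=> s /andP[s0 sT]; have := h s; rewrite ger0_norm // => /(_ sT).
  by rewrite ler_norml => /andP[].
have dE2 (s : R) : is_derive s 1 (fun x => E (- x)) (- E' (- s)).
  have d := @is_derive1_comp R E (fun y => - y) s _ _ (dE (- s)) (is_deriveNid s (1 : R)).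
  by apply: is_derive_eq d _; rewrite mulrN1.
have := gronwall1 dE2 dA (T := T) _ (t := `|t|); rewrite ltr0_norm // opprK oppr0; apply.
  move=> s /andP[s0 sT]; have := h (- s); rewrite normrN ger0_norm // => /(_ sT).
  by rewrite ler_norml => /andP[? ?]; lra.
by rewrite -ltr0_norm // normr_ge0.
Qed.

Definition qj (t : R) : R := Num.sqrt (jap t).
(** A primitive, bounded above, of an explicit majorant of <t>^(-3/2) on t >= 0. The derivative of -
    2 <t>^(-1/2) is t <t>^(-5/2), of the right size for large t; the arctangent supplies what is
    missing near 0. *)
Definition Aj (t : R) : R := atan t - 2 * (qj t)^-1.
Definition alj (t : R) : R := (1 + t ^+ 2)^-1 + t * (qj t)^-1 ^+ 5.

Lemma jap_ge1 (t : R) : 1 <= jap t.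
Proof. by rewrite /jap -{1}sqrtr1 ler_sqrt ?ler_wpDr ?ler01 ?sqr_ge0 // lerDl sqr_ge0. Qed.
Lemma qj_ge1 (t : R) : 1 <= qj t.
Proof. by rewrite /qj -{1}sqrtr1 ler_sqrt; [exact: jap_ge1|exact: le_trans ler01 (jap_ge1 t)]. Qed.
Lemma jap_sqr (t : R) : jap t ^+ 2 = 1 + t ^+ 2.
Proof. by rewrite sqr_sqrtr // addr_ge0 ?sqr_ge0. Qed.
Lemma qj_sqr (t : R) : qj t ^+ 2 = jap t.
Proof. by rewrite sqr_sqrtr // (le_trans ler01 (jap_ge1 t)). Qed.
Lemma jap_abs (t : R) : jap `|t| = jap t. Proof. by rewrite /jap real_normK ?num_real. Qed.

Lemma is_derive_jap (t : R) : is_derive t 1 (@jap R) (t / jap t).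
Proof.
have d1 : is_derive t 1 (fun s : R => 1 + s * s) (2 * t).
  have d := is_deriveD (is_derive_cst (1 : R) t (1 : R)) (is_deriveM (is_derive_id t (1 : R)) (is_derive_id t (1 : R))).
  by apply: is_derive_eq d _; rewrite /GRing.scale /=; ring.
have j1 := jap_ge1 t; have -> : t / jap t = (2 * jap t)^-1 * (2 * t) by field; lra.
have E : @jap R = fun s => Num.sqrt (1 + s * s) by apply/funext => s; rewrite /jap expr2.
rewrite [X in is_derive _ _ X _]E.
have e : jap t = Num.sqrt (1 + t * t) by rewrite /jap expr2.
rewrite e; apply: (@is_derive1_comp R Num.sqrt (fun s => 1 + s * s)).
by apply: is_derive1_sqrt; rewrite -expr2 ltr_pwDl ?sqr_ge0.
Qed.

Lemma is_derive_Aj (t : R) : is_derive t 1 Aj (alj t).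
Proof.
have j1 := jap_ge1 t; have q1 := qj_ge1 t.
have p0 : 0 < 1 + t ^+ 2 by rewrite ltr_pwDl ?sqr_ge0.
have dj := is_derive_jap t; rewrite (_ : t / jap t = (2 * jap t)^-1 * (2 * t)) in dj; last by field; lra.
have dq : is_derive t 1 qj ((2 * qj t)^-1 * ((2 * jap t)^-1 * (2 * t))).
  apply: (@is_derive1_comp R Num.sqrt (@jap R)).
  by apply: is_derive1_sqrt; lra.
have q0 : qj t != 0 by rewrite gt_eqF //; lra.
have dV := is_deriveV q0 dq.
have d2 := is_deriveB (is_derive1_atan t) (is_deriveZ 2 dV).
apply: is_derive_eq d2 _; rewrite /alj /GRing.scale /= -qj_sqr.
by congr (_ + _); field.
Qed.

Lemma alj_ge (t : R) : 0 <= t -> (qj t)^-1 ^+ 3 <= alj t.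
Proof.
move=> t0; have q1 := qj_ge1 t; have q0 : 0 < qj t by lra.
have E : 1 + t ^+ 2 = qj t ^+ 4 by rewrite -jap_sqr -qj_sqr -exprM.
rewrite /alj E; have j1 : jap t <= 1 + t.
  have := jap_sqr t; have := jap_ge1 t; nra.
have H : 0 <= (qj t)^-1 ^+ 5 * (qj t + t - qj t ^+ 2).
  by rewrite mulr_ge0 ?exprn_ge0 ?invr_ge0 ?(ltW q0) //; rewrite qj_sqr; lra.
rewrite -subr_ge0 (_ : _ - _ = (qj t)^-1 ^+ 5 * (qj t + t - qj t ^+ 2)) //.
by field; rewrite gt_eqF.
Qed.

(** The arctangent contributes at most pi / 2 < 2, the other term at most 2. *)
Lemma Aj_bound (t : R) : Aj t - Aj 0 <= 4.
Proof.
have q1 := qj_ge1 t; have q2 := qj_ge1 0.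
have : 0 <= (qj t)^-1 by rewrite invr_ge0; lra.
have : (qj 0)^-1 <= 1 by rewrite invf_le1 //; lra.
have := atan_ltpi2 t; rewrite /Aj atan0; have := pihalf_lt2 R; lra.
Qed.

End Curves.

(** * Continuous curves in H^m, the nonlinearity, weighted curves *)

Section Evolution.
Variable R : realType.
Local Notation mu := (@lebesgue_measure R).
Local Notation C := R[i].
Local Notation Re := (@complex.Re R).
Local Notation Im := (@complex.Im R).
Local Notation M := (Mfun R).
Local Notation ii := (@ii R).
Local Notation kap := (@kap R).
Local Notation Fo := (@Fo R).
Local Notation h0 := (@h0 R).
Local Notation XM := (@XM R).
Implicit Types (f g : M) (a b : R -> M).

Definition contH (s : nat) a : Prop := (forall t, Hs s (a t)) /\
  forall t (e : R), 0 < e -> exists2 d : R, 0 < d & forall h, `|h| <= d -> hn s (a (t + h) - a t) <= e.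

Lemma nm_XM_Fo s j f : Hs s f -> (j <= s)%N -> nm (XM ^+ j * Fo f) = Num.sqrt kap * nm (Dd j f).
Proof. by move=> H js; rewrite -(Fo_Dd H js) Fo_nm //; exact: L2_Dd H js. Qed.

Lemma contH_F s a : contH s a -> forall j, (j <= s)%N -> ccont (fun t => XM ^+ j * Fo (a t)).
Proof.
move=> [Ha ca] j js; split=> [t|t e e0]; first exact: (Ha t).2 j js.
have k0 : 0 < Num.sqrt kap by rewrite sqrtr_gt0 kap_gt0.
have [d d0 hd] := ca t _ (divr_gt0 e0 k0); exists d => // h /hd H.
have HB := HsB (Ha (t + h)) (Ha t).
rewrite -mulrBr -FoB; [|exact: (Ha _).1|exact: (Ha _).1].
rewrite (nm_XM_Fo HB js) mulrC -ler_pdivlMr //; apply: le_trans H; exact: nm_Dd_le.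
Qed.

Lemma contH_ofF s a : (forall t, L2 (a t)) -> (forall j, (j <= s)%N -> ccont (fun t => XM ^+ j * Fo (a t))) ->
  contH s a.
Proof.
move=> La H; have Ha t : Hs s (a t) by split=> // j js; have [h _] := H j js.
split=> // t e e0; suff HH r : (r <= s)%N -> forall e : R, 0 < e ->
    exists2 d : R, 0 < d & forall h, `|h| <= d -> hn r (a (t + h) - a t) <= e by exact: HH.
have k0 : 0 < Num.sqrt kap by rewrite sqrtr_gt0 kap_gt0.
have one j : (j <= s)%N -> forall e : R, 0 < e ->
    exists2 d : R, 0 < d & forall h, `|h| <= d -> nm (Dd j (a (t + h) - a t)) <= e.
  move=> js e1 e10; have [_ c] := H j js; have [d d0 hd] := c t _ (mulr_gt0 k0 e10).
  exists d => // h /hd; rewrite -mulrBr -FoB // (nm_XM_Fo (HsB (Ha _) (Ha _)) js).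
  by rewrite ler_pM2l.
elim: r => [_|r IH rs] e1 e10.
  have [d d0 hd] := one 0%N (leq0n s) _ e10; exists d => // h /hd.
  by rewrite hn0 ?Dd0 //; exact: L2B.
have e2 : 0 < e1 / 2 by rewrite divr_gt0.
have [d1 d10 h1] := IH (ltnW rs) _ e2; have [d2 d20 h2] := one _ rs _ e2.
exists (Num.min d1 d2); first by rewrite lt_min d10.
by move=> h; rewrite le_min => /andP[/h1 ? /h2 ?]; rewrite hnS (splitr e1) lerD.
Qed.

Lemma contH_le s r a : (r <= s)%N -> contH s a -> contH r a.
Proof.
move=> rs [Ha ca]; split=> [t|t e /(ca t)[d d0 hd]]; first exact: Hs_le rs (Ha t).
by exists d => // h /hd; apply: le_trans; exact: hn_mono.
Qed.

Lemma contHD s a b : contH s a -> contH s b -> contH s (fun t => a t + b t).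
Proof.
move=> [Ha ca] [Hb cb]; split=> [t|t e e0]; first exact: HsD.
have e2 : 0 < e / 2 by rewrite divr_gt0.
have [d1 d10 h1] := ca t _ e2; have [d2 d20 h2] := cb t _ e2.
exists (Num.min d1 d2); first by rewrite lt_min d10.
move=> h; rewrite le_min => /andP[/h1 H1 /h2 H2].
rewrite (_ : _ - _ = (a (t + h) - a t) + (b (t + h) - b t)); last by ring.
by apply: le_trans (hnD (HsB (Ha _) (Ha _)) (HsB (Hb _) (Hb _))) _; rewrite (splitr e) lerD.
Qed.

Lemma contH_op s r (T : M -> M) a (K : R) : 0 <= K -> (forall f, Hs s f -> Hs r (T f) /\ hn r (T f) <= K * hn s f) ->
  (forall f g, Hs s f -> Hs s g -> T (f - g) = T f - T g) -> contH s a -> contH r (fun t => T (a t)).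
Proof.
move=> K0 hT TB [Ha ca]; split=> [t|t e e0]; first by have [] := hT _ (Ha t).
have K1 : 0 < K + 1 by rewrite ltr_wpDl.
have [d d0 hd] := ca t _ (divr_gt0 e0 K1); exists d => // h /hd.
rewrite -TB // ler_pdivlMr // => H; have [_ hh] := hT _ (HsB (Ha (t + h)) (Ha t)).
apply: le_trans hh _; have := hn_ge0 s (a (t + h) - a t); nra.
Qed.

Lemma contH_conj s a : contH s a -> contH s (fun t => Mconj (a t)).
Proof.
apply: (contH_op (T := @Mconj R) ler01) => [f Hf|f g _ _]; last exact: MconjB.
by split; [have [] := Hs_conj Hf|rewrite mul1r hn_conj].
Qed.

Lemma contH_Zr s (r : R) a : contH s a -> contH s (fun t => Mcst (cr r) * a t).
Proof.
apply: (contH_op (T := fun f => Mcst (cr r) * f) (normr_ge0 r)) => [f Hf|f g _ _]; last by rewrite mulrBr.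
by split; [exact: HsZ|rewrite hnZ].
Qed.

Lemma contH_mul m a b : contH m.+1 a -> contH m.+1 b -> contH m.+1 (fun t => a t * b t).
Proof.
move=> [Ha ca] [Hb cb]; have [K K0 hK] := Hs_alg R m.
split=> [t|t e e0]; first by have [] := hK _ _ (Ha t) (Hb t).
pose A := hn m.+1 (a t) + 1; pose B := hn m.+1 (b t).
have A0 : 0 < A by rewrite ltr_wpDl ?hn_ge0.
have B0 : 0 <= B by exact: hn_ge0.
pose e1 := Num.min 1 (e / (K * (A + B) + 1)).
have D0 : 0 < K * (A + B) + 1 by rewrite ltr_wpDl // mulr_ge0 // addr_ge0 // ltW.
have e10 : 0 < e1 by rewrite lt_min ltr01 divr_gt0.
have [d1 d10 h1] := ca t _ e10; have [d2 d20 h2] := cb t _ e10.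
exists (Num.min d1 d2); first by rewrite lt_min d10.
move=> h; rewrite le_min => /andP[/h1 H1 /h2 H2].
have Ea : a (t + h) * b (t + h) - a t * b t = a (t + h) * (b (t + h) - b t) + (a (t + h) - a t) * b t by ring.
have HDa := HsB (Ha (t + h)) (Ha t); have HDb := HsB (Hb (t + h)) (Hb t).
have [P1 N1] := hK _ _ (Ha (t + h)) HDb; have [P2 N2] := hK _ _ HDa (Hb t).
rewrite Ea; apply: le_trans (hnD P1 P2) _.
have nA : hn m.+1 (a (t + h)) <= A.
  rewrite -[a (t + h)](subrK (a t)); apply: le_trans (hnD HDa (Ha t)) _.
  rewrite /A addrC lerD2l; apply: le_trans H1 _; by rewrite /e1 ge_min lexx.
have eK : e1 * (K * (A + B) + 1) <= e by rewrite -ler_pdivlMr // /e1 ge_min lexx orbT.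
have s1 : K * (hn m.+1 (a (t + h)) * hn m.+1 (b (t + h) - b t)) <= K * (A * e1).
  by rewrite ler_wpM2l // ler_pM ?hn_ge0.
have s2 : K * (hn m.+1 (a (t + h) - a t) * hn m.+1 (b t)) <= K * (e1 * B).
  by rewrite ler_wpM2l // ler_pM ?hn_ge0.
have := ltW e10; nra.
Qed.

(** |f|^(2k) f as a polynomial in f and its conjugate, so that the Leibniz rule applies and no
    modulus is differentiated. *)
Definition Nl (k : nat) f : M := (f * Mconj f) ^+ k * f.

Lemma contH_Nl m k a : contH m.+1 a -> contH m.+1 (fun t => Nl k (a t)).
Proof.
move=> ca; have cc := contH_conj ca; have c2 := contH_mul ca cc.
elim: k => [|k IH].
  by rewrite (_ : (fun t => _) = a) //; apply/funext => t; rewrite /Nl expr0 mul1r.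
rewrite (_ : (fun t => _) = (fun t => a t * Mconj (a t) * Nl k (a t))); last first.
  by apply/funext => t; rewrite /Nl exprS mulrA.
exact: contH_mul.
Qed.

Section Potential.
Variables (s k : nat) (lambda B : R) (W : nat -> R -> R).
Hypothesis hW : smoothV s W B.

Definition NN f : M := rM (W 0%N) * f + Mcst (cr lambda) * Nl k f.

Lemma contH_NN m a : (m.+1 <= s)%N -> contH m.+1 a -> contH m.+1 (fun t => NN (a t)).
Proof.
move=> ms ca; apply: contHD; last by apply: contH_Zr; exact: contH_Nl.
have [B0 _ _ _] := hW; have [K K0 hK] := Hs_rM m.+1 B0.
apply: (contH_op (T := fun f => rM (W 0%N) * f) K0) ca => [f Hf|f g _ _]; last by rewrite mulrBr.
exact: hK hW _ Hf.
Qed.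
End Potential.

Definition Em (t : R) : M := expi (fun xi : R => t * xi ^+ 2).
Lemma measurable_tsq (t : R) : measurable_fun setT (fun xi : R => t * xi ^+ 2).
Proof. by apply: measurable_funM => //; exact: measurable_funX. Qed.
Lemma EmD (t u : R) : Em (t + u) = Em t * Em u.
Proof.
rewrite /Em -expiD; [|exact: measurable_tsq|exact: measurable_tsq].
by congr expi; apply/funext => x; rewrite mulrDl.
Qed.
Lemma Em0 : Em 0 = 1.
Proof. by rewrite /Em -expi0; congr expi; apply/funext => x; rewrite mul0r. Qed.
Lemma bdd_Em t : bdd (Em t) 1. Proof. apply: bdd_expi; exact: measurable_tsq. Qed.
Lemma L2_Em t f : L2 f -> L2 (Em t * f). Proof. exact: L2M (bdd_Em t). Qed.
Lemma nm_Em t f : nm (Em t * f) = nm f. Proof. apply: nm_expi; exact: measurable_tsq. Qed.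
Lemma EmNE t : Em (- t) = expi (fun xi : R => - (t * xi ^+ 2)).
Proof. by rewrite /Em; congr expi; apply/funext => x; rewrite mulNr. Qed.
Lemma conj_Em t : Mconj (Em t) = Em (- t).
Proof. by rewrite EmNE /Em expi_conj //; exact: measurable_tsq. Qed.
Lemma EmK t f : Em (- t) * (Em t * f) = f.
Proof. by rewrite mulrA -EmD addNr Em0 mul1r. Qed.
Lemma EmKn t f : Em t * (Em (- t) * f) = f.
Proof. by rewrite mulrA -EmD addrN Em0 mul1r. Qed.

Lemma Em_tz h f : L2 f -> tends0 h -> tz (fun n => nm ((Em (h n) - 1) * f)).
Proof.
move=> Lf ht; have mm (a : R) : cmeas (fun x => cis (a * x ^+ 2)) by apply: cmeas_cis; exact: measurable_tsq.
apply: (@dct_nm _ _ _ (1 + cmod (1 : C))) => // [n|].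
  by apply: bddB; [exact: bdd_Em|exact: bdd_cst].
have E : {ae mu, forall x n, rep (Em (h n) - 1) x = cis (h n * x ^+ 2) - 1}.
  apply/ae_foralln => n; apply: aeS3 _ (repB (Em (h n)) 1) (rep_cst 1) (piE (mm (h n))) => x -> -> <-.
  by rewrite /Em expiE.
apply: aeS _ E => x h1.
apply: (ctends_small (K := 2 * x ^+ 2) ht) => n; rewrite h1 subr0.
apply: le_trans (cmod_le_ReIm _) _; rewrite /= subr0.
have dc (y : R) : is_derive y 1 (@cos R) (- sin y) by exact: is_derive_cos.
have := lip_of_deriv dc (B := 1) (fun x => _) 0 (h n * x ^+ 2); rewrite cos0 subr0 mul1r normrM => hl.
have {}hl : `|cos (h n * x ^+ 2) - 1| <= `|h n| * `|x ^+ 2| by apply: hl => y; rewrite normrN sin_max.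
have hx : `|x ^+ 2| = x ^+ 2 :> R by rewrite ger0_norm ?sqr_ge0.
rewrite hx in hl; have := norm_sin_le (h n * x ^+ 2); rewrite normrM hx; have := mulr_ge0 (normr_ge0 (h n)) (sqr_ge0 x); lra.
Qed.

Lemma ccont_Em a (sg : R) : ccont a -> ccont (fun t => Em (sg * t) * a t).
Proof.
move=> [La ca]; split=> [t|t e e0]; first exact: L2_Em.
have e2 : 0 < e / 2 by rewrite divr_gt0.
have [d1 d10 h1] := ca t _ e2.
have K0 : 0 < `|sg| + 1 by rewrite ltr_wpDl.
have [d2 d20 h2] := eps_of_tz (P := fun h => nm ((Em h - 1) * a t)) (fun h ht => Em_tz (La t) ht) e2.
exists (Num.min d1 (d2 / (`|sg| + 1))); first by rewrite lt_min d10 divr_gt0.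
move=> h; rewrite le_min ler_pdivlMr // => /andP[/h1 H1 hh].
have H2 : nm ((Em (sg * h) - 1) * a t) <= e / 2.
  have [->|sh0] := eqVneq (sg * h) 0; first by rewrite Em0 subrr mul0r nm0 ltW.
  apply: h2 => //; rewrite normrM; have := normr_ge0 h; nra.
rewrite (_ : _ - _ = Em (sg * (t + h)) * (a (t + h) - a t) + Em (sg * t) * ((Em (sg * h) - 1) * a t)); last first.
  by rewrite mulrDr EmD; ring.
have LA : L2 (a (t + h) - a t) by exact: L2B.
have LB : L2 ((Em (sg * h) - 1) * a t) by rewrite mulrBl mul1r; apply: L2B => //; exact: L2_Em.
apply: le_trans (nmD (L2_Em _ LA) (L2_Em _ LB)) _; rewrite !nm_Em (splitr e); exact: lerD.
Qed.

(** Duality with test functions of bounded support: against these, powers of [XM] are bounded and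
    can be moved across the inner product. *)
Lemma nm_dual_ind f (K : R) : L2 f -> 0 <= K ->
  (forall (n : nat) c, L2 c -> rip f (indM n%:R * c) <= K * nm c) -> nm f <= K.
Proof.
move=> Lf K0 h; have [f0|f0] := eqVneq (nm f) 0; first by rewrite f0.
have A : 0 < nm f by rewrite lt_def f0 nm_ge0.
rewrite -(ler_pM2r A) -expr2 -rip_nm.
apply: (tz_bound (tz_mul (nm_ge0 f) (indM_tz Lf))) => n.
have LI := L2_indM n%:R Lf; have := h n _ Lf.
have : rip f (f - indM n%:R * f) <= nm f * nm (f - indM n%:R * f).
  by apply: le_trans (ler_norm _) _; apply: CS => //; exact: L2B.
rewrite ripBr //; lra.
Qed.

Lemma bdd_indM_XMj (n j : nat) : bdd (indM n%:R * XM ^+ j) (n%:R ^+ j).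
Proof.
elim: j => [|j IH]; first by rewrite !expr0 mulr1; exact: bdd_indM.
rewrite -indM_idem [in X in bdd X]exprS (_ : _ * _ = (indM n%:R * XM) * (indM n%:R * XM ^+ j)); last by ring.
rewrite exprS; apply: bddM IH; [exact: ler0n|exact: bdd_indM_XM].
Qed.

Section Weighted.
Variables (Y Z : R -> M).
Hypothesis LY : forall t, L2 (Y t).
Hypothesis LZ : forall t, L2 (Z t).
Hypothesis dYZ : forall c, L2 c -> forall t : R, is_derive t 1 (fun s => rip (Y s) c) (rip (Z t) c).

(** The weight is moved to the test function, where it is bounded, and the scalar mean value theorem
    applies to [dYZ]. *)
Lemma weighted_mvt (j n : nat) t h c : L2 c ->
  exists2 tau, `|tau - t| <= `|h| &
    rip (XM ^+ j * (Y (t + h) - Y t)) (indM n%:R * c) = h * rip (XM ^+ j * Z tau) (indM n%:R * c).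
Proof.
move=> Lc; pose c' := Mconj (indM n%:R * XM ^+ j) * c.
have Lc' : L2 c' by apply: L2M Lc; apply: bdd_conj; exact: bdd_indM_XMj.
have E w : rip (XM ^+ j * w) (indM n%:R * c) = rip w c'.
  by rewrite rip_adj /c' MconjM conj_indM; congr rip; ring.
have [tau htau Et] := mvt_ex (dYZ Lc') t (t + h); exists tau.
  move: htau; have := ler_norm h; have := ler_norm (- h); rewrite normrN ler_norml.
  by case: (leP t (t + h)) => hh n1 n2 /andP[? ?]; apply/andP; split; lra.
by rewrite !E ripBl // Et mulrC (addrC t) addrK.
Qed.

(** From derivatives of scalar pairings to a derivative in the weighted norm: the mean value point
    depends on the test function but lies within |h| of t, where the weighted Z is uniformly close
    to its value at t. *)
Lemma weighted_cder (j : nat) : (forall t, L2 (XM ^+ j * Y t)) -> ccont (fun t => XM ^+ j * Z t) ->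
  cder (fun t => XM ^+ j * Y t) (fun t => XM ^+ j * Z t).
Proof.
move=> LXY [LXZ cXZ]; split=> // t e e0; have [d d0 hd] := cXZ t _ e0; exists d => // h hh.
have LD : L2 (XM ^+ j * Y (t + h) - XM ^+ j * Y t - Mcst (cr h) * (XM ^+ j * Z t)).
  by apply: L2B; [exact: L2B|exact: L2Z].
apply: nm_dual_ind => //; first by rewrite mulr_ge0 // ltW.
move=> n c Lc; have LI := L2_indM n%:R Lc.
have [tau tt E] := weighted_mvt j n t h Lc.
have LXD : L2 (XM ^+ j * (Y (t + h) - Y t)) by rewrite mulrBr; exact: L2B.
rewrite -mulrBr (ripBl LXD (L2Z _ (LXZ t)) LI) E ripZl // -mulrBr -ripBl //.
have H := hd (tau - t) (le_trans tt hh); rewrite subrKC in H.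
have LDZ := L2B (LXZ tau) (LXZ t).
apply: le_trans (ler_norm _) _; rewrite normrM -mulrA (mulrC e) -mulrA ler_wpM2l //.
apply: le_trans (CS LDZ LI) _; rewrite [leRHS]mulrC; apply: ler_pM; [exact: nm_ge0|exact: nm_ge0|exact: H|].
by have := nmM_bdd (bdd_indM n%:R) Lc; rewrite mul1r.
Qed.

Lemma weighted_lip (j : nat) (T K : R) : (forall t, L2 (XM ^+ j * Y t)) -> (forall t, L2 (XM ^+ j * Z t)) ->
  0 <= K -> (forall t, `|t| <= T -> nm (XM ^+ j * Z t) <= K) ->
  forall t h, `|t| + `|h| <= T -> nm (XM ^+ j * Y (t + h) - XM ^+ j * Y t) <= K * `|h|.
Proof.
move=> LXY LXZ K0 hK t h th; apply: nm_dual_ind; [exact: L2B|by rewrite mulr_ge0|].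
move=> n c Lc; have LI := L2_indM n%:R Lc.
have [tau tt E] := weighted_mvt j n t h Lc.
rewrite -mulrBr E; apply: le_trans (ler_norm _) _; rewrite normrM (mulrC K) -mulrA ler_wpM2l //.
apply: le_trans (CS (LXZ tau) LI) _; apply: ler_pM => //; do ?exact: nm_ge0.
  apply: hK; have := ler_normD (tau - t) t; rewrite subrK; lra.
by have := nmM_bdd (bdd_indM n%:R) Lc; rewrite mul1r.
Qed.
End Weighted.

End Evolution.

(** * Regularity of the solution *)

Section Solution.
Variable R : realType.
Local Notation mu := (@lebesgue_measure R).
Local Notation C := R[i].
Local Notation Re := (@complex.Re R).
Local Notation Im := (@complex.Im R).
Local Notation M := (Mfun R).
Local Notation ii := (@ii R).
Local Notation kap := (@kap R).
Local Notation Fo := (@Fo R).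
Local Notation h0 := (@h0 R).
Local Notation XM := (@XM R).

Lemma nm_Sobolev1 (f : R -> C) : in_Sobolev 1 f -> Hs 1 (pi f) /\
  Sobolev_norm2 1 f = (nm (pi f) ^+ 2 + nm (Dd 1 (pi f)) ^+ 2)%:E.
Proof.
move=> /in_SobolevP[mf [F [c F0]]]; have [H E] := chain_Hs c; rewrite F0 in H E.
split=> //; rewrite (Sobolev_norm2E mf c F0) !big_ord_recr big_ord0 /= add0r.
by rewrite F0 (E 1%N).
Qed.

Lemma contH_of_H1 (u : R -> R -> C) : continuous_in_H1 u ->
  (forall t, cmeas (u t)) /\ contH 1 (fun t => pi (u t)).
Proof.
move=> [hu hc]; have mu_ t : cmeas (u t) by have /in_SobolevP[] := hu t.
split=> //; have H1 t : Hs 1 (pi (u t)) by have [] := nm_Sobolev1 (hu t).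
split=> // t0 e e0; have e2 : 0 < e / 2 by rewrite divr_gt0.
have H : nbhs t0 [set t | (Sobolev_norm2 1 (fun x => (u t x - u t0 x)%R) < ((e / 2) ^+ 2)%:E)%E].
  exact: (ecvg0_lt _ (hc t0) (exprn_gt0 2 e2)).
move/nbhs_ballP: H => [d d0 hd].
exists (d / 2); first exact: divr_gt0.
move=> h hh; have : ball t0 d (t0 + h).
  by rewrite /ball /= opprD addrA subrr sub0r normrN; apply: le_lt_trans hh _; rewrite ltr_pdivrMr // ltr_pMr // ltrDl.
move=> /hd /=; have piB : pi (fun x => u (t0 + h) x - u t0 x) = pi (u (t0 + h)) - pi (u t0).
  by rewrite piN // piD //; exact: cmeasN.
have HB := HsB (H1 (t0 + h)) (H1 t0).
have S1 : in_Sobolev 1 (fun x => u (t0 + h) x - u t0 x).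
  apply/in_SobolevP; split; first by apply: cmeasD => //; exact: cmeasN.
  by exists (fun j => Dd j (pi (u (t0 + h)) - pi (u t0))); split; [exact: Hs_chain|rewrite Dd0 ?piB //; exact: Hs_L2 HB].
have [_ ->] := nm_Sobolev1 S1; rewrite piB lte_fin.
rewrite /hn !big_ord_recr big_ord0 /= add0r (Dd0 (Hs_L2 HB)).
have := nm_ge0 (pi (u (t0 + h)) - pi (u t0)); have := nm_ge0 (Dd 1 (pi (u (t0 + h)) - pi (u t0))).
set p := nm _; set q := nm _ => p0 q0 hpq.
have hp : p <= e / 2 by rewrite -(@ler_pXn2r _ 2) ?nnegrE ?(ltW e2) //; have := sqr_ge0 q; lra.
have hq : q <= e / 2 by rewrite -(@ler_pXn2r _ 2) ?nnegrE ?(ltW e2) //; have := sqr_ge0 p; lra.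
lra.
Qed.

Lemma Lfun_infty (V : R -> R) : V \in Lfun mu +oo%E -> measurable_fun setT V /\
  exists2 B, 0 <= B & bdd (rM V) B.
Proof.
rewrite inE => /andP[/[!inE] mV hf]; split=> //.
have mT : (0 < mu [set: R])%E.
  apply: (@lt_le_trans _ _ (mu `[0 : R, 1])).
    by rewrite lebesgue_measure_itv /= lte_fin ltr01 oppr0 adde0 lte_fin.
  by apply: le_measure; rewrite ?inE.
move: hf; rewrite /finite_norm unlock /Lnorm mT => hf.
pose G x : R := `|V x|.
have [B hB] := ess_supr_bounded (hf : (ess_sup mu (EFin \o G) < +oo)%E).
exists `|B| => //; apply: aeS2 _ hB (rep_rM mV) => x h ->.
by rewrite cmod_real (le_trans h) // ler_norm.
Qed.

Lemma smoothV_of (s : nat) (V : R -> R) : V \in Lfun mu +oo%E ->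
  (forall j : nat, (j < s)%N -> forall x : R, derivable (derive1n j V) x 1) ->
  (forall j : nat, (1 <= j <= s)%N ->
     exists2 K : R, 0 < K & forall x : R, `|derive1n j V x| <= K * (1 + `|x|)^-1) ->
  exists B, smoothV s (fun j => derive1n j V) B.
Proof.
move=> hV dV hd; have [mV [B0 B00 hB0]] := Lfun_infty hV.
have dW j : (j < s)%N -> forall x : R, is_derive x 1 (derive1n j V) (derive1n j.+1 V x).
  by move=> js x; rewrite derive1nS derive1E; apply: DeriveDef => //; exact: dV.
have mW j : (j <= s)%N -> measurable_fun setT (derive1n j V).
  case: j => // j js; have [_ m] := measurable_deriv (dW j js); exact: m.
have [B [BB hB]] : exists B, B0 <= B /\ forall j, (0 < j <= s)%N -> forall x, `|derive1n j V x| <= B.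
  suff H r : (r <= s)%N -> exists B, B0 <= B /\ forall j, (0 < j <= r)%N -> forall x, `|derive1n j V x| <= B by exact: H.
  elim: r => [_|r IH rs]; first by exists B0; split=> // -[|j].
  have [B [h1 h2]] := IH (ltnW rs); have [|K K0 hK] := hd r.+1; first by rewrite rs.
  exists (Num.max B K); split=> [|j]; first by rewrite le_max h1.
  rewrite (leq_eqVlt j) => /andP[j0 /orP[/eqP -> x|js x]]; rewrite le_max; last by rewrite h2 // j0.
  have x1 : 1 <= 1 + `|x| by rewrite lerDl.
  have x2 : (1 + `|x|)^-1 <= 1 by rewrite invf_le1 // (lt_le_trans ltr01).
  by apply/orP; right; apply: le_trans (hK x) _; rewrite ler_piMr ?(ltW K0).
exists B; split=> //; first exact: le_trans B00 BB.
move=> [|i] is_; first exact: bdd_le BB hB0.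
by apply: bdd_rM; [exact: mW|exact: hB].
Qed.

Lemma pi_source (k : nat) (lambda : R) (V : R -> R) (v : R -> C) : measurable_fun setT V -> cmeas v ->
  cmeas (source k lambda V v) /\
  pi (source k lambda V v) = NN k lambda (fun j => derive1n j V) (pi v).
Proof.
move=> mV mv; have mc := cmeas_conj mv; have mvc := cmeasM mv mc.
have mk : forall n, cmeas (fun x => (v x * (v x)^*) ^+ n) /\ (pi v * Mconj (pi v)) ^+ n = pi (fun x => (v x * (v x)^*) ^+ n).
  elim=> [|n [IH1 IH2]].
    split; first exact: (@cmeas_cst R 1).
    by rewrite expr0 -[1]/(Mcst 1) Mcst_pi.
  have E : (fun x => (v x * (v x)^*) ^+ n.+1) = (fun x => (v x * (v x)^*) * (v x * (v x)^*) ^+ n).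
    by apply/funext => x; rewrite exprS.
  by rewrite exprS IH2 Mconj_pi // piM // piM // E; split=> //; exact: cmeasM.
have [mk1 mk2] := mk k.
have mVc : cmeas (fun x => (V x)%:C) by exact: cmeas_real.
have m1 : cmeas (fun x => (V x)%:C * v x) by exact: cmeasM.
have m2 : cmeas (fun x => (v x * (v x)^*) ^+ k * v x) by exact: cmeasM.
have m3 : cmeas (fun x => cr lambda * ((v x * (v x)^*) ^+ k * v x)) by apply: cmeasM => //; exact: cmeas_cst.
have Es : source k lambda V v = fun x => (V x)%:C * v x + cr lambda * ((v x * (v x)^*) ^+ k * v x).
  apply/funext => x; rewrite /source.
  have -> : v x * (v x)^* = (cmod (v x) ^+ 2)%:C.
    by rewrite cmod_sqr; case: (v x) => p q; apply: Ceq; rewrite /csq /=; ring.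
  by rewrite rmorphD rmorphM /= mulrDl mulrA exprM rmorphXn.
rewrite Es; split; first exact: cmeasD.
rewrite /NN /Nl mk2 /rM derive1n0 Mcst_pi !piM //; last exact: cmeas_cst.
by rewrite piD.
Qed.

Section Duhamel.
Variables (s k : nat) (lambda : R) (V : R -> R) (f : R -> C) (u : R -> R -> C) (B : R).
Hypothesis hs : (1 <= s)%N.
Hypothesis mV : measurable_fun setT V.
Hypothesis hW : smoothV s (fun j => derive1n j V) B.
Hypothesis hf : in_L2 f.
Hypothesis hu : NLS_solution k lambda V f u.
Local Notation NN := (NN k lambda (fun j => derive1n j V)).

Let U t : M := pi (u t).
(** The transform of u(t) with the free evolution undone, so that the time derivative [Z] contains
    no second derivative of u. *)
Let Y t : M := Em t * Fo (U t).
Let Z t : M := ii * (Em t * Fo (NN (U t))).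

Lemma ccont_Z : ccont Z.
Proof.
have [h1 _ _] := hu; have [_ cU] := contH_of_H1 h1.
have cN := contH_NN k lambda hW (hs : (0.+1 <= s)%N) cU.
have c0 := contH_F cN (leq0n 1).
have {}c0 : ccont (fun t => Fo (NN (U t))).
  by rewrite (_ : (fun t => _) = (fun t => XM ^+ 0 * Fo (NN (U t)))) //; apply/funext => t; rewrite expr0 mul1r.
have c1 := ccont_Em 1 c0.
have := ccont_bdd (bdd_cst 'i) c1.
by congr ccont; apply/funext => t; rewrite mul1r.
Qed.

(** Duhamel's formula is given by duality, so it expresses each pairing of Y t with c as an integral
    in time; its integrand is continuous by [ccont_Z], and [FTC_between] differentiates it. *)
Lemma duhamel_deriv c : L2 c -> forall t : R, is_derive t 1 (fun s => rip (Y s) c) (rip (Z t) c).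
Proof.
move=> Lc; have [h1 h2 h3] := hu; have [mu_ cU] := contH_of_H1 h1.
have LU t : L2 (U t) := Hs_L2 (cU.1 t).
have cN := contH_NN k lambda hW (hs : (0.+1 <= s)%N) cU.
have LN t : L2 (NN (U t)) := Hs_L2 (cN.1 t).
have k0 : kap != 0 by rewrite gt_eqF // kap_gt0.
have LZ := ccont_Z.1; have /in_L2P[mf Lf] := hf.
have ms t := pi_source k lambda mV (mu_ t).
have hN t : in_L2 (source k lambda V (u t)).
  have [m E] := ms t; apply/in_L2P; split; [exact: m|rewrite E; exact: (LN t)].
have key t : rip (Y t) c = rip (Fo (pi f)) c +
    (if 0 <= t then 1 else -1) * \int[mu]_(x in `[Num.min 0 t, Num.max 0 t]) rip (Z x) c.
  have [D [hD _ hI] hut] := h3 t; have /in_L2P[mD LD] := hD.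
  have [hff Eff] := free_flowP t hf; have /in_L2P[mff Lff] := hff.
  have EU : U t = pi (free_flow t f) + ii * pi D.
    rewrite /ii Mcst_pi piM //; last exact: cmeas_cst.
    have mi : cmeas (fun x => 'i * D x) by apply: cmeasM => //; exact: cmeas_cst.
    by rewrite piD //; apply: pi_eq => //; exact: cmeasD.
  (* [e] is the adjoint of i [Em t] applied to c, and [hM] its inverse transform: up to [kap],
     pairing the Duhamel integral with [hM] gives its contribution to the pairing of Y t with c. *)
  pose e := - (ii * (Em (- t) * c)); pose hM := Fi e.
  have Le : L2 e by apply: L2N; apply: L2ii; exact: L2_Em.
  have LhM : L2 hM by exact: L2Fi.
  have [[iRe _] /(congr1 Re)] := hI _ (in_L2_rep LhM).
  have ReIn (a b : R -> C) : cmeas a -> cmeas b -> Re (L2inner a b) = rip (pi a) (pi b).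
    move=> ma mb; rewrite rip_pi // /L2inner /cintegral /=; apply: eq_Rintegral => x _ /=.
    by case: (a x) => p q; case: (b x) => p' q'; rewrite /rdot /=; ring.
  rewrite ReIn //; last exact: rep_meas.
  rewrite pi_rep => hz.
  have Lii : L2 (ii * Fo (pi D)) by apply: L2ii; exact: L2Fo.
  have E1 : rip (Y t) c = rip (Fo (pi f)) c + kap * rip (pi D) hM.
    rewrite /Y EU FoD //; last exact: L2ii.
    rewrite FoZ // Eff -EmNE mulrDr EmKn ripDl //; [|exact: L2Fo|exact: L2_Em].
    congr (_ + _); rewrite -Fo_rip // /hM FoK // rip_adj conj_Em rip_adj ii_conj mulNr //.
  rewrite E1 hz; congr (_ + _).
  have sg : forall z : C, Re ((if 0 <= t then 1 else -1) * z) = (if 0 <= t then 1 else -1) * Re z.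
    by move=> [p q]; case: ifP => _ /=; ring.
  rewrite sg /cintegral /= mulrCA; congr (_ * _).
  rewrite -RintegralZl //.
  - apply: eq_Rintegral => x _.
    transitivity (kap * Re (L2inner (free_flow (t - x) (source k lambda V (u x))) (rep hM))); first by [].
    have [hfx Efx] := free_flowP (t - x) (hN x); have /in_L2P[mfx Lfx] := hfx.
    rewrite ReIn //; last exact: rep_meas.
    rewrite pi_rep -Fo_rip // Efx (ms x).2 /hM FoK // -EmNE /e.
    rewrite (_ : - (ii * (Em (- t) * c)) = Mconj (ii * Em t) * c); last first.
      by rewrite MconjM ii_conj conj_Em; ring.
    by rewrite -rip_adj -mulrA (mulrA (Em t)) -EmD (_ : t + - (t - x) = x) //; ring.
move=> t; apply: (@FTC_between R (fun t => rip (Z t) c) (fun t => rip (Y t) c)).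
  have cc := ccont_cst Lc; exact: ccont_rip ccont_Z cc.
move=> t'; rewrite key (key 0); congr (_ + _).
by rewrite minxx maxxx set_itv1 Rintegral_set1 mulr0 addr0.
Qed.

Lemma U0 : U 0 = pi f.
Proof.
have [h1 h2 _] := hu; have [mu_ _] := contH_of_H1 h1; have /in_L2P[mf _] := hf.
exact: pi_eq.
Qed.
End Duhamel.

End Solution.

(** * Persistence of H^s regularity *)

Section Persistence.
Variable R : realType.
Local Notation mu := (@lebesgue_measure R).
Local Notation C := R[i].
Local Notation Re := (@complex.Re R).
Local Notation Im := (@complex.Im R).
Local Notation M := (Mfun R).
Local Notation ii := (@ii R).
Local Notation kap := (@kap R).
Local Notation Fo := (@Fo R).
Local Notation h0 := (@h0 R).
Local Notation XM := (@XM R).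
Implicit Types f g : M.

(** On a ball of the algebra H^(m+1) a polynomial is bounded, and by [dqM] its difference quotient
    is controlled linearly by that of f. *)
Lemma Nl_bound m k (A : R) : 0 <= A -> exists2 K, 0 <= K & forall f, Hs m.+1 f -> hn m.+1 f <= A ->
  [/\ Hs m.+1 (Nl k f), hn m.+1 (Nl k f) <= K &
      forall h, hn m.+1 (dq h (Nl k f)) <= K * hn m.+1 (dq h f)].
Proof.
move=> A0; have [K K0 hK] := Hs_alg R m; elim: k => [|k [L L0 IH]].
  exists (A + 1) => [|f Hf fA]; first by rewrite addr_ge0.
  rewrite /Nl expr0 mul1r; split=> // [|h]; first by lra.
  have := hn_ge0 m.+1 (dq h f); nra.
exists (K * (K * A * A) * L + K * (K * A + K * A) * L) => [|f Hf fA].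
  by rewrite addr_ge0 // !mulr_ge0 // addr_ge0 // mulr_ge0.
have [Hc Ec] := Hs_conj Hf; have [H1 N1 D1] := IH f Hf fA; have [H2 N2] := hK _ _ Hf Hc.
have E : Nl k.+1 f = f * Mconj f * Nl k f by rewrite /Nl exprS mulrA.
have n2 : hn m.+1 (f * Mconj f) <= K * A * A.
  apply: le_trans N2 _; rewrite (hn_conj Hf) -mulrA ler_wpM2l // ler_pM ?hn_ge0 //.
rewrite E; have [H3 N3] := hK _ _ H2 H1; split=> // [|h].
  apply: (@le_trans _ _ (K * (K * A * A) * L)); last first.
    by rewrite lerDl !mulr_ge0 // addr_ge0 // mulr_ge0.
  by apply: le_trans N3 _; rewrite -mulrA ler_wpM2l // ler_pM ?hn_ge0.
have Hd := Hs_dq h Hf; have Hdc := Hs_dq h Hc; have [HT _] := Hs_Tr h Hf.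
have [HT2 _] := Hs_Tr h H2; have Hdn := Hs_dq h H1; set q := hn m.+1 (dq h f).
have q0 : 0 <= q by exact: hn_ge0.
have qc : hn m.+1 (dq h (Mconj f)) = q by rewrite dq_conj hn_conj.
have [P1 M1] := hK _ _ HT Hdc; have [P2 M2] := hK _ _ Hd Hc.
rewrite hn_Tr // qc in M1; rewrite (hn_conj Hf) in M2.
have M3 : hn m.+1 (dq h (f * Mconj f)) <= (K * A + K * A) * q.
  rewrite dqM; apply: le_trans (hnD P1 P2) _; rewrite mulrDl; apply: lerD.
    by apply: le_trans M1 _; rewrite -mulrA ler_wpM2l // ler_wpM2r.
  by apply: le_trans M2 _; rewrite -mulrA ler_wpM2l // mulrC ler_wpM2r.
have Hdm := Hs_dq h H2; have [P3 M4] := hK _ _ HT2 Hdn; have [P4 M5] := hK _ _ Hdm H1.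
rewrite hn_Tr // in M4; rewrite dqM; apply: le_trans (hnD P3 P4) _; rewrite mulrDl; apply: lerD.
  apply: le_trans M4 _; rewrite -!mulrA ler_wpM2l // !mulrA -mulrA ler_pM ?hn_ge0 //.
apply: le_trans M5 _; rewrite -!mulrA ler_wpM2l // (mulrC L) mulrA ler_pM ?hn_ge0 //.
Qed.

Lemma contH_bounded (s : nat) (a : R -> M) (T : R) : contH s a ->
  exists2 A, 0 <= A & forall t, `|t| <= T -> hn s (a t) <= A.
Proof.
move=> [Ha ca]; have cn : continuous (fun t => hn s (a t)).
  apply: cont_eps => t e /(ca t)[d d0 hd]; exists d => // h /hd H.
  apply: le_trans H; have L := HsB (Ha (t + h)) (Ha t).
  have h1 : hn s (a (t + h)) <= hn s (a (t + h) - a t) + hn s (a t).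
    by rewrite -{1}(subrK (a t) (a (t + h))); exact: hnD.
  have h2 : hn s (a t) <= hn s (a (t + h) - a t) + hn s (a (t + h)).
    rewrite -(hnN L) -{1}(subrK (a (t + h)) (a t)) opprB; apply: hnD => //; exact: HsB.
  by rewrite ler_norml; apply/andP; split; lra.
have cp : {within `[- `|T|, `|T|], continuous (fun t => hn s (a t))} by exact: continuous_subspaceT.
have /compact_bounded[B0 [_ hB]] := continuous_compact cp (@segment_compact _ _ _).
exists (`|B0| + 1) => [|t tT]; first by rewrite addr_ge0.
apply: le_trans (ler_norm _) _; apply: (hB (`|B0| + 1)); first by apply: le_lt_trans (ler_norm _) _; rewrite ltrDl.
by exists t => //=; rewrite in_itv /= -ler_norml (le_trans tT) // ler_norm.
Qed.

Section Stage1.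
Variables (s k : nat) (lambda B : R) (W : nat -> R -> R) (U : R -> M).
Hypothesis hW : smoothV s W B.
Local Notation NN := (NN k lambda W).
Let Y t : M := Em t * Fo (U t).
Let Z t : M := ii * (Em t * Fo (NN (U t))).
Hypothesis hU0 : Hs s (U 0).
Hypothesis hd : forall c, L2 c -> forall t : R, is_derive t 1 (fun s => rip (Y s) c) (rip (Z t) c).

Lemma NN_bound m (A : R) : 0 <= A -> (m.+1 <= s)%N -> exists2 K, 0 <= K &
  forall f, Hs m.+1 f -> hn m.+1 f <= A -> Hs m.+1 (NN f) /\ hn m.+1 (NN f) <= K.
Proof.
move=> A0 ms; have [B0 _ _ _] := hW; have [K1 K10 h1] := Hs_rM m.+1 B0.
have [K2 K20 h2] := Nl_bound m k A0.
exists (K1 * A + `|lambda| * K2) => [|f Hf fA]; first by rewrite addr_ge0 // mulr_ge0.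
have [H1 N1] := h1 s W 0%N f hW ms Hf; have [H2 N2 _] := h2 f Hf fA.
split; first by apply: HsD => //; exact: HsZ.
apply: le_trans (hnD H1 (HsZ _ H2)) _; apply: lerD.
  by apply: le_trans N1 _; rewrite ler_wpM2l.
by rewrite hnZ // ler_wpM2l.
Qed.

(** The mean value theorem pays for the division by h with one derivative of V, uniformly in h. *)
Lemma smoothV_dq m h : (m.+1 <= s)%N -> h != 0 ->
  smoothV m (fun i x => h^-1 * (W i (x + h) - W i x)) B.
Proof.
move=> ms hn0; have [B0 dW bW WB] := hW.
have h1 : 0 < `|h| by rewrite normr_gt0.
have bd i : (i <= m)%N -> forall x, `|h^-1 * (W i (x + h) - W i x)| <= B.
  move=> im x; have is_ : (i < s)%N by apply: leq_ltn_trans im _.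
  rewrite normrM normfV mulrC ler_pdivrMr //.
  have := lip_of_deriv (dW i is_) (WB i.+1 is_) x (x + h).
  by rewrite addrAC subrr add0r.
have mW i : (i <= m)%N -> measurable_fun setT (W i).
  move=> im; have is_ : (i < s)%N by apply: leq_ltn_trans im _.
  by have [mi _] := measurable_deriv (dW i is_).
split=> // [i im x|i im|i /andP[_ im]]; last exact: bd.
- have is_ : (i < s)%N by apply: ltn_trans im _.
  have d1 : is_derive x 1 (fun y => W i (y + h)) (W i.+1 (x + h)).
    have da := is_deriveD (is_derive_id x (1 : R)) (is_derive_cst h x (1 : R)).
    have := @is_derive1_comp R (W i) (fun y => y + h) x _ _ (dW i is_ (x + h)) da.
    by move=> dd; apply: is_derive_eq dd _; rewrite addr0 mulr1.
  exact: (is_deriveZ h^-1 (is_deriveB d1 (dW i is_ x))).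
- apply: bdd_rM; last exact: bd.
  by apply: measurable_funM => //; apply: measurable_funB; [apply: measurable_shift|]; exact: mW.
Qed.

(** The 1 on the right is the quotient falling on the potential, which costs one derivative of V.
    The product with the translate of V is handled by translating [dq h f] back, multiplying by V,
    and translating again. *)
Lemma dq_NN m (A : R) : 0 <= A -> (m.+2 <= s)%N -> exists2 K, 0 <= K & forall f h, h != 0 ->
  Hs m.+1 f -> hn m.+1 f <= A -> hn m.+1 (dq h (NN f)) <= K * (1 + hn m.+1 (dq h f)).
Proof.
move=> A0 ms; have [B0 dW bW WB] := hW; have [K1 K10 h1] := Hs_rM m.+1 B0.
have [K2 K20 h2] := Nl_bound m k A0.
exists (K1 + K1 * A + `|lambda| * K2) => [|f h hn0 Hf fA].
  by rewrite !addr_ge0 // mulr_ge0.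
have s0 : (0 < s)%N by apply: leq_trans ms.
have [mW0 _] := measurable_deriv (dW 0%N s0).
have Hq := Hs_dq h Hf; set q := hn m.+1 (dq h f); have q0 : 0 <= q by exact: hn_ge0.
have [H1 N1] := h1 s W 0%N f hW (ltnW ms) Hf; have [H2 N2 D2] := h2 f Hf fA.
have EN : dq h (NN f) = dq h (rM (W 0%N) * f) + Mcst (cr lambda) * dq h (Nl k f).
  by rewrite /NN dqD; congr (_ + _); rewrite /dq TrM Tr_cst; ring.
have [HTq ETq] := Hs_Tr (- h) Hq.
have [P1 M1] := h1 s W 0%N (Tr (- h) (dq h f)) hW (ltnW ms) HTq.
have [PT _] := Hs_Tr h P1.
have ET : Tr h (rM (W 0%N) * Tr (- h) (dq h f)) = Tr h (rM (W 0%N)) * dq h f.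
  by rewrite TrM TrTr addrN Tr0.
have sV := smoothV_dq ms hn0.
have [P2 M2] := h1 _ _ 0%N f sV (leqnn _) Hf.
have Edq : rM (fun x => h^-1 * (W 0%N (x + h) - W 0%N x)) = dq h (rM (W 0%N)).
  have msh := measurable_shift h mW0.
  rewrite /dq Tr_rM // rMN // rMD //; last exact: measurableT_comp.
  by rewrite -rM_cst rMM //; apply: measurable_funB.
rewrite Edq in P2 M2.
rewrite EN; have HD : Hs m.+1 (dq h (Nl k f)) by exact: Hs_dq.
have E1 : dq h (rM (W 0%N) * f) = Tr h (rM (W 0%N) * Tr (- h) (dq h f)) + dq h (rM (W 0%N)) * f.
  by rewrite dqM ET.
rewrite E1; apply: le_trans (hnD (HsD PT P2) (HsZ _ HD)) _; rewrite hnZ //.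
have S1 := hnD PT P2; rewrite hn_Tr // in S1; rewrite hn_Tr // -/q in M1.
have S2 : hn m.+1 (dq h (rM (W 0%N)) * f) <= K1 * A by apply: le_trans M2 _; rewrite ler_wpM2l.
have S3 : `|lambda| * hn m.+1 (dq h (Nl k f)) <= `|lambda| * K2 * q by rewrite -mulrA ler_wpM2l.
have := mulr_ge0 K10 A0; have := mulr_ge0 (normr_ge0 lambda) K20; nra.
Qed.

Lemma L2_XY m t : Hs m (U t) -> forall j, (j <= m)%N -> L2 (XM ^+ j * Y t).
Proof. by move=> [_ H] j jm; rewrite /Y mulrCA; apply: L2_Em; exact: H. Qed.

Lemma ccont_XZ m j : (m.+1 <= s)%N -> contH m.+1 U -> (j <= m.+1)%N -> ccont (fun t => XM ^+ j * Z t).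
Proof.
move=> ms cU jm; have := ccont_bdd (bdd_cst 'i) (ccont_Em 1 (contH_F (contH_NN k lambda hW ms cU) jm)).
by congr ccont; apply/funext => t; rewrite mul1r /Z /ii; ring.
Qed.

Lemma cder_XY m j : (m.+1 <= s)%N -> contH m.+1 U -> (j <= m.+1)%N ->
  cder (fun t => XM ^+ j * Y t) (fun t => XM ^+ j * Z t).
Proof.
move=> ms cU jm; have [LZ cZ] := ccont_XZ ms cU (leq0n _).
have LZ0 t : L2 (Z t) by have := LZ t; rewrite expr0 mul1r.
have LY0 t : L2 (Y t) by have := L2_XY (cU.1 t) (leq0n _); rewrite expr0 mul1r.
apply: weighted_cder => //.
- by move=> t; apply: L2_XY (cU.1 t) _ jm.
- exact: ccont_XZ ms cU jm.
Qed.

Lemma is_derive_bigsum n (F F' : nat -> R -> R) (t : R) :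
  (forall j, (j < n)%N -> is_derive t 1 (F j) (F' j t)) ->
  is_derive t 1 (fun x => \sum_(j < n) F j x) (\sum_(j < n) F' j t).
Proof.
elim: n => [|n IH] h.
  rewrite big_ord0 (_ : (fun x => _) = cst 0); first exact: is_derive_cst.
  by apply/funext => x; rewrite big_ord0.
rewrite big_ord_recr (_ : (fun x => _) = (fun x => \sum_(j < n) F j x) + F n); last first.
  by apply/funext => x; rewrite big_ord_recr.
by apply: is_deriveD; [apply: IH => j jn; apply: h; exact: ltnW|exact: h].
Qed.

Lemma hn_sqr_le m f : hn m f ^+ 2 <= m.+1%:R * \sum_(j < m.+1) nm (Dd j f) ^+ 2.
Proof.
rewrite /hn; elim: m => [|m IH]; first by rewrite !big_ord_recr !big_ord0 /= !add0r mul1r.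
rewrite big_ord_recr [X in _ <= _ * X]big_ord_recr /=; set S := \sum_(i < m.+1) _ in IH *.
set Q := \sum_(i < m.+1) _ in IH *; set x := nm _.
have N0 : 0 <= m.+1%:R :> R by [].
have Q0 : 0 <= Q by apply: sumr_ge0 => j _; exact: sqr_ge0.
rewrite -[m.+2]addn1 natrD; set N := m.+1%:R in IH N0 *.
have N1 : 1 <= N by rewrite /N ler1n.
have key : 2 * S * x <= Q + N * x ^+ 2.
  have h1 : 0 <= (S - N * x) ^+ 2 by exact: sqr_ge0.
  have h2 : N * (2 * S * x) <= N * (Q + N * x ^+ 2) by nra.
  by move: h2; rewrite ler_pM2l //; lra.
nra.
Qed.

(** For fixed h the quotient has the regularity of u, so its H^(m+1) energy can be differentiated in
    time before u is known to be in H^(m+2). The bound is uniform in h because at time 0 it is one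
    by derivatives of the datum. *)
Lemma dq_U_bound m (T : R) : (m.+2 <= s)%N -> contH m.+1 U -> exists2 K, 0 <= K &
  forall h t, h != 0 -> `|t| <= T -> hn m.+1 (dq h (U t)) <= K.
Proof.
move=> ms cU; have ms1 := ltnW ms; have k0 := kap_gt0 R.
have [A A0 hA] := contH_bounded T cU; have [K K0 hK] := dq_NN A0 ms.
pose n : R := m.+2%:R; have n0 : 0 < n by [].
pose al := 2 * n * (K * (2 * n)).
pose E0 := \sum_(j < m.+2) nm (Dd j.+1 (U 0)) ^+ 2.
have E00 : 0 <= E0 by apply: sumr_ge0 => j _; exact: sqr_ge0.
pose Bd := n * ((E0 + 1) * expR (al * `|T|)); exists (Bd + 1) => [|h t hn0 tT].
  by rewrite addr_ge0 // mulr_ge0 ?(ltW n0) // mulr_ge0 ?expR_ge0 // addr_ge0.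
(* The Fourier symbol of [dq h]; bounded for fixed h, so it may be applied to the curve [Y]. *)
pose kp : M := Mcst (cr h^-1) * (modu h - 1).
have bk : bdd kp (cmod (cr h^-1) * (1 + cmod (1 : C))).
  apply: bddM; [exact: cmod_ge0|exact: bdd_cst|apply: bddB; [|exact: bdd_cst]].
  by apply: bdd_expi; exact: measurable_lin.
pose F j x := rip (kp * (XM ^+ j * Y x)) (kp * (XM ^+ j * Y x)).
pose F' j x := rip (kp * (XM ^+ j * Z x)) (kp * (XM ^+ j * Y x)) + rip (kp * (XM ^+ j * Y x)) (kp * (XM ^+ j * Z x)).
have dF_ j (x : R) : (j < m.+2)%N -> is_derive x 1 (F j) (F' j x).
  by move=> jm; have dk := cder_bdd bk (cder_XY ms1 cU jm); exact: (cder_rip x dk dk).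
have HU x := cU.1 x; have cN := contH_NN k lambda hW ms1 cU; have HN x := cN.1 x.
have nY j x : (j <= m.+1)%N -> nm (kp * (XM ^+ j * Y x)) = Num.sqrt kap * nm (Dd j (dq h (U x))).
  move=> jm; rewrite (_ : _ * _ = Em x * (XM ^+ j * Fo (dq h (U x)))); last first.
    by rewrite Fo_dq0 -/kp; [rewrite /Y; ring|exact: (HU x).1].
  by rewrite nm_Em; apply: nm_XM_Fo jm; exact: Hs_dq.
have nZ j x : (j <= m.+1)%N -> nm (kp * (XM ^+ j * Z x)) = Num.sqrt kap * nm (Dd j (dq h (NN (U x)))).
  move=> jm; rewrite (_ : _ * _ = ii * (Em x * (XM ^+ j * Fo (dq h (NN (U x)))))); last first.
    by rewrite Fo_dq0 -/kp; [rewrite /Z; ring|exact: (HN x).1].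
  by rewrite nm_ii nm_Em; apply: nm_XM_Fo jm; exact: Hs_dq.
have LY j x : (j <= m.+1)%N -> L2 (kp * (XM ^+ j * Y x)).
  by move=> jm; apply: L2M bk _; exact: L2_XY (HU x) _ jm.
have LZ j x : (j <= m.+1)%N -> L2 (kp * (XM ^+ j * Z x)).
  by move=> jm; apply: L2M bk _; have [] := ccont_XZ ms1 cU jm.
have sk : Num.sqrt kap * Num.sqrt kap = kap by rewrite -expr2 sqr_sqrtr // ltW.
(* The added 1 absorbs the inhomogeneous term of [dq_NN]. *)
pose E x := 1 + kap^-1 * \sum_(j < m.+2) F j x.
have dE (x : R) : is_derive x 1 E (kap^-1 * \sum_(j < m.+2) F' j x).
  have d := is_deriveD (is_derive_cst (1 : R) x (1 : R)) (is_deriveZ kap^-1 (is_derive_bigsum (fun j jm => dF_ j x jm))).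
  by apply: is_derive_eq d _; rewrite add0r.
have FE j x : (j <= m.+1)%N -> F j x = kap * nm (Dd j (dq h (U x))) ^+ 2.
  by move=> jm; rewrite /F rip_nm nY // exprMn [Num.sqrt kap ^+ 2]expr2 sk.
have EE x : E x = 1 + \sum_(j < m.+2) nm (Dd j (dq h (U x))) ^+ 2.
  rewrite /E mulr_sumr; congr (_ + _); apply: eq_bigr => j _.
  by rewrite FE ?mulKf ?gt_eqF // -ltnS.
have qE x : hn m.+1 (dq h (U x)) ^+ 2 <= n * (E x - 1).
  by rewrite EE addrAC subrr add0r; exact: hn_sqr_le.
have E1 x : 1 <= E x.
  by rewrite EE lerDl; apply: sumr_ge0 => j _; exact: sqr_ge0.
have dEb x : `|x| <= T -> `|kap^-1 * \sum_(j < m.+2) F' j x| <= al * E x.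
  move=> xT; have q0 := hn_ge0 m.+1 (dq h (U x)); set q := hn m.+1 (dq h (U x)) in q0 *.
  have p1 := hK _ _ hn0 (HU x) (hA x xT); set p := hn m.+1 (dq h (NN (U x))) in p1.
  have F'b j : (j <= m.+1)%N -> `|F' j x| <= kap * (2 * p * q).
    move=> jm; apply: le_trans (ler_normD _ _) _.
    have c1 := CS (LZ j x jm) (LY j x jm); rewrite [X in _ + `|X|]ripC.
    rewrite nY // nZ // in c1.
    have a1 : nm (Dd j (dq h (NN (U x)))) <= p by exact: nm_Dd_le.
    have a2 : nm (Dd j (dq h (U x))) <= q by exact: nm_Dd_le.
    have a3 : nm (Dd j (dq h (NN (U x)))) * nm (Dd j (dq h (U x))) <= p * q.
      by apply: ler_pM => //; exact: nm_ge0.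
    have c2 : `|rip (kp * (XM ^+ j * Z x)) (kp * (XM ^+ j * Y x))| <= kap * (p * q).
      apply: le_trans c1 _; rewrite [leLHS](_ : _ = Num.sqrt kap * Num.sqrt kap * (nm (Dd j (dq h (NN (U x)))) * nm (Dd j (dq h (U x))))); last by ring.
      by rewrite sk; exact: ler_wpM2l (ltW k0) _ _ a3.
    by rewrite (_ : kap * (2 * p * q) = kap * (p * q) + kap * (p * q)); [exact: lerD|ring].
  have Sb : `|\sum_(j < m.+2) F' j x| <= n * (kap * (2 * p * q)).
    apply: le_trans (ler_norm_sum _ _ _) _.
    rewrite (_ : n * _ = \sum_(j < m.+2) kap * (2 * p * q)); last by rewrite sumr_const card_ord -[RHS]mulr_natl.
    by apply: ler_sum => j _; apply: F'b; rewrite -ltnS.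
  have ki : 0 < kap^-1 by rewrite invr_gt0.
  rewrite normrM (gtr0_norm ki) mulrC ler_pdivrMr //.
  apply: le_trans Sb _; rewrite (_ : n * _ = kap * (2 * n * (p * q))); last by ring.
  rewrite [leRHS]mulrC ler_wpM2l ?(ltW k0) //.
  have pq : p * q <= K * ((1 + q) * q) by rewrite mulrA ler_wpM2r.
  have qq := qE x; rewrite -/q in qq; have e1 := E1 x.
  have n1 : 1 <= n by rewrite /n ler1n.
  have qb : (1 + q) * q <= 2 * n * E x by nra.
  apply: (@le_trans _ _ (2 * n * (K * ((1 + q) * q)))).
    by rewrite ler_wpM2l // mulr_ge0 // ltW.
  apply: (@le_trans _ _ (2 * n * (K * (2 * n * E x)))).
    by rewrite ler_wpM2l ?ler_wpM2l // mulr_ge0 // ltW.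
  by rewrite le_eqVlt; apply/orP; left; apply/eqP; rewrite /al; ring.
have E0b : E 0 <= 1 + E0.
  rewrite EE lerD2l; apply: ler_sum => j _.
  have jm : (j < s)%N by apply: leq_trans (ltn_ord j) ms.
  have d := dF_Dd hU0 jm; rewrite (Dd_dq _ (HU 0)) -1?ltnS //.
  by rewrite ler_pXn2r ?nnegrE ?nm_ge0 //; exact: nm_dq_le hn0 d.
have dA (x : R) : is_derive x 1 (fun y => al * y) al.
  have d := is_deriveZ al (is_derive_id x (1 : R)).
  by apply: is_derive_eq d _; rewrite /GRing.scale /= mulr1.
have := gronwall dE dA dEb tT; rewrite mulr0 subr0 => G.
have al0 : 0 <= al by rewrite /al !mulr_ge0 // ltW.
have G1 : E t <= (E0 + 1) * expR (al * `|T|).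
  apply: le_trans G _; apply: ler_pM; [by have := E1 0; lra|exact: expR_ge0|lra|].
  by rewrite ler_expR ler_wpM2l // (le_trans tT) // ler_norm.
have := qE t; have := hn_ge0 m.+1 (dq h (U t)); set q := hn _ _ => q0 q2.
have B1 : n * (E t - 1) <= Bd by rewrite /Bd ler_wpM2l ?(ltW n0) //; lra.
nra.
Qed.

(** Quotients bounded uniformly in h give one more derivative by [dF_of_dq], with a bound that is
    uniform on bounded times. Continuity at the new order then follows from the weighted Lipschitz
    estimate for [Y]. *)
Lemma stage1_step m : (m.+2 <= s)%N -> contH m.+1 U -> contH m.+2 U.
Proof.
move=> ms cU; have ms1 := ltnW ms; have HU x := cU.1 x.
have step (T : R) : exists2 K, 0 <= K & forall t, `|t| <= T -> Hs m.+2 (U t) /\ nm (Dd m.+2 (U t)) <= K.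
  have [K K0 hK] := dq_U_bound T ms cU; exists K => // t tT.
  have LD := L2_Dd (HU t) (leqnn _).
  have [g dg ng] : exists2 g, dF (Dd m.+1 (U t)) g & nm g <= K.
    apply: (dF_of_dq LD (@h0_tends R)) => n; have [hn0 _] := @h0_tends R n.
    rewrite -(Dd_dq _ (HU t) (leqnn _)); apply: le_trans (nm_Dd_le _ (leqnn _)) _.
    exact: hK.
  have [_ Lg Eg] := dg; rewrite (Fo_Dd (HU t) (leqnn _)) mulrA -exprS in Eg.
  have H2 : Hs m.+2 (U t).
    split; first exact: (HU t).1.
    move=> j; rewrite leq_eqVlt => /orP[/eqP ->|jm]; last exact: (HU t).2.
    by rewrite -Eg; exact: L2Fo.
  split=> //; rewrite /Dd -Eg FiK //.
have H2 t : Hs m.+2 (U t) by have [K _ hK] := step `|t|; have [] := hK t (lexx _).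
have LU t : L2 (U t) := Hs_L2 (HU t).
have [LZ _] := ccont_XZ ms1 cU (leq0n _).
have LZ0 t : L2 (Z t) by have := LZ t; rewrite expr0 mul1r.
have LY0 t : L2 (Y t) by have := L2_XY (HU t) (leq0n _); rewrite expr0 mul1r.
have HN2 t : Hs m.+2 (NN (U t)).
  by have [K _ hK] := NN_bound (hn_ge0 m.+2 (U t)) ms; have [] := hK (U t) (H2 t) (lexx _).
have LXY t : L2 (XM ^+ m.+2 * Y t) by exact: L2_XY (H2 t) _ (leqnn _).
have LXZ t : L2 (XM ^+ m.+2 * Z t).
  rewrite /Z (_ : _ * _ = ii * (Em t * (XM ^+ m.+2 * Fo (NN (U t))))); last by ring.
  by apply: L2ii; apply: L2_Em; exact: (HN2 t).2.
have cXY : ccont (fun t => XM ^+ m.+2 * Y t).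
  split=> // t e e0; pose T := `|t| + 1.
  have [K K0 hK] := step T; have [A A0 hA] := contH_bounded T cU.
  have [L L0 hL] := NN_bound (addr_ge0 A0 K0) ms.
  pose Q := Num.sqrt kap * L; have Q0 : 0 <= Q by rewrite mulr_ge0 ?sqrtr_ge0.
  have lip := weighted_lip LY0 hd (j := m.+2) (T := T) LXY LXZ Q0 _.
  have Q1 : 0 < Q + 1 by rewrite ltr_wpDl.
  exists (Num.min 1 (e / (Q + 1))); first by rewrite lt_min ltr01 divr_gt0.
  move=> h; rewrite le_min ler_pdivlMr // => /andP[h1 h2].
  apply: le_trans (lip _ t h _) _; last by have := normr_ge0 h; nra.
    move=> x xT; rewrite /Z (_ : _ * _ = ii * (Em x * (XM ^+ m.+2 * Fo (NN (U x))))); last by ring.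
    rewrite nm_ii nm_Em (nm_XM_Fo (HN2 x) (leqnn _)) /Q ler_wpM2l ?sqrtr_ge0 //.
    have hx : hn m.+2 (U x) <= A + K by rewrite hnS lerD ?hA //; have [] := hK x xT.
    by apply: le_trans (nm_Dd_le _ (leqnn _)) _; have [_] := hL (U x) (H2 x) hx.
  by rewrite /T lerD2l.
apply: contH_ofF => // j; rewrite leq_eqVlt => /orP[/eqP ->|jm]; last by apply: contH_F cU _ _.
have := ccont_Em (-1) cXY; congr ccont; apply/funext => t.
by rewrite /Y mulN1r mulrCA EmK.
Qed.

Lemma stage1 : (1 <= s)%N -> contH 1 U -> contH s U.
Proof.
move=> s1 c1; suff H m : (m.+1 <= s)%N -> contH m.+1 U by rewrite -(prednK s1); apply: H; rewrite prednK.
by elim: m => // m IH ms; apply: stage1_step => //; apply: IH; exact: ltnW.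
Qed.

End Stage1.
End Persistence.

(** * The nonlinear term *)

Section Nonlinear.
Variable R : realType.
Local Notation mu := (@lebesgue_measure R).
Local Notation C := R[i].
Local Notation Re := (@complex.Re R).
Local Notation Im := (@complex.Im R).
Local Notation M := (Mfun R).
Local Notation ii := (@ii R).
Local Notation kap := (@kap R).
Local Notation Fo := (@Fo R).
Local Notation h0 := (@h0 R).
Local Notation XM := (@XM R).
Implicit Types f g : M.

(** The least almost everywhere bound; 0 for an unbounded class, as the infimum of the empty set. *)
Definition ninf g : R := inf [set B | 0 <= B /\ bdd g B].
Lemma ninfP g B : bdd g B -> bdd g (ninf g) /\ ninf g <= B.
Proof.
move=> bB; have B0 := bdd_ge0 bB.
have hl : has_lbound [set B | 0 <= B /\ bdd g B] by exists 0 => y [].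
have hi : has_inf [set B | 0 <= B /\ bdd g B] by split=> //; exists B.
split; last by apply: ge_inf.
have E : {ae mu, forall x (n : nat), cmod (rep g x) <= ninf g + n.+1%:R^-1}.
  apply/ae_foralln => n; have n0 : 0 < n.+1%:R^-1 :> R by rewrite invr_gt0.
  have [y [y0 by_] hy] := inf_adherent n0 hi.
  by apply: aeS _ by_ => x h; apply: le_trans h (ltW hy).
apply: aeS _ E => x h; apply/ler_addgt0Pr => e e0; apply: le_trans (h (Num.truncn e^-1)) _.
rewrite lerD2l -[leRHS]invrK lef_pV2 ?posrE ?invr_gt0 //; apply: ltW.
exact: truncnS_gt.
Qed.
Lemma ninf_ge0 g : 0 <= ninf g.
Proof.
have [[B bB]|N] := pselect (exists B, bdd g B); first by have [/bdd_ge0] := ninfP bB.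
by rewrite /ninf (_ : [set _ | _] = set0) ?inf0 //; apply/seteqP; split=> // y [_ by_]; apply: N; exists y.
Qed.

(** Optimises d in [landau]: d = sqrt (x / z) turns the bound into 6 sqrt (x z), whence 36. If x or
    z is 0, a small or a large d shows that y = 0. *)
Lemma landau_mul f f' f'' : dF f f' -> dF f' f'' -> (exists B, bdd f'' B) ->
  ninf f' ^+ 2 <= 36 * ninf f * ninf f''.
Proof.
move=> d d' [B'' b'']; have [B bB] := dF_bdd d.
have [b0 _] := ninfP bB; have [b2 _] := ninfP b''.
have H e : 0 < e -> ninf f' <= 2 * (2 * ninf f / e + e * ninf f'').
  by move=> e0; have := landau d d' b0 b2 e0 => /ninfP[].
have a0 := ninf_ge0 f; have a1 := ninf_ge0 f'; have a2 := ninf_ge0 f''.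
move: H a0 a1 a2; set x := ninf f; set y := ninf f'; set z := ninf f'' => H x0 y0 z0.
have [x1|x1] := eqVneq x 0.
  suff -> : y = 0 by rewrite expr0n x1 mulr0 mul0r.
  apply/eqP; rewrite eq_le y0 andbT; apply/ler_addgt0Pr => e e0; rewrite add0r.
  have z1 : 0 < z + 1 by rewrite ltr_wpDl.
  have d0 : 0 < e / (2 * (z + 1)) by rewrite divr_gt0 // mulr_gt0.
  apply: le_trans (H _ d0) _; rewrite x1 mulr0 mul0r add0r mulrA.
  rewrite (_ : 2 * _ * z = e * (z / (z + 1))); last by field; rewrite gt_eqF.
  by rewrite ler_piMr ?(ltW e0) // ler_pdivrMr // mul1r lerDl.
have [z1|z1] := eqVneq z 0.
  suff -> : y = 0 by rewrite expr0n z1 mulr0.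
  apply/eqP; rewrite eq_le y0 andbT; apply/ler_addgt0Pr => e e0; rewrite add0r.
  have d0 : 0 < 4 * (x + 1) / e by rewrite divr_gt0 // mulr_gt0 // ltr_wpDl.
  apply: le_trans (H _ d0) _; rewrite z1 mulr0 addr0.
  rewrite (_ : 2 * _ = e * (x / (x + 1))); last by field; rewrite !gt_eqF // ltr_wpDl.
  by rewrite ler_piMr ?(ltW e0) // ler_pdivrMr ?mul1r ?lerDl // ltr_wpDl.
have {}x0 : 0 < x by rewrite lt_def x1.
have {}z0 : 0 < z by rewrite lt_def z1.
have d0 : 0 < Num.sqrt (x / z) by rewrite sqrtr_gt0 divr_gt0.
have := H _ d0; set e := Num.sqrt (x / z) in d0 *.
have ee : e ^+ 2 = x / z by rewrite sqr_sqrtr // divr_ge0 // ltW.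
have xe : x = e ^+ 2 * z by rewrite ee divfK.
have -> : 2 * (2 * x / e + e * z) = 6 * (e * z) by rewrite xe; field; rewrite gt_eqF.
move=> h; have : y ^+ 2 <= (6 * (e * z)) ^+ 2.
  by rewrite ler_pXn2r ?nnegrE // mulr_ge0 // mulr_ge0 // ltW.
by move=> h2; apply: le_trans h2 _; rewrite xe le_eqVlt; apply/orP; left; apply/eqP; ring.
Qed.

(** Moves a pair of indices apart by one on each side. The induction multiplies the inequality for
    (i, l) by the one at l + 1 and cancels a_l a_(l+1); if a_(l+1) = 0 the claim is trivial. *)
Lemma logconvex_shift (K : R) (a : nat -> R) r : 1 <= K -> (forall i, 0 <= a i) ->
  (forall i, (0 < i)%N -> (i < r)%N -> a i ^+ 2 <= K * a i.-1 * a i.+1) ->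
  forall n i, (0 < i)%N -> (i + n < r)%N -> a i * a (i + n)%N <= K ^+ n.+1 * a i.-1 * a (i + n).+1.
Proof.
move=> K1 a0 h; elim=> [|n IH] i i0; rewrite ?addn0 => ir; first by rewrite -expr2 expr1; exact: h.
have IH1 := IH i i0 (leq_trans (leqnSn _) (leq_trans (_ : _ < _)%N ir)).
have {IH1}IH1 : a i * a (i + n)%N <= K ^+ n.+1 * a i.-1 * a (i + n).+1.
  by apply: IH1; rewrite addnS ltnS.
have Hl := h (i + n.+1)%N (leq_trans i0 (leq_addr _ _)) ir; rewrite addnS /= in Hl ir *.
set l := (i + n)%N in IH1 Hl ir *.
have K0 : 0 <= K by lra.
have Kn0 : 0 <= K ^+ n.+2 by exact: exprn_ge0.
have [z|z] := eqVneq (a l.+1) 0.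
  by rewrite z mulr0; apply: mulr_ge0 => //; apply: mulr_ge0.
have {}z : 0 < a l.+1 by rewrite lt_def z a0.
have w : 0 < a l.
  rewrite lt_def a0 andbT; apply/eqP => w; move: Hl; rewrite w mulr0 mul0r => h2.
  by have := exprn_gt0 2 z; lra.
rewrite -(ler_pM2r (mulr_gt0 w z)).
have -> : a i * a l.+1 * (a l * a l.+1) = (a i * a l) * a l.+1 ^+ 2 by ring.
have -> : K ^+ n.+2 * a i.-1 * a l.+2 * (a l * a l.+1) = (K ^+ n.+1 * a i.-1 * a l.+1) * (K * a l * a l.+2).
  by rewrite exprS; ring.
by apply: ler_pM => //; [exact: mulr_ge0|exact: sqr_ge0].
Qed.

(** Moves the pair (i, l) apart until it is (0, i + l). With a_i the sup norm of the i-th derivative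
    of u, a product of derivatives is traded for the decaying a_0 and a single derivative. *)
Lemma logconvex_merge (K : R) (a : nat -> R) r : 1 <= K -> (forall i, 0 <= a i) ->
  (forall i, (0 < i)%N -> (i < r)%N -> a i ^+ 2 <= K * a i.-1 * a i.+1) ->
  forall i l, (i + l <= r)%N -> a i * a l <= (K ^+ r) ^+ r * a 0%N * a (i + l)%N.
Proof.
move=> K1 a0 h; have K0 : 0 <= K by lra.
have L1 : 1 <= K ^+ r by exact: exprn_ege1.
have main i l : (i <= l)%N -> (i + l <= r)%N -> a i * a l <= (K ^+ r) ^+ i * a 0%N * a (i + l)%N.
  elim: i l => [|i IH] l il ir; first by rewrite expr0 mul1r.
  have := logconvex_shift K1 a0 h (n := (l - i.+1)%N) (isT : (0 < i.+1)%N).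
  rewrite subnKC // => /(_ (leq_trans (leq_addl i _) (_ : (i + l.+1 <= r)%N))).
  rewrite addnS -addSn => /(_ ir) /= H1.
  have H2 := IH l.+1 (leq_trans (leqnSn i) (leq_trans il (leqnSn l))).
  rewrite addnS -addSn in H2; have {}H2 := H2 ir.
  have e1 : K ^+ (l - i.+1).+1 <= K ^+ r.
    apply: ler_weXn2l => //; rewrite -subSn // subSS; apply: leq_trans (leq_subr _ _) _.
    exact: leq_trans (leq_addl _ _) ir.
  apply: le_trans H1 _; rewrite -mulrA.
  apply: le_trans (ler_wpM2r _ e1) _; first exact: mulr_ge0.
  rewrite [(K ^+ r) ^+ i.+1]exprS -!mulrA ler_wpM2l ?exprn_ge0 //.
  by rewrite mulrA.
move=> i l ir.
have up n : (n <= r)%N -> (K ^+ r) ^+ n <= (K ^+ r) ^+ r by exact: ler_weXn2l.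
have [il|li] := leqP i l.
  apply: le_trans (main i l il ir) _; rewrite -!mulrA ler_wpM2r ?mulr_ge0 // up //.
  exact: leq_trans (leq_addr _ _) ir.
rewrite mulrC addnC in ir *; apply: le_trans (main l i (ltnW li) ir) _.
rewrite -!mulrA ler_wpM2r ?mulr_ge0 // up //; exact: leq_trans (leq_addr _ _) ir.
Qed.

(* A monomial is a list of (conjugated?, order of the derivative). *)
Notation mono := (seq (bool * nat)).
Definition fac f (x : bool * nat) : M := if x.1 then Mconj (Dd x.2 f) else Dd x.2 f.
Fixpoint mv f (m : mono) : M := if m is x :: m' then fac f x * mv f m' else 1.
Definition ev f (e : seq mono) : M := \sum_(m <- e) mv f m.
Definition up (x : bool * nat) := (x.1, x.2.+1).
Fixpoint dm (m : mono) : seq mono :=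
  if m is x :: m' then (up x :: m') :: map (cons x) (dm m') else [::].
Definition de (e : seq mono) : seq mono := flatten (map dm e).
Definition ord (m : mono) : nat := sumn (map snd m).

Lemma dm_cons x m : dm (x :: m) = (up x :: m) :: map (cons x) (dm m).
Proof. by []. Qed.
Lemma ev_cons f x e : ev f (map (cons x) e) = fac f x * ev f e.
Proof. by rewrite /ev big_map mulr_sumr. Qed.
Lemma ev_cat f e e' : ev f (e ++ e') = ev f e + ev f e'.
Proof. by rewrite /ev big_cat. Qed.

Lemma dm_spec m m' : m' \in dm m -> size m' = size m /\ ord m' = (ord m).+1.
Proof.
elim: m m' => // x m IH m' /=; rewrite inE => /orP[/eqP -> //|/mapP[m2 /IH[h1 h2] ->]].
by rewrite /= h1 /ord /= -/(ord m2) h2 addnS.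
Qed.

Lemma dF_fac j f x : Hs j f -> (x.2 < j)%N -> dF (fac f x) (fac f (up x)).
Proof.
move=> H xj; have d := dF_Dd H xj; rewrite /fac /=; case: x.1 => //.
exact: dF_conj.
Qed.

Lemma dF_mv j f m : Hs j f -> (0 < size m)%N -> (ord m < j)%N -> dF (mv f m) (ev f (dm m)).
Proof.
move=> H; elim: m => // x m IH _ mj.
have xj : (x.2 < j)%N by apply: leq_ltn_trans mj; rewrite /ord /= leq_addr.
have dx := dF_fac H xj; case: m IH mj => [|y m] IH mj.
  by rewrite /= /ev /= big_seq1 /= !mulr1.
have dm_ := IH isT (leq_ltn_trans (leq_addl x.2 _) mj).
rewrite dm_cons {1}/ev big_cons -!/(ev f _) ev_cons addrC; exact: dF_mul dx dm_.
Qed.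

Lemma dF0 : dF (0 : M) 0.
Proof.
split; [exact: L20|exact: L20|].
have E : Fo (0 : M) = 0.
  by rewrite -{1}(subrr (0 : M)) FoB ?subrr //; exact: L20.
by rewrite E mulr0.
Qed.

Lemma dF_ev j f n i e : Hs j f -> (0 < n)%N -> (i < j)%N ->
  (forall m, m \in e -> size m = n /\ ord m = i) -> dF (ev f e) (ev f (de e)).
Proof.
move=> H n0 ij; elim: e => [|m e IH] he; first by rewrite /ev /de /= !big_nil; exact: dF0.
rewrite /ev big_cons /de /= -!/(ev f _) ev_cat; apply: dFD.
  have [h1 h2] := he m (mem_head _ _); apply: dF_mv H _ _; [by rewrite h1|by rewrite h2].
by apply: IH => m' hm; apply: he; rewrite inE hm orbT.
Qed.

Definition mono0 (k : nat) : mono := flatten (nseq k [:: (false, 0%N); (true, 0%N)]) ++ [:: (false, 0%N)].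
Definition eN k i : seq mono := iter i de [:: mono0 k].

Lemma eN_spec k i m : m \in eN k i -> size m = (2 * k).+1 /\ ord m = i.
Proof.
elim: i m => [|i IH] m /=.
  rewrite inE => /eqP ->; rewrite /mono0; elim: k {m} => [|k [h1 h2]] //.
  by rewrite mulnS add2n /= -cat_cons h1 /ord /= -/(ord _) h2.
rewrite /de => /flatten_mapP[m' /IH[h1 h2] /dm_spec[-> ->]].
by rewrite h1 h2.
Qed.

Lemma mv_cat f m m' : mv f (m ++ m') = mv f m * mv f m'.
Proof. by elim: m => [|x m IH] /=; rewrite ?mul1r // IH mulrA. Qed.

Lemma ev_eN0 k f : L2 f -> ev f (eN k 0) = Nl k f.
Proof.
move=> Lf; rewrite /ev /= big_seq1 /mono0 mv_cat /Nl /= mulr1 [X in _ * X]/fac /= Dd0 //; congr (_ * _).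
elim: k => [|k IH] /=; first by rewrite expr0.
by rewrite IH /fac /= Dd0 // exprS mulrA.
Qed.

Lemma Hs_Nl j k f : Hs j f -> L2 (Nl k f) -> Hs j (Nl k f) /\
  forall i, (i <= j)%N -> Dd i (Nl k f) = ev f (eN k i).
Proof.
move=> H LN; have [|h1 h2] := @chain_Hs R j (fun i => ev f (eN k i)).
  split; first by rewrite ev_eN0 //; exact: Hs_L2 H.
  by move=> i ij; apply: (dF_ev H (n := (2 * k).+1) _ ij) => // m; exact: eN_spec.
by rewrite ev_eN0 in h1 h2; [split=> // i /h2|exact: Hs_L2 H..].
Qed.

Section Bounds.
Variables (j : nat) (f : M) (L Bc : R).
Hypothesis j0 : (0 < j)%N.
Hypothesis H : Hs j f.
Hypothesis L1 : 1 <= L.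
Hypothesis Bc1 : 1 <= Bc.
Let a i := ninf (Dd i f).
Let c i := nm (Dd i f).
Hypothesis merge : forall i l, (i + l < j)%N -> a i * a l <= L * a 0%N * a (i + l)%N.
Hypothesis hc : forall i, (i < j)%N -> c i <= Bc.

Lemma bdd_fac x : (x.2 < j)%N -> bdd (fac f x) (a x.2).
Proof.
move=> xj; have [B bB] := dF_bdd (dF_Dd H xj); have [b _] := ninfP bB.
by rewrite /fac; case: x.1 => //; exact: bdd_conj.
Qed.

Lemma a_le i : (i < j)%N -> a i <= 2 * Csob R * (Bc + c j).
Proof.
move=> ij; have d := dF_Dd H ij; have [_ h] := ninfP (sobolev_bdd d).
apply: le_trans h _; have C0 := Csob_ge0 R; have n0 : 0 <= c j by exact: nm_ge0.
have B1 := Bc1; have h1 := hc ij; have h2 : c i.+1 <= Bc + c j.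
  move: ij; rewrite leq_eqVlt => /orP[/eqP ->|/hc]; [by lra|by move=> h2; lra].
rewrite /c in h1 h2 n0 *; nra.
Qed.

(** Each merge of two orders costs a factor L and releases a factor a_0. *)
Lemma sup_mono m : (0 < size m)%N -> (ord m < j)%N ->
  bdd (mv f m) (L ^+ size m * a 0%N ^+ (size m).-1 * a (ord m)).
Proof.
have L0 : 0 <= L := le_trans ler01 L1.
have B1 := Bc1; have a0 i : 0 <= a i by exact: ninf_ge0.
elim: m => // x m IH _ mj; have xj : (x.2 < j)%N by apply: leq_ltn_trans mj; rewrite /ord /= leq_addr.
have bx := bdd_fac xj; case: m IH mj => [|y m] IH mj.
  rewrite /= mulr1 expr1 expr0 mulr1 /ord /= addn0; apply: bdd_le bx.
  by rewrite ler_peMl.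
have mj' : (ord (y :: m) < j)%N by apply: leq_ltn_trans mj; rewrite [ord (x :: _)]/ord /= leq_addl.
have bm := IH isT mj'; rewrite [mv f (x :: _)]/=; apply: bdd_le (bddM (a0 _) bx bm).
set p := size m; have -> : size [:: x, y & m] = p.+2 by [].
have -> : size (y :: m) = p.+1 by [].
have E : ord [:: x, y & m] = (x.2 + ord (y :: m))%N by [].
rewrite E /=; rewrite E in mj; have mg := merge mj.
rewrite (_ : a x.2 * _ = L ^+ p.+1 * a 0%N ^+ p * (a x.2 * a (ord (y :: m)))); last by ring.
rewrite (_ : L ^+ p.+2 * _ * _ = L ^+ p.+1 * a 0%N ^+ p * (L * a 0%N * a (x.2 + ord (y :: m))%N)); last first.
  by rewrite !exprS; ring.
by rewrite ler_wpM2l // mulr_ge0 // exprn_ge0.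
Qed.

Definition Qb : R := a 0%N + 2 * Csob R * Bc.

Lemma L2_fac x : (x.2 <= j)%N -> L2 (fac f x) /\ nm (fac f x) = c x.2.
Proof.
move=> xj; have LD := L2_Dd H xj; rewrite /fac; case: x.1 => //.
by rewrite nm_conj; split=> //; exact: L2conj.
Qed.

Definition mono_bound n := if n is p.+2 then a 0%N ^+ p * L ^+ n * Qb * (Bc + c j) else Bc + c j.
(** A factor of positive order goes to L^2 and the merged others to the sup norm. If it has the full
    order j the others are powers of a_0; otherwise the merged derivative is bounded by Sobolev, at
    the price of one decaying factor. A leading factor of order 0 is bounded by a_0 and the
    induction goes on. *)
Lemma nm_mono m : (0 < size m)%N -> ord m = j -> L2 (mv f m) /\ nm (mv f m) <= mono_bound (size m).
Proof.
have L0 : 0 <= L := le_trans ler01 L1.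
have B1 := Bc1; have a0 i : 0 <= a i by exact: ninf_ge0.
have c0 i : 0 <= c i by exact: nm_ge0.
have C0 := Csob_ge0 R.
have Q0 : 0 <= Qb by have := a0 0%N; have := mulr_ge0 C0 (le_trans ler01 B1); rewrite /Qb; lra.
elim: m => // x m IH _ mj.
have xj : (x.2 <= j)%N by rewrite -mj /ord /= leq_addr.
have [Lx nx] := L2_fac xj.
case: m IH mj => [|y m] IH mj.
  have E : x.2 = j by rewrite -mj /ord /= addn0.
  by rewrite /= mulr1 nx E; split=> //; rewrite /mono_bound; lra.
set p := size m; have E : ord [:: x, y & m] = (x.2 + ord (y :: m))%N by [].
rewrite E in mj; rewrite [mv f (x :: _)]/=.
have -> : size [:: x, y & m] = p.+2 by [].
have [x0|x0] := posnP x.2.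
  rewrite x0 add0n in mj; have [Lm nmm] := IH isT mj.
  have xj' : (x.2 < j)%N by rewrite x0.
  have bx := bdd_fac xj'; split; first exact: L2M bx Lm.
  apply: le_trans (nmM_bdd bx Lm) _; rewrite x0.
  apply: le_trans (ler_wpM2l (a0 _) nmm) _; have -> : size (y :: m) = p.+1 by [].
  rewrite /mono_bound; case: p => [|p].
    have S0 : 0 <= Bc + c j by have := c0 j; lra.
    rewrite expr0 mul1r; apply: (@ler_wpM2r _ (Bc + c j) S0 (a 0%N) (L ^+ 2 * Qb)).
    apply: (@le_trans _ _ Qb); first by have := mulr_ge0 C0 (le_trans ler01 B1); rewrite /Qb; lra.
    by rewrite ler_peMl // exprn_ege1.
  cbv iota.
  rewrite [leLHS](_ : _ = a 0%N ^+ p.+1 * (L ^+ p.+2 * Qb * (Bc + c j))); last by rewrite (exprS (a 0%N)); ring.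
  rewrite [leRHS](_ : _ = a 0%N ^+ p.+1 * (L * (L ^+ p.+2 * Qb * (Bc + c j)))); last by rewrite (exprS L); ring.
  apply: ler_wpM2l; first exact: exprn_ge0.
  have S0 : 0 <= Bc + c j by have := c0 j; lra.
  by rewrite ler_peMl //; apply: mulr_ge0 => //; apply: mulr_ge0 => //; exact: exprn_ge0.
have mj' : (ord (y :: m) < j)%N by rewrite -mj -[X in (X < _)%N]add0n ltn_add2r.
have bm := @sup_mono (y :: m) isT mj'.
rewrite mulrC; split; first exact: L2M bm Lx.
apply: le_trans (nmM_bdd bm Lx) _; rewrite nx.
have -> : size (y :: m) = p.+1 by [].
rewrite /mono_bound [p.+1.-1]/=.
have [xe|xe] := eqVneq x.2 j.
  have -> : ord (y :: m) = 0%N by apply/eqP; rewrite -(eqn_add2l x.2) addn0 mj xe.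
  rewrite xe (_ : L ^+ p.+1 * _ * _ * _ = a 0%N ^+ p * L ^+ p.+1 * (a 0%N * c j)); last by ring.
  rewrite (_ : _ * Qb * _ = a 0%N ^+ p * L ^+ p.+1 * (L * (Qb * (Bc + c j)))); last by rewrite (exprS _ p.+1); ring.
  rewrite ler_wpM2l ?mulr_ge0 ?exprn_ge0 //.
  have h1 : a 0%N * c j <= Qb * (Bc + c j).
    by apply: ler_pM => //; [have := mulr_ge0 C0 (le_trans ler01 B1); rewrite /Qb; lra|lra].
  by apply: le_trans h1 _; rewrite ler_peMl // mulr_ge0 //; have := c0 j; lra.
have xlt : (x.2 < j)%N by rewrite ltn_neqAle xe.
have ha := a_le mj'; have hcx := hc xlt.
rewrite (_ : L ^+ p.+1 * _ * _ * _ = a 0%N ^+ p * L ^+ p.+1 * (a (ord (y :: m)) * c x.2)); last by ring.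
rewrite (_ : _ * Qb * _ = a 0%N ^+ p * L ^+ p.+1 * (L * (Qb * (Bc + c j)))); last by rewrite (exprS _ p.+1); ring.
rewrite ler_wpM2l ?mulr_ge0 ?exprn_ge0 //.
have h1 : a (ord (y :: m)) * c x.2 <= Qb * (Bc + c j).
  apply: (@le_trans _ _ (2 * Csob R * (Bc + c j) * Bc)); first exact: ler_pM.
  rewrite mulrAC ler_wpM2r //; [by have := c0 j; lra|].
  by rewrite /Qb lerDr.
by apply: le_trans h1 _; rewrite ler_peMl // mulr_ge0 //; have := c0 j; lra.
Qed.
End Bounds.

(** For j > 0, of the 2k + 1 factors of a monomial 2k - 1 surely decay like 1 / q, and k >= 2 makes
    this at least 3; with q = <t>^(1/2) the rate is <t>^(-3/2). The bound is linear in the norm of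
    order j because the lower orders are already bounded by Bc. *)
Lemma NL_decay j k (M0 Bc : R) : (2 <= k)%N -> 0 <= M0 -> 1 <= Bc -> exists2 K, 0 <= K &
  forall f q, 1 <= q -> Hs j f -> bdd f (M0 / q) -> (forall i, (i < j)%N -> nm (Dd i f) <= Bc) ->
    L2 (Nl k f) /\ nm (Dd j (Nl k f)) <= K * q^-1 ^+ 3 * (1 + nm (Dd j f)).
Proof.
move=> k2 M00 Bc1.
pose L : R := (36 ^+ j.-1) ^+ j.-1; pose Q := M0 + 2 * Csob R * Bc.
have C0 := Csob_ge0 R.
have L1 : 1 <= L by rewrite !exprn_ege1 // ler1n.
have Q0 : 0 <= Q by have := mulr_ge0 C0 (le_trans ler01 Bc1); rewrite /Q; lra.
have qpow q n : 1 <= q -> (3 <= n)%N -> (M0 / q) ^+ n <= M0 ^+ n * q^-1 ^+ 3.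
  move=> q1 n3; rewrite exprMn ler_wpM2l ?exprn_ge0 //.
  by apply: ler_wiXn2l => //; [rewrite invr_ge0; lra|rewrite invf_le1 //; lra].
have k3 : (3 <= (2 * k).-1)%N by case: k k2 => [|[|k]] // _; rewrite !mulnS.
have k4 : (3 <= 2 * k)%N by apply: leq_trans k3 (leq_pred _).
have LNl f q : 1 <= q -> L2 f -> bdd f (M0 / q) -> L2 (Nl k f) /\ nm (Nl k f) <= (M0 / q) ^+ (2 * k) * nm f.
  move=> q1 Lf bf; have B0 := bdd_ge0 bf.
  have b2 : bdd (f * Mconj f) ((M0 / q) ^+ 2) by rewrite expr2; apply: bddM => //; exact: bdd_conj.
  have bk : bdd ((f * Mconj f) ^+ k) ((M0 / q) ^+ (2 * k)).
    rewrite exprM; elim: (k) => [|n IH]; last by rewrite (exprS _ n) (exprS (_ ^+ 2)); exact: bddM (sqr_ge0 _) b2 IH.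
    rewrite !expr0; have := @bdd_cst R 1; apply: bdd_le.
    by rewrite /cmod /Normc.normc /= expr0n addr0 expr1n sqrtr1.
  split; first exact: L2M bk Lf.
  exact: nmM_bdd.
have [j0|j0] := posnP j.
  exists (M0 ^+ (2 * k)) => [|f q q1 Hf bf _]; first exact: exprn_ge0.
  have Lf := Hs_L2 Hf; have [LN nN] := LNl f q q1 Lf bf; split=> //.
  rewrite j0 !Dd0 //; apply: le_trans nN _; apply: ler_pM; [|exact: nm_ge0|exact: qpow|].
    by rewrite exprn_ge0 // divr_ge0 //; lra.
  by lra.
pose K1 := M0 ^+ (2 * k).-1 * L ^+ (2 * k).+1 * Q * Bc.
have K10 : 0 <= K1 by rewrite !mulr_ge0 ?exprn_ge0 //; lra.
exists ((size (eN k j))%:R * K1) => [|f q q1 Hf bf hc]; first exact: mulr_ge0.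
have Lf := Hs_L2 Hf; have [LN _] := LNl f q q1 Lf bf; split=> //.
have [_ ->] := Hs_Nl Hf LN; last by [].
have bf' : bdd (Dd 0 f) (M0 / q) by rewrite Dd0.
have a0 := (ninfP bf').2; have a00 := ninf_ge0 (Dd 0 f).
have bD i : (i < j)%N -> exists B, bdd (Dd i f) B by move=> ij; exact: dF_bdd (dF_Dd Hf ij).
have merge i l : (i + l < j)%N -> ninf (Dd i f) * ninf (Dd l f) <= L * ninf (Dd 0 f) * ninf (Dd (i + l) f).
  move=> il; apply: (@logconvex_merge 36 (fun i => ninf (Dd i f)) j.-1) => //.
  - by rewrite ler1n.
  - by move=> n; exact: ninf_ge0.
  - move=> [|n] // _ nj; have nj' : (n.+2 < j)%N by rewrite -[j]prednK.
    apply: landau_mul; [apply: dF_Dd Hf _|apply: dF_Dd Hf _|exact: bD nj'].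
      exact: ltnW (ltnW nj').
    exact: ltnW nj'.
  by rewrite -ltnS prednK.
have one m : m \in eN k j -> L2 (mv f m) /\ nm (mv f m) <= K1 * q^-1 ^+ 3 * (1 + nm (Dd j f)).
  move=> /eN_spec[sm om]; have [|//|Lm nmm] := nm_mono j0 Hf L1 Bc1 merge hc (m := m); first by rewrite sm.
  split=> //; apply: le_trans nmm _; rewrite sm.
  have c0 := nm_ge0 (Dd j f).
  have p1 : ninf (Dd 0 f) ^+ (2 * k).-1 <= M0 ^+ (2 * k).-1 * q^-1 ^+ 3.
    apply: le_trans (qpow q _ q1 k3); rewrite lerXn2r ?nnegrE //; exact: le_trans a00 a0.
  have p2 : Qb f Bc <= Q.
    rewrite /Qb /Q lerD2r; apply: le_trans a0 _; rewrite ler_pdivrMr; [|lra].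
    by rewrite ler_peMr.
  have p3 : Bc + nm (Dd j f) <= Bc * (1 + nm (Dd j f)) by nra.
  have E : (2 * k).-1.+2 = (2 * k).+1 by rewrite prednK //; apply: leq_trans k4.
  rewrite -{1}E /mono_bound; cbv iota; rewrite E.
  rewrite [leRHS](_ : _ = (M0 ^+ (2 * k).-1 * q^-1 ^+ 3) * L ^+ (2 * k).+1 * Q * (Bc * (1 + nm (Dd j f)))); last by rewrite /K1; ring.
  have L0 : 0 <= L ^+ (2 * k).+1 by rewrite exprn_ge0 //; lra.
  have Qb0 : 0 <= Qb f Bc by have := mulr_ge0 C0 (le_trans ler01 Bc1); rewrite /Qb; lra.
  apply: ler_pM => //; [|lra|].
    by rewrite !mulr_ge0 // exprn_ge0.
  apply: ler_pM => //; first by rewrite mulr_ge0 // exprn_ge0.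
  by apply: ler_wpM2r.
have : forall e : seq mono, (forall m, m \in e -> L2 (mv f m) /\ nm (mv f m) <= K1 * q^-1 ^+ 3 * (1 + nm (Dd j f))) ->
    L2 (ev f e) /\ nm (ev f e) <= (size e)%:R * (K1 * q^-1 ^+ 3 * (1 + nm (Dd j f))).
  elim=> [|m e IH] he; first by rewrite /ev big_nil nm0 mul0r; split=> //; exact: L20.
  have [Lm nmm] := he m (mem_head _ _).
  have [|Le ne] := IH; first by move=> m' hm; apply: he; rewrite inE hm orbT.
  rewrite /ev big_cons -/(ev f e); split; first exact: L2D.
  by apply: le_trans (nmD Lm Le) _; rewrite -[size (m :: e)]/((size e).+1) -nat1r mulrDl mul1r lerD.
move=> /(_ (eN k j) one)[_]; rewrite !mulrA; exact.
Qed.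

End Nonlinear.

(** * Uniform bound in H^s *)

Section SchrodingerPowers.
Variable R : realType.
Local Notation mu := (@lebesgue_measure R).
Local Notation C := R[i].
Local Notation Re := (@complex.Re R).
Local Notation Im := (@complex.Im R).
Local Notation M := (Mfun R).
Local Notation ii := (@ii R).
Local Notation kap := (@kap R).
Local Notation Fo := (@Fo R).
Local Notation h0 := (@h0 R).
Local Notation XM := (@XM R).
Implicit Types f g : M.

(** Differences and multiples are the form in which continuity and derivatives of curves use
    linearity; sums follow in [linD]. *)
Definition lin (r : nat) (T : M -> M) : Prop :=
  (forall f g, Hs r f -> Hs r g -> T (f - g) = T f - T g) /\
  (forall z f, Hs r f -> T (Mcst z * f) = Mcst z * T f).
Definition lbd (r p : nat) (T : M -> M) : Prop := lin r T /\
  exists2 K, 0 <= K & forall f, Hs r f -> Hs p (T f) /\ hn p (T f) <= K * hn r f.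

Lemma lbd_comp r p q T S : lbd r p T -> lbd p q S -> lbd r q (S \o T).
Proof.
move=> [[TB TZ] [K K0 hK]] [[SB SZ] [L L0 hL]]; split.
  split=> [f g Hf Hg|z f Hf] /=; first by rewrite TB // SB //; [have [] := hK _ Hf|have [] := hK _ Hg].
  by rewrite TZ // SZ //; have [] := hK _ Hf.
exists (L * K) => [|f Hf]; first exact: mulr_ge0.
have [H h] := hK _ Hf; have [H' h'] := hL _ H; split=> //.
by apply: le_trans h' _; rewrite -mulrA ler_wpM2l.
Qed.

Lemma lbd_sub r p T S : lbd r p T -> lbd r p S -> lbd r p (fun f => T f - S f).
Proof.
move=> [[TB TZ] [K K0 hK]] [[SB SZ] [L L0 hL]]; split.
  by split=> [f g Hf Hg|z f Hf]; [rewrite TB // SB //; ring|rewrite TZ // SZ // mulrBr].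
exists (K + L) => [|f Hf]; first exact: addr_ge0.
have [H h] := hK _ Hf; have [H' h'] := hL _ Hf; split; first exact: HsB.
by apply: le_trans (hnB H H') _; rewrite mulrDl lerD.
Qed.

Lemma linD r T f g : lin r T -> Hs r f -> Hs r g -> T (f + g) = T f + T g.
Proof.
move=> [TB TZ] Hf Hg; have N h : Hs r h -> T (- h) = - T h.
  move=> Hh; have H0 := HsB Hh Hh; rewrite -(sub0r h) -{1}(subrr h) TB // TB // subrr sub0r; ring.
by rewrite -{1}(opprK g) TB ?N ?opprK //; exact: HsN.
Qed.

Definition cderH (r : nat) (a b : R -> M) : Prop :=
  [/\ forall t, Hs r (a t), forall t, Hs r (b t) &
  forall t (e : R), 0 < e -> exists2 d : R, 0 < d &
    forall h, `|h| <= d -> hn r (a (t + h) - a t - Mcst (cr h) * b t) <= e * `|h|].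

Lemma cderH_op r p T a b : lbd r p T -> cderH r a b -> cderH p (fun t => T (a t)) (fun t => T (b t)).
Proof.
move=> [[TB TZ] [K K0 hK]] [Ha Hb hd]; split=> [t|t|t e e0]; do ?by have [] := hK _ (Ha t).
  by have [] := hK _ (Hb t).
have K1 : 0 < K + 1 by rewrite ltr_wpDl.
have [d d0 {}hd] := hd t _ (divr_gt0 e0 K1); exists d => // h /hd.
have H1 := HsB (Ha (t + h)) (Ha t); have H2 := HsZ (cr h) (Hb t).
rewrite -TB // -TZ // -TB //; have [_ H] := hK _ (HsB H1 H2); move: H.
set x := hn p _; set y := hn r _ => H; rewrite mulrAC ler_pdivlMr //.
have y0 : 0 <= y := hn_ge0 _ _; have := normr_ge0 h; nra.
Qed.

Lemma cderH_cder r a b : cderH r a b -> cder a b.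
Proof.
move=> [Ha Hb hd]; split=> [t|t|t e e0]; [exact: Hs_L2 (Ha t)|exact: Hs_L2 (Hb t)|].
have [d d0 {}hd] := hd t _ e0; exists d => // h /hd; apply: le_trans; apply: nm_le_hn.
exact: L2B (L2B (Hs_L2 (Ha _)) (Hs_L2 (Ha _))) (L2Z _ (Hs_L2 (Hb _))).
Qed.

Lemma cder_cderH a b : cder a b -> cderH 0 a b.
Proof.
move=> [La Lb hd]; split=> [t|t|t e e0]; do ?exact: Hs0.
have [d d0 {}hd] := hd t _ e0; exists d => // h /hd; rewrite hn0 //.
exact: L2B (L2B (La _) (La _)) (L2Z _ (Lb _)).
Qed.

Lemma hn_Dd r j f : Hs (j + r) f -> hn r (Dd j f) <= hn (j + r) f.
Proof.
move=> Hf; rewrite /hn (eq_bigr (fun i : 'I__ => nm (Dd (i + j) f))) => [|i _]; last by rewrite (Dd_Dd i Hf) // leq_addr.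
rewrite -(big_mkord xpredT (fun i => nm (Dd (i + j) f))) -(big_mkord xpredT (fun i => nm (Dd i f))).
have -> : \sum_(0 <= i < r.+1) nm (Dd (i + j) f) = \sum_(j <= i < (j + r).+1) nm (Dd i f).
  by rewrite -{2}[j]add0n big_addn -addnS addKn.
rewrite [leRHS](@big_cat_nat _ _ _ j) //=; last exact: leqW (leq_addr _ _).
by rewrite lerDr sumr_ge0 // => i _; exact: nm_ge0.
Qed.

Lemma lbd_Dd r j : lbd (j + r) r (Dd j).
Proof.
split.
  by split=> [f g Hf Hg|z f Hf]; [apply: DdB Hf Hg (leq_addr _ _)|apply: DdZ Hf (leq_addr _ _)].
by exists 1 => // f Hf; rewrite mul1r; split; [exact: Hs_Dd|exact: hn_Dd].
Qed.

Lemma hn_sub0 r f : Hs r f -> hn r (f - f) = 0.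
Proof.
move=> Hf; rewrite /hn big1 // => i _; have ir : (i <= r)%N by rewrite -ltnS.
by rewrite (DdB Hf Hf ir) subrr nm0.
Qed.

Section Powers.
Variables (s : nat) (B : R) (W : nat -> R -> R).
Hypothesis hW : smoothV s W B.

Definition Pop f : M := Dd 2 f + rM (W 0%N) * f.
Definition Pm (m : nat) f : M := iter m Pop f.

Lemma lbd_rM m r : (m <= s)%N -> (m <= r)%N -> lbd r m (fun f => rM (W 0%N) * f).
Proof.
move=> ms mr; split; first by split=> [f g _ _|z f _]; rewrite ?mulrBr // mulrCA.
have [B0 _ _ _] := hW; have [K K0 hK] := Hs_rM m B0; exists K => // f Hf.
have [H h] := hK s W 0%N f hW ms (Hs_le mr Hf); split=> //.
by apply: le_trans h _; rewrite ler_wpM2l // hn_mono.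
Qed.

Lemma lbd_ext r p T S : (forall f, Hs r f -> T f = S f) -> lbd r p S -> lbd r p T.
Proof.
move=> E [[SB SZ] [K K0 hK]]; split; last by exists K => // f Hf; rewrite E //; exact: hK.
by split=> [f g Hf Hg|z f Hf]; rewrite !E ?SB ?SZ //; [exact: HsB|exact: HsZ].
Qed.

Lemma lbd_N r p T : lbd r p T -> lbd r p (fun f => - T f).
Proof.
move=> [[TB TZ] [K K0 hK]]; split; first by split=> [f g Hf Hg|z f Hf]; [rewrite TB //; ring|rewrite TZ // mulrN].
by exists K => // f Hf; have [H h] := hK _ Hf; rewrite hnN //; split=> //; exact: HsN.
Qed.

Lemma lbd_Pop m : (m <= s)%N -> lbd m.+2 m Pop.
Proof.
move=> ms; apply: (@lbd_ext _ _ _ (fun f => Dd 2 f - (- (rM (W 0%N) * f)))) => [f _|]; first by rewrite opprK.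
apply: lbd_sub; first exact: (lbd_Dd m 2).
by apply: lbd_N; apply: lbd_rM => //; exact: leq_trans (leqnSn _) (leqnSn _).
Qed.

(** Each P lands two orders lower and V has to act only there, so 2 m + b may reach s + 2 although V
    has s derivatives. *)
Lemma lbd_Pm m b : (2 * m + b <= s.+2)%N -> lbd (2 * m + b) b (Pm m).
Proof.
elim: m b => [|m IH] b hm.
  by split=> //; exists 1 => // f Hf; rewrite mul1r.
have E : (2 * m.+1 + b = 2 * m + b.+2)%N by rewrite mulnS !addSn add0n !addnS.
rewrite E in hm *; apply: (lbd_comp (IH b.+2 hm)); apply: lbd_Pop.
by rewrite -ltnS -ltnS; apply: leq_trans hm; exact: leq_addl.
Qed.

Definition lw (j : nat) f : R := \sum_(i < j) nm (Dd i f).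
Lemma lw_mono i j f : (i <= j)%N -> lw i f <= lw j f.
Proof.
move=> ij; rewrite /lw -!(big_mkord xpredT (fun i => nm (Dd i f))).
by rewrite (@big_cat_nat _ _ _ i 0 j) //= lerDl sumr_ge0 // => l _; exact: nm_ge0.
Qed.
(** Every term containing V has at least two derivatives less, hence only orders up to 2 m + b - 2
    on the right. *)
Lemma Pm_principal m b : (2 * m + b <= s.+2)%N -> exists2 K, 0 <= K & forall f, Hs (2 * m + b) f ->
  hn b (Pm m f - Dd (2 * m) f) <= K * lw (2 * m + b).-1 f.
Proof.
elim: m b => [|m IH] b hm.
  by exists 0 => // f Hf; rewrite mul0r /Pm /= muln0 Dd0 ?hn_sub0 //; exact: Hs_L2 Hf.
have E : (2 * m.+1 + b = 2 * m + b.+2)%N by rewrite mulnS !addSn add0n !addnS.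
rewrite E in hm *; have [K K0 hK] := IH b.+2 hm.
have bs : (b <= s)%N by rewrite -ltnS -ltnS; apply: leq_trans hm; exact: leq_addl.
have [[PB _] [L L0 hL]] := lbd_Pop bs; have [_ [L' L'0 hL']] := lbd_rM bs (leqnn b).
have [_ [Q _ hQ]] := lbd_Pm hm.
exists (L * K + L') => [|f Hf]; first by rewrite addr_ge0 ?mulr_ge0.
have HD : Hs b.+2 (Dd (2 * m) f) := Hs_Dd Hf; have [HP _] := hQ f Hf.
have -> : Pm m.+1 f - Dd (2 * m.+1) f = Pop (Pm m f - Dd (2 * m) f) + rM (W 0%N) * Dd (2 * m) f.
  rewrite PB // mulnS -(Dd_Dd 2 Hf (leq_addr _ _)) [Pm m.+1 f]/(Pop (Pm m f)).
  rewrite /Pop; ring.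
have [H1 h1] := hL _ (HsB HP HD); have [H2 h2] := hL' _ (Hs_le (leq_trans (leqnSn b) (leqnSn _)) HD).
apply: le_trans (hnD H1 H2) _; rewrite mulrDl; apply: lerD.
  by apply: le_trans h1 _; rewrite -mulrA ler_wpM2l //; exact: hK.
apply: le_trans h2 _; rewrite ler_wpM2l //.
have Hf' : Hs (2 * m + b) f by apply: Hs_le Hf; rewrite !addnS; exact: leq_trans (leqnSn _) (leqnSn _).
by apply: le_trans (hn_Dd Hf') _; rewrite !addnS.
Qed.
End Powers.
End SchrodingerPowers.

(** * The frequency cutoff *)

Section Truncation.
Variable R : realType.
Local Notation mu := (@lebesgue_measure R).
Local Notation C := R[i].
Local Notation Re := (@complex.Re R).
Local Notation Im := (@complex.Im R).
Local Notation M := (Mfun R).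
Local Notation ii := (@ii R).
Local Notation kap := (@kap R).
Local Notation Fo := (@Fo R).
Local Notation h0 := (@h0 R).
Local Notation XM := (@XM R).
Implicit Types f g : M.

(** Cutoff to frequencies in [-n, n]: it maps L^2 into every H^r and commutes with derivatives,
    though not with multiplication by V. *)
Definition Jn (n : nat) f : M := Fi (indM n%:R * Fo f).

Lemma L2_Jn n f : L2 f -> L2 (Jn n f).
Proof. by move=> Lf; apply: L2Fi; apply: L2_indM; exact: L2Fo. Qed.
Lemma Fo_Jn n f : L2 f -> Fo (Jn n f) = indM n%:R * Fo f.
Proof. by move=> Lf; rewrite FoK //; apply: L2_indM; exact: L2Fo. Qed.
Lemma kap_sqrt_gt0 : 0 < Num.sqrt kap. Proof. by rewrite sqrtr_gt0 kap_gt0. Qed.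
Lemma nm_Fi g : L2 g -> nm (Fi g) = (Num.sqrt kap)^-1 * nm g.
Proof.
move=> Lg; rewrite -{2}(FoK Lg) Fo_nm; last exact: L2Fi.
by rewrite mulKf // gt_eqF // kap_sqrt_gt0.
Qed.
Lemma nm_Jn n f : L2 f -> nm (Jn n f) <= nm f.
Proof.
move=> Lf; have LF := L2Fo Lf; rewrite nm_Fi; last exact: L2_indM.
rewrite -[leRHS](mulKf (x := Num.sqrt kap)) ?gt_eqF ?kap_sqrt_gt0 // -Fo_nm //.
by rewrite ler_pM2l ?invr_gt0 ?kap_sqrt_gt0 //; have := nmM_bdd (bdd_indM n%:R) LF; rewrite mul1r.
Qed.
Lemma Jn_Dd n s j f : Hs s f -> (j <= s)%N -> Dd j (Jn n f) = Jn n (Dd j f).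
Proof. by move=> Hf js; rewrite {1}/Dd (Fo_Jn n (Hs_L2 Hf)) mulrCA -(Fo_Dd Hf js). Qed.
Lemma XM_indM n j g : XM ^+ j * (indM n%:R * g) = (indM n%:R * XM ^+ j) * g.
Proof. ring. Qed.

Lemma lbd_Fi n r : lbd 0 r (fun g => Fi (indM n%:R * g)).
Proof.
have Li g : Hs 0 g -> L2 (indM n%:R * g) by move=> Hg; apply: L2_indM; exact: Hs_L2 Hg.
split.
  split=> [f g Hf Hg|z f Hf]; last by rewrite mulrCA FiZ //; exact: Li.
  have h1 := Li _ Hf; have h2 := Li _ Hg; rewrite mulrBr.
  apply: Fo_inj; [exact: L2Fi (L2B h1 h2)|exact: L2B (L2Fi h1) (L2Fi h2)|].
  by rewrite FoB ?FoK //; [exact: L2B|exact: L2Fi|exact: L2Fi].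
have kn0 : 0 <= (Num.sqrt kap)^-1 * (\sum_(j < r.+1) n%:R ^+ j) :> R.
  by rewrite mulr_ge0 ?invr_ge0 ?sqrtr_ge0 // sumr_ge0 // => i _; rewrite exprn_ge0.
exists ((Num.sqrt kap)^-1 * (\sum_(j < r.+1) n%:R ^+ j)) => // g Hg; have Lg := Hs_L2 Hg; have LI := Li _ Hg.
have LX j : L2 (XM ^+ j * Fo (Fi (indM n%:R * g))).
  by rewrite FoK // XM_indM; exact: L2M (bdd_indM_XMj R n j) Lg.
split; first by split=> [|j _]; [exact: L2Fi|exact: LX].
rewrite hn0 // -mulrA mulr_suml mulr_sumr; apply: ler_sum => j _.
have := LX j; rewrite /Dd FoK // => LXj; rewrite nm_Fi // ler_wpM2l ?invr_ge0 ?sqrtr_ge0 //.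
by rewrite XM_indM; exact: nmM_bdd (bdd_indM_XMj R n j) Lg.
Qed.

Lemma Hs_Jn n r f : L2 f -> Hs r (Jn n f).
Proof. by move=> Lf; have [_ [K _ h]] := lbd_Fi n r; have [] := h _ (Hs0 (L2Fo Lf)). Qed.

Lemma JnB n f g : L2 f -> L2 g -> Jn n (f - g) = Jn n f - Jn n g.
Proof.
by move=> Lf Lg; have [[h _] _] := lbd_Fi n 0; rewrite /Jn FoB // h //; apply: Hs0; exact: L2Fo.
Qed.

Lemma hn_Jn n s f : Hs s f -> hn s (Jn n f) <= hn s f.
Proof.
move=> Hf; apply: ler_sum => i _; have iS : (i <= s)%N by rewrite -ltnS.
by rewrite (Jn_Dd n Hf iS); apply: nm_Jn; exact: L2_Dd Hf iS.
Qed.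

Lemma hn_subJ n s f : Hs s f ->
  hn s (f - Jn n f) = (Num.sqrt kap)^-1 * \sum_(j < s.+1) nm (Fo (Dd j f) - indM n%:R * Fo (Dd j f)).
Proof.
move=> Hf; have HJ := Hs_Jn n s (Hs_L2 Hf); rewrite mulr_sumr; apply: eq_bigr => j _.
have js : (j <= s)%N by rewrite -ltnS.
have LD := L2_Dd Hf js; have LJ := L2_Jn n LD.
rewrite (DdB Hf HJ js) (Jn_Dd n Hf js) -(Fo_Jn n LD) -FoB // Fo_nm; last exact: L2B.
by rewrite mulKf // gt_eqF // kap_sqrt_gt0.
Qed.

Lemma hn_subJ_tz s f : Hs s f -> tz (fun n => hn s (f - Jn n f)).
Proof.
move=> Hf; have k0 : 0 <= (Num.sqrt kap)^-1 by rewrite invr_ge0 sqrtr_ge0.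
have H r : (r <= s.+1)%N -> tz (fun n => \sum_(j < r) nm (Fo (Dd j f) - indM n%:R * Fo (Dd j f))).
  elim: r => [|r IH] rs; first by move=> e e0; exists 0%N => n _; rewrite big_ord0 ltW.
  apply: (@tz_squeeze _ _ (fun n => \sum_(j < r) nm (Fo (Dd j f) - indM n%:R * Fo (Dd j f)) +
    nm (Fo (Dd r f) - indM n%:R * Fo (Dd r f)))) => [n|]; first by rewrite big_ord_recr.
  apply: tz_add; first exact: IH (ltnW rs).
  by apply: indM_tz; apply: L2Fo; exact: L2_Dd Hf _.
apply: tz_squeeze (tz_mul k0 (H _ (leqnn _))) => n; by rewrite hn_subJ.
Qed.

(** At a fixed time the cutoff error tends to 0; continuity of the curve and compactness of [-T, T]
    make this uniform in time. *)
Lemma Jn_unif s a (T e : R) : contH s a -> 0 < e ->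
  exists n0, forall n t, (n0 <= n)%N -> `|t| <= T -> hn s (a t - Jn n (a t)) <= e.
Proof.
move=> [Ha ca] e0; have e4 : 0 < e / 4 by rewrite divr_gt0.
have near_x (x : R) : \forall x' \near x & n \near \oo, hn s (a x' - Jn n (a x')) <= e.
  have [d d0 hd] := ca x _ e4; have [N hN] := hn_subJ_tz (Ha x) e4.
  exists (ball x d, [set n | (N <= n)%N]) => /=; first by split; [exact: nbhsx_ballx|exact: nbhs_infty_ge].
  move=> [y n] /= [yx Nn]; have hy : `|y - x| <= d by apply: ltW; rewrite distrC.
  have := hd _ hy; rewrite (_ : x + (y - x) = y); last by ring.
  move=> H1; have H2 := hN n Nn.
  have Hd := HsB (Ha y) (Ha x); have Ld := Hs_L2 Hd; have Lx := Hs_L2 (Ha x); have Ly := Hs_L2 (Ha y).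
  have -> : a y - Jn n (a y) = (a y - a x) + ((a x - Jn n (a x)) - Jn n (a y - a x)) by rewrite JnB //; ring.
  have HJ1 := Hs_Jn n s Ld; have HJ2 := HsB (Ha x) (Hs_Jn n s Lx).
  have h1 := hnD Hd (HsB HJ2 HJ1); have h2 := hnB HJ2 HJ1; have h3 := hn_Jn n Hd; lra.
have := (compact_near_coveringP _).1 (@segment_compact R (- T) T) nat \oo _ _ (fun x _ => near_x x).
move=> [n0 _ H]; exists n0 => n t nn tT; apply: (H n nn).
by rewrite /= in_itv /= -ler_norml.
Qed.

Section Derivative.
Variables (s k : nat) (lambda B : R) (W : nat -> R -> R) (U : R -> M).
Hypothesis s1 : (1 <= s)%N.
Hypothesis hW : smoothV s W B.
Local Notation NN := (NN k lambda W).
Let Y t : M := Em t * Fo (U t).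
Let Z t : M := ii * (Em t * Fo (NN (U t))).
Hypothesis hd : forall c, L2 c -> forall t : R, is_derive t 1 (fun s => rip (Y s) c) (rip (Z t) c).
Hypothesis hU : contH 1 U.

(** Since [XM] squared is - x^2, the bracket is exp(- i th) - 1 + i th with th = h x^2; it is at
    most 2 th^2, and |x| <= n on the cutoff. *)
Lemma Em_taylor n (h : R) :
  bdd (indM n%:R * (Em (- h) - 1 - Mcst (cr h) * (ii * XM ^+ 2))) (2 * n%:R ^+ 4 * h ^+ 2).
Proof.
have cx := cmeas_ix R; have ce : cmeas (fun x : R => cis (- h * x ^+ 2)) by apply: cmeas_cis; exact: measurable_tsq.
have c1 : cmeas (fun x : R => (\1_(`[- n%:R, n%:R]%classic) x)%:C) by exact: cmeas_ind.
have ch (z : C) : cmeas (fun _ : R => z) by exact: cmeas_cst.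
have cX := cmeasM cx cx; have cT := cmeasM (ch (cr h)) (cmeasM (ch 'i) cX).
have ceB := cmeasD (cmeasD ce (cmeasN (ch 1))) (cmeasN cT).
have -> : indM n%:R * (Em (- h) - 1 - Mcst (cr h) * (ii * XM ^+ 2)) =
  pi (fun x : R => (\1_(`[- n%:R, n%:R]%classic) x)%:C *
     (cis (- h * x ^+ 2) - 1 - cr h * ('i * ((0 +i* x) * (0 +i* x))))).
  have M1 : 1 = pi (fun=> 1 : C) by rewrite -[LHS]cr1 /Mcst -lock.
  rewrite expr2 XME /indM /Em expiE -[ii]/(Mcst 'i) M1 /Mcst -!lock.
  rewrite (piM cx cx) (piM (ch 'i) cX) (piM (ch _) (cmeasM (ch 'i) cX)) (piN (ch 1)) (piN cT).
  by rewrite (piD ce (cmeasN (ch 1))) (piD (cmeasD ce (cmeasN (ch 1))) (cmeasN cT)) (piM c1 ceB).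
apply: bdd_pi; first exact: cmeasM c1 ceB.
move=> x; set th := h * x ^+ 2.
rewrite [X in _ * X](_ : _ = (cos th - 1) +i* (th - sin th)); last first.
  apply/eqP; rewrite eq_complex /= /th mulNr cosN sinN; apply/andP; split; apply/eqP; ring.
rewrite cmodM cmod_real; set zz := cmod (_ +i* _).
rewrite indicE mem_setE /= in_itv /= -ler_norml.
case: (leP `|x| n%:R) => [hx|_]; last first.
  by rewrite normr0 mul0r; apply: mulr_ge0; [apply: mulr_ge0 => //; exact: exprn_ge0|exact: sqr_ge0].
rewrite (_ : true%:R = 1 :> R) // normr1 mul1r.
apply: le_trans (cmod_le_ReIm _) _ => /=.
have h1 := one_sub_cos_le th; have h2 := sin_sub_le th; rewrite distrC in h2.
have h3 : `|cos th - 1| <= th ^+ 2.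
  by rewrite distrC ger0_norm ?subr_ge0 ?cos_le1 //; have := sqr_ge0 th; lra.
apply: (@le_trans _ _ (2 * th ^+ 2)); first by lra.
rewrite -mulrA ler_pM2l // /th exprMn mulrC -exprM; apply: ler_wpM2r; first exact: sqr_ge0.
by rewrite exprM -(real_normK (num_real x)) -exprM; apply: lerXn2r; rewrite ?nnegrE.
Qed.

(** On bounded frequencies the factor [Em (- t)] is differentiable, by [Em_taylor], so the
    derivative of [Y] yields the cut off equation itself, second derivative included. *)
Lemma cder_J n : cder (fun t => indM n%:R * Fo (U t))
  (fun t => ii * (XM ^+ 2 * (indM n%:R * Fo (U t))) + ii * (indM n%:R * Fo (NN (U t)))).
Proof.
have [HU _] := hU; have LU t := Hs_L2 (HU t).
have [LY LZ dYZ] : cder Y Z.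
  have := cder_XY hW hd s1 hU (leq0n 1); rewrite (_ : (fun t => _) = Y); last by apply/funext => t; rewrite expr0 mul1r.
  by rewrite (_ : (fun t => _) = Z) //; apply/funext => t; rewrite expr0 mul1r.
have LN t : L2 (NN (U t)) := Hs_L2 ((contH_NN k lambda hW s1 hU).1 t).
have LX f : L2 f -> L2 (XM ^+ 2 * (indM n%:R * f)) /\ nm (XM ^+ 2 * (indM n%:R * f)) <= n%:R ^+ 2 * nm f.
  move=> Lf; rewrite XM_indM; split; first exact: L2M (bdd_indM_XMj R n 2) Lf.
  exact: nmM_bdd (bdd_indM_XMj R n 2) Lf.
have LI t := L2_indM n%:R (L2Fo (LU t)).
split=> [//|t|t e e0].
  by apply: L2D; apply: L2ii; [exact: (LX _ (L2Fo (LU t))).1|apply: L2_indM; exact: L2Fo].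
set y := Fo (U t); set z := ii * Fo (NN (U t)).
have Ly : L2 y := L2Fo (LU t); have Lz : L2 z := L2ii (L2Fo (LN t)).
pose Kt := 2 * n%:R ^+ 4 * (nm y + nm z) + n%:R ^+ 2 * nm z.
have y0 := nm_ge0 y; have z0 := nm_ge0 z; have n0 : 0 <= n%:R :> R by [].
have Kt0 : 0 <= Kt by rewrite /Kt addr_ge0 ?mulr_ge0 ?exprn_ge0 ?addr_ge0.
have e2 : 0 < e / 2 by rewrite divr_gt0.
have [d d0 {}dYZ] := dYZ t _ e2.
have d1 : 0 < e / 2 / (Kt + 1) by rewrite divr_gt0 // ltr_wpDl.
exists (Num.min d (Num.min 1 (e / 2 / (Kt + 1)))) => [|h]; first by rewrite !lt_min d0 d1 ltr01.
rewrite !le_min => /andP[/dYZ hYZ /andP[h1]]; rewrite ler_pdivlMr ?ltr_wpDl // => h2.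
set D := Y (t + h) - Y t - Mcst (cr h) * Z t in hYZ.
have LD : L2 D := L2B (L2B (LY _) (LY _)) (L2Z _ (LZ _)).
pose T := indM n%:R * (Em (- h) - 1 - Mcst (cr h) * (ii * XM ^+ 2)).
have bT : bdd T _ := Em_taylor n h.
(* The increment splits into the error of [Y], two Taylor errors of the exponential and a term
   quadratic in h. *)
have -> : indM n%:R * Fo (U (t + h)) - indM n%:R * y - Mcst (cr h) * (ii * (XM ^+ 2 * (indM n%:R * y)) +
    ii * (indM n%:R * Fo (NN (U t)))) =
  indM n%:R * (Em (- (t + h)) * D) + T * y + Mcst (cr h) * (T * z + Mcst (cr h) * (ii * (XM ^+ 2 * (indM n%:R * z)))).
  have E1 : Fo (U (t + h)) = Em (- (t + h)) * Y (t + h) by rewrite EmK.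
  have E2 : Em (- t) * Y t = y by rewrite EmK.
  have E3 : Em (- t) * Z t = z by rewrite /Z mulrCA EmK.
  have -> : Em (- (t + h)) * D = Em (- (t + h)) * Y (t + h) - Em (- h) * y - Mcst (cr h) * (Em (- h) * z).
    rewrite /D -E2 -E3 opprD EmD; ring.
  rewrite E1 /T /z; ring.
have [LXz nXz] := LX _ Lz.
have LTy := L2M bT Ly; have LTz := L2M bT Lz; have LXi := L2Z (cr h) (L2ii LXz).
have LA := L2_indM n%:R (L2_Em (- (t + h)) LD).
apply: le_trans (nmD (L2D LA LTy) (L2Z (cr h) (L2D LTz LXi))) _.
have b1 := nmD LA LTy.
have b2 : nm (indM n%:R * (Em (- (t + h)) * D)) <= nm D.
  by have := nmM_bdd (bdd_indM n%:R) (L2_Em (- (t + h)) LD); rewrite mul1r nm_Em.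
have b3 := nmM_bdd bT Ly; have b4 := nmM_bdd bT Lz; have b5 := nmD LTz LXi.
rewrite (nmZ h (L2ii LXz)) (nm_ii (XM ^+ 2 * _)) in b5; rewrite (nmZ h (L2D LTz LXi)).
move: b1 b2 b3 b4 b5 nXz hYZ h1 h2; rewrite -(real_normK (num_real h)) /Kt.
have := normr_ge0 h; set x := `|h|; set P := n%:R ^+ 4; set Q := n%:R ^+ 2.
set n1 := nm (_ + T * y); set n2 := nm (_ + _ * (ii * _)); set n3 := nm (T * y); set n4 := nm (T * z).
set n5 := nm (indM _ * (Em _ * _)); set n6 := nm (XM ^+ 2 * _); set n7 := nm D; set a := nm y; set b := nm z.
move=> x0 b1 b2 b3 b4 b5 b6 b7 x1 h2.
have h3 : x * n2 <= x * (2 * P * x ^+ 2 * b + x * (Q * b)).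
  by apply: ler_wpM2l => //; apply: le_trans b5 _; apply: lerD => //; exact: ler_wpM2l.
have P0 : 0 <= P by rewrite exprn_ge0.
have h4 : 2 * P * x ^+ 2 * b * x <= 2 * P * b * x ^+ 2.
  rewrite (_ : _ * x = 2 * P * b * x ^+ 2 * x); last by ring.
  by rewrite ler_piMr // !mulr_ge0 ?sqr_ge0.
have h5 : x * (x * (2 * P * (a + b) + Q * b + 1)) <= x * (e / 2) by exact: ler_wpM2l.
have := sqr_ge0 x; nra.
Qed.
End Derivative.
End Truncation.

(** * Energy estimates *)

Section UniformBound.
Variable R : realType.
Local Notation mu := (@lebesgue_measure R).
Local Notation C := R[i].
Local Notation Re := (@complex.Re R).
Local Notation Im := (@complex.Im R).
Local Notation M := (Mfun R).
Local Notation ii := (@ii R).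
Local Notation kap := (@kap R).
Local Notation Fo := (@Fo R).
Local Notation h0 := (@h0 R).
Local Notation XM := (@XM R).
Implicit Types f g : M.

Lemma rip_ii0 f : L2 f -> rip f (ii * f) = 0.
Proof.
move=> Lf; have := rip_adj ii f f; rewrite ii_conj mulNr ripNr //; last exact: L2ii.
by rewrite [rip (ii * f) f]ripC => h; lra.
Qed.

Section Energy.
Variables (s : nat) (B : R) (W : nat -> R -> R).
Hypothesis hW : smoothV s W B.
Local Notation P := (Pop W).
Let V := rM (W 0%N).

Lemma measurable_W : measurable_fun setT (W 0%N) \/ s = 0%N.
Proof.
have [_ hd _ _] := hW; case: (s) hd => [|r] hd; [by right|left].
by have [] := measurable_deriv (hd 0%N isT).
Qed.
Hypothesis s1 : (1 <= s)%N.
Lemma conj_V : Mconj V = V.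
Proof. by apply: conj_rM; case: measurable_W => // h; move: s1; rewrite h. Qed.
Lemma bdd_V : bdd V B. Proof. by have [_ _ h _] := hW; exact: h. Qed.
Lemma B_ge0 : 0 <= B. Proof. by have [] := hW. Qed.

Lemma rip_P f g : Hs 2 f -> Hs 1 g -> rip (P f) g = - rip (Dd 1 f) (Dd 1 g) + rip (V * f) g.
Proof.
move=> Hf Hg; rewrite /Pop ripDl; [|exact: L2_Dd Hf _|exact: L2M bdd_V (Hs_L2 Hf)|exact: Hs_L2 Hg].
by congr (_ + _); apply: (dF_adj (dF_Dd Hf (isT : 1 < 2)%N)); exact: dF_Dd1 Hg.
Qed.

Lemma P_sym f g : Hs 2 f -> Hs 2 g -> rip (P f) g = rip f (P g).
Proof.
move=> Hf Hg; rewrite (rip_P Hf (Hs_le _ Hg)) // [RHS]ripC (rip_P Hg (Hs_le _ Hf)) //.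
by rewrite [rip (Dd 1 g) _]ripC rip_adj conj_V [rip f _]ripC.
Qed.

Lemma P_lin : lin 2 P. Proof. by have [] := lbd_Pop hW (leq0n s). Qed.
Lemma L2_P f : Hs 2 f -> L2 (P f).
Proof. by move=> Hf; have [_ [K _ h]] := lbd_Pop hW (leq0n s); exact: Hs_L2 (h _ Hf).1. Qed.

Lemma rip_P_bound f g : Hs 2 f -> Hs 1 g -> `|rip (P f) g| <= (1 + B) * (hn 1 f * hn 1 g).
Proof.
move=> Hf Hg; have B0 := B_ge0; rewrite rip_P //; apply: le_trans (ler_normD _ _) _; rewrite normrN.
have Lf := Hs_L2 Hf; have Lg := Hs_L2 Hg.
have h1 := CS (L2_Dd Hf (isT : 1 <= 2)%N) (L2_Dd Hg (leqnn 1)).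
have h2 := CS (L2M bdd_V Lf) Lg; have h3 := nmM_bdd bdd_V Lf.
have f1 : hn 1 f = nm f + nm (Dd 1 f) by rewrite hnS hn0.
have g1 : hn 1 g = nm g + nm (Dd 1 g) by rewrite hnS hn0.
have f0 := nm_ge0 f; have g0 := nm_ge0 g; have f2 := nm_ge0 (Dd 1 f); have g2 := nm_ge0 (Dd 1 g).
have h4 := ler_wpM2r g0 h3; rewrite f1 g1.
have := mulr_ge0 B0 (mulr_ge0 f0 g2); have := mulr_ge0 B0 (mulr_ge0 f2 g0); have := mulr_ge0 B0 (mulr_ge0 f2 g2).
have := mulr_ge0 f0 g0; have := mulr_ge0 f0 g2; have := mulr_ge0 f2 g0.
move: h1 h2 h4; set x := `|_|; set y := `|_|; set p := nm (V * f) * _; lra.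
Qed.

(** For a = 0 the energy is |w|^2, for a = 1 it is - <P w, w>. In the time derivative the term with
    i P w drops out, P being symmetric, and only the source g is left. For a = 1 the H^1 norm is
    controlled up to a multiple of |w|^2, the price of the potential. *)
Lemma energy (a : nat) (w g : R -> M) : (a <= 1)%N -> (forall t, Hs a (g t)) ->
  cderH 2 w (fun t => ii * (P (w t) + g t)) ->
  exists E E' : R -> R, [/\ forall t : R, is_derive t 1 E (E' t),
    forall t, `|E' t| <= 2 * (1 + B) * (hn a (w t) * hn a (g t)),
    forall t, hn a (w t) ^+ 2 <= 2 * E t + (if a == 0%N then 0 else 2 * (1 + B) * nm (w t) ^+ 2) &
    forall t, E t <= (1 + B) * hn a (w t) ^+ 2].
Proof.
move=> a1 Hg cw; have [Hw Hw' _] := cw; have B0 := B_ge0.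
have Lg t := Hs_L2 (Hg t); have Lw t := Hs_L2 (Hw t); have LP t := L2_P (Hw t).
have LiP t := L2ii (LP t); have Lig t := L2ii (Lg t).
case: a a1 Hg => [|[|//]] _ Hg.
  exists (fun t => rip (w t) (w t)), (fun t => 2 * rip (w t) (ii * g t)); split=> t; rewrite ?hn0 //.
  - have d := cder_rip t (cderH_cder cw) (cderH_cder cw); apply: is_derive_eq d _.
    rewrite [rip (ii * _) _]ripC mulrDr !ripDr //.
    suff -> : rip (w t) (ii * P (w t)) = 0 by ring.
    have := P_sym (Hw t) (HsZ 'i (Hw t)); rewrite P_lin.2 // -/ii.
    have := rip_adj ii (P (w t)) (w t); rewrite ii_conj mulNr ripNr; [|exact: L2ii|exact: LP].
    by rewrite [rip (ii * _) _]ripC -/ii => h1 h2; lra.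
  - rewrite normrM ger0_norm // -mulrA; apply: ler_wpM2l => //.
    have := CS (Lw t) (Lig t); rewrite nm_ii => h; apply: le_trans h _.
    by rewrite ler_peMl ?mulr_ge0 ?nm_ge0 //; lra.
  - by rewrite rip_nm eqxx; have := sqr_ge0 (nm (w t)); lra.
  - by rewrite rip_nm; have := mulr_ge0 B0 (sqr_ge0 (nm (w t))); lra.
have cP := cderH_op (lbd_Pop hW (leq0n s)) cw.
exists (fun t => - rip (P (w t)) (w t)), (fun t => - (2 * rip (P (w t)) (ii * g t))); split=> t.
- have d := is_deriveN (cder_rip t (cderH_cder cP) (cderH_cder cw)); apply: is_derive_eq d _.
  congr (- _); rewrite (P_sym (Hw' t) (Hw t)) [rip (ii * _) _]ripC mulrDr !ripDr //.
  by rewrite rip_ii0 //; ring.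
- rewrite normrN normrM ger0_norm // -!mulrA; apply: ler_wpM2l => //.
  by have := rip_P_bound (Hw t) (HsZ 'i (Hg t)); rewrite hn_ii.
- rewrite (rip_P (Hw t) (Hs_le (isT : 1 <= 2)%N (Hw t))) hnS hn0 // rip_nm.
  have h2 := CS (L2M bdd_V (Lw t)) (Lw t); have h3 := ler_wpM2r (nm_ge0 (w t)) (nmM_bdd bdd_V (Lw t)).
  move: h2 h3; rewrite ler_norml => /andP[_ h2] h3.
  have := sqr_ge0 (nm (w t) - nm (Dd 1 (w t))).
  rewrite (_ : (1%N == 0%N) = false) //; lra.
- have := rip_P_bound (Hw t) (Hs_le (isT : 1 <= 2)%N (Hw t)); rewrite -expr2 -normrN; exact: le_trans (ler_norm _).
Qed.
End Energy.

Section Flow.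
Variables (s k : nat) (lambda B M0 : R) (W : nat -> R -> R) (U : R -> M).
Hypothesis s1 : (1 <= s)%N.
Hypothesis k2 : (2 <= k)%N.
Hypothesis hW : smoothV s W B.
Local Notation NN := (NN k lambda W).
Local Notation P := (Pop W).
Let V := rM (W 0%N).
Let Y t : M := Em t * Fo (U t).
Let Z t : M := ii * (Em t * Fo (NN (U t))).
Hypothesis hd : forall c, L2 c -> forall t : R, is_derive t 1 (fun s => rip (Y s) c) (rip (Z t) c).
Hypothesis hU : contH s U.
Hypothesis M00 : 0 <= M0.
Hypothesis hdec : forall t, bdd (U t) (M0 / qj t).

Lemma HsU t : Hs s (U t). Proof. exact: hU.1. Qed.
Lemma L2U t : L2 (U t). Proof. exact: Hs_L2 (HsU t). Qed.
Lemma contH_1 : contH 1 U. Proof. exact: contH_le s1 hU. Qed.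
Lemma L2_NN t : L2 (NN (U t)). Proof. exact: Hs_L2 ((contH_NN k lambda hW s1 contH_1).1 t). Qed.

Lemma cderH_v n r : cderH r (fun t => Jn n (U t)) (fun t => ii * (Dd 2 (Jn n (U t)) + Jn n (NN (U t)))).
Proof.
have := cderH_op (lbd_Fi R n r) (cder_cderH (cder_J s1 hW hd contH_1 n)).
have -> : (fun t => Fi (indM n%:R * (indM n%:R * Fo (U t)))) = (fun t => Jn n (U t)).
  by apply/funext => t; rewrite mulrA indM_idem.
rewrite (_ : (fun t => Fi (indM n%:R * (_ + _))) = (fun t => ii * (Dd 2 (Jn n (U t)) + Jn n (NN (U t))))) //.
apply/funext => t; have [Ll _] := lbd_Fi R n 0; have LF := L2_indM n%:R (L2Fo (L2U t)).
have LN := L2_indM n%:R (L2Fo (L2_NN t)).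
have LX : L2 (XM ^+ 2 * (indM n%:R * Fo (U t))).
  by rewrite XM_indM; exact: L2M (bdd_indM_XMj R n 2) (L2Fo (L2U t)).
have := linD Ll (Hs0 (L2ii LX)) (Hs0 (L2ii LN)) => /= ->.
rewrite !(Ll.2 'i) ?mulrDr; [|exact: Hs0|exact: Hs0].
congr (_ * _ + _ * _); last by rewrite mulrA indM_idem.
by rewrite /Dd (Fo_Jn n (L2U t)) mulrCA [indM _ * (indM _ * _)]mulrA indM_idem.
Qed.

(** What the equation for the cut off solution v contains beyond i P v: the commutator of the cutoff
    with V, and the nonlinear term. *)
Definition rn n t : M := Jn n (NN (U t)) - V * Jn n (U t).

Lemma Hs_V j f : (j <= s)%N -> Hs j f -> Hs j (V * f).
Proof. by move=> js Hf; have [_ [K _ h]] := lbd_rM hW js (leqnn j); have [] := h _ Hf. Qed.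

Lemma Hs_rn n t j : (j <= s)%N -> Hs j (rn n t).
Proof. by move=> js; apply: HsB; [exact: Hs_Jn (L2_NN t)|apply: Hs_V => //; exact: Hs_Jn (L2U t)]. Qed.

(** P^m commutes with the P of the equation, so the linear part keeps its form and only P^m of the
    remainder is added. *)
Lemma cderH_w n m a : (2 * m + a <= s)%N ->
  cderH 2 (fun t => Pm W m (Jn n (U t))) (fun t => ii * (P (Pm W m (Jn n (U t))) + Pm W m (rn n t))).
Proof.
move=> ms; have m2 : (2 * m + 2 <= s.+2)%N by rewrite addn2 !ltnS; apply: leq_trans ms; exact: leq_addr.
have := cderH_op (lbd_Pm hW m2) (cderH_v n (2 * m + 2)).
rewrite (_ : (fun t => Pm W m (ii * _)) = (fun t => ii * (P (Pm W m (Jn n (U t))) + Pm W m (rn n t)))) //.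
apply/funext => t; have ms' : (2 * m + 0 <= s.+2)%N by rewrite addn0; apply: leq_trans (leqW (leqW ms)); exact: leq_addr.
have ms2 : (2 * m + 0 <= s)%N by rewrite addn0; apply: leq_trans ms; exact: leq_addr.
have [Ll _] := lbd_Pm hW ms'; have HJ := Hs_Jn n (2 * m + 0).+2 (L2U t).
have HP : Hs (2 * m + 0) (P (Jn n (U t))).
  by have [_ [K _ h]] := lbd_Pop hW ms2; have [] := h _ HJ.
have Hr := Hs_rn n t ms2.
have -> : Dd 2 (Jn n (U t)) + Jn n (NN (U t)) = P (Jn n (U t)) + rn n t by rewrite /Pop /rn -/V; ring.
rewrite Ll.2; last exact: HsD.
by congr (_ * _); rewrite (linD Ll HP Hr) /Pm -iterSr.
Qed.

Lemma lw_le j f c : (forall i, (i < j)%N -> nm (Dd i f) <= c) -> lw j f <= j%:R * c.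
Proof.
move=> h; apply: (@le_trans _ _ (\sum_(i < j) c)); first by apply: ler_sum => i _; exact: h.
by rewrite sumr_const card_ord mulr_natl.
Qed.

Lemma hn_Nl j (Bc : R) : 1 <= Bc -> exists2 K, 0 <= K &
  forall f q, 1 <= q -> Hs j f -> bdd f (M0 / q) -> (forall i, (i < j)%N -> nm (Dd i f) <= Bc) ->
    Hs j (Nl k f) /\ hn j (Nl k f) <= K * q^-1 ^+ 3 * (1 + nm (Dd j f)).
Proof.
move=> B1; suff H r : (r <= j.+1)%N -> exists2 K, 0 <= K & forall f q, 1 <= q -> Hs j f -> bdd f (M0 / q) ->
    (forall i, (i < j)%N -> nm (Dd i f) <= Bc) -> Hs j (Nl k f) /\ lw r (Nl k f) <= K * q^-1 ^+ 3 * (1 + nm (Dd j f)).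
  by have [K K0 hK] := H j.+1 (leqnn _); exists K.
elim: r => [|r IH] rj.
  have [K K0 hK] := NL_decay j k2 M00 B1; exists 0 => // f q q1 Hf bf hB.
  by rewrite !mul0r /lw big_ord0; split=> //; have [] := Hs_Nl Hf (hK f q q1 Hf bf hB).1.
have [K K0 hK] := IH (ltnW rj); have [L L0 hL] := NL_decay r k2 M00 B1.
exists (K + L * (1 + Bc)) => [|f q q1 Hf bf hB]; first by rewrite addr_ge0 ?mulr_ge0 //; lra.
have [HN h1] := hK f q q1 Hf bf hB; split=> //.
have rj' : (r <= j)%N by rewrite -ltnS.
have [_ h2] := hL f q q1 (Hs_le rj' Hf) bf (fun i ir => hB i (leq_trans ir rj')).
rewrite /lw big_ord_recr /= -/(lw r _) -mulrA mulrDl mulrA; apply: lerD h1 _; apply: le_trans h2 _.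
have q0 : 0 <= q^-1 ^+ 3 by rewrite exprn_ge0 // invr_ge0; lra.
rewrite [leRHS](_ : _ = L * q^-1 ^+ 3 * ((1 + Bc) * (1 + nm (Dd j f)))); last by ring.
apply: ler_wpM2l; first exact: mulr_ge0.
have nj := nm_ge0 (Dd j f); move: rj'; rewrite leq_eqVlt => /orP[/eqP ->|/hB h3]; nra.
Qed.

(** One order j = 2 m + a at a time, with the lower orders bounded for all times. P^m v takes the
    place of the derivatives of v because commutators of d^j with V would not decay in time. *)
Lemma UB_step m a (Bc : R) : (a <= 1)%N -> (2 * m + a <= s)%N -> 1 <= Bc ->
  (forall i t, (i < 2 * m + a)%N -> nm (Dd i (U t)) <= Bc) ->
  exists K, forall t, nm (Dd (2 * m + a) (U t)) <= K.
Proof.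
move=> a1; set j := (2 * m + a)%N => js B1 hB; have B0 := B_ge0 hW.
have js2 : (j <= s.+2)%N := leqW (leqW js).
have [_ [Kp Kp0 hKp]] := lbd_Pm hW js2; have [Ke Ke0 hKe] := Pm_principal hW js2.
have jsm : (2 * m + 0 <= s.+2)%N by rewrite addn0; apply: leq_trans js2; exact: leq_addr.
have [_ [K0 K00 hK0]] := lbd_Pm hW jsm.
have [KN KN0 hKN] := hn_Nl j B1; have [_ [Kv Kv0 hKv]] := lbd_rM hW js (leqnn j).
have cV : contH j (fun t => V * U t).
  apply: (contH_op (T := fun f => V * f) Kv0 hKv) (contH_le js hU) => f g _ _; exact: mulrBr.
pose L := j%:R * Bc; have L0 : 0 <= L by rewrite mulr_ge0 //; lra.
(* A shift of the energy: the first summand absorbs the |w|^2 loss for a = 1, which involves lower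
   orders only, and the 1 keeps the shifted energy above a positive constant. *)
pose K1 := (1 + B) * (K0 * L) ^+ 2 + 1; have K11 : 1 <= K1 by rewrite /K1 lerDr mulr_ge0 ?sqr_ge0 //; lra.
pose C1 := 2 * (1 + B) * Kp * ((1 + Kv) + `|lambda| * KN * (4 + Ke * L)).
have C10 : 0 <= C1.
  have KL0 : 0 <= Ke * L by exact: mulr_ge0.
  apply: mulr_ge0; first by apply: mulr_ge0 => //; lra.
  by apply: addr_ge0; [lra|apply: mulr_ge0; [exact: mulr_ge0|lra]].
pose E0 := (1 + B) * (Kp * hn j (U 0)) ^+ 2 + K1.
exists (E0 * expR (C1 * 5) + Ke * L + 1) => t0; set T := `|t0|.
have T0 : 0 <= T by exact: normr_ge0.
(* The cutoff error allowed at times up to T; integrated over [0, T] it is at most 1. The cutoff n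
   depends on T, unlike all constants fixed before. *)
pose de := (1 + T)^-1; have d0 : 0 < de by rewrite invr_gt0; lra.
have d1 : de <= 1 by rewrite invf_le1; lra.
have dT : de * T <= 1 by rewrite mulrC ler_pdivrMr; lra.
have [n1 hn1] := Jn_unif T (contH_le js hU) d0; have [n2 hn2] := Jn_unif T cV d0.
pose n := maxn n1 n2.
pose v t := Jn n (U t); pose w t := Pm W m (v t); pose g t := Pm W m (rn n t).
have Hv t : Hs j (v t) := Hs_Jn n j (L2U t).
have Hr t : Hs j (rn n t) := Hs_rn n t js.
have [E [E' [dE hE' hE hE2]]] := energy hW s1 a1 (fun t => (hKp _ (Hr t)).1) (cderH_w n js).
have vL t : lw j (v t) <= L.
  apply: lw_le => i ij; have ijs : (i <= j)%N := ltnW ij.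
  rewrite /v (Jn_Dd n (HsU t) (leq_trans ijs js)); apply: le_trans (hB i t ij); apply: nm_Jn.
  exact: L2_Dd (HsU t) (leq_trans ijs js).
have X0 t : 0 <= hn a (w t) by exact: hn_ge0.
have wK t : hn a (w t) ^+ 2 + 2 <= 2 * (E t + K1).
  have := hE t; rewrite -/v -/(w t) /K1; case: eqP => [_|/eqP a0].
    by have := mulr_ge0 (addr_ge0 ler01 B0) (sqr_ge0 (K0 * L)); lra.
  have ae : a = 1%N by apply/eqP; rewrite eqn_leq a1 lt0n.
  have H0 : Hs (2 * m + 0) (v t) by exact: Hs_Jn (L2U t).
  have [Hw0 h] := hK0 _ H0; rewrite -/(w t) hn0 in h; last exact: Hs_L2 Hw0.
  have h2 : nm (w t) <= K0 * L.
    apply: le_trans h _; rewrite ler_wpM2l //; apply: le_trans (vL t).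
    by rewrite /j ae addn1 addn0.
  have h3 : nm (w t) ^+ 2 <= (K0 * L) ^+ 2 by apply: lerXn2r h2; rewrite nnegrE; [exact: nm_ge0|exact: mulr_ge0].
  have := ler_wpM2l (addr_ge0 ler01 B0) h3; lra.
have Dv t : nm (Dd j (v t)) <= hn a (w t) + Ke * L.
  have e1 : Dd j (v t) = Dd a (Dd (2 * m) (v t)) by rewrite (Dd_Dd a (Hv t) (leq_addr _ _)) addnC.
  have Hw := (hKp _ (Hv t)).1; have HD : Hs a (Dd (2 * m) (v t)) := Hs_Dd (Hv t).
  rewrite e1; apply: le_trans (nm_Dd_le _ (leqnn a)) _.
  rewrite -[Dd (2 * m) _](subKr (w t)); apply: le_trans (hnB Hw (HsB Hw HD)) _.
  rewrite lerD2l; apply: le_trans (hKe _ (Hv t)) _; rewrite ler_wpM2l //.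
  by apply: le_trans (vL t); apply: lw_mono; exact: leq_pred.
have near t : `|t| <= T -> hn j (U t - v t) <= de /\ hn j (V * U t - Jn n (V * U t)) <= de.
  by move=> tT; split; [apply: hn1 => //; exact: leq_maxl|apply: hn2 => //; exact: leq_maxr].
have DU t : `|t| <= T -> nm (Dd j (U t)) <= hn a (w t) + Ke * L + de.
  move=> /near[h1 _]; have HU := Hs_le js (HsU t).
  have := nm_Dd_le (U t - v t) (leqnn j); rewrite (DdB HU (Hv t) (leqnn j)) => h2.
  have := nm_sub (L2_Dd HU (leqnn j)) (L2_Dd (Hv t) (leqnn j)); have := Dv t; lra.
have rb t : `|t| <= T -> hn j (rn n t) <= (1 + Kv) * de + `|lambda| * KN * ((qj t)^-1 ^+ 3 * (1 + nm (Dd j (U t)))).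
  move=> tT; have [h1 h2] := near t tT; have HU := Hs_le js (HsU t).
  have [HN hN] := hKN _ _ (qj_ge1 t) HU (hdec t) (fun i ij => hB i t ij).
  have HVU := Hs_V js HU; have HZ := HsZ (cr lambda) HN.
  have LVU := Hs_L2 HVU; have LZ := Hs_L2 HZ.
  have -> : rn n t = V * (U t - v t) - (V * U t - Jn n (V * U t)) + Jn n (Mcst (cr lambda) * Nl k (U t)).
    have EN : Jn n (NN (U t)) = Jn n (V * U t) + Jn n (Mcst (cr lambda) * Nl k (U t)).
      have := JnB n LVU (L2N LZ); rewrite opprK -[_ + _]/(NN (U t)) => ->; congr (_ + _).
      by have := JnB n (@L20 R) LZ; have := JnB n LZ LZ; rewrite !subrr sub0r => -> ->; rewrite sub0r opprK.
    by rewrite /rn EN -/(v t); ring.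
  have Hd := HsB HU (Hv t); have [HVd hVd] := hKv _ Hd.
  have HJ := Hs_Jn n j LVU; have HJN := Hs_Jn n j LZ.
  apply: le_trans (hnD (HsB HVd (HsB HVU HJ)) HJN) _; apply: lerD.
    apply: le_trans (hnB HVd (HsB HVU HJ)) _; have := ler_wpM2l Kv0 h1; lra.
  apply: le_trans (hn_Jn n HZ) _; rewrite hnZ // -mulrA ler_wpM2l // mulrA; exact: hN.
(* In the rate, [de] stems from the commutator with the cutoff and [alj] from the decay of the
   nonlinear term. *)
have main t : `|t| <= T -> `|E' t| <= C1 * (de + alj `|t|) * (E t + K1).
  move=> tT; apply: le_trans (hE' t) _; rewrite -/(w t).
  have hg := (hKp _ (Hr t)).2; have hr := rb t tT; have hD := DU t tT; have hw := wK t; have x0 := X0 t.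
  have := alj_ge (normr_ge0 t); rewrite /qj jap_abs -/(qj t) => hal.
  have q0 : 0 <= (qj t)^-1 ^+ 3 by rewrite exprn_ge0 // invr_ge0; have := qj_ge1 t; lra.
  move: hg hr hD hw x0 hal q0; set x := hn a (w t); set y := hn j (rn n t); set e := E t + K1.
  set q := (qj t)^-1 ^+ 3; set al := alj _; set z := nm _; set G := hn a _ => hg hr hD hw x0 hal q0.
  have e1 : x <= e by have := sqr_ge0 (x - 1); nra.
  have xz : x * (1 + z) <= (4 + Ke * L) * e.
    have c0 : 0 <= Ke * L by rewrite mulr_ge0.
    have : x * (1 + z) <= x * (1 + (x + Ke * L + 1)) by rewrite ler_wpM2l //; lra.
    have := ler_wpM2l c0 e1; nra.
  have e0 : 0 <= e by lra.
  have l0 : 0 <= `|lambda| * KN by rewrite mulr_ge0.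
  have xy : x * y <= ((1 + Kv) + `|lambda| * KN * (4 + Ke * L)) * ((de + al) * e).
    apply: le_trans (ler_wpM2l x0 hr) _.
    have h1 : x * ((1 + Kv) * de) <= (1 + Kv) * ((de + al) * e).
      rewrite mulrCA ler_wpM2l //; [by lra|]; rewrite mulrC; apply: ler_pM => //; [exact: ltW|lra].
    have h2 : x * (`|lambda| * KN * (q * (1 + z))) <= `|lambda| * KN * (4 + Ke * L) * ((de + al) * e).
      rewrite mulrCA -[leRHS]mulrA ler_wpM2l // mulrCA [leRHS]mulrCA.
      apply: ler_pM => //; [|lra]; rewrite mulr_ge0 //; have := nm_ge0 (Dd j (U t)); rewrite -/z; lra.
    by rewrite mulrDr [leRHS]mulrDl; exact: lerD.
  have KB : 0 <= 2 * (1 + B) by lra.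
  rewrite -!mulrA in xy *; rewrite /C1; apply: (@le_trans _ _ (2 * (1 + B) * (Kp * (x * y)))).
    by rewrite -mulrA ler_wpM2l // ?ler_wpM2l //; [lra|rewrite mulrCA ler_wpM2l].
  by rewrite -!mulrA ler_wpM2l // ler_wpM2l ?ler_wpM2l //; lra.
have dEK (t : R) : is_derive t 1 (fun t => E t + K1) (E' t).
  by have d := is_deriveD (dE t) (is_derive_cst K1 t 1); apply: is_derive_eq d _; rewrite addr0.
have dA (t : R) : is_derive t 1 (fun t => C1 * (de * t + Aj t)) (C1 * (de + alj t)).
  have d := is_deriveZ C1 (is_deriveD (is_deriveZ de (is_derive_id t 1)) (is_derive_Aj t)).
  by apply: is_derive_eq d _; rewrite /GRing.scale /= mulr1.
have := gronwall dEK dA main (lexx T); rewrite -/T mulr0 add0r => hG.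
have hx := wK t0; have h0 := DU t0 (lexx _); have h1 : hn a (w t0) <= E t0 + K1.
  by have := sqr_ge0 (hn a (w t0) - 1); nra.
suff : E t0 + K1 <= E0 * expR (C1 * 5) by lra.
apply: le_trans hG _; apply: ler_pM; [by have := wK 0; have := sqr_ge0 (hn a (w 0)); lra|exact: expR_ge0| |].
  rewrite /E0 lerD2r; apply: le_trans (hE2 0) _; rewrite ler_wpM2l //; first by lra.
  rewrite lerXn2r ?nnegrE ?hn_ge0 ?mulr_ge0 ?hn_ge0 //; apply: le_trans (hKp _ (Hv 0)).2 _.
  by rewrite ler_wpM2l //; apply: hn_Jn; exact: Hs_le js (HsU 0).
(* The 5 is 1 from the cutoff error and 4 from [Aj_bound]. *)
by rewrite ler_expR -mulrBr ler_wpM2l //; have := Aj_bound T; lra.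
Qed.

Lemma stage2 : exists2 K, 0 <= K & forall t, hn s (U t) <= K.
Proof.
suff H j : (j <= s.+1)%N -> exists2 Bc, 1 <= Bc & forall i t, (i < j)%N -> nm (Dd i (U t)) <= Bc.
  have [Bc B1 h] := H s.+1 (leqnn _); exists (s.+1%:R * Bc) => [|t]; first by rewrite mulr_ge0 //; lra.
  by apply: (@lw_le s.+1) => i; exact: h.
elim: j => [|j IH] js; first by exists 1.
have [Bc B1 h] := IH (ltnW js).
(* The parity of the order selects the energy: |w|^2 for even j, - <P w, w> for odd j. *)
have E : j = (2 * j./2 + odd j)%N by rewrite mul2n addnC odd_double_half.
have [K hK] : exists K, forall t, nm (Dd j (U t)) <= K.
  rewrite E; apply: (@UB_step _ _ Bc) => //; rewrite -?E //; by case: (odd j).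
exists (Bc + `|K|) => [|i t]; first by have := normr_ge0 K; lra.
have := normr_ge0 K; rewrite ltnS leq_eqVlt => k0 /orP[/eqP ->|/h h1]; last by apply: le_trans (h1 t) _; lra.
by apply: le_trans (hK t) _; have := ler_norm K; lra.
Qed.
End Flow.
End UniformBound.

(** * Weighted estimates *)

Section Weights.
Variable R : realType.
Local Notation mu := (@lebesgue_measure R).
Local Notation C := R[i].
Local Notation Re := (@complex.Re R).
Local Notation Im := (@complex.Im R).
Local Notation M := (Mfun R).
Local Notation ii := (@ii R).
Local Notation kap := (@kap R).
Local Notation Fo := (@Fo R).
Local Notation h0 := (@h0 R).
Local Notation XM := (@XM R).
Implicit Types f g : M.

(** A discrete maximum principle. Divide d_b by A^phi(b), with A = th + 2 and phi(b) = b (2 s - b),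
    and take a maximal index. At an interior one, phi(c) + phi(c + 2) + 2 = 2 phi(c + 1) and A^2 > 1
    + A th force the maximum to be 0; at 0 or s the claim is immediate. *)
Lemma interp_seq (th : R) (s : nat) (d : nat -> R) : 0 <= th -> (forall b, 0 <= d b) ->
  (forall b, (b.+1 < s)%N -> d b.+1 ^+ 2 <= d b * (d b.+2 + th * d b.+1)) ->
  (0 < s)%N -> d 1%N <= (th + 2) ^+ (2 * s).-1 * (d 0%N + d s).
Proof.
move=> th0 d0 hd s0; pose A := th + 2; have A0 : 0 < A by rewrite /A; lra.
have A1 : 1 <= A by rewrite /A; lra.
pose phi b := (b * (2 * s - b))%N; pose e (b : 'I_s.+1) := d b / A ^+ phi b.
have Ap n : 0 < A ^+ n by exact: exprn_gt0.
have [b _ hb] := @arg_maxP _ R 'I_s.+1 ord0 xpredT e isT.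
have hmax i : (i <= s)%N -> d i <= A ^+ phi i * e b.
  by move=> is_; have := hb (Ordinal (is_ : i < s.+1)%N) isT; rewrite /e /= ler_pdivrMr // mulrC.
have e0 : 0 <= e b by rewrite /e divr_ge0 // ltW.
have phi1 : phi 1%N = (2 * s).-1 by rewrite /phi mul1n subn1.
have end_ (i : nat) : e b <= d i -> d 1%N <= A ^+ (2 * s).-1 * d i.
  move=> h; apply: le_trans (hmax 1%N s0) _; rewrite phi1 ler_wpM2l //; exact: ltW.
have eb : e b <= d b by rewrite /e ler_pdivrMr // ler_peMr // exprn_ege1.
have sum0 := d0 0%N; have sums := d0 s.
have [z|bpos] := posnP b.
  apply: le_trans (end_ 0%N _) _; first by move: eb; rewrite z.
  by rewrite ler_wpM2l ?(ltW (Ap _)) // lerDl.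
have [z|bs] := eqVneq (b : nat) s.
  apply: le_trans (end_ s _) _; first by move: eb; rewrite z.
  by rewrite ler_wpM2l ?(ltW (Ap _)) // lerDr.
have {bs}bs : (b < s)%N by rewrite ltn_neqAle bs -ltnS ltn_ord.
suff ez : e b = 0.
  by apply: le_trans (hmax 1%N s0) _; rewrite ez mulr0 mulr_ge0 ?(ltW (Ap _)) // addr_ge0.
have {eb}eb : d b = A ^+ phi b * e b by rewrite /e mulrC divfK // gt_eqF.
case E : (b : nat) bpos bs eb => [//|c] _ cs eb.
have := hd c cs; rewrite eb; have h1 := hmax c (ltnW (ltnW cs)); have h2 := hmax c.+2 cs.
move: (e b) e0 h1 h2 => m m0 h1 h2 h.
have p1 : phi c.+1 = (phi c + (2 * (s - c.+1)).+1)%N.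
  rewrite /phi; have -> : (s = c.+1 + (s - c.+1))%N by rewrite subnKC // ltnW.
  set l := (s - _)%N; rewrite addKn; have -> : (2 * (c.+1 + l) - c.+1 = c.+1 + 2 * l)%N by lia.
  have -> : (2 * (c.+1 + l) - c = c.+2 + 2 * l)%N by lia.
  by lia.
have p2 : (phi c + phi c.+2 + 2 = 2 * phi c.+1)%N.
  rewrite /phi; have -> : (s = c.+2 + (s - c.+2))%N by rewrite subnKC.
  set l := (s - _)%N; have -> : (2 * (c.+2 + l) - c.+1 = c.+3 + 2 * l)%N by lia.
  have -> : (2 * (c.+2 + l) - c = c.+4 + 2 * l)%N by lia.
  have -> : (2 * (c.+2 + l) - c.+2 = c.+2 + 2 * l)%N by lia.
  by lia.
set P := A ^+ phi c.+1 in h eb; have P0 : 0 < P := Ap _.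
have q1 : A * A ^+ phi c <= P.
  by rewrite -exprS /P p1; apply: ler_weXn2l => //; rewrite addnS ltnS leq_addr.
have q2 : A ^+ 2 * (A ^+ phi c * A ^+ phi c.+2) = P ^+ 2 by rewrite -!exprD addnC p2 mulnC exprM.
have h3 : d c * (d c.+2 + th * (P * m)) <= A ^+ phi c * m * (A ^+ phi c.+2 * m + th * (P * m)).
  apply: ler_pM => //; first by rewrite addr_ge0 // !mulr_ge0 // ltW.
  by rewrite lerD2r.
have h4 : A ^+ 2 * (P * m) ^+ 2 <= (1 + A * th) * (P * m) ^+ 2.
  apply: le_trans (ler_wpM2l (ltW (Ap 2)) (le_trans h h3)) _.
  rewrite [leLHS](_ : _ = A ^+ 2 * (A ^+ phi c * A ^+ phi c.+2) * m ^+ 2 + A * th * (A * A ^+ phi c) * P * m ^+ 2); last by ring.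
  rewrite q2 [leRHS](_ : _ = P ^+ 2 * m ^+ 2 + A * th * P * P * m ^+ 2); last by ring.
  rewrite lerD2l ler_wpM2r ?sqr_ge0 // ler_wpM2r ?(ltW P0) // ler_wpM2l // mulr_ge0 //; exact: ltW.
have PP : 0 < P ^+ 2 by exact: exprn_gt0.
have mm := sqr_ge0 m; rewrite exprMn in h4.
apply/eqP; rewrite -sqrf_eq0 eq_le mm andbT.
have A2 : 1 + A * th + 1 <= A ^+ 2 by rewrite /A; nra.
have Pm0 : 0 <= P ^+ 2 * m ^+ 2 by rewrite mulr_ge0 // ltW.
by rewrite -(pmulr_rle0 _ PP); nra.
Qed.

Section Weight.
Variables (r r' : R -> R) (T La : R).
Hypothesis dr : forall y : R, is_derive y 1 r (r' y).
Hypothesis T1 : 1 <= T.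
Hypothesis rT : forall x, T <= r x.
Hypothesis rL : forall x, r x <= La.
Hypothesis r'1 : forall x, `|r' x| <= 1.

(** Powers of the weight as multipliers. The upper bound La only keeps the products in L^2; the
    lower bound T is the one that makes estimates quantitative. *)
Definition wm (p : nat) : M := rM (fun x => r x ^+ p).
Let rh : M := rM r'.
Let ki : M := rM (fun x => (r x)^-1).

Lemma r_gt0 x : 0 < r x. Proof. by apply: lt_le_trans (rT x); have := T1; lra. Qed.
Lemma La_ge1 : 1 <= La. Proof. by have := rT 0; have := rL 0; have := T1; lra. Qed.
Lemma meas_r : measurable_fun setT r. Proof. by have [] := measurable_deriv dr. Qed.
Lemma meas_rp p : measurable_fun setT (fun x => r x ^+ p).
Proof. exact: measurable_funX meas_r. Qed.
Lemma wmD p q : wm (p + q) = wm p * wm q.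
Proof.
rewrite /wm rMM; [|exact: meas_rp|exact: meas_rp].
by congr rM; apply/funext => x; rewrite exprD.
Qed.
Lemma wm0 : wm 0 = 1.
Proof. by rewrite -[1]cr1 -rM_cst; congr rM; apply/funext => x; rewrite expr0. Qed.
Lemma conj_wm p : Mconj (wm p) = wm p. Proof. exact: conj_rM (meas_rp p). Qed.
Lemma bdd_wm p : bdd (wm p) (La ^+ p).
Proof.
apply: bdd_rM (meas_rp p) _ => x; have r0 := r_gt0 x; have L1 := La_ge1.
rewrite ger0_norm ?exprn_ge0 ?(ltW r0) //; apply: lerXn2r (rL x); rewrite nnegrE; lra.
Qed.
Lemma bdd_rh : bdd rh 1. Proof. by apply: bdd_rM r'1; have [] := measurable_deriv dr. Qed.
Lemma meas_ki : measurable_fun setT (fun x => (r x)^-1).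
Proof.
have d (y : R) : is_derive y 1 (fun x => (r x)^-1) (- (r y) ^- 2 *: r' y).
  by apply: is_deriveV; rewrite gt_eqF // r_gt0.
by have [] := measurable_deriv d.
Qed.
Lemma bdd_ki : bdd ki T^-1.
Proof.
apply: bdd_rM meas_ki _ => x; have r0 := r_gt0 x; rewrite ger0_norm ?invr_ge0 ?(ltW r0) //.
by rewrite lef_pV2 // posrE; have := T1; lra.
Qed.
Lemma wm_ki p : wm p = ki * wm p.+1.
Proof.
rewrite /wm /ki rMM; [|exact: meas_ki|exact: meas_rp].
by congr rM; apply/funext => x; rewrite exprS mulKf // gt_eqF // r_gt0.
Qed.

Lemma L2_wm p f : L2 f -> L2 (wm p * f). Proof. exact: L2M (bdd_wm p). Qed.
(** One power of r less gains 1 / T, because r >= T. *)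
Lemma wm_le p f : L2 f -> nm (wm p * f) <= T^-1 * nm (wm p.+1 * f).
Proof. by move=> Lf; rewrite wm_ki -mulrA; apply: nmM_bdd bdd_ki _; exact: L2_wm. Qed.

Lemma dF_wm p f f' : dF f f' ->
  dF (wm p * f) (wm p * f' + Mcst (cr p%:R) * (wm p.-1 * (rh * f))).
Proof.
move=> d; have L1 := La_ge1; have [r'm] := measurable_deriv dr => mr'.
have dp (y : R) : is_derive y 1 (fun x => r x ^+ p) (p%:R * r y ^+ p.-1 * r' y).
  by have d1 := is_deriveX p (dr y); rewrite exprfctE in d1; apply: is_derive_eq d1 _.
have B (x : R) : `|p%:R * r x ^+ p.-1 * r' x| <= p%:R * La ^+ p.-1.
  have r0 := r_gt0 x; rewrite !normrM ger0_norm // (ger0_norm (exprn_ge0 _ (ltW r0))).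
  rewrite -[leRHS]mulr1; apply: ler_pM (r'1 x) => //; first by rewrite mulr_ge0 // exprn_ge0 // ltW.
  by rewrite ler_wpM2l //; apply: lerXn2r (rL x); rewrite nnegrE; lra.
have := dF_rM dp (bdd_wm p) B d.
rewrite (_ : rM (fun x => p%:R * _ * _) * f = Mcst (cr p%:R) * (wm p.-1 * (rh * f))) // !mulrA; congr (_ * _).
have mc : measurable_fun setT (fun _ : R => p%:R : R) by exact: measurable_cst.
by rewrite -rM_cst /wm /rh !rMM //; [exact: measurable_funM mc (meas_rp _)|exact: meas_rp].
Qed.

Lemma rip_wm p q f g : L2 f -> L2 g -> `|rip (wm (p + q) * f) g| <= nm (wm p * f) * nm (wm q * g).
Proof.
move=> Lf Lg; rewrite addnC wmD -mulrA rip_adj conj_wm; apply: CS; exact: L2_wm.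
Qed.
Lemma rip_wm_rh p q f g : L2 f -> L2 g -> `|rip (wm (p + q) * (rh * f)) g| <= nm (wm p * f) * nm (wm q * g).
Proof.
move=> Lf Lg; have Lr := L2M bdd_rh Lf; apply: le_trans (rip_wm p q Lr Lg) _.
rewrite ler_wpM2r ?nm_ge0 // mulrCA; have := nmM_bdd bdd_rh (L2_wm p Lf); by rewrite mul1r.
Qed.

(** Moving one derivative off f' in |r^(p+1) f'|^2 pairs f'' with f under the weights p and p + 2.
    The derivative may also fall on the weight; two powers of r are then missing on f, that is a
    factor T^-2. *)
Lemma wm_interp p f f' f'' : dF f f' -> dF f' f'' ->
  nm (wm p.+1 * f') ^+ 2 <= nm (wm p * f'') * nm (wm p.+2 * f) +
    (p.+1 + p.+1)%:R * T^-1 ^+ 2 * (nm (wm p.+1 * f') * nm (wm p.+2 * f)).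
Proof.
move=> d d'; have [Lf Lf' _] := d; have [_ Lf'' _] := d'.
rewrite -rip_nm rip_adj conj_wm mulrA -wmD (dF_adj d (dF_wm (p.+1 + p.+1) d')) ripC.
have Lr := L2M bdd_rh Lf'; have Lm := L2_wm (p.+1 + p.+1).-1 Lr.
rewrite ripDl ?ripZl //; [|exact: L2_wm|exact: L2Z].
have h1 := rip_wm p p.+2 Lf'' Lf; have h2 := rip_wm_rh p.+1 p Lf' Lf.
have T0 : 0 <= T^-1 by rewrite invr_ge0; have := T1; lra.
have h3 : nm (wm p * f) <= T^-1 ^+ 2 * nm (wm p.+2 * f).
  by apply: le_trans (wm_le p Lf) _; rewrite expr2 -mulrA ler_wpM2l // wm_le.
have h4 := ler_wpM2l (nm_ge0 (wm p.+1 * f')) h3.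
have -> : (p.+1 + p.+1 = p + p.+2)%N by rewrite !addnS.
have -> : ((p + p.+2).-1 = p.+1 + p)%N by lia.
move: h1 h2 h4; rewrite !ler_norml => /andP[h1 _] /andP[h2 _] h4.
have n0 : 0 <= (p + p.+2)%:R :> R by [].
have h5 := ler_wpM2l n0 h4; have h6 := ler_wpM2l n0 h2; rewrite opprD; lra.
Qed.

End Weight.
End Weights.

(** * Growth of the weighted norm *)

Section WeightedEvolution.
Variable R : realType.
Local Notation mu := (@lebesgue_measure R).
Local Notation C := R[i].
Local Notation Re := (@complex.Re R).
Local Notation Im := (@complex.Im R).
Local Notation M := (Mfun R).
Local Notation ii := (@ii R).
Local Notation kap := (@kap R).
Local Notation Fo := (@Fo R).
Local Notation h0 := (@h0 R).
Local Notation XM := (@XM R).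
Implicit Types f g : M.

(** Multiplication by i th is skew-adjoint when th is real. *)
Lemma rip_selfadj0 (th f : M) : Mconj th = th -> L2 f -> L2 (ii * (th * f)) -> rip f (ii * (th * f)) = 0.
Proof.
move=> hth Lf; rewrite mulrA => L; have := rip_adj (ii * th) f f; rewrite MconjM ii_conj hth !mulNr ripNr //.
by rewrite ripC => h; lra.
Qed.

Section Evolution.
Variables (s k : nat) (lambda B K : R) (W : nat -> R -> R) (U : R -> M).
Hypothesis s1 : (1 <= s)%N.
Hypothesis hW : smoothV s W B.
Local Notation NN := (NN k lambda W).
Let Y t : M := Em t * Fo (U t).
Let Z t : M := ii * (Em t * Fo (NN (U t))).
Hypothesis hd : forall c, L2 c -> forall t : R, is_derive t 1 (fun s => rip (Y s) c) (rip (Z t) c).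
Hypothesis hU : contH s U.
Hypothesis K0 : 0 <= K.
Hypothesis hK : forall t, hn s (U t) <= K.

Variables (r r' : R -> R) (T La : R).
Hypothesis dr : forall y : R, is_derive y 1 r (r' y).
Hypothesis T1 : 1 <= T.
Hypothesis rT : forall x, T <= r x.
Hypothesis rL : forall x, r x <= La.
Hypothesis r'1 : forall x, `|r' x| <= 1.
Local Notation wm := (wm r).

Let bw p : bdd (wm p) (La ^+ p) := bdd_wm dr T1 rT rL p.
Let Lw p f : L2 f -> L2 (wm p * f) := L2_wm dr T1 rT rL p (f := f).
Definition Cs : R := ((s + s)%:R + 2) ^+ (2 * s).-1.

(** The norms T^(b-s) |r^(s-b) d^b f| satisfy the hypothesis of [interp_seq] by [wm_interp]; the
    powers of T make the constant of the error term independent of T. *)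
Lemma interp_v f : Hs s f ->
  nm (wm s.-1 * Dd 1 f) <= Cs * (T^-1 * nm (wm s * f) + T ^+ s.-1 * nm (Dd s f)).
Proof.
move=> Hf; have T0 : 0 < T by have := T1; lra.
pose ta := T^-1; have t0 : 0 < ta by rewrite invr_gt0.
have t1 : ta <= 1 by rewrite invf_le1.
pose d b := ta ^+ (s - b) * nm (wm (s - b) * Dd b f).
have dge0 b : 0 <= d b by apply: mulr_ge0; [rewrite exprn_ge0 // ltW|exact: nm_ge0].
have dint b : (b.+1 < s)%N -> d b.+1 ^+ 2 <= d b * (d b.+2 + (s + s)%:R * d b.+1).
  move=> bs; have E0 : (s - b = (s - b.+2).+2)%N by rewrite -!subSn ?subSS // ltnW.
  have E1 : (s - b.+1 = (s - b.+2).+1)%N by rewrite -!subSn ?subSS.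
  rewrite /d E0 E1; have ps : ((s - b.+2).+1 <= s)%N by rewrite -E1 leq_subr.
  set p := (s - b.+2)%N in ps *.
  have h := wm_interp dr T1 rT rL r'1 p (dF_Dd Hf (ltnW bs)) (dF_Dd Hf bs).
  move: h; set x := nm (wm p.+1 * _); set y := nm (wm p * _); set z := nm (wm p.+2 * _) => h.
  have x0 : 0 <= x := nm_ge0 _; have z0 : 0 <= z := nm_ge0 _.
  have q0 : 0 <= ta ^+ p by rewrite exprn_ge0 // ltW.
  have h2 := ler_wpM2l (sqr_ge0 (ta ^+ p.+1)) h.
  rewrite exprMn; apply: le_trans h2 _.
  have -> : ta ^+ p.+2 * z * (ta ^+ p * y + (s + s)%:R * (ta ^+ p.+1 * x)) =
    (ta ^+ p.+1) ^+ 2 * (y * z) + (s + s)%:R * ta * ((ta ^+ p.+1) ^+ 2 * (x * z)).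
    by rewrite !exprS; ring.
  rewrite mulrDr lerD2l mulrCA mulrC -/ta -[leRHS]mulrA [leRHS]mulrC -mulrA mulrC -!mulrA.
  have X0 : 0 <= (ta ^+ p.+1) ^+ 2 * (x * z) by rewrite mulr_ge0 ?sqr_ge0 // mulr_ge0.
  have c1 : (p.+1 + p.+1)%:R * ta ^+ 2 <= (s + s)%:R * ta.
    apply: ler_pM => //; [exact: sqr_ge0|by rewrite ler_nat leq_add|].
    by rewrite expr2 ler_piMr // ltW.
  have := ler_wpM2r X0 c1; lra.
have := interp_seq (ler0n _ _) dge0 dint s1.
rewrite /d subnn expr0 mul1r wm0 mul1r subn0 subn1 Dd0; last exact: Hs_L2 Hf.
move=> h.
have P0 : 0 < T ^+ s.-1 by exact: exprn_gt0.
have Pt : T ^+ s.-1 * ta ^+ s.-1 = 1 by rewrite -exprMn mulfV ?expr1n // gt_eqF.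
have Ps : T ^+ s.-1 * ta ^+ s = ta by rewrite -{2}(prednK s1) exprSr mulrA Pt mul1r.
have := ler_wpM2l (ltW P0) h; rewrite mulrA Pt mul1r => {}h; apply: le_trans h _.
rewrite mulrCA -/(Cs) mulrDr mulrA Ps; exact: lexx.
Qed.

Definition Cexp : R := 8 * s%:R * Cs + 1.
Definition Cw : R := 2 * expR Cexp * (K ^+ 2 + 4) + 2.

(** In the derivative of |r^s v|^2 the term d^2 leaves only the derivative of the weight against
    r^(s-1) v_x, which [interp_v] and the H^s bound estimate. Potential and nonlinearity act on u as
    a real multiplier, so they contribute a cutoff error only. The resulting rate is a constant over
    T, whose integral over |t| <= T is bounded. *)
Lemma wevol t0 : `|t0| <= T ->
  nm (wm s * U t0) ^+ 2 <= Cw * (nm (wm s * U 0) ^+ 2 + T ^+ (2 * s)).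
Proof.
move=> t0T; have T0 : 0 < T by have := T1; lra.
have L1 : 1 <= La := La_ge1 T1 rT rL; have hs1 : (0.+1 <= s)%N by [].
have [Kn Kn0 hKn] := NN_bound k lambda hW K0 hs1.
have hU1 : contH 1 U := contH_le s1 hU.
have LU t := L2U hU t; have cN := contH_NN k lambda hW s1 hU1.
have N1 t : nm (NN (U t)) <= Kn.
  have H1 := hU1.1 t; have h1 : hn 1 (U t) <= K := le_trans (hn_mono _ s1) (hK t).
  have [HN h] := hKn _ H1 h1; exact: le_trans (nm_le_hn _ (Hs_L2 HN)) h.
pose ta := T^-1; have t_0 : 0 < ta by rewrite invr_gt0.
have t1 : ta <= 1 by rewrite invf_le1.
have P1 p : 1 <= La ^+ p by exact: exprn_ege1.
(* The bound La of the weight enters only this tolerance, hence n, and not the final constant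
   [Cw]. *)
pose de := ta / (2 * La ^+ (s + s) * (K + Kn) + La ^+ s + 1).
have D0 : 0 < 2 * La ^+ (s + s) * (K + Kn) + La ^+ s + 1.
  have := P1 s; have : 0 <= 2 * La ^+ (s + s) * (K + Kn); last by lra.
  by rewrite !mulr_ge0 ?addr_ge0 //; have := P1 (s + s)%N; lra.
have d0 : 0 < de by rewrite divr_gt0.
have dD : de * (2 * La ^+ (s + s) * (K + Kn) + La ^+ s + 1) = ta by rewrite /de divfK // gt_eqF.
have L20' : 0 <= 2 * La ^+ (s + s) * (K + Kn).
  by rewrite !mulr_ge0 ?addr_ge0 //; have := P1 (s + s)%N; lra.
have d1 : de * La ^+ s <= 1 by have := mulr_ge0 (ltW d0) L20'; lra.
have d2 : 2 * La ^+ (s + s) * (K + Kn) * de <= ta.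
  by have := mulr_ge0 (ltW d0) (le_trans ler01 (P1 s)); lra.
have [n1 hn1] := Jn_unif T hU1 d0; have [n2 hn2] := Jn_unif T cN d0.
pose n := maxn n1 n2; pose v t := Jn n (U t); pose JN t := Jn n (NN (U t)).
have near t : `|t| <= T -> nm (U t - v t) <= de /\ nm (NN (U t) - JN t) <= de.
  move=> tT; have LN := Hs_L2 (cN.1 t); split.
    apply: le_trans (nm_le_hn 1 (L2B (LU t) (L2_Jn n (LU t)))) _; apply: hn1 => //; exact: leq_maxl.
  apply: le_trans (nm_le_hn 1 (L2B LN (L2_Jn n LN))) _; apply: hn2 => //; exact: leq_maxr.
have Hv t p : Hs p (v t) := Hs_Jn n p (LU t).
have cv := cder_bdd (bw s) (cderH_cder (cderH_v s1 hW hd hU n 2)).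
(* The shift is the size expected of the solution: the H^s term of [interp_v] and the cutoff errors
   then become multiples of G. *)
pose G t := rip (wm s * v t) (wm s * v t) + T ^+ (2 * s) * (K ^+ 2 + 1).
pose G' t := 2 * rip (wm s * v t) (wm s * (ii * (Dd 2 (v t) + JN t))).
have dG (t : R) : is_derive t 1 G (G' t).
  have d := is_deriveD (cder_rip t cv cv) (is_derive_cst (T ^+ (2 * s) * (K ^+ 2 + 1)) t 1).
  by apply: is_derive_eq d _; rewrite addr0 /G' ripC mulr_natl mulr2n.
have Ts : 1 <= T ^+ (2 * s) by exact: exprn_ege1.
have G1 t : 1 <= G t.
  have T2 : 1 <= T ^+ (2 * s) * (K ^+ 2 + 1) by apply: mulr_ege1 => //; rewrite lerDr sqr_ge0.
  by rewrite /G rip_nm; have := sqr_ge0 (nm (wm s * v t)); lra.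
have main t : `|t| <= T -> `|G' t| <= Cexp * ta * G t.
  move=> tT; have [e1 e2] := near t tT; have Lv := Hs_L2 (Hv t 0%N); have LN := Hs_L2 (cN.1 t).
  have LJ : L2 (JN t) := L2_Jn n LN; have dv := dF_Dd1 (Hv t 1%N).
  have dv2 := dFZ 'i (dF_Dd (Hv t 2%N) (isT : 1 < 2)%N); have [_ LD1 _] := dv; have [_ LD2 _] := dv2.
  have LD2' := L2_Dd (Hv t 2%N) (leqnn 2).
  set W0 := nm (wm s * v t); set W1 := nm (wm s.-1 * Dd 1 (v t)).
  have A1 : `|rip (wm (s + s) * v t) (ii * Dd 2 (v t))| <= (s + s)%:R * (W0 * W1).
    have E := dF_adj (dF_wm dr T1 rT rL r'1 (s + s) dv) dv2; rewrite -/ii in E.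
    have -> : rip (wm (s + s) * v t) (ii * Dd 2 (v t)) = - - rip (wm (s + s) * v t) (ii * Dd 2 (v t)) by rewrite opprK.
    have Lr := L2M (bdd_rh dr r'1) Lv; have Lm := L2_wm dr T1 rT rL (s + s).-1 Lr.
    rewrite -E normrN ripDl ?ripZl //; [|exact: L2ii|exact: Lw|exact: L2Z|exact: L2ii].
    have -> : rip (wm (s + s) * Dd 1 (v t)) (ii * Dd 1 (v t)) = 0.
      rewrite rip_adj (conj_wm dr) mulrCA; apply: (rip_selfadj0 (conj_wm dr _) LD1).
      by apply: L2ii; exact: Lw LD1.
    rewrite add0r normrM ger0_norm // ler_wpM2l //.
    have -> : ((s + s).-1 = s + s.-1)%N by rewrite -{2}(prednK s1) addnS.
    have := rip_wm_rh dr T1 rT rL r'1 s s.-1 Lv (L2ii LD1); rewrite [wm s.-1 * _]mulrCA nm_ii; exact.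
  have A2 : `|rip (wm (s + s) * v t) (ii * JN t)| <= La ^+ (s + s) * (K + Kn) * de.
    (* V + lambda |u|^(2k), a real multiplier with N(u) = th u, so that r^(2 s) u is orthogonal to i
       N(u). *)
    pose th : M := rM (W 0%N) + Mcst (cr lambda) * (U t * Mconj (U t)) ^+ k.
    have cth : Mconj th = th.
      rewrite MconjD (conj_V hW s1) MconjM cr_conj; congr (_ + _ * _).
      elim: (k) => [|p IH]; first by rewrite !expr0 -cr1 cr_conj.
      by rewrite !exprS MconjM IH MconjM MconjK; ring.
    have eN : NN (U t) = th * U t by rewrite /NN /Nl /th mulrDl mulrA.
    have Z0 : rip (wm (s + s) * U t) (ii * NN (U t)) = 0.
      rewrite rip_adj (conj_wm dr) mulrCA eN [wm _ * _]mulrA; apply: rip_selfadj0 => //.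
        by rewrite MconjM (conj_wm dr) cth.
      by rewrite -mulrA -eN; apply: L2ii; exact: Lw LN.
    have Ld := L2B (LU t) Lv; have Le := L2B LN LJ.
    have -> : rip (wm (s + s) * v t) (ii * JN t) =
        - rip (wm (s + s) * v t) (ii * (NN (U t) - JN t)) - rip (wm (s + s) * (U t - v t)) (ii * NN (U t)).
      rewrite (mulrBr ii) (ripBr (L2ii LN) (L2ii LJ) (Lw (s + s) Lv)).
      by rewrite (mulrBr (wm (s + s))) (ripBl (Lw (s + s) (LU t)) (Lw (s + s) Lv) (L2ii LN)) Z0; ring.
    have h1 := CS (Lw (s + s) Lv) (L2ii Le); have h2 := CS (Lw (s + s) Ld) (L2ii LN).
    rewrite nm_ii in h1; rewrite nm_ii in h2.
    have h3 := nmM_bdd (bw (s + s)) Lv; have h4 := nmM_bdd (bw (s + s)) Ld.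
    have h5 : nm (v t) <= K.
      by apply: le_trans (nm_Jn n (LU t)) _; apply: le_trans (hK t); exact: nm_le_hn (LU t).
    have P0 := le_trans ler01 (P1 (s + s)%N).
    have h6 : nm (wm (s + s) * v t) * nm (NN (U t) - JN t) <= (La ^+ (s + s) * K) * de.
      by apply: ler_pM => //; do ?exact: nm_ge0; apply: le_trans h3 _; rewrite ler_wpM2l.
    have h7 : nm (wm (s + s) * (U t - v t)) * nm (NN (U t)) <= (La ^+ (s + s) * de) * Kn.
      by apply: ler_pM => //; do ?exact: nm_ge0; apply: le_trans h4 _; rewrite ler_wpM2l.
    by apply: le_trans (ler_normB _ _) _; rewrite normrN; lra.
  have W00 : 0 <= W0 := nm_ge0 _; have C0 : 0 <= Cs by rewrite exprn_ge0 // addr_ge0.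
  have A3 : W1 <= Cs * (ta * W0 + T ^+ s.-1 * K).
    apply: le_trans (interp_v (Hv t s)) _; rewrite ler_wpM2l // lerD2l ler_wpM2l ?exprn_ge0 ?(ltW T0) //.
    rewrite (Jn_Dd n (hU.1 t) (leqnn s)); apply: le_trans (nm_Jn n (L2_Dd (hU.1 t) (leqnn s))) _.
    exact: le_trans (nm_Dd_le _ (leqnn s)) (hK t).
  have A4 : W0 * W1 <= 2 * Cs * ta * (W0 ^+ 2 + T ^+ (2 * s) * K ^+ 2).
    apply: le_trans (ler_wpM2l W00 A3) _.
    have Tp : T ^+ s.-1 = ta * T ^+ s by rewrite -{2}(prednK s1) exprS mulrA mulVf ?mul1r // gt_eqF.
    rewrite Tp mulnC exprM (_ : W0 * _ = Cs * ta * (W0 ^+ 2 + T ^+ s * K * W0)); last by ring.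
    rewrite (_ : 2 * _ * _ * _ = Cs * ta * (2 * (W0 ^+ 2 + (T ^+ s) ^+ 2 * K ^+ 2))); last by ring.
    rewrite ler_wpM2l ?mulr_ge0 ?(ltW t_0) // -exprMn; move: (T ^+ s * K) => q.
    by have := sqr_ge0 (q - W0); have := sqr_ge0 q; have := sqr_ge0 W0; lra.
  have eG : G' t = 2 * (rip (wm (s + s) * v t) (ii * Dd 2 (v t)) + rip (wm (s + s) * v t) (ii * JN t)).
    rewrite /G' ripC rip_adj (conj_wm dr) (mulrA (wm s)) -(wmD dr) ripC mulrDr.
    by rewrite (ripDr (L2ii LD2') (L2ii LJ) (Lw (s + s) Lv)).
  rewrite eG normrM (ger0_norm (ler0n R 2)); have := ler_normD (rip (wm (s + s) * v t) (ii * Dd 2 (v t))) (rip (wm (s + s) * v t) (ii * JN t)).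
  have eG2 : G t = W0 ^+ 2 + T ^+ (2 * s) * K ^+ 2 + T ^+ (2 * s) by rewrite /G rip_nm mulrDr mulr1 addrA.
  have g1 := G1 t; have g2 : W0 ^+ 2 + T ^+ (2 * s) * K ^+ 2 <= G t by rewrite eG2; lra.
  have c1 : 0 <= 2 * Cs * ta by rewrite !mulr_ge0 // ltW.
  have A5 : W0 * W1 <= 2 * Cs * ta * G t by apply: le_trans A4 _; rewrite ler_wpM2l.
  have s0 : 0 <= s%:R :> R by []; have A6 := ler_wpM2l s0 A5.
  have g3 : ta <= ta * G t by rewrite ler_peMr // ltW.
  rewrite natrD in A1; rewrite /Cexp; lra.
have dA (t : R) : is_derive t 1 (fun t => Cexp * ta * t) (Cexp * ta).
  by have d := is_deriveZ (Cexp * ta) (is_derive_id t (1 : R)); apply: is_derive_eq d _; rewrite /GRing.scale /= mulr1.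
have := gronwall dG dA main t0T; rewrite mulr0 subr0 => hG.
have near2 t : `|t| <= T -> nm (wm s * U t - wm s * v t) <= 1.
  move=> /near[h _]; rewrite -mulrBr; apply: le_trans (nmM_bdd (bw s) (L2B (LU t) (L2_Jn n (LU t)))) _.
  by apply: le_trans (ler_wpM2l (le_trans ler01 (P1 s)) h) _; rewrite mulrC.
have ab (x y : R) : 0 <= x -> 0 <= y -> x <= y + 1 -> x ^+ 2 <= 2 * y ^+ 2 + 2.
  by move=> x0 y0 xy; have := sqr_ge0 (y - 1); nra.
have LWU t := Lw s (LU t); have LWv t := Lw s (L2_Jn n (LU t)).
have i1 : nm (wm s * U t0) ^+ 2 <= 2 * nm (wm s * v t0) ^+ 2 + 2.
  apply: ab; rewrite ?nm_ge0 //; have := nm_sub (LWU t0) (LWv t0); have := near2 t0 t0T; lra.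
have i2 : nm (wm s * v 0) ^+ 2 <= 2 * nm (wm s * U 0) ^+ 2 + 2.
  have z : `|0 : R| <= T by rewrite normr0 ltW.
  apply: ab; rewrite ?nm_ge0 //; have := nm_sub (LWv 0) (LWU 0); rewrite nmBC; have := near2 0 z; lra.
have ex : expR (Cexp * ta * `|t0|) <= expR Cexp.
  rewrite ler_expR -mulrA ler_piMr //; last by rewrite mulrC ler_pdivrMr ?mul1r.
  by rewrite /Cexp addr_ge0 // !mulr_ge0 // exprn_ge0 // addr_ge0.
have E1 : 1 <= expR Cexp.
  by rewrite -expR0 ler_expR /Cexp addr_ge0 // !mulr_ge0 // exprn_ge0 // addr_ge0.
have g1 := le_trans hG (ler_wpM2l (le_trans ler01 (G1 0)) ex); move: g1 i1 i2.
rewrite /G !rip_nm /Cw; set X := nm (wm s * U t0); set x := nm (wm s * v t0); set y := nm (wm s * v 0).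
set z := nm (wm s * U 0); set e := expR Cexp in E1 *; set P := T ^+ (2 * s) in Ts *; set K2 := K ^+ 2 => g1 i1 i2.
have K20 : 0 <= K2 by exact: sqr_ge0.
have z0 := sqr_ge0 z; have e0 : 0 <= e by lra.
have g2 : (y ^+ 2 + P * (K2 + 1)) * e <= (2 * z ^+ 2 + 2 + P * (K2 + 1)) * e by rewrite ler_wpM2r //; lra.
have PK : 0 <= P * (K2 + 1) by rewrite mulr_ge0 //; lra.
have g3 : 2 * z ^+ 2 + 2 + P * (K2 + 1) <= (K2 + 4) * (z ^+ 2 + P) by have := mulr_ge0 K20 z0; nra.
have := ler_wpM2r e0 g3; nra.
Qed.
End Evolution.
End WeightedEvolution.

(** * Concrete weights and conclusion *)

Section FinalWeight.
Variable R : realType.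
Local Notation mu := (@lebesgue_measure R).
Local Notation C := R[i].
Local Notation Re := (@complex.Re R).
Local Notation Im := (@complex.Im R).
Local Notation M := (Mfun R).
Local Notation ii := (@ii R).
Local Notation kap := (@kap R).
Local Notation Fo := (@Fo R).
Local Notation h0 := (@h0 R).
Local Notation XM := (@XM R).
Implicit Types f g : M.

Lemma nm_rM_le (w1 w2 : R -> R) f : measurable_fun setT w1 -> measurable_fun setT w2 ->
  (forall x, `|w1 x| <= `|w2 x|) -> L2 (rM w2 * f) -> L2 (rM w1 * f) /\ nm (rM w1 * f) <= nm (rM w2 * f).
Proof.
move=> m1 m2 h L; suff H : (n2 (rM w1 * f)%R <= n2 (rM w2 * f)%R)%E.
  have L1 : L2 (rM w1 * f) by exact: le_lt_trans H L.
  split=> //; move: H; rewrite !n2E // lee_fin ler_pXn2r ?nnegrE ?nm_ge0 //.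
apply: n2_le; [by apply: measurable_csq; exact: rep_meas| |by move=> x; exact: csq_ge0].
have E w : measurable_fun setT w -> {ae mu, forall x, rep (rM w * f) x = (w x)%:C * rep f x}.
  by move=> mw; apply: aeS2 _ (rep_rM mw) (repM (rM w) f) => x h1 ->; rewrite h1.
apply: aeS2 _ (E _ m1) (E _ m2) => x -> ->; rewrite !csqM ler_wpM2r ?csq_ge0 //.
by rewrite -!cmod_sqr !cmod_real lerXn2r ?nnegrE.
Qed.

Lemma weight_norm2E s (g : R -> C) : cmeas g ->
  weight_norm2 s g = n2 (rM (fun x => x ^+ s) * pi g).
Proof.
move=> mg; have mx : measurable_fun setT (fun x : R => x ^+ s) by exact: measurable_funX.
have mc : cmeas (fun x : R => (x ^+ s)%:C) by exact: cmeas_real.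
rewrite /rM piM // n2_pi; last exact: cmeasM.
apply: eq_integral => x _; congr (_%:E); rewrite csqM cmod_sqr; congr (_ * _).
by rewrite /csq /= expr0n addr0 mulnC exprM.
Qed.

(** T plus <x> damped to stay below 1 / e. It increases to T + <x> as e decreases to 0, while its
    derivative [rw'] stays at most 1 in modulus for every e. *)
Definition rw (T e x : R) : R := T + jap x / (1 + e * jap x).
Definition rw' (e x : R) : R := x / jap x / (1 + e * jap x) ^+ 2.

Lemma norm_le_jap (x : R) : `|x| <= jap x.
Proof.
have j1 := jap_ge1 x; rewrite -(@ler_pXn2r _ 2) ?nnegrE //; last by lra.
by rewrite jap_sqr real_normK ?num_real // lerDr.
Qed.
Lemma jap_le (x : R) : jap x <= 1 + `|x|.
Proof.
have j1 := jap_ge1 x; have x0 := normr_ge0 x; rewrite -(@ler_pXn2r _ 2) ?nnegrE //; try lra.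
by rewrite jap_sqr -(real_normK (num_real x)); nra.
Qed.

Section Concrete.
Variables (T e : R).
Hypothesis T1 : 1 <= T.
Hypothesis e0 : 0 < e.

Lemma ej x : 1 <= 1 + e * jap x.
Proof. by rewrite lerDl mulr_ge0 ?(ltW e0) // (le_trans ler01 (jap_ge1 x)). Qed.
Lemma is_derive_rw (y : R) : is_derive y 1 (rw T e) (rw' e y).
Proof.
have h := ej y; have j1 := jap_ge1 y; have dj := is_derive_jap y.
have ne : 1 + e * jap y != 0 by rewrite gt_eqF //; lra.
have d1 : is_derive y 1 (fun x => 1 + e * jap x) (e * (y / jap y)).
  by have d := is_deriveD (is_derive_cst (1 : R) y (1 : R)) (is_deriveZ e dj); apply: is_derive_eq d _; rewrite add0r.
have dV : is_derive y 1 (fun x => (1 + e * jap x)^-1) (- (1 + e * jap y) ^- 2 *: (e * (y / jap y))).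
  exact: is_deriveV.
have d := is_deriveD (is_derive_cst T y (1 : R)) (is_deriveM dj dV).
apply: is_derive_eq d _; rewrite /GRing.scale /= /rw'; field.
by rewrite ne gt_eqF //; lra.
Qed.
Lemma rw_ge x : T <= rw T e x.
Proof.
by rewrite lerDl divr_ge0 //; [have := jap_ge1 x|have := ej x]; lra.
Qed.
Lemma rw_le x : rw T e x <= T + e^-1.
Proof.
rewrite lerD2l ler_pdivrMr; last by have := ej x; lra.
by rewrite mulrDr mulKf ?gt_eqF // lerDr mulr1 invr_ge0 ltW.
Qed.
Lemma rw_le2 x : rw T e x <= T * (2 + `|x|).
Proof.
have h1 := T1; have j1 := jap_ge1 x; have h := jap_le x; have : jap x / (1 + e * jap x) <= jap x.
  by rewrite ler_pdivrMr ?ler_peMr //; have := ej x; lra.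
have := mulr_ge0 (_ : 0 <= T - 1) (normr_ge0 x); rewrite subr_ge0 => /(_ T1).
by rewrite /rw; lra.
Qed.
Lemma rw'_le x : `|rw' e x| <= 1.
Proof.
have h := ej x; have j1 := jap_ge1 x; have j2 := norm_le_jap x.
rewrite !normrM !normfV (ger0_norm (sqr_ge0 _)) (@ger0_norm _ (jap x)); last by lra.
rewrite ler_pdivrMr ?mul1r; last by apply: exprn_gt0; lra.
by apply: (@le_trans _ _ 1); [rewrite ler_pdivrMr ?mul1r //; lra|rewrite exprn_ege1].
Qed.
Lemma le_rw x : e * jap x <= 1 -> `|x| <= 2 * rw T e x.
Proof.
move=> h; apply: le_trans (norm_le_jap x) _; have t1 := T1; have j1 := jap_ge1 x; have h1 := ej x.
have : jap x / 2 <= jap x / (1 + e * jap x).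
  by rewrite ler_wpM2l ?lef_pV2 ?posrE //; lra.
by rewrite /rw; lra.
Qed.
End Concrete.

Lemma measurable_xs s : measurable_fun setT (fun x : R => x ^+ s).
Proof. exact: measurable_funX. Qed.

(** The bound r <= T (2 + |x|) does not involve e, and (2 + |x|)^s is at most 3^s (1 + |x|^s), by
    the cases |x| <= 1 and |x| > 1. *)
Lemma rw_init s f (T e : R) : 1 <= T -> 0 < e -> L2 f -> L2 (rM (fun x => x ^+ s) * f) ->
  nm (wm (rw T e) s * f) <= 3 ^+ s * T ^+ s * (nm f + nm (rM (fun x => x ^+ s) * f)).
Proof.
move=> T1 e0 Lf Lx; have mx := measurable_xs s.
have ma : measurable_fun setT (fun x : R => `|x ^+ s|).
  exact: (measurableT_comp (@normr_measurable R setT)).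
have hle x : `|(`|x ^+ s|)| <= `|x ^+ s| :> R by rewrite normr_id.
have [La na] := nm_rM_le ma mx hle Lx; pose c : R := 3 ^+ s * T ^+ s.
have c0 : 0 <= c by rewrite mulr_ge0 ?exprn_ge0 //; lra.
have m1 : measurable_fun setT (fun x : R => c * (1 + `|x ^+ s|)).
  by apply: measurable_funM; [exact: measurable_cst|apply: measurable_funD; [exact: measurable_cst|]].
have E : rM (fun x : R => c * (1 + `|x ^+ s|)) * f = Mcst (cr c) * (f + rM (fun x => `|x ^+ s|) * f).
  have m2 : measurable_fun setT (fun x : R => 1 + `|x ^+ s|) by apply: measurable_funD; [exact: measurable_cst|].
  rewrite -[RHS]mulr1 -(rMM (measurable_cst c) m2) -(rMD (measurable_cst (1 : R)) ma) !rM_cst cr1; ring.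
have LS := L2D Lf La.
have hw x : `|rw T e x ^+ s| <= `|c * (1 + `|x ^+ s|)|.
  have r0 := rw_ge T e0 x; rewrite ger0_norm ?exprn_ge0 //; last by lra.
  rewrite ger0_norm; last by rewrite mulr_ge0 // addr_ge0.
  have h := rw_le2 T1 e0 x; have x0 := normr_ge0 x.
  apply: (@le_trans _ _ ((T * (2 + `|x|)) ^+ s)).
    by apply: lerXn2r h; rewrite nnegrE; [lra|apply: mulr_ge0; lra].
  rewrite exprMn /c -mulrA mulrCA; apply: ler_wpM2l; first by apply: exprn_ge0; lra.
  have [x1|x1] := leP `|x| 1.
    apply: (@le_trans _ _ (3 ^+ s)); first by apply: lerXn2r; rewrite ?nnegrE; lra.
    by rewrite ler_peMr ?exprn_ge0 // lerDl.
  apply: (@le_trans _ _ ((3 * `|x|) ^+ s)); first by apply: lerXn2r; rewrite ?nnegrE; lra.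
  by rewrite exprMn ler_wpM2l ?exprn_ge0 // normrX lerDr.
have LE : L2 (rM (fun x : R => c * (1 + `|x ^+ s|)) * f) by rewrite E; exact: L2Z.
have [L n] := nm_rM_le (measurable_funX s (meas_r (is_derive_rw T e0))) m1 hw LE.
apply: le_trans n _; rewrite E nmZ // (ger0_norm c0) ler_wpM2l //.
by apply: le_trans (nmD Lf La) _; rewrite lerD2l.
Qed.

(** On [-n, n] the choice e = 1 / (n + 1) ensures e <x> <= 1, hence |x| <= 2 r; Fatou's lemma then
    lets n tend to infinity. *)
Lemma rw_limit s f (T D : R) : 1 <= T -> L2 f -> (forall e, 0 < e -> nm (wm (rw T e) s * f) <= D) ->
  L2 (rM (fun x => x ^+ s) * f) /\ nm (rM (fun x => x ^+ s) * f) <= 2 ^+ s * D.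
Proof.
move=> T1 Lf hD; have mx := measurable_xs s.
pose w n (x : R) : R := \1_(`[- n%:R, n%:R]%classic) x * x ^+ s.
have mw n : measurable_fun setT (w n) by apply: measurable_funM => //; exact: measurable_indic.
have hw (n : nat) : L2 (rM (w n) * f) /\ nm (rM (w n) * f) <= 2 ^+ s * D.
  pose e : R := n.+1%:R^-1; have e0 : 0 < e by rewrite invr_gt0.
  have mr := measurable_funX s (meas_r (is_derive_rw T e0)).
  have m2 : measurable_fun setT (fun x : R => 2 ^+ s * rw T e x ^+ s).
    exact: measurable_funM (measurable_cst _) mr.
  have E : rM (fun x : R => 2 ^+ s * rw T e x ^+ s) * f = Mcst (cr (2 ^+ s)) * (wm (rw T e) s * f).
    by rewrite -(rMM (measurable_cst (2 ^+ s : R)) mr) rM_cst mulrA.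
  have Lr : L2 (wm (rw T e) s * f) := L2_wm (is_derive_rw T e0) T1 (rw_ge T e0) (rw_le T e0) s Lf.
  have hwx x : `|w n x| <= `|2 ^+ s * rw T e x ^+ s|.
    have r0 := rw_ge T e0 x; rewrite /w normrM indicE mem_setE /= in_itv /= -ler_norml.
    case: (leP `|x| n%:R) => hx; last by rewrite normr0 mul0r.
    rewrite (_ : true%:R = 1 :> R) // normr1 mul1r -exprMn !normrX.
    apply: lerXn2r; rewrite ?nnegrE // [leRHS]ger0_norm; last by rewrite mulr_ge0 //; lra.
    apply: le_rw => //; rewrite /e mulrC ler_pdivrMr // mul1r -natr1.
    by have := jap_le x; lra.
  have LE : L2 (rM (fun x : R => 2 ^+ s * rw T e x ^+ s) * f) by rewrite E; exact: L2Z.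
  have [L h] := nm_rM_le (mw n) m2 hwx LE; split=> //; apply: le_trans h _.
  by rewrite E nmZ // ger0_norm ?exprn_ge0 // ler_wpM2l ?exprn_ge0 //; exact: hD.
apply: (fatou_nm (h := fun n => rM (w n) * f)) => [n|n|]; [exact: (hw n).1|exact: (hw n).2|].
have E : {ae mu, forall x n, rep (rM (w n) * f) x = (w n x)%:C * rep f x}.
  by apply/ae_foralln => n; apply: aeS2 _ (rep_rM (mw n)) (repM (rM (w n)) f) => x h1 ->; rewrite h1.
apply: aeS3 _ E (rep_rM mx) (repM (rM (fun x => x ^+ s)) f) => x h1 h2 h3 e e0.
exists (Num.truncn `|x|).+1 => n hn; rewrite h1 h3 h2 /w indicE mem_setE /= in_itv /= -ler_norml.
rewrite (_ : (`|x| <= n%:R) = true) ?mul1r ?subrr; first by rewrite cmod_real normr0 ltW.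
by apply: le_trans (ltW (truncnS_gt `|x|)) _; rewrite ler_nat.
Qed.

Lemma main_bound (s k : nat) (hs : (1 <= s)%N) (hk : (2 <= k)%N) (lambda : R) (V : R -> R)
  (hV : V \in Lfun mu +oo%E)
  (hVdiff : forall j : nat, (j < s)%N -> forall x : R, derivable (derive1n j V) x 1)
  (hVdecay : forall j : nat, (1 <= j <= s)%N ->
     exists2 C : R, 0 < C & forall x : R, `|derive1n j V x| <= C * (1 + `|x|)^-1)
  (f : R -> C) (hf : in_Sigma s f) (u : R -> R -> C) (hu : NLS_solution k lambda V f u)
  (hdecay : exists M : R, forall t x : R, Num.sqrt (jap t) * cmod (u t x) <= M) :
  exists2 D : R, 0 <= D & forall t, [/\ cmeas (u t), Hs s (pi (u t)), hn s (pi (u t)) <= D,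
    L2 (rM (fun x => x ^+ s) * pi (u t)) & nm (rM (fun x => x ^+ s) * pi (u t)) <= D * jap t ^+ s].
Proof.
have [mV _] := Lfun_infty hV; have [B hW] := smoothV_of hV hVdiff hVdecay.
have [hfS hfw] := hf; have hf2 := hfS.1; have [cu c1] := contH_of_H1 (let: And3 h _ _ := hu in h).
have hd := duhamel_deriv hs mV hW hf2 hu; have u0 := U0 hf2 hu; pose U t : M := pi (u t).
have HU0 : Hs s (U 0).
  by have [_ [F [cF F0]]] := (in_SobolevP s f).1 hfS; rewrite /U u0 -F0; exact: (chain_Hs cF).1.
have cs : contH s U := stage1 hW HU0 hd hs c1.
have [M hM] := hdecay; have M0 : 0 <= M by apply: le_trans (hM 0 0); rewrite mulr_ge0 ?sqrtr_ge0 ?cmod_ge0.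
have bU t : bdd (U t) (M / qj t).
  apply: bdd_pi (cu t) _ => x; rewrite ler_pdivlMr; last by have := qj_ge1 t; lra.
  by rewrite mulrC; exact: hM.
have [K K0 hK] := stage2 hs hk hW hd cs M0 bU.
have mf : cmeas f := ((in_L2P f).1 hf2).1; have Lf := L2U cs.
have Lx0 : L2 (rM (fun x => x ^+ s) * U 0) by rewrite /U u0 /L2 -weight_norm2E.
pose A := 3 ^+ s * (nm (U 0) + nm (rM (fun x => x ^+ s) * U 0)).
have A0 : 0 <= A by rewrite mulr_ge0 ?exprn_ge0 // addr_ge0 ?nm_ge0.
pose D1 := Cw s K * (A ^+ 2 + 1); have Cw0 : 0 <= Cw s K.
  by rewrite addr_ge0 // !mulr_ge0 ?expR_ge0 // addr_ge0 // sqr_ge0.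
have D10 : 0 <= D1 by rewrite mulr_ge0 // addr_ge0 // sqr_ge0.
exists (K + 2 ^+ s * Num.sqrt D1) => [|t]; first by rewrite addr_ge0 // mulr_ge0 ?exprn_ge0 ?sqrtr_ge0.
(* Each t is treated with its own weight, for T = <t>: then t lies in [-T, T], and T^s is the growth
   claimed. *)
have T1 := jap_ge1 t; have tT := norm_le_jap t.
have P0 : 0 <= 2 ^+ s * Num.sqrt D1 by rewrite mulr_ge0 ?exprn_ge0 ?sqrtr_ge0.
have hD e : 0 < e -> nm (wm (rw (jap t) e) s * U t) <= Num.sqrt D1 * jap t ^+ s.
  move=> e0; have T0 : 0 <= jap t ^+ s by rewrite exprn_ge0 //; lra.
  rewrite -(@ler_pXn2r _ 2) ?nnegrE ?nm_ge0 ?mulr_ge0 ?sqrtr_ge0 //.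
  apply: le_trans (wevol hs hW hd cs K0 hK (is_derive_rw (jap t) e0) T1 (rw_ge _ e0) (rw_le _ e0) (rw'_le e0) tT) _.
  rewrite exprMn sqr_sqrtr // /D1 -mulrA ler_wpM2l // mulrDl mul1r mulnC exprM lerD2r -exprMn.
  apply: lerXn2r; rewrite ?nnegrE ?nm_ge0 //; first exact: mulr_ge0.
  by apply: le_trans (rw_init T1 e0 (Lf 0) Lx0) _; rewrite /A mulrAC.
have [L h] := rw_limit T1 (Lf t) hD; split=> //; [exact: cs.1|by have := hK t; rewrite -/(U t); lra|].
apply: le_trans h _; rewrite mulrA ler_wpM2r ?exprn_ge0 //; lra.
Qed.
End FinalWeight.

Theorem theorem1p2 (R : realType) (s k : nat) (hs : (1 <= s)%N) (hk : (2 <= k)%N)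
  (lambda : R) (hlambda : lambda < 0)
  (V : R -> R)
  (hV : V \in Lfun (@lebesgue_measure R) +oo%E)
  (hVdiff : forall j : nat, (j < s)%N -> forall x : R, derivable (derive1n j V) x 1)
  (hVdecay : forall j : nat, (1 <= j <= s)%N ->
     exists2 C : R, 0 < C & forall x : R, `|derive1n j V x| <= C * (1 + `|x|)^-1)
  (hVpos : schrodinger_nonneg V)
  (f : R -> R[i]) (hf : in_Sigma s f)
  (u : R -> R -> R[i]) (hu : NLS_solution k lambda V f u)
  (hdecay : exists M : R, forall t x : R, Num.sqrt (jap t) * cmod (u t x) <= M) :
  exists2 C : R, 0 < C &
    forall t : R, in_Sigma s (u t) /\
      (Sigma_norm2 s (u t) <= (C * jap t ^+ (2 * s))%:E)%E.
Proof.
have [D D0 hD] := main_bound hs hk hV hVdiff hVdecay hf hu hdecay.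
exists (s.+1%:R * D ^+ 2 + D ^+ 2 + 1) => [|t].
  by rewrite ltr_wpDl // addr_ge0 ?mulr_ge0 ?sqr_ge0.
have [mu_ HU hn_ L h] := hD t.
have F0 : Dd 0 (pi (u t)) = pi (u t) by apply: Dd0; exact: Hs_L2 HU.
have cF := Hs_chain HU; have T1 := jap_ge1 t.
have W := weight_norm2E s mu_; rewrite n2E // in W.
split; first split.
- by apply/in_SobolevP; split=> //; exists (fun j => Dd j (pi (u t))).
- by rewrite W ltry.
rewrite /Sigma_norm2 (Sobolev_norm2E mu_ cF F0) W -EFinD lee_fin.
have J1 : 1 <= jap t ^+ (2 * s) by exact: exprn_ege1.
have D2 := sqr_ge0 D.
have h1 : \sum_(j < s.+1) nm (Dd j (pi (u t))) ^+ 2 <= s.+1%:R * D ^+ 2.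
  apply: (@le_trans _ _ (\sum_(j < s.+1) D ^+ 2)); last by rewrite sumr_const card_ord mulr_natl.
  apply: ler_sum => j _; apply: lerXn2r; rewrite ?nnegrE ?nm_ge0 //.
  by apply: le_trans hn_; apply: nm_Dd_le; rewrite -ltnS.
have h2 : nm (rM (fun x => x ^+ s) * pi (u t)) ^+ 2 <= D ^+ 2 * jap t ^+ (2 * s).
  rewrite mulnC exprM -exprMn; apply: lerXn2r; rewrite ?nnegrE ?nm_ge0 //.
  by rewrite mulr_ge0 // exprn_ge0 //; lra.
have c0 : 0 <= s.+1%:R * D ^+ 2 by rewrite mulr_ge0.
have h3 := ler_peMr c0 J1; lra.
Qed.
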